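(* Let $(\mathrm{M},\mathcal{G})$ be a flag built matroid. Then its Chow polynomial $\mathrm{H}(\mathrm{M},\mathcal{G})(t)$ is $\gamma$-positive. Moreover, for every cone $\sigma$ of the nested set fan $\Sigma_{\mathrm{M},\mathcal{G}}$, the Hilbert--Poincaré series of the Chow ring of the toric variety associated with the star fan of $\sigma$ in $\Sigma_{\mathrm{M},\mathcal{G}}$ is $\gamma$-positive.
   Context: $\mathrm{M}$ is a loopless matroid on a finite set $E$ with lattice of flats $\mathcal{L}$ (inclusion order, $\hat0=\varnothing$, $\hat1=E$, $F\vee G=\operatorname{cl}_{\mathrm{M}}(F\cup G)$). A building set is $\mathcal{G}\subseteq\mathcal{L}\setminus\{\hat0\}$ such that for every $F\neq\hat0$ the join map $\prod_{G\in\max\mathcal{G}_{\leqslant F}}[\hat0,G]\to[\hat0,F]$ is a poset isomorphism ($\max\mathcal{G}_{\leqslant F}$ = maximal elements of $\{G\in\mathcal{G}:G\leqslant F\}$). $\mathcal{S}\subseteq\mathcal{G}$ is nested if for every antichain $A\subseteq\mathcal{S}$ and $\{S_1,\dots,S_k\}\subseteq A$, $k\geqslant2$, $S_1\vee\dots\vee S_k\notin\mathcal{G}$. $\mathbf{N}(\mathcal{L},\mathcal{G})$ is the simplicial complex of nested sets contained in $\mathcal{G}\setminus\max\mathcal{G}$. $(\mathrm{M},\mathcal{G})$ is flag if $\mathbf{N}(\mathcal{L},\mathcal{G})$ is a flag complex (every minimal non-face has exactly two elements). Chow ring $\mathrm{CH}(\mathrm{M},\mathcal{G})=\mathbb{Q}[x_G:G\in\mathcal{G}]/(I+J)$,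 $I$ generated by $x_{G_1}\cdots x_{G_k}$ with $\{G_1,\dots,G_k\}$ not nested, $J$ by $\sum_{G\in\mathcal{G},G\geqslant a}x_G$ for atoms $a$; the Chow polynomial is its Hilbert--Poincaré series. A palindromic polynomial $h$ of degree $d$ is $\gamma$-positive if $h=\sum_{i}\gamma_it^i(1+t)^{d-2i}$ with all $\gamma_i\geqslant0$. Nested set fan: in $\mathbb{R}^E$ with basis $(\mathbf{e}_i)$, $\mathbf{e}_S=\sum_{i\in S}\mathbf{e}_i$; with $\max\mathcal{G}=\{G_1,\dots,G_k\}$ let $\mathbf{L}=\sum_j\mathbb{R}\mathbf{e}_{G_j}$; for $\mathcal{S}\in\mathbf{N}(\mathcal{L},\mathcal{G})$ let $\sigma_{\mathcal{S}}=\mathbf{L}+\operatorname{cone}\{\mathbf{e}_S:S\in\mathcal{S}\}$; $\Sigma_{\mathrm{M},\mathcal{G}}=\{\sigma_{\mathcal{S}}\}$, a unimodular fan with lineality space $\mathbf{L}$. The star fan of a cone $\sigma$ is the fan in $\mathbb{R}^E/\operatorname{span}(\sigma)$ formed by the images of the cones containing $\sigma$; its toric variety is smooth and its rational Chow ring is the one given by the Stanley--Reisner presentation. *)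

(* Defs.v *)
From HB Require Import structures.
From mathcomp Require Import all_boot all_order all_algebra.
From mathcomp Require Import mpoly.
Set Implicit Arguments.
Unset Strict Implicit.
Unset Printing Implicit Defensive.
Import GRing.Theory Num.Theory.
Local Open Scope ring_scope.

Section Matroid.
Variable E : finType.
Variable r : {set E} -> nat.

Definition matroid_rank : Prop :=
  [/\ forall A : {set E}, (r A <= #|A|)%N,
      forall A B : {set E}, A \subset B -> (r A <= r B)%N &
      forall A B : {set E}, (r (A :|: B) + r (A :&: B) <= r A + r B)%N].

Definition loopless : Prop := forall e : E, r [set e] = 1%N.

Definition cl (A : {set E}) : {set E} := [set x | r (x |: A) == r A].
Definition flat (F : {set E}) : bool := cl F == F.

Definition joinF (A : {set {set E}}) : {set E} := cl (\bigcup_(X in A) X).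

Definition atom (a : {set E}) : bool :=
  [&& flat a, a != set0 &
      [forall F : {set E}, (flat F && (F \proper a)) ==> (F == set0)]].

Definition maxset (G : {set {set E}}) : {set {set E}} :=
  [set X in G | [forall Y in G, (X \subset Y) ==> (Y == X)]].

Definition maxG_le (G : {set {set E}}) (F : {set E}) : {set {set E}} :=
  maxset [set X in G | X \subset F].

(* Building set: G consists of nonempty flats and for every flat F <> 0,
   the join map prod_{X in max G_{<=F}} [0, X] -> [0, F] is a poset isomorphism.
   An element of the product is a family H (a function, only its values on
   max G_{<=F} matter) with H X a flat contained in X. *)
Definition building_set (G : {set {set E}}) : Prop :=
  (forall X, X \in G -> flat X /\ X != set0) /\
  forall F : {set E}, flat F -> F != set0 ->
    let Mx := maxG_le G F in
    let valid (H : {set E} -> {set E}) :=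
      forall X, X \in Mx -> flat (H X) /\ H X \subset X in
    let jm (H : {set E} -> {set E}) := cl (\bigcup_(X in Mx) H X) in
    [/\
        forall H, valid H -> jm H \subset F,
        forall H H', valid H -> valid H' ->
          ((forall X, X \in Mx -> H X \subset H' X) <-> jm H \subset jm H') &
        forall K : {set E}, flat K -> K \subset F ->
          exists2 H, valid H & jm H = K].

Definition antichain (A : {set {set E}}) : bool :=
  [forall X in A, forall Y in A, (X \subset Y) ==> (X == Y)].

Definition nested (G S : {set {set E}}) : bool :=
  (S \subset G) &&
  [forall A : {set {set E}}, forall B : {set {set E}},
     [&& A \subset S, antichain A, B \subset A & (1 < #|B|)%N] ==>
     (joinF B \notin G)].

Definition NLG_face (G S : {set {set E}}) : bool :=
  (S \subset G :\: maxset G) && nested G S.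

Definition flag (G : {set {set E}}) : Prop :=
  forall T : {set {set E}}, T \subset G :\: maxset G -> ~~ NLG_face G T ->
    (forall T' : {set {set E}}, T' \proper T -> NLG_face G T') -> #|T| = 2%N.

End Matroid.

Section Quotient.
Variable n : nat.
Local Notation P := {mpoly rat[n]}.

Definition homog_deg (k : nat) (p : P) : bool :=
  all [pred m | mdeg m == k] (msupp p).

Definition in_ideal (gens : P -> Prop) (p : P) : Prop :=
  exists s : seq (P * P), (forall q, q \in s -> gens q.2) /\
                          p = \sum_(q <- s) q.1 * q.2.

Definition quot_dim (gens : P -> Prop) (k d : nat) : Prop :=
  exists b : 'I_d -> P,
    [/\ forall i, homog_deg k (b i),
        forall c : 'I_d -> rat, in_ideal gens (\sum_i c i *: b i) ->
                                forall i, c i = 0 &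
        forall p, homog_deg k p ->
          exists c : 'I_d -> rat, in_ideal gens (p - \sum_i c i *: b i)].

Definition hilbert_poincare (gens : P -> Prop) (h : {poly int}) : Prop :=
  forall k, exists2 d : nat, h`_k = d%:Z & quot_dim gens k d.
End Quotient.

Definition gamma_positive (h : {poly int}) : Prop :=
  let d := (size h).-1 in
  exists g : nat -> int, (forall i, 0 <= g i) /\
    h = \sum_(i < d./2.+1) g i *: ('X^i * (1 + 'X) ^+ (d - i.*2)).

Section Chow.
Variable E : finType.
Variable r : {set E} -> nat.
Variable G : {set {set E}}.
Local Notation n := #|G|.
(* variable x_G for G in G is 'X_i with enum_val i = G *)
Definition gvar (i : 'I_n) : {set E} := enum_val i.

Definition chow_gens (p : {mpoly rat[n]}) : Prop :=
  (exists S : {set {set E}}, [/\ S \subset G, ~~ nested r G S &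
       p = \prod_(i < n | gvar i \in S) 'X_i]) \/
  (exists a : {set E}, atom r a /\ p = \sum_(i < n | a \subset gvar i) 'X_i).

Definition chow_polynomial (h : {poly int}) : Prop :=
  hilbert_poincare chow_gens h.

(* ---------- Star fan of the cone sigma_S of the nested set fan ----------
   For S a face of N(L,G), the cones of Sigma containing sigma_S are the
   sigma_T with S \subset T; the star fan has rays the images of e_X for
   X in Rays S, and (Stanley--Reisner presentation) its rational Chow ring is
   Q[x_X : X in Rays S] / (monomials of non-faces + linear forms
   sum_X <m, e_X> x_X for m linear functionals vanishing on span(sigma_S)). *)
Definition star_rays (S : {set {set E}}) : {set {set E}} :=
  [set X in G :\: maxset G | (X \notin S) && NLG_face r G (X |: S)].

Definition eS (X : {set E}) (m : E -> rat) : rat := \sum_(i in X) m i.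

Definition star_gens (S : {set {set E}}) (p : {mpoly rat[#|star_rays S|]}) : Prop :=
  (exists T : {set {set E}}, [/\ T \subset star_rays S, ~~ NLG_face r G (S :|: T) &
       p = \prod_(i < #|star_rays S| | enum_val i \in T) 'X_i]) \/
  (exists m : E -> rat,
     [/\ forall X, X \in maxset G -> eS X m = 0,
         forall X, X \in S -> eS X m = 0 &
         p = \sum_(i < #|star_rays S|) eS (enum_val i) m *: 'X_i]).

Definition star_chow_polynomial (S : {set {set E}}) (h : {poly int}) : Prop :=
  hilbert_poincare (@star_gens S) h.
End Chow.

(* Main.v *)
Require Import Defs.
From HB Require Import structures.
From mathcomp Require Import all_boot all_order all_algebra.
From mathcomp Require Import zify ring lra polyrcf realalg.
From mathcomp Require Import mpoly.
Require Import Defs.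
Set Implicit Arguments.
Unset Strict Implicit.
Unset Printing Implicit Defensive.

(** The proof is Hodge-theoretic.  To a matroid rank function [r] with building
set [G] one attaches a linear functional [phi] on polynomials in variables
[h_X]: a monomial of top degree has value [1] when it satisfies the dragon
condition [cnt m F <= r F - 1] for all [F], and [0] otherwise.  Modulo the
radical of [phi] one recovers the Chow ring in its simplicial presentation,
[x_Z] being represented by a class [y_Z] with [phi (y_Z q)] equal to the
functional of the star of [Z] evaluated at [q].

The Hodge-Riemann relations for all positive combinations of the [h_X] follow by
induction on the degree.  The relations in the stars give hard Lefschetz for
[phi]; adding one flat with exactly two factors to [G] changes the quotient by
an orthogonal summand coming from a star, so a path of Lefschetz classes carries
the relations from one building set to another; deletion of a non-coloop reduces
to a smaller matroid, and Boolean matroids are products of projective spaces,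
embedded in products of projective lines.

If all [h_X] satisfy square-zero relations [(h_X - h_A) (h_X - h_B) = 0] with [A] and
[B] smaller, which is what flagness provides, then splitting off one class at a
time writes the dimensions of the graded pieces as a [gamma]-nonnegative sum.
The dimensions are those of the given ring by a sandwich: Feichtner-Yuzvinsky
monomials in the [x_Z] span it, the corresponding monomials in the [h_X] are
independent modulo the radical, and [x_Z |-> y_Z] is surjective. *)

(** In the simplicial variables the degree map takes only the values 0 and 1 on monomials: duality
    is built in by dividing by a radical, and stars, deletions and flips become comparisons of
    dragon conditions. The price is that the given presentation must be recovered at the end, where
    only dimensions are compared. Hodge-Riemann relations, and not just hard Lefschetz, drive the
    gamma vector: if N squares to zero, powers of s N + L expand to first order in s, and both the
    image and the annihilator of N inherit the relations for L. Classes are thus removed one by one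
    until L = 0, where the relations say that only the middle degree survives. Strict positivity
    does not pass to limits, hence signatures are transported along segments on which hard Lefschetz
    is known. Roots of polynomials replace continuity there, so the argument runs over a real closed
    field, into which rational coefficients are mapped. A single polynomial ring, with a variable
    for every subset of E, serves all matroids and building sets; a substitution kills the variables
    not in use. *)

Module M.

(** * Matroids, building sets and stars on a fixed ground set *)

Section Matroids.
Variable E : finType.
Implicit Types (A B D F X Y Z : {set E}) (G : {set {set E}}) (r : {set E} -> nat).

(* A loopless matroid on the ground set [D]; points outside [D] are loops. *)
Record mat D r : Prop := Mat {
  m_card : forall A, r A <= #|A|;
  m_mono : forall A B, A \subset B -> r A <= r B;
  m_sub : forall A B, r (A :|: B) + r (A :&: B) <= r A + r B;
  m_sing : forall x, x \in D -> r [set x] = 1;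
  m_out : forall A, r (A :&: D) = r A }.

Definition clD D r A := [set x in D | r (x |: A) == r A].
Definition fl D r F := (F \subset D) && [forall x in D, (r (x |: F) == r F) ==> (x \in F)].
(** A separator: the restriction to F is the direct sum of those to X and to F \ X. *)
Definition sep r F X := (X \subset F) && (r F == r X + r (F :\: X)).

Lemma in_maxset G X : reflect (X \in G /\ forall Y, Y \in G -> X \subset Y -> Y = X) (X \in maxset G).
Proof.
rewrite inE; apply: (iffP andP) => -[h1 h2]; split=> //.
  by move=> Y hY hXY; apply/eqP; move/forall_inP/(_ Y hY)/implyP: h2; apply.
by apply/forall_inP => Y hY; apply/implyP => hXY; apply/eqP/h2.
Qed.

Lemma maxset_above G X : X \in G -> exists2 Y, Y \in maxset G & X \subset Y.
Proof.
move=> hX; pose P := [pred Y | (Y \in G) && (X \subset Y)].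
have PX : P X by rewrite /= hX subxx.
case: (@arg_maxnP _ X P (fun Y => #|Y|) PX) => Y /andP[hY XY] hmax.
exists Y => //; apply/in_maxset; split=> // W hW YW; apply/eqP; rewrite eq_sym eqEcard YW.
by apply: hmax; rewrite /= hW (subset_trans XY).
Qed.

Lemma in_fac G F X : reflect [/\ X \in G, X \subset F &
  forall Y, Y \in G -> Y \subset F -> X \subset Y -> Y = X] (X \in maxG_le G F).
Proof.
apply: (iffP (in_maxset _ _)) => [[]|[h1 h2 h3]].
  rewrite inE => /andP[h1 h2] h3; split=> // Y hY YF; apply: h3; by rewrite inE hY.
by rewrite inE h1 h2; split=> // Y; rewrite inE => /andP[hY YF]; apply: h3.
Qed.

Lemma fac_above G F X : X \in G -> X \subset F -> exists2 Y, Y \in maxG_le G F & X \subset Y.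
Proof. by move=> hX XF; apply: maxset_above; rewrite inE hX. Qed.

Section Mat.
Variables (D : {set E}) (r : {set E} -> nat).
Hypothesis M : mat D r.

Lemma r0 : r set0 = 0.
Proof. by have := m_card M set0; rewrite cards0; lia. Qed.

Lemma rU A B : r (A :|: B) <= r A + r B.
Proof. by have := m_sub M A B; lia. Qed.

Lemma r_addmono A B x : A \subset B -> r (x |: A) = r A -> r (x |: B) = r B.
Proof.
move=> AB h; have := m_sub M (x |: A) B; rewrite -setUA (setUidPr AB) h.
have : r A <= r ((x |: A) :&: B) by apply: (m_mono M); rewrite subsetI subsetUr.
have : r B <= r (x |: B) by apply: (m_mono M); apply: subsetUr.
lia.
Qed.

Lemma r_absorb A B : (forall x, x \in B -> r (x |: A) = r A) -> r (A :|: B) = r A.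
Proof.
have [n] := ubnP #|B|; elim: n B => // n IH B hn h.
have [->|[x xB]] := set_0Vmem B; first by rewrite setU0.
have e : r (A :|: (B :\ x)) = r A.
  apply: IH => [|y]; first by move: hn; rewrite (cardsD1 x) xB; lia.
  by rewrite !inE => /andP[_]; apply: h.
have := @r_addmono A (A :|: B :\ x) x (subsetUl _ _) (h x xB).
by rewrite e setUCA setD1K.
Qed.

Lemma fl_sub F : fl D r F -> F \subset D. Proof. by case/andP. Qed.

Lemma fl_in F x : fl D r F -> x \in D -> r (x |: F) = r F -> x \in F.
Proof. by move=> /andP[_ /forall_inP h] xD /eqP e; move/implyP: (h x xD); apply. Qed.

Lemma flP F : F \subset D -> (forall x, x \in D -> r (x |: F) = r F -> x \in F) -> fl D r F.
Proof.
move=> FD h; rewrite /fl FD; apply/forall_inP => x xD; apply/implyP => /eqP; exact: h.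
Qed.

Lemma cl_subD A : clD D r A \subset D.
Proof. by apply/subsetP => x; rewrite inE => /andP[]. Qed.

Lemma sub_clD A : A \subset D -> A \subset clD D r A.
Proof.
move=> AD; apply/subsetP => x xA; rewrite inE (subsetP AD) //=.
by rewrite (setUidPr _) // sub1set.
Qed.

Lemma r_cl A : A \subset D -> r (clD D r A) = r A.
Proof.
move=> AD; rewrite -[clD D r A](setUidPr (sub_clD AD)); apply: r_absorb => x.
by rewrite inE => /andP[_ /eqP].
Qed.

Lemma fl_cl A : A \subset D -> fl D r (clD D r A).
Proof.
move=> AD; apply: flP => [|x xD h]; first exact: cl_subD.
rewrite inE xD; apply/eqP/anti_leq; rewrite [r A <= _](m_mono M) ?subsetUr // andbT.
by rewrite -(r_cl AD) -h (m_mono M) // setUS // sub_clD.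
Qed.

Lemma cl_min A F : A \subset F -> fl D r F -> clD D r A \subset F.
Proof.
move=> AF fF; apply/subsetP => x; rewrite inE => /andP[xD /eqP h].
apply: (fl_in fF) => //; exact: r_addmono AF h.
Qed.

Lemma fl_eq A F : fl D r F -> F \subset A -> A \subset D -> r A <= r F -> A = F.
Proof.
move=> fF FA AD h; apply/eqP; rewrite eqEsubset FA andbT; apply/subsetP => x xA.
apply: (fl_in fF); first exact: (subsetP AD).
apply/anti_leq; rewrite [r F <= _](m_mono M) ?subsetUr // andbT.
by apply: leq_trans h; rewrite (m_mono M) // subUset sub1set xA.
Qed.

Lemma flI A B : fl D r A -> fl D r B -> fl D r (A :&: B).
Proof.
move=> fA fB; apply: flP => [|x xD h]; first by rewrite subIset // (fl_sub fA).
by rewrite inE (fl_in fA) ?(fl_in fB) //; apply: r_addmono h; rewrite ?subsetIl ?subsetIr.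
Qed.

Lemma r_gt0 A x : x \in A -> x \in D -> 0 < r A.
Proof. by move=> xA xD; rewrite -(m_sing M xD) (m_mono M) // sub1set. Qed.

Lemma sep_split F X A : sep r F X -> A \subset F -> r A = r (A :&: X) + r (A :\: X).
Proof.
move=> /andP[XF /eqP e] AF.
have h1 := m_sub M A X; have h2 := m_sub M (A :|: X) (F :\: X).
have e2 : A :|: X :|: F :\: X = F.
  by rewrite -setUA -{1}(setIidPr XF) setID (setUidPr AF).
have e3 : (A :|: X) :&: (F :\: X) = A :\: X.
  by apply/setP => x; rewrite !inE; have := subsetP AF x; case: (x \in A); case: (x \in X); case: (x \in F) => //= /(_ isT).
rewrite e2 e3 in h2; have := rU (A :&: X) (A :\: X); rewrite setID; lia.
Qed.

Lemma fl_sepD F X : fl D r F -> sep r F X -> fl D r (F :\: X).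
Proof.
move=> fF sX; have FD := fl_sub fF; apply: flP => [|x xD h]; first by rewrite subDset subsetU // FD orbT.
have xF : x \in F by apply: (fl_in fF) => //; apply: r_addmono h; apply: subsetDl.
rewrite inE xF andbT; apply/negP => xX.
have := @sep_split F X (x |: F :\: X) sX; rewrite subUset sub1set xF subsetDl => /(_ isT).
have -> : (x |: F :\: X) :&: X = [set x].
  by apply/setP => y; rewrite !inE; case: eqP => [->|_]; rewrite ?xX //=; case: (y \in X) => //=; rewrite andbF.
have -> : (x |: F :\: X) :\: X = F :\: X.
  by apply/setP => y; rewrite !inE; case: eqP => [->|_]; rewrite ?xX //=; case: (y \in X).
by rewrite (m_sing M xD); lia.
Qed.

(** A point outside X in the closure of X ∪ Z is, by the direct sum along X, already in the closure
    of Z \ X. *)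
Lemma fl_sepU F X Z : fl D r F -> sep r F X -> fl D r Z -> Z \subset F -> fl D r X -> fl D r (X :|: Z).
Proof.
move=> fF sX fZ ZF fX; have FD := fl_sub fF; have XF : X \subset F by case/andP: sX.
apply: flP => [|x xD h]; first by rewrite subUset !fl_sub.
have xF : x \in F by apply: (fl_in fF) => //; apply: r_addmono h; rewrite subUset XF.
rewrite inE; case: (boolP (x \in X)) => //= xX; apply: (fl_in fZ) => //.
apply: (@r_addmono (Z :\: X)); first exact: subsetDl.
have h1 := @sep_split F X (x |: (X :|: Z)) sX; have h2 := @sep_split F X (X :|: Z) sX.
move: h1 h2; rewrite !subUset sub1set xF XF ZF => /(_ isT) h1 /(_ isT) h2.
have e1 : (x |: (X :|: Z)) :&: X = X.
  by apply/setP => y; rewrite !inE; case: eqP => [->|_]; rewrite ?(negPf xX) ?andbF //=; case: (y \in X); rewrite ?andbF.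
have e2 : (X :|: Z) :&: X = X by rewrite setIUl setIid; apply/setUidPl; apply: subsetIr.
have e3 : (x |: (X :|: Z)) :\: X = x |: (Z :\: X).
  by apply/setP => y; rewrite !inE; case: eqP => [->|_]; rewrite ?(negPf xX) //=; case: (y \in X).
have e4 : (X :|: Z) :\: X = Z :\: X by rewrite setDUl setDv set0U.
rewrite e1 e3 in h1; rewrite e2 e4 in h2; lia.
Qed.

End Mat.

(** Building sets through closure conditions instead of interval isomorphisms: joins of intersecting
    members stay inside, and the factors of a flat are direct summands. This form is the one checked
    for stars, flips and deletions. *)
Record built D r G : Prop := Built {
  b_fl : forall X, X \in G -> fl D r X;
  b_n0 : forall X, X \in G -> X != set0;
  b_pt : forall x, x \in D -> exists2 X, X \in G & (x \in X) && (r X == 1);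
  b_join : forall X Y, X \in G -> Y \in G -> X :&: Y != set0 -> clD D r (X :|: Y) \in G;
  b_sep : forall F X, fl D r F -> X \in maxG_le G F -> sep r F X }.

Section Built.
Variables (D : {set E}) (r : {set E} -> nat) (G : {set {set E}}).
Hypothesis M : mat D r.
Hypothesis bG : built D r G.

Lemma b_subD X : X \in G -> X \subset D.
Proof. by move/(b_fl bG)/fl_sub. Qed.

Lemma b_rgt0 X : X \in G -> 0 < r X.
Proof.
move=> hX; have [x xX] := set0Pn _ (b_n0 bG hX).
by apply: (r_gt0 M xX); apply: (subsetP (b_subD hX)).
Qed.

(** If Y meets the factor X, the join of the two is a member of G below F, so it equals X by
    maximality. *)
Lemma fac_dich F X Y : fl D r F -> X \in maxG_le G F -> Y \in G -> Y \subset F ->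
  Y \subset X \/ Y :&: X = set0.
Proof.
move=> fF /in_fac[XG XF mX] YG YF; have [|h] := eqVneq (Y :&: X) set0; [by right | left].
have JG := b_join bG YG XG h.
have sJ : Y :|: X \subset D by rewrite subUset !b_subD.
have e : clD D r (Y :|: X) = X.
  apply: mX => //; first by apply: (cl_min M) => //; rewrite subUset YF.
  by apply: (subset_trans _ (sub_clD r sJ)); apply: subsetUr. 
by rewrite -e; apply: (subset_trans _ (sub_clD r sJ)); apply: subsetUl.
Qed.

Lemma fac_pt F x : fl D r F -> x \in F -> exists2 X, X \in maxG_le G F & x \in X.
Proof.
move=> fF xF; have xD := subsetP (fl_sub fF) _ xF.
have [X XG /andP[xX /eqP rX]] := b_pt bG xD.
have XF : X \subset F.
  have := @flI _ _ M _ _ (b_fl bG XG) fF => fI.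
  have e : X = X :&: F.
    apply: (fl_eq M fI); [exact: subsetIl | exact: b_subD|].
    by rewrite rX (r_gt0 M (x := x)) // inE xX.
  by rewrite e subsetIr.
have [Y hY XY] := fac_above XG XF; exists Y => //; exact: (subsetP XY).
Qed.

Lemma fac_eq F X Y x : fl D r F -> X \in maxG_le G F -> Y \in maxG_le G F -> x \in X -> x \in Y -> X = Y.
Proof.
move=> fF hX hY xX xY; have /in_fac[XG XF mX] := hX; have /in_fac[YG YF mY] := hY.
have [h|/setP/(_ x)] := fac_dich fF hX YG YF; last by rewrite !inE xX xY.
exact: mY.
Qed.

Lemma fl_D : fl D r D.
Proof. exact: flP. Qed.

Lemma maxset_fac : maxset G = maxG_le G D.
Proof.
apply/setP => X; apply/in_maxset/in_fac => [[h1 h2]|[h1 _ h2]]; split=> //; first exact: b_subD.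
  by move=> Y hY _; apply: h2.
by move=> Y hY; apply: h2 => //; apply: b_subD.
Qed.

Lemma max_sep X : X \in maxset G -> sep r D X.
Proof. by rewrite maxset_fac; apply: (b_sep bG); apply: fl_D. Qed.

End Built.

Section Star.
Variables (D : {set E}) (r : {set E} -> nat) (G : {set {set E}}) (Z : {set E}).
Hypothesis M : mat D r.
Hypothesis bG : built D r G.
Hypothesis fZ : fl D r Z.

(** The rank of the direct sum of the restriction to Z and the contraction by Z, kept on the same
    ground set. [up] and [Gs] give the building set that G induces on it. *)
Definition rs A := r (A :&: Z) + (r (A :|: Z) - r Z).
Definition up X := if X \subset Z then X else clD D r (X :|: Z) :\: Z.
Definition Gs := [set up X | X in G].

Lemma rs_in A : A \subset Z -> rs A = r A.
Proof. by move=> AZ; rewrite /rs (setIidPl AZ) (setUidPr AZ) subnn addn0. Qed.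

Lemma rs_out A : A :&: Z = set0 -> rs A = r (A :|: Z) - r Z.
Proof. by move=> AZ; rewrite /rs AZ (r0 M). Qed.

Lemma rZU A : r Z <= r (A :|: Z). Proof. by rewrite (m_mono M) // subsetUr. Qed.

Lemma rs1_in x A : x \in Z -> r ((x |: A) :&: Z) = r (x |: (A :&: Z)) /\ (x |: A) :|: Z = A :|: Z.
Proof.
move=> xZ; split; first by congr (r _); apply/setP => y; rewrite !inE; case: eqP => // ->; rewrite xZ.
by rewrite -setUA; apply/setUidPr; rewrite sub1set inE xZ orbT.
Qed.

Lemma rs1_out x A : x \notin Z -> (x |: A) :&: Z = A :&: Z /\ (x |: A) :|: Z = x |: (A :|: Z).
Proof.
move=> xZ; split; last by rewrite setUA.
by apply/setP => y; rewrite !inE; case: eqP => [->|//]; rewrite (negPf xZ) !andbF.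
Qed.

Lemma mat_star : mat D rs.
Proof.
have ZD := fl_sub fZ; split.
- move=> A; have h := rU M (A :\: Z) Z.
  have e : A :\: Z :|: Z = A :|: Z by apply/setP => y; rewrite !inE; case: (y \in Z); rewrite ?orbT ?orbF.
  rewrite e in h; have := m_card M (A :&: Z); have := m_card M (A :\: Z); have := cardsID Z A.
  rewrite /rs; lia.
- move=> A B AB; rewrite /rs; have h1 : r (A :&: Z) <= r (B :&: Z) by rewrite (m_mono M) // setSI.
  have h2 : r (A :|: Z) <= r (B :|: Z) by rewrite (m_mono M) // setSU.
  lia.
- move=> A B; rewrite /rs (setIUl A B Z) (setUIl A B Z).
  have h1 := m_sub M (A :&: Z) (B :&: Z); have h2 := m_sub M (A :|: Z) (B :|: Z).
  have e1 : A :&: Z :&: (B :&: Z) = A :&: B :&: Z by rewrite setIACA setIid.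
  have e2 : A :|: Z :|: (B :|: Z) = A :|: B :|: Z by rewrite setUACA setUid.
  rewrite e1 in h1; rewrite e2 in h2.
  have := rZU A; have := rZU B; have := rZU (A :|: B).
  have : r Z <= r ((A :|: Z) :&: (B :|: Z)) by rewrite (m_mono M) // subsetI !subsetUr.
  lia.
- move=> x xD; rewrite /rs; case: (boolP (x \in Z)) => xZ.
    have /setIidPl -> : [set x] \subset Z by rewrite sub1set.
    have /setUidPr -> : [set x] \subset Z by rewrite sub1set.
    by rewrite (m_sing M xD) subnn addn0.
  have -> : [set x] :&: Z = set0 by apply/setP => y; rewrite !inE; case: eqP => // ->; rewrite (negPf xZ).
  rewrite (r0 M); have := rU M [set x] Z; rewrite (m_sing M xD).
  have := rZU [set x]; have : r (x |: Z) <> r Z by move=> h; rewrite (fl_in fZ xD h) in xZ.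
  lia.
- move=> A; rewrite /rs; congr (_ + (_ - _)).
    by rewrite -setIA (setIidPr ZD).
  by rewrite -(m_out M (A :|: Z)) setIUl (setIidPl ZD).
Qed.

Lemma fl_star F : fl D rs F <-> [/\ F \subset D, fl D r (F :&: Z) & fl D r (F :|: Z)].
Proof.
have ZD := fl_sub fZ; split=> [fF|[FD f1 f2]].
  have FD := fl_sub fF; split=> //; apply: flP => [|x xD h]; rewrite ?subUset ?FD // 1?subIset ?FD //.
    have xZ : x \in Z by exact: (fl_in fZ xD (r_addmono M (subsetIr _ _) h)).
    have [e1 e2] := rs1_in F xZ.
    by rewrite inE xZ (fl_in fF) // /rs e1 h e2.
  rewrite inE; case: (boolP (x \in Z)) => xZ; first by rewrite orbT.
  by have [e1 e2] := rs1_out F xZ; rewrite (fl_in fF) // /rs e1 e2 h.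
apply: flP => // x xD; case: (boolP (x \in Z)) => xZ.
  have [e1 e2] := rs1_in F xZ; rewrite /rs e1 e2 => h.
  have := @fl_in D r _ x f1 xD; rewrite inE xZ andbT; apply; lia.
have [e1 e2] := rs1_out F xZ; rewrite /rs e1 e2 => h.
have := @fl_in D r _ x f2 xD; rewrite inE (negPf xZ) orbF; apply.
have := rZU F; have : r (F :|: Z) <= r (x |: (F :|: Z)) by rewrite (m_mono M) // subsetUr.
lia.
Qed.

Lemma fl0 : fl D r set0.
Proof. by apply: flP => [|x xD]; rewrite ?sub0set // setU0 (m_sing M xD) (r0 M). Qed.

Lemma cl_eq A F : A \subset F -> fl D r F -> r F <= r A -> clD D r A = F.
Proof.
move=> AF fF h; have AD := subset_trans AF (fl_sub fF).
symmetry; apply: (fl_eq M (fl_cl M AD)); [exact: (cl_min M AF fF) | exact: fl_sub fF | by rewrite (r_cl M)].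
Qed.

Lemma pt_sub F X x : fl D r F -> X \in G -> r X = 1 -> x \in X -> x \in F -> X \subset F.
Proof.
move=> fF XG rX xX xF; have fI := flI M (b_fl bG XG) fF; have XD := b_subD bG XG.
suff -> : X = X :&: F by rewrite subsetIr.
apply: (fl_eq M fI); rewrite ?subsetIl // rX (r_gt0 M (x := x)) // ?inE ?xX //.
exact: (subsetP XD).
Qed.

Lemma up_in X : X \subset Z -> up X = X. Proof. by rewrite /up => ->. Qed.

Lemma in_Gs X' : X' \in Gs -> (X' \in G /\ X' \subset Z) \/
  exists X, [/\ X \in G, ~~ (X \subset Z), X' = clD D r (X :|: Z) :\: Z & X' :&: Z = set0].
Proof.
case/imsetP => X XG ->; rewrite /up; case: ifPn => h; [by left | right].
exists X; split=> //; by rewrite setDE -setIA [~: Z :&: Z]setIC setICr setI0.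
Qed.

Lemma sub_flat_fac F A : fl D r F -> Z \subset F -> A \in maxG_le G F -> fl D r (A :|: Z).
Proof.
move=> fF ZF hA; have /in_fac[AG _ _] := hA.
exact: (fl_sepU M fF (b_sep bG fF hA) fZ ZF (b_fl bG AG)).
Qed.

(** A factor of a flat over Z has a union with Z that is already closed, so the closure in [up]
    disappears. *)
Lemma up_fac F A : fl D r F -> Z \subset F -> A \in maxG_le G F -> ~~ (A \subset Z) -> up A = A :\: Z.
Proof.
move=> fF ZF hA h; rewrite /up (negPf h) (cl_eq (F := A :|: Z)) ?(sub_flat_fac fF) //.
by rewrite setDUl setDv setU0.
Qed.

Lemma fac_of X F : fl D r F -> Z \subset F -> X \in G -> X \subset F -> ~~ (X \subset Z) ->
  exists A, [/\ A \in maxG_le G F, X \subset A, ~~ (A \subset Z), up X \subset A :\: Z & up A = A :\: Z].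
Proof.
move=> fF ZF XG XF h; have [A hA XA] := fac_above XG XF.
have h' : ~~ (A \subset Z) by apply: contra h; apply: subset_trans.
exists A; split=> //; last exact: up_fac hA h'.
rewrite /up (negPf h) -(up_fac fF ZF hA h') /up (negPf h') setSD //.
have AG : A \in G by case/in_fac: hA.
have AZD : A :|: Z \subset D by rewrite subUset (b_subD bG AG) (fl_sub fZ).
apply: (cl_min M _ (fl_cl M AZD)).
exact: subset_trans (setSU _ XA) (sub_clD r AZD).
Qed.

Lemma XZD X : X \in G -> X :|: Z \subset D.
Proof. by move=> XG; rewrite subUset (b_subD bG XG) (fl_sub fZ). Qed.

(** The factor A of X ∨ Z over X can stand for X: it has the same join with Z, and that join is a
    plain union. *)
Lemma up_facW X : X \in G -> ~~ (X \subset Z) ->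
  exists A, [/\ A \in G, X \subset A, clD D r (X :|: Z) = A :|: Z & ~~ (A \subset Z)].
Proof.
move=> XG h; set W := clD D r (X :|: Z); have fW : fl D r W := fl_cl M (XZD XG).
have sW : X :|: Z \subset W := sub_clD r (XZD XG).
have ZW : Z \subset W := subset_trans (subsetUr _ _) sW.
have XW : X \subset W := subset_trans (subsetUl _ _) sW.
have [A [hA XA nA _ _]] := fac_of fW ZW XG XW h; have /in_fac[AG AW _] := hA.
exists A; split=> //; apply/eqP; rewrite eqEsubset subUset AW ZW !andbT.
apply: (cl_min M _ (sub_flat_fac fW ZW hA)).
by rewrite setSU.
Qed.

Lemma DZI A : (A :\: Z) :&: Z = set0.
Proof. by apply/setP => y; rewrite !inE; case: (y \in Z); rewrite ?andbF. Qed.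

Lemma DZU A : Z \subset A -> A :\: Z :|: Z = A.
Proof.
move=> ZA; apply/setP => y; rewrite !inE; case: (boolP (y \in Z)); rewrite ?orbT ?orbF //.
by move/(subsetP ZA) => ->.
Qed.

Lemma rs_DZ A : Z \subset A -> rs (A :\: Z) = r A - r Z.
Proof. by move=> ZA; rewrite rs_out ?DZI // DZU. Qed.

Lemma cl_star_eq A F : A \subset F -> fl D rs F -> rs F <= rs A -> clD D rs A = F.
Proof.
move=> AF fF h; have AD := subset_trans AF (fl_sub fF).
symmetry; apply: (fl_eq mat_star (fl_cl mat_star AD)).
- exact: (cl_min mat_star AF fF).
- exact: fl_sub fF.
- by rewrite (r_cl mat_star AD).
Qed.

(** Joins and separators outside Z are checked on representatives that are factors of a flat over Z,
    for which [up] is mere removal of Z. *)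
Lemma built_star : built D rs Gs.
Proof.
have ZD := fl_sub fZ.
have flup X : X \in G -> fl D rs (up X).
  move=> XG; apply/fl_star; rewrite /up; case: ifPn => h.
    by rewrite (setIidPl h) (setUidPr h) (b_fl bG) // (b_subD bG).
  have ZW : Z \subset clD D r (X :|: Z).
    by apply: (subset_trans _ (sub_clD r (XZD XG))); apply: subsetUr.
  split.
  - by rewrite subDset subsetU // cl_subD orbT.
  - by rewrite DZI; exact: fl0.
  - by rewrite DZU // (fl_cl M) // XZD.
split.
- by move=> _ /imsetP[X XG ->]; apply: flup.
- move=> _ /imsetP[X XG ->]; rewrite /up; case: ifPn => h; first exact: (b_n0 bG).
  rewrite setD_eq0; apply: contra h => h; apply: subset_trans h.
  by apply: (subset_trans _ (sub_clD r (XZD XG))); apply: subsetUl.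
- move=> x xD; have [X XG /andP[xX /eqP rX]] := b_pt bG xD.
  exists (up X); first exact: imset_f.
  have [h|h] := boolP (X \subset Z).
    by rewrite up_in // xX rs_in // rX.
  have xZ : x \notin Z by apply: contra h => xZ; apply: pt_sub fZ XG rX xX xZ.
  have xU : x \in up X.
    rewrite /up (negPf h) inE xZ; apply: (subsetP (sub_clD r (XZD XG))).
    by rewrite inE xX.
  rewrite xU eqn_leq (r_gt0 mat_star xU xD) andbT.
  have ZW : Z \subset clD D r (X :|: Z).
    by apply: (subset_trans _ (sub_clD r (XZD XG))); apply: subsetUr.
  rewrite /up (negPf h) rs_DZ // (r_cl M (XZD XG)).
  by have := rU M X Z; rewrite rX; lia.
- move=> _ _ /imsetP[X XG ->] /imsetP[Y YG ->] /set0Pn[x]; rewrite inE.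
  have [hX|hX] := boolP (X \subset Z); have [hY|hY] := boolP (Y \subset Z).
  + rewrite !up_in // => xXY; have JG : clD D r (X :|: Y) \in G.
      by apply: (b_join bG) => //; apply/set0Pn; exists x; rewrite inE.
    have sZ : clD D r (X :|: Y) \subset Z by apply: (cl_min M) => //; rewrite subUset hX.
    have sD : X :|: Y \subset D by rewrite subUset !(b_subD bG).
    rewrite (@cl_star_eq _ (clD D r (X :|: Y))) ?sub_clD //.
    * by rewrite -(up_in sZ) imset_f.
    * by rewrite -(up_in sZ) flup.
    * by rewrite !rs_in ?subUset ?hX // r_cl.
  + by rewrite (up_in hX) => /andP[/(subsetP hX) xZ]; rewrite /up (negPf hY) inE xZ.
  + by rewrite (up_in hY) => /andP[h /(subsetP hY) xZ]; move: h; rewrite /up (negPf hX) inE xZ.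
  have [A [AG XA eA nA]] := up_facW XG hX; have [B [BG YB eB nB]] := up_facW YG hY.
  rewrite /up (negPf hX) (negPf hY) eA eB => /andP[]; rewrite !inE.
  case: (x \in Z) => //=; rewrite !orbF => xA xB.
  have JG : clD D r (A :|: B) \in G by apply: (b_join bG) => //; apply/set0Pn; exists x; rewrite inE xA.
  set J := clD D r (A :|: B) in JG.
  have sD : A :|: B \subset D by rewrite subUset !(b_subD bG).
  have AJ : A :|: B \subset J := sub_clD r sD.
  have nJ : ~~ (J \subset Z).
    by apply: contra nA => h; apply: subset_trans h; apply: subset_trans AJ; apply: subsetUl.
  have e : (A :|: Z) :\: Z :|: (B :|: Z) :\: Z = (A :|: B) :\: Z.
    by apply/setP => y; rewrite !inE; case: (y \in Z); case: (y \in A); case: (y \in B).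
  rewrite e (@cl_star_eq _ (up J)) ?imset_f ?flup //; rewrite /up (negPf nJ).
    by apply/setSD/(subset_trans AJ)/(subset_trans _ (sub_clD r (XZD JG)))/subsetUl.
  have ZW : Z \subset clD D r (J :|: Z).
    by apply: (subset_trans _ (sub_clD r (XZD JG))); apply: subsetUr.
  rewrite rs_DZ // rs_out ?DZI // (r_cl M (XZD JG)).
  have -> : (A :|: B) :\: Z :|: Z = A :|: B :|: Z.
    by apply/setP => y; rewrite !inE; case: (y \in Z); rewrite ?orbT ?orbF.
  have ABZ : A :|: B :|: Z \subset D by rewrite subUset sD.
  rewrite -(r_cl M ABZ) leq_sub2r // (m_mono M) // subUset.
  apply/andP; split; last exact: subset_trans (subsetUr _ _) (sub_clD r ABZ).
  apply: (cl_min M _ (fl_cl M ABZ)); exact: subset_trans (subsetUl _ _) (sub_clD r ABZ).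
- move=> F _ fF /in_fac[/imsetP[X XG ->] XF mX]; have /fl_star[FD f1 f2] := fF.
  have hF2 : Z \subset F :|: Z := subsetUr _ _.
  have [h|h] := boolP (X \subset Z).
    rewrite (up_in h) in XF mX *; have hX : X \in maxG_le G (F :&: Z).
      apply/in_fac; split=> // [|Y YG]; first by rewrite subsetI XF.
      rewrite subsetI => /andP[YF YZ] XY; apply: mX => //.
      by rewrite -(up_in YZ) imset_f.
    have /andP[_ /eqP s1] := b_sep bG f1 hX.
    rewrite /sep XF (rs_in h) /rs s1; apply/eqP.
    have -> : (F :\: X) :&: Z = F :&: Z :\: X by apply/setP => y; rewrite !inE andbA.
    have -> : F :\: X :|: Z = F :|: Z.
      apply/setP => y; rewrite !inE; case: (boolP (y \in Z)); rewrite ?orbT ?orbF // => yZ.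
      by rewrite (contraNN (subsetP h y) yZ).
    by rewrite addnA.
  have XD : X \subset F :|: Z.
    have sW := sub_clD r (XZD XG); apply/subsetP => y yX; rewrite inE.
    case: (boolP (y \in Z)) => yZ; rewrite ?orbT // orbF; apply: (subsetP XF).
    by rewrite /up (negPf h) inE yZ (subsetP sW) // inE yX.
  have [A [hA XA nA sA eA]] := fac_of f2 hF2 XG XD h; have /in_fac[AG AF _] := hA.
  have AZF : A :\: Z \subset F.
    by apply/subsetP => y; rewrite inE => /andP[yZ /(subsetP AF)]; rewrite inE (negPf yZ) orbF.
  have eX : up X = A :\: Z by apply/esym/mX => //; rewrite -eA imset_f.
  have sep2 := b_sep bG f2 hA.
  rewrite /sep XF eX; apply/eqP; rewrite [rs (A :\: Z)]rs_out ?DZI // /rs.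
  have e1 : (F :\: (A :\: Z)) :&: Z = F :&: Z.
    by apply/setP => y; rewrite !inE; case: (y \in Z); rewrite ?andbF ?andbT.
  have e2 : F :\: (A :\: Z) :|: Z = (F :|: Z) :\: A :|: Z.
    by apply/setP => y; rewrite !inE; case: (y \in Z); rewrite ?orbT ?orbF ?andbT.
  have e3 : A :\: Z :|: Z = A :|: Z.
    by apply/setP => y; rewrite !inE; case: (y \in Z); rewrite ?orbT ?orbF.
  rewrite e1 e2 e3.
  have AFs : A \subset F :|: Z := AF.
  (* The ranks of A ∪ Z, Z, F ∪ Z and ((F ∪ Z) \ A) ∪ Z, each split along the factor A, make the
     claim a linear identity. *)
  have h1 := sep_split M sep2 (A := A :|: Z); have h2 := sep_split M sep2 hF2.
  have h3 := sep_split M sep2 (subxx _); have h4 := sep_split M sep2 (A := (F :|: Z) :\: A :|: Z).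
  move: h1 h4; rewrite !subUset AFs hF2 subsetDl => /(_ isT) h1 /(_ isT) h4.
  have k1 : (A :|: Z) :&: A = A by rewrite setIUl setIid; apply/setUidPl; apply: subsetIr.
  have k2 : (A :|: Z) :\: A = Z :\: A by rewrite setDUl setDv set0U.
  have k3 : (F :|: Z) :&: A = A by apply/setIidPr.
  have k4 : ((F :|: Z) :\: A :|: Z) :&: A = Z :&: A.
    by apply/setP => y; rewrite !inE; case: (y \in A); rewrite ?andbF ?andbT.
  have k5 : ((F :|: Z) :\: A :|: Z) :\: A = (F :|: Z) :\: A.
    by apply/setP => y; rewrite !inE; case: (y \in A); case: (y \in Z); rewrite ?orbT ?orbF.
  rewrite k1 k2 in h1; rewrite k3 in h3; rewrite k4 k5 in h4.
  have a1 := rZU F; have a2 := rZU A; have a3 := rZU ((F :|: Z) :\: A).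
  clear -h1 h2 h3 h4 a1 a2 a3; lia.
Qed.

End Star.
End Matroids.

End M.
Import M.

(** * Top degrees of stars, and chains of building sets *)

Module M2.

Section More.
Variable E : finType.
Implicit Types (A B D F X Y Z T : {set E}) (G C : {set {set E}}) (r : {set E} -> nat).

(** The dimension of the associated variety, which adds up over the maximal elements of G. *)
Definition topdeg r G := \sum_(X in maxset G) (r X).-1.

Lemma sep_comp D r F X : mat D r -> sep r D X -> F \subset D -> r F = r (F :&: X) + r (F :\: X).
Proof. by move=> M s FD; apply: (sep_split M s). Qed.

Section StarMax.
Variables (D : {set E}) (r : {set E} -> nat) (G : {set {set E}}) (Z Ej : {set E}).
Hypothesis M : mat D r.
Hypothesis bG : built D r G.
Hypothesis fZ : fl D r Z.
Hypothesis hE : Ej \in maxset G.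
Hypothesis ZE : Z \proper Ej.
Hypothesis Z0 : Z != set0.

Let EG : Ej \in G. Proof. by case/in_maxset: hE. Qed.
Let ZsE : Z \subset Ej. Proof. exact: proper_sub. Qed.

Lemma max_disj X : X \in maxset G -> X != Ej -> X :&: Z = set0.
Proof.
move=> hX ne; apply/setP => x; rewrite !inE; apply/negP => /andP[xX xZ].
move: hX hE; rewrite (maxset_fac bG) => hX hE'; move/eqP: ne; apply.
exact: (fac_eq M bG (fl_D D r) hX hE' xX (subsetP ZsE _ xZ)).
Qed.

Lemma max_nsub X : X \in maxset G -> ~~ (X \subset Z).
Proof.
move=> hX; have XG : X \in G by case/in_maxset: hX.
have [->|ne] := eqVneq X Ej; first by case/properP: ZE => _ [x xE xZ]; apply/subsetPn; exists x.
apply/negP => h; have := max_disj hX ne; rewrite (setIidPl h) => e; by have := b_n0 bG XG; rewrite e eqxx.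
Qed.

Lemma up_max X : X \in maxset G -> up D r Z X = X :\: Z.
Proof.
move=> hX; apply: (up_fac M bG fZ (fl_D D r) (fl_sub fZ)); last exact: max_nsub.
by rewrite -(maxset_fac bG).
Qed.

Lemma up_max_ne X : X \in maxset G -> X != Ej -> X :\: Z = X.
Proof. by move=> hX ne; apply/setDidPl; rewrite -setI_eq0 max_disj. Qed.

Lemma rs_max X : X \in maxset G -> rs r Z (X :\: Z) = if X == Ej then r Ej - r Z else r X.
Proof.
move=> hX; case: eqP => [->|/eqP ne]; first by rewrite (rs_DZ M).
rewrite up_max_ne // (rs_out M) ?max_disj //.
have XD : X \subset D by apply: (b_subD bG); case/in_maxset: hX.
have := sep_split M (max_sep bG hX) (A := X :|: Z); rewrite subUset XD (fl_sub fZ) => /(_ isT).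
have -> : (X :|: Z) :&: X = X by rewrite setIUl setIid; apply/setUidPl; apply: subsetIr.
have -> : (X :|: Z) :\: X = Z.
  by rewrite setDUl setDv set0U; apply/setDidPl; rewrite -setI_eq0 setIC max_disj.
lia.
Qed.

Lemma maxset_star : maxset (Gs D r G Z) = maxG_le G Z :|: [set X :\: Z | X in maxset G].
Proof.
have topfac Y : Y \in G -> ~~ (Y \subset Z) -> exists A, [/\ A \in maxset G, up D r Z Y \subset A :\: Z & A :\: Z \in Gs D r G Z].
  move=> YG h; have [A [hA YA nA sA eA]] := fac_of M bG fZ (fl_D D r) (fl_sub fZ) YG (b_subD bG YG) h.
  have /in_fac[AG _ _] := hA.
  by exists A; rewrite (maxset_fac bG) hA sA -eA imset_f.
apply/setP => X'; apply/in_maxset/setUP => [[hX' mX']|].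
  case/imsetP: (hX') => Y YG eY; have [h|h] := boolP (Y \subset Z).
    left; have [A hA YA] := fac_above YG h; have /in_fac[AG AZ _] := hA.
    have AGs : A \in Gs D r G Z by apply/imsetP; exists A => //; rewrite up_in.
    by rewrite up_in // in eY; rewrite -(mX' A) // eY.
  right; have [A [hA sA AGs]] := topfac Y YG h; apply/imsetP; exists A => //.
  by rewrite -(mX' _ AGs) // eY.
case=> [/in_fac[XG XZ mX]|/imsetP[X hX ->]].
  split=> [|Y' hY' XY']; first by apply/imsetP; exists X' => //; rewrite up_in.
  have [x xX] := set0Pn _ (b_n0 bG XG).
  case: (in_Gs hY') => [[YG YZ]|[Y [_ _ _ e]]]; first exact: mX.
  by move/setP/(_ x): e; rewrite !inE (subsetP XY' _ xX) (subsetP XZ _ xX).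
have XG : X \in G by case/in_maxset: hX.
split=> [|Y' /imsetP[Y YG ->] sXY]; first by rewrite -up_max // imset_f.
have [x xX xZ] := subsetPn (max_nsub hX).
have xY : x \in up D r Z Y by apply: (subsetP sXY); rewrite inE xZ.
have h : ~~ (Y \subset Z) by apply: contra xZ => h; move: xY; rewrite up_in //; apply: (subsetP h).
have [A [hA sA _]] := topfac Y YG h.
have eA : A = X.
  move: hA hX; rewrite (maxset_fac bG) => hA hX.
  by apply: (fac_eq M bG (fl_D D r) hA hX _ xX); have := subsetP sA _ xY; rewrite inE => /andP[].
by apply/eqP; rewrite eqEsubset sXY -{1}eA sA.
Qed.

(** The factors of Z become new maximal elements, the component [Ej] is replaced by its contraction,
    and the other components do not change. *)
Lemma topdeg_star : topdeg (rs r Z) (Gs D r G Z) + (r Ej).-1 =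
  \sum_(X in maxG_le G Z) (r X).-1 + (r Ej - r Z).-1 + topdeg r G.
Proof.
rewrite {1}/topdeg maxset_star.
rewrite (eq_bigl (mem [predU maxG_le G Z & [set X :\: Z | X in maxset G]])); last by move=> X; rewrite in_setU.
rewrite bigU /=; last first.
  rewrite -setI_eq0; apply/eqP/setP => X'; rewrite [RHS]inE; apply/negP => /setIP[/in_fac[XG XZ _]].
  case/imsetP => X hX e; have [x xX] := set0Pn _ (b_n0 bG XG).
  by have := subsetP XZ _ xX; move: xX; rewrite e inE => /andP[/negPf->].
have inj : {in maxset G &, injective (fun X => X :\: Z)}.
  move=> X Y hX hY /= e; have [x xX xZ] := subsetPn (max_nsub hX).
  have xY : x \in Y by have : x \in X :\: Z; [rewrite inE xZ | rewrite e inE => /andP[]].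
  by move: hX hY; rewrite (maxset_fac bG) => hX hY; apply: (fac_eq M bG (fl_D D r) hX hY xX xY).
rewrite big_imset //= -!addnA; congr (_ + _).
  by apply: eq_bigr => X /in_fac[_ XZ _]; rewrite rs_in.
rewrite /topdeg (bigD1 Ej) //= [in RHS](bigD1 Ej) //= rs_max // eqxx.
have -> : \sum_(X in maxset G | X != Ej) (rs r Z (X :\: Z)).-1 = \sum_(X in maxset G | X != Ej) (r X).-1.
  by apply: eq_bigr => X /andP[hX /negPf ne]; rewrite rs_max // ne.
by rewrite -addnA; congr (_ + _); rewrite addnC.
Qed.

Lemma rZE : r Z < r Ej.
Proof.
rewrite ltn_neqAle (m_mono M) // andbT; apply/eqP => e; case/properP: ZE => _ [x xE xZ].
have ED := b_subD bG EG.
by have := fl_eq M fZ ZsE ED; rewrite e => /(_ (leqnn _)) e2; rewrite -e2 xE in xZ.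
Qed.

End StarMax.

Lemma topdeg_star1 D r G Z Ej : mat D r -> built D r G -> Ej \in maxset G -> Z \proper Ej ->
  Z \in G -> (topdeg (rs r Z) (Gs D r G Z)).+1 = topdeg r G.
Proof.
move=> M bG hE ZE ZG; have fZ := b_fl bG ZG; have Z0 := b_n0 bG ZG.
have := topdeg_star M bG fZ hE ZE Z0; have := rZE M bG fZ hE ZE; have := b_rgt0 M bG ZG.
have -> : maxG_le G Z = [set Z].
  apply/setP => X; rewrite in_set1; apply/in_fac/eqP => [[XG XZ mX]|->]; first by rewrite (mX Z).
  by split=> // Y _ YZ ZY; apply/eqP; rewrite eqEsubset YZ.
rewrite big_set1; lia.
Qed.

(** A flat with two factors is the center of a blow-up of codimension two; this is why adding it
    creates a single new summand, shifted by one degree. *)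
Lemma topdeg_star2 D r G Z Ej T1 T2 : mat D r -> built D r G -> Ej \in maxset G -> Z \proper Ej ->
  fl D r Z -> maxG_le G Z = [set T1; T2] -> T1 != T2 -> r Z = r T1 + r T2 ->
  (topdeg (rs r Z) (Gs D r G Z)).+2 = topdeg r G.
Proof.
move=> M bG hE ZE fZ e ne eZ.
have h T : T \in [set T1; T2] -> 0 < r T by rewrite -e => /in_fac[TG _ _]; apply: (b_rgt0 M bG).
have := h T1; have := h T2; rewrite !inE !eqxx orbT => /(_ isT) h2 /(_ isT) h1.
have Z0 : Z != set0 by apply/eqP => e0; move: eZ; rewrite e0 (r0 M); lia.
have := topdeg_star M bG fZ hE ZE Z0; have := rZE M bG fZ hE ZE; rewrite e.
rewrite big_setU1 ?inE //= big_set1; lia.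
Qed.

(** A direct sum decomposition of the matroid into nonempty blocks, which may be further
    decomposable. *)
Record comps D r C : Prop := Comps {
  c_n0 : forall X, X \in C -> X != set0;
  c_sep : forall X, X \in C -> sep r D X;
  c_cov : forall x, x \in D -> exists2 X, X \in C & x \in X;
  c_disj : forall X Y x, X \in C -> Y \in C -> x \in X -> x \in Y -> X = Y }.

Lemma comps_max D r G : mat D r -> built D r G -> comps D r (maxset G).
Proof.
move=> M bG; split.
- by move=> X /in_maxset[XG _]; apply: (b_n0 bG).
- by move=> X; apply: (max_sep bG).
- by move=> x xD; rewrite (maxset_fac bG); apply: (fac_pt M bG (fl_D D r)).
- by move=> X Y x; rewrite (maxset_fac bG) => hX hY; apply: (fac_eq M bG (fl_D D r)).
Qed.

Lemma fl_comp D r C X : mat D r -> comps D r C -> X \in C -> fl D r X.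
Proof.
move=> M cC hX; have /andP[XD /eqP e] := c_sep cC hX.
have s : sep r D (D :\: X).
  by rewrite /sep subsetDl setDDr setDv set0U (setIidPr XD) e addnC eqxx.
by have := fl_sepD M (fl_D D r) s; rewrite setDDr setDv set0U (setIidPr XD).
Qed.

(** The singleton is excluded so that the point i itself stays in [Gm]. *)
Definition coloop r X i := [&& i \in X, X != [set i] & r (X :\ i) < r X].

(** The building set adapted to the deletion of i. If i is a coloop of the flat X, then X and X \ i
    have the same trace after deletion; once such X are left out, removing i is injective on the
    remaining members other than {i}. *)
Definition Gm D r C i := [set X | [&& fl D r X, X != set0, [exists c in C, X \subset c] & ~~ coloop r X i]].

Lemma built_Gm D r C i : mat D r -> comps D r C -> built D r (Gm D r C i).
Proof.
move=> M cC.
have GmP X : X \in Gm D r C i -> [/\ fl D r X, X != set0, exists2 c, c \in C & X \subset c & ~~ coloop r X i].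
  by rewrite inE => /and4P[h1 h2 /exists_inP h3 h4].
have fC c : c \in C -> fl D r c := fl_comp M cC.
split.
- by move=> X /GmP[].
- by move=> X /GmP[].
- move=> x xD; have sx : [set x] \subset D by rewrite sub1set.
  have xc : x \in clD D r [set x] by rewrite (subsetP (sub_clD r sx)) ?inE.
  have rc : r (clD D r [set x]) = 1 by rewrite (r_cl M sx) (m_sing M xD).
  exists (clD D r [set x]); last by rewrite xc rc.
  have [c cCc xc'] := c_cov cC xD.
  rewrite inE (fl_cl M sx) /=; apply/and3P; split; first by apply/set0Pn; exists x.
    apply/exists_inP; exists c => //; apply: (cl_min M _ (fC _ cCc)); by rewrite sub1set.
  apply/negP => /and3P[ic ne]; rewrite rc ltnS leqn0 => /eqP r0'.
  have [y yc] : exists y, y \in clD D r [set x] :\ i.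
    apply/set0Pn; apply: contra ne => /eqP e; rewrite -(setD1K ic) e setU0 //.
  have yD : y \in D by apply: (subsetP (cl_subD D r [set x])); move: yc; rewrite inE => /andP[].
  by have := r_gt0 M yc yD; rewrite r0'.
- move=> X Y /GmP[fX X0 [c cCc Xc] nX] /GmP[fY Y0 [c' cCc' Yc] nY] /set0Pn[x /setIP[xX xY]].
  have ec : c' = c by apply: (c_disj cC cCc' cCc (subsetP Yc _ xY) (subsetP Xc _ xX)).
  rewrite {c' cCc'}ec in Yc; have sD : X :|: Y \subset D by rewrite subUset !(@fl_sub _ D r).
  have sW := sub_clD r sD; set W := clD D r (X :|: Y) in sW *.
  rewrite inE (fl_cl M sD) /=; apply/and3P; split.
  + by apply/set0Pn; exists x; rewrite (subsetP sW) // inE xX.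
  + apply/exists_inP; exists c => //; apply: (cl_min M _ (fC _ cCc)); by rewrite subUset Xc.
  apply/negP => /and3P[iW neW]; rewrite ltnNge => /negP; apply.
  have rW : r W = r (X :|: Y) := r_cl M sD.
  (* If i is in U without being a coloop of U, it is spanned by U \ i, hence by W \ i. *)
  have noX U V : ~~ coloop r U i -> U :|: V = X :|: Y -> i \in U -> U != [set i] -> r W <= r (W :\ i).
    move=> nU eUV iU neU; have UW : U \subset W by apply: subset_trans sW; rewrite -eUV subsetUl.
    have hU : r (U :\ i) = r U.
      apply/eqP; rewrite eqn_leq (m_mono M) ?subsetDl //= leqNgt; apply: contra nU => h.
      by rewrite /coloop iU neU.
    have := r_addmono M (setSD [set i] UW) (x := i); rewrite setD1K // hU => /(_ erefl).
    by rewrite setD1K // => ->.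
  have [iX|iX] := boolP (i \in X); last have [iY|iY] := boolP (i \in Y).
  + have [eX|neX] := eqVneq X [set i]; last exact: (noX X Y).
    have iY : i \in Y by move: xX xY; rewrite eX inE => /eqP ->.
    have eW : X :|: Y = Y by apply/setUidPr; rewrite eX sub1set.
    apply: (noX Y Y) => //; first by rewrite setUid eW.
    apply: contra neW => /eqP eY; rewrite eqEsubset; apply/andP; split; last by rewrite sub1set.
    by apply: (cl_min M); rewrite ?eW -?eY.
  + have [eY|neY] := eqVneq Y [set i]; last by apply: (noX Y X); rewrite // setUC.
    by move: xY; rewrite eY inE => /eqP e; rewrite -e xX in iX.
  + rewrite rW (m_mono M) //; apply/subsetP => y yU; rewrite in_setD1 (subsetP sW) // andbT.
    by apply: contraTneq yU => ->; rewrite inE negb_or iX.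
- move=> F X fF /in_fac[XG XF mX]; have [fX X0 [c cCc Xc] nX] := GmP X XG.
  have FD := fl_sub fF; have rF := sep_comp M (c_sep cC cCc) FD.
  have fFc : fl D r (F :&: c) := flI M fF (fC _ cCc).
  have sFc : sep r F (F :&: c) by rewrite /sep subsetIl /= setDIr setDv set0U rF.
  have XFc : X \subset F :&: c by rewrite subsetI XF.
  have Fc0 : F :&: c != set0 by apply: contra X0 => /eqP e; rewrite -subset0 -e.
  have inG U : fl D r U -> U != set0 -> U \subset F :&: c -> ~~ coloop r U i -> U \in Gm D r C i.
    move=> fU U0 Us nU; rewrite inE fU U0 nU andbT; apply/exists_inP; exists c => //.
    exact: subset_trans Us (subsetIr _ _).
  have [co|nco] := boolP (coloop r (F :&: c) i); last first.
    by rewrite (_ : X = F :&: c) //; apply/esym/mX; rewrite ?subsetIl // inG.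
  have /and3P[iFc neFc rlt] := co.
  have iD : i \in D by apply: (subsetP FD); move: iFc; rewrite inE => /andP[].
  have ri := m_sing M iD.
  have rFc : r (F :&: c) = 1 + r ((F :&: c) :\ i).
    have u := rU M [set i] ((F :&: c) :\ i); rewrite setD1K // ri in u; clear -u rlt; lia.
  have si : sep r (F :&: c) [set i] by rewrite /sep sub1set iFc rFc ri eqxx.
  have fFi : fl D r ((F :&: c) :\ i) := fl_sepD M fFc si.
  have [eX|neX] := eqVneq X [set i].
    have iF : i \in F by move: iFc; rewrite inE => /andP[].
    have := sep_split M sFc (subsetDl F [set i]).
    have -> : (F :\ i) :&: (F :&: c) = (F :&: c) :\ i.
      by apply/setP => y; rewrite !inE; case: (y \in F); rewrite ?andbF ?andbT.
    have -> : F :\ i :\: (F :&: c) = F :\: c.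
      apply/setP => y; rewrite !inE; case: eqP => [->|_]; last by case: (y \in F); rewrite ?andbF ?andbT.
      by move: iFc; rewrite inE => /andP[-> ->].
    move=> e; rewrite /sep eX sub1set iF rF rFc ri /= e.
    by rewrite addnA.
  have iX : i \notin X.
    apply/negP => iX; have hX : r (X :\ i) = r X.
      apply/eqP; rewrite eqn_leq (m_mono M) ?subsetDl //= leqNgt; apply: contra nX => h.
      by rewrite /coloop iX neX.
    have := r_addmono M (setSD [set i] XFc) (x := i); rewrite setD1K // hX => /(_ erefl).
    by rewrite setD1K // => e; rewrite e ltnn in rlt.
  have Xs : X \subset (F :&: c) :\ i by rewrite subsetD1 XFc.
  have eX : (F :&: c) :\ i = X.
    apply: mX => //; last by apply: subset_trans (subsetIl F c); apply: subsetDl.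
    apply: inG => //; [|exact: subsetDl| by rewrite /coloop !inE eqxx].
    by apply: contra X0 => /eqP e; rewrite -subset0 -e.
  have := sep_split M sFc (subsetDl F X).
  have -> : (F :\: X) :&: (F :&: c) = [set i].
    rewrite -eX; apply/setP => y; rewrite !inE; case: eqP => [->|_] /=.
      by move: iFc; rewrite inE => /andP[-> ->].
    by case: (y \in F); case: (y \in c).
  have -> : F :\: X :\: (F :&: c) = F :\: c.
    rewrite -eX; apply/setP => y; rewrite !inE.
    by case: (y \in F); case: (y \in c); rewrite ?andbF ?andbT.
  move=> e; rewrite /sep XF rF rFc eX /= e ri.
  by rewrite addnA (addnC 1).
Qed.

Lemma max_Gm D r C i : mat D r -> comps D r C -> (forall c, c \in C -> ~~ coloop r c i) ->
  maxset (Gm D r C i) = C.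
Proof.
move=> M cC nc.
have inG c : c \in C -> c \in Gm D r C i.
  move=> hc; rewrite inE (fl_comp M cC hc) (c_n0 cC hc) nc // andbT.
  by apply/exists_inP; exists c.
have sub X : X \in Gm D r C i -> exists2 c, c \in C & X \subset c.
  by rewrite inE => /and4P[_ _ /exists_inP].
have n0 X : X \in Gm D r C i -> exists x, x \in X by rewrite inE => /and4P[_ /set0Pn].
apply/setP => X; apply/in_maxset/idP => [[XG mX]|hX].
  by have [c hc Xc] := sub X XG; rewrite -(mX c) ?inG.
split=> [|Y YG XY]; first exact: inG.
have [c hc Yc] := sub Y YG; have [x xX] := n0 X (inG X hX).
have e : c = X by apply: (c_disj cC hc hX (subsetP Yc _ (subsetP XY _ xX)) xX).
by apply/eqP; rewrite eqEsubset XY -{1}e Yc.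
Qed.


(** The upper end of the chains: it contains every building set with maximal elements C. *)
Definition flatsin D r C := [set X | [&& fl D r X, X != set0 & [exists c in C, X \subset c]]].

Lemma built_flatsin D r G : mat D r -> built D r G -> {subset G <= flatsin D r (maxset G)}.
Proof.
move=> M bG X XG; rewrite inE (b_fl bG XG) (b_n0 bG XG) /=; apply/exists_inP.
by have [Y hY XY] := maxset_above XG; exists Y.
Qed.

(** A smallest missing flat S has two factors S1 and S2. Among the missing flats with two factors,
    one over S1 and one over S2, a largest one can be added: joins with it cannot leave the enlarged
    family. *)
Lemma flip D r G : mat D r -> built D r G -> G != flatsin D r (maxset G) ->
  exists T Ej T1 T2, [/\ T \in flatsin D r (maxset G), T \notin G, Ej \in maxset G & T \proper Ej] /\
    [/\ maxG_le G T = [set T1; T2], T1 != T2, r T = r T1 + r T2, T = T1 :|: T2 & built D r (T |: G)].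
Proof.
move=> M bG ne; have cC := comps_max M bG.
have inP X : X \in flatsin D r (maxset G) -> [/\ fl D r X, X != set0 & exists2 c, c \in maxset G & X \subset c].
  by rewrite inE => /and3P[h1 h2 /exists_inP].
have [S0 hS0] : exists S0, S0 \in flatsin D r (maxset G) :\: G.
  apply/set0Pn; apply: contra ne; rewrite setD_eq0 eqEsubset => ->; rewrite andbT.
  by apply/subsetP; apply: built_flatsin.
case: (@arg_minnP _ S0 (mem (flatsin D r (maxset G) :\: G)) (fun X => #|X|) hS0) => S.
rewrite /= in_setD => /andP[SG Sin] Smin; have [fS Sn0 [c hc Sc]] := inP S Sin.
have [x xS] := set0Pn _ Sn0; have [S1 hS1 xS1] := fac_pt M bG fS xS.
have /in_fac[S1G S1S _] := hS1; have sepS := b_sep bG fS hS1.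
have S2G : S :\: S1 \in G.
  apply: contraT => h; have : S :\: S1 \in flatsin D r (maxset G) :\: G.
    rewrite in_setD h inE (fl_sepD M fS sepS) /=; apply/andP; split.
      by rewrite setD_eq0; apply: contra SG => h'; rewrite (_ : S = S1) //; apply/eqP; rewrite eqEsubset h'.
    by apply/exists_inP; exists c => //; apply: subset_trans Sc; apply: subsetDl.
  move/Smin; rewrite leqNgt => /negP; case; apply: proper_card; apply/properP; split; first exact: subsetDl.
  by exists x => //; rewrite inE xS1.
set S2 := S :\: S1 in S2G.
(* The candidates keep the two pieces over S1 and S2 apart; maximality will be taken among them,
   whereas S itself was minimal. *)
pose cand T := [&& fl D r T, T \notin G, [exists c in maxset G, T \subset c] &
  [exists T1 in G, [exists T2 in G, [&& S1 \subset T1, S2 \subset T2, T1 :&: T2 == set0,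
     T == T1 :|: T2 & r T == r T1 + r T2]]]].
have candS : cand S.
  rewrite /cand fS SG /=; apply/andP; split; first by apply/exists_inP; exists c.
  apply/exists_inP; exists S1 => //; apply/exists_inP; exists S2 => //.
  rewrite !subxx /= /S2 setDE setICA setICr setI0 eqxx /= -setDE.
  have /andP[_ ->] := sepS; rewrite andbT eqEsubset subUset S1S subsetDl !andbT.
  by apply/subsetP => y yS; rewrite !inE yS andbT; case: (y \in S1).
case: (@arg_maxnP _ S cand (fun X => #|X|) candS) => T.
case/and4P=> fT TG /exists_inP[Ej hE TE] /exists_inP[T1 T1G /exists_inP[T2 T2G]].
case/and5P=> ST1 ST2 /eqP dT /eqP eT /eqP rT Tmax.
have EG : Ej \in G by case/in_maxset: hE.
have TEp : T \proper Ej by rewrite properEneq TE andbT; apply: contraNneq TG => ->.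
have T0 : T != set0.
  by apply/set0Pn; have [y yT] := set0Pn _ (b_n0 bG T1G); exists y; rewrite eT inE yT.
have Tin : T \in flatsin D r (maxset G) by rewrite inE fT T0; apply/exists_inP; exists Ej.
have [s1 s2] : T1 \subset T /\ T2 \subset T by rewrite eT subsetUl subsetUr.
have TD := fl_sub fT.
have facT Ta Tb : Ta \in G -> Tb \in G -> T = Ta :|: Tb -> Ta \in maxG_le G T.
  move=> aG bG' e; apply/in_fac; split=> //; first by rewrite e subsetUl.
  move=> A AG AT TA; have [AT2|h] := eqVneq (A :&: Tb) set0.
    apply/eqP; rewrite eqEsubset TA andbT; apply/subsetP => y yA; have := subsetP AT _ yA.
    by rewrite e inE => /orP[//|yb]; move/setP/(_ y): AT2; rewrite !inE yA yb.
  have eU : A :|: Tb = T.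
    by apply/eqP; rewrite eqEsubset subUset AT {1 2}e subsetUr /= setSU.
  have := b_join bG AG bG' h; rewrite eU (cl_eq M (subxx _) fT (leqnn _)).
  by rewrite (negPf TG).
have hT1 := facT _ _ T1G T2G eT; have hT2 : T2 \in maxG_le G T by apply: (facT T2 T1) => //; rewrite setUC.
have facE : maxG_le G T = [set T1; T2].
  apply/setP => X; apply/idP/set2P => [hX|[->|->]//]; have /in_fac[XG XT _] := hX.
  have [y yX] := set0Pn _ (b_n0 bG XG); have := subsetP XT _ yX; rewrite eT inE.
  by case/orP => h; [left | right]; apply: (fac_eq M bG fT hX _ yX h).
have neT : T1 != T2.
  apply/eqP => e; have [y y1] := set0Pn _ (b_n0 bG T1G).
  by move/setP/(_ y): dT; rewrite !inE -e y1.
(* The join of T with an element meeting one of its two factors has again at most two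
   factors, so it lies in G or equals T by maximality. *)
have key X Ta Tb : X \in G -> Ta \in G -> Tb \in G -> T = Ta :|: Tb -> X :&: Ta != set0 ->
    (forall A B, A \in G -> B \in G -> Ta \subset A -> Tb \subset B -> A :&: B = set0 ->
       fl D r (A :|: B) -> r (A :|: B) = r A + r B -> A :|: B \notin G -> A :|: B \subset Ej -> cand (A :|: B)) ->
    clD D r (X :|: T) \in T |: G.
  move=> XG aG bG' e h hcand; have XE : X \subset Ej.
    have [y /setIP[yX ya]] := set0Pn _ h; have [c' hc' Xc'] := maxset_above XG.
    rewrite (_ : Ej = c') //; apply: (c_disj cC hE hc' _ (subsetP Xc' _ yX)).
    by apply: (subsetP TE); rewrite e inE ya.
  have sD : X :|: T \subset D by rewrite subUset (b_subD bG XG).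
  set F := clD D r (X :|: T); have fF : fl D r F := fl_cl M sD; have sF : X :|: T \subset F := sub_clD r sD.
  have aD : X :|: Ta \subset D by rewrite subUset !(b_subD bG).
  have UG := b_join bG XG aG h; set U := clD D r (X :|: Ta) in UG.
  have UF : U \subset F.
    by apply: (cl_min M _ fF); apply: subset_trans sF; rewrite setUS // e subsetUl.
  have bF : Tb \subset F by apply: subset_trans sF; rewrite e setUA subsetUr.
  have [A hA UA] := fac_above UG UF; have [B hB bB] := fac_above bG' bF.
  have sU : X :|: Ta \subset U := sub_clD r aD.
  have [XA aA] : X \subset A /\ Ta \subset A.
    by split; apply: subset_trans UA; apply: subset_trans sU; rewrite ?subsetUl ?subsetUr.
  have /in_fac[AG AF _] := hA; have /in_fac[BG BF _] := hB.
  have [eAB|neAB] := eqVneq A B.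
    rewrite in_setU1; apply/orP; right; rewrite (_ : F = A) //; apply/eqP; rewrite eqEsubset AF andbT.
    by apply: (cl_min M _ (b_fl bG AG)); rewrite e !subUset XA aA eAB bB.
  have dAB : A :&: B = set0.
    apply/setP => y; rewrite !inE; apply/negP => /andP[yA yB].
    by move/eqP: neAB; apply; apply: (fac_eq M bG fF hA hB yA yB).
  have sA := b_sep bG fF hA; have /andP[_ /eqP rFA] := sA.
  have BFA : B \subset F :\: A by rewrite subsetD BF -setI_eq0 setIC dAB eqxx.
  have rF : r F <= r A + r B.
    rewrite (r_cl M sD); apply: leq_trans (rU M A B); rewrite (m_mono M) // e !subUset.
    by rewrite !subsetU ?XA ?aA ?bB ?orbT.
  have eB : F :\: A = B.
    apply: (fl_eq M (b_fl bG BG) BFA); last by move: rF; rewrite rFA leq_add2l.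
    by rewrite subDset subsetU // (fl_sub fF) orbT.
  have eF : F = A :|: B by rewrite -eB setDE setUIr setUCr setIT (setUidPr AF).
  have FE : F \subset Ej by apply: (cl_min M _ (b_fl bG EG)); rewrite subUset XE.
  rewrite in_setU1 orbC; case: (boolP (F \in G)) => //= FG.
  have := hcand A B AG BG aA bB dAB; rewrite -eF => /(_ fF _ FG FE) cF.
  have : cand F by apply: cF; rewrite rFA eB.
  move/Tmax => /= hle; have TF : T \subset F by apply: subset_trans sF; exact: subsetUr.
  by apply/eqP/esym/eqP; rewrite eqEcard TF.
have candP A B : A \in G -> B \in G -> S1 \subset A -> S2 \subset B -> A :&: B = set0 ->
       fl D r (A :|: B) -> r (A :|: B) = r A + r B -> A :|: B \notin G -> A :|: B \subset Ej -> cand (A :|: B).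
  move=> AG BG sA sB dAB fAB rAB nAB AE; rewrite /cand fAB nAB /=; apply/andP; split.
    by apply/exists_inP; exists Ej.
  apply/exists_inP; exists A => //; apply/exists_inP; exists B => //.
  by rewrite sA sB dAB rAB !eqxx.
have joinT X : X \in G -> X :&: T != set0 -> clD D r (X :|: T) \in T |: G.
  move=> XG; rewrite {1}eT setIUr setU_eq0 negb_and => /orP[] h.
    apply: (key X T1 T2) => // A B AG BG aA bB; apply: candP => //; exact: subset_trans ST1 aA || exact: subset_trans ST2 bB.
  apply: (key X T2 T1) => //; first by rewrite setUC.
  move=> A B AG BG aA bB dAB; rewrite setUC addnC => *; apply: candP => //.
  - exact: subset_trans ST1 bB.
  - exact: subset_trans ST2 aA.
  - by rewrite setIC.
exists T, Ej, T1, T2; split; split=> //.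
split.
- by move=> X /setU1P[->//|/(b_fl bG)].
- by move=> X /setU1P[->//|/(b_n0 bG)].
- by move=> y yD; have [X XG hX] := b_pt bG yD; exists X => //; rewrite in_setU1 XG orbT.
- move=> X Y /setU1P[->|XG] /setU1P[->|YG] h.
  + by rewrite setUid (cl_eq M (subxx _) fT (leqnn _)) setU11.
  + by rewrite setUC; apply: joinT => //; rewrite setIC.
  + exact: joinT.
  + by rewrite in_setU1 (b_join bG) ?orbT.
move=> F X fF /in_fac[XG XF mX].
have [XinG|XnG] := boolP (X \in G).
  apply: (b_sep bG fF); apply/in_fac; split=> // Y YG; apply: mX; by rewrite in_setU1 YG orbT.
have eX : X = T by move: XG; rewrite in_setU1 (negPf XnG) orbF => /eqP.
rewrite {}eX in XF mX * => {X XG XnG}.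
(* A member of G over [Ta] below F has a join with T in the enlarged family; T being a factor of F
   there, this join is T, so [Ta] was already maximal. *)
have hF Ta Tb : Ta \in G -> Tb \in G -> T = Ta :|: Tb -> Ta \in maxG_le G F.
  move=> aG bG' e; have aT : Ta \subset T by rewrite e subsetUl.
  have [A hA aA] := fac_above aG (subset_trans aT XF); have /in_fac[AG AF mA] := hA.
  have AT : A :&: T != set0.
    have [y ya] := set0Pn _ (b_n0 bG aG); apply/set0Pn; exists y.
    by rewrite inE (subsetP aA) // (subsetP aT).
  have sD : A :|: T \subset D by rewrite subUset (b_subD bG AG).
  have e' : clD D r (A :|: T) = T.
    apply: mX; first exact: joinT.
      by apply: (cl_min M _ fF); rewrite subUset AF.
    by apply: subset_trans (sub_clD r sD); apply: subsetUr.
  have A_T : A \subset T.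
    by rewrite -e'; apply: subset_trans (sub_clD r sD); apply: subsetUl.
  have /in_fac[_ _ mTa] := facT _ _ aG bG' e.
  by rewrite -(mTa A AG A_T aA).
have h1 := b_sep bG fF (hF _ _ T1G T2G eT).
have h2 : sep r F T2 by apply: (b_sep bG fF (hF T2 T1 T2G T1G _)); rewrite setUC.
have /andP[_ /eqP k1] := h1.
have := sep_split M h2 (subsetDl F T1).
have -> : (F :\: T1) :&: T2 = T2.
  apply/setIidPr; rewrite subsetD -setI_eq0 [T2 :&: T1]setIC dT eqxx andbT; exact: subset_trans s2 XF.
have -> : F :\: T1 :\: T2 = F :\: T by rewrite setDDl -eT.
by move=> k2; rewrite /sep XF k1 k2 rT addnA /= eqxx.
Qed.

Lemma maxset_flip D r G T Ej : mat D r -> built D r G -> T \notin G -> Ej \in maxset G -> T \proper Ej ->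
  T != set0 -> maxset (T |: G) = maxset G.
Proof.
move=> M bG TG hE TE T0; have EG : Ej \in G by case/in_maxset: hE.
apply/setP => X; apply/in_maxset/in_maxset => [[/setU1P[->|XG] mX]|[XG mX]].
- have := mX Ej; rewrite in_setU1 EG orbT (proper_sub TE) => /(_ isT isT) e.
  by move: TE; rewrite e properxx.
- by split=> // Y YG; apply: mX; rewrite in_setU1 YG orbT.
split=> [|Y /setU1P[->|YG]]; [by rewrite in_setU1 XG orbT | | exact: mX].
move=> XT; have e : Ej = X by apply: mX => //; apply: subset_trans XT (proper_sub TE).
by move: TE; rewrite properE e XT andbF.
Qed.

End More.

End M2.
Import M2.

(** * Nested sets and their images in a star *)

Module Nested.

Section Nested.
Variable E : finType.
Implicit Types (A F V W X Y Z : {set E}) (B G S : {set {set E}}) (r : {set E} -> nat).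

(** Subsets of antichains are antichains, so the larger antichain of the definition can be taken
    equal to the family being joined (see [nested_nst]). *)
Definition nst D r G S := (S \subset G) && [forall B : {set {set E}},
  [&& B \subset S, antichain B & 1 < #|B|] ==> (clD D r (\bigcup_(X in B) X) \notin G)].
Definition nst2 D r G V W := [|| V \subset W, W \subset V | clD D r (V :|: W) \notin G].

Lemma nstP D r G S : reflect (S \subset G /\ forall B, B \subset S -> antichain B -> 1 < #|B| ->
   clD D r (\bigcup_(X in B) X) \notin G) (nst D r G S).
Proof.
apply: (iffP andP) => -[h1 h2]; split=> //.
  by move=> B b1 b2 b3; move/forallP/(_ B)/implyP: h2; apply; rewrite b1 b2.
by apply/forallP => B; apply/implyP => /and3P[]; apply: h2.
Qed.

Lemma antiP B : reflect (forall X Y, X \in B -> Y \in B -> X \subset Y -> X = Y) (antichain B).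
Proof.
apply: (iffP forall_inP) => h X.
  by move=> Y hX hY XY; move/forall_inP/(_ Y hY)/implyP/(_ XY)/eqP: (h X hX).
by move=> hX; apply/forall_inP => Y hY; apply/implyP => XY; rewrite (h X Y).
Qed.

Lemma nst_sub D r G S S' : S' \subset S -> nst D r G S -> nst D r G S'.
Proof.
move=> s /nstP[h1 h2]; apply/nstP; split; first exact: subset_trans s h1.
by move=> B b1; apply: h2; apply: subset_trans b1 s.
Qed.

Lemma nst2C D r G V W : nst2 D r G V W = nst2 D r G W V.
Proof. by rewrite /nst2 setUC orbA [(V \subset W) || _]orbC -orbA. Qed.

Section One.
Variables (D : {set E}) (r : {set E} -> nat) (G : {set {set E}}).
Hypothesis M : mat D r.
Hypothesis bG : built D r G.

Lemma anti_pair V W : ~~ (V \subset W) -> ~~ (W \subset V) -> antichain [set V; W] /\ #|[set V; W]| = 2.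
Proof.
move=> h1 h2; split; last by rewrite cards2; case: eqVneq h1 => // ->; rewrite subxx.
by apply/antiP => X Y /set2P[]-> /set2P[]->; rewrite ?(negPf h1) ?(negPf h2).
Qed.

Lemma nst_pair S V W : nst D r G S -> V \in S -> W \in S -> nst2 D r G V W.
Proof.
move=> /nstP[_ h] hV hW; rewrite /nst2; case: (boolP (V \subset W)) => //= h1; case: (boolP (W \subset V)) => //= h2.
have [a1 a2] := anti_pair h1 h2; have := h [set V; W]; rewrite a1 a2 big_setU1 ?big_set1 /=.
  by apply=> //; rewrite subUset !sub1set hV.
by rewrite inE; apply: contraNneq h1 => ->.
Qed.

(** Inside a factor F1 of the join, the members of B lying below F1 span F1 by a rank count; since
    F1 is in G, nestedness leaves just one of them, namely F1. *)
Lemma nst_fac S B : nst D r G S -> B \subset S -> antichain B -> B != set0 ->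
  maxG_le G (clD D r (\bigcup_(X in B) X)) = B.
Proof.
move=> /nstP[SG h] BS /antiP aB B0; set A := \bigcup_(X in B) X; set F := clD D r A.
have BG X : X \in B -> X \in G by move=> hX; apply: (subsetP SG); apply: (subsetP BS).
have AD : A \subset D by apply/bigcupsP => X /BG/(b_subD bG).
have AF : A \subset F := sub_clD r AD; have fF : fl D r F := fl_cl M AD.
have sub F1 : F1 \in maxG_le G F -> F1 \in B.
  move=> hF1; have /in_fac[F1G F1F _] := hF1; have sF := b_sep bG fF hF1.
  have /andP[_ /eqP eF] := sF; pose B1 := [set X in B | X \subset F1].
  have eA : A :&: F1 = \bigcup_(X in B1) X.
    apply/setP => x; apply/setIP/bigcupP => [[/bigcupP[X hX xX] xF]|[X]]; last first.
      by rewrite inE => /andP[hX XF] xX; split; [apply/bigcupP; exists X | apply: (subsetP XF)].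
    exists X => //; rewrite inE hX /=.
    have [//|e] := fac_dich M bG fF hF1 (BG X hX) (subset_trans (bigcup_sup X hX) AF).
    by have : x \in X :&: F1 by [rewrite inE xX]; rewrite e inE.
  have := sep_split M sF AF; have h1 : r (A :\: F1) <= r (F :\: F1) by rewrite (m_mono M) // setSD.
  have rA : r F = r A := r_cl M AD.
  move=> h2; have h3 : r F1 <= r (A :&: F1) by move: h1 h2 eF rA; clear; lia.
  have eC : clD D r (\bigcup_(X in B1) X) = F1.
    by rewrite -eA; apply: (cl_eq M) => //; [apply: subsetIr | apply: (b_fl bG)].
  have B1B : B1 \subset B by apply/subsetP => X; rewrite inE => /andP[].
  have : ~~ (1 < #|B1|).
    apply/negP => c1; have a1 : antichain B1; last by have := h B1 (subset_trans B1B BS) a1 c1; rewrite eC F1G.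
    by apply/antiP => X Y hX hY; apply: aB; apply: (subsetP B1B).
  rewrite -leqNgt leq_eqVlt ltnS leqn0 => /orP[/cards1P[X eX]|]; last first.
    rewrite cards_eq0 => /eqP e0; move: h3; rewrite eA e0 big_set0 (r0 M).
    by have := b_rgt0 M bG F1G; clear; lia.
  have XB : X \in B by apply: (subsetP B1B); rewrite eX inE.
  by move: eC; rewrite eX big_set1 (cl_eq M (subxx X)) ?(b_fl bG) ?BG // => <-.
apply/setP => X; apply/idP/idP => [/sub//|hX].
have [Y hY XY] := fac_above (BG X hX) (subset_trans (bigcup_sup X hX) AF).
by rewrite (aB X Y hX (sub Y hY) XY).
Qed.

(** The case of two elements of [nst_fac], with the consequence that the join is a disjoint union
    with additive rank. *)
Lemma pair_fac V W : V \in G -> W \in G -> ~~ (V \subset W) -> ~~ (W \subset V) -> nst2 D r G V W ->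
  [/\ maxG_le G (V :|: W) = [set V; W], fl D r (V :|: W), r (V :|: W) = r V + r W & V :&: W = set0].
Proof.
move=> VG WG h1 h2 h; have [a1 a2] := anti_pair h1 h2.
have hn : clD D r (V :|: W) \notin G by move: h; rewrite /nst2 (negPf h1) (negPf h2).
have nS : nst D r G [set V; W].
  apply/nstP; split; first by rewrite subUset !sub1set VG.
  move=> B BS _ c; have -> : B = [set V; W] by apply/eqP; rewrite eqEcard BS a2.
  by rewrite big_setU1 ?big_set1 // inE; apply: contraNneq h1 => ->.
have VWD : V :|: W \subset D by rewrite subUset !(b_subD bG).
have d0 : V :&: W = set0.
  by apply/eqP; apply: contraNT hn => /(b_join bG VG WG).
have := nst_fac nS (subxx _) a1; rewrite -cards_eq0 a2 big_setU1 ?big_set1 /=; last first.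
  by rewrite inE; apply: contraNneq h1 => ->.
move=> /(_ isT); set F := clD D r (V :|: W) => eF.
have fF : fl D r F := fl_cl M VWD.
have hV : V \in maxG_le G F by rewrite eF !inE eqxx.
have sV := b_sep bG fF hV; have /andP[_ /eqP e1] := sV.
have eFV : F = V :|: W.
  apply/eqP; rewrite eqEsubset (sub_clD r VWD) andbT; apply/subsetP => x xF.
  by have [X] := fac_pt M bG fF xF; rewrite eF => /set2P[]-> xX; rewrite inE xX ?orbT.
have eW : F :\: V = W.
  by rewrite eFV setDUl setDv set0U; apply/setDidPl; rewrite disjoint_sym -setI_eq0 d0.
by rewrite -eFV; split=> //; rewrite e1 eW.
Qed.

Section Star.
Variable W : {set E}.
Hypothesis WG : W \in G.
Let fW : fl D r W. Proof. exact: (b_fl bG). Qed.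
Let W0 : W != set0. Proof. exact: (b_n0 bG). Qed.
Local Notation up := (up D r W).
Local Notation GW := (Gs D r G W).

Lemma up_nst Z : Z \in G -> ~~ (Z \subset W) -> nst2 D r G Z W ->
  [/\ up Z = Z :\: W, fl D r (Z :|: W) & maxG_le G (Z :|: W) = if W \subset Z then [set Z] else [set Z; W]].
Proof.
move=> ZG nZ hn; case: (boolP (W \subset Z)) => WZ.
  rewrite (setUidPl WZ); split; last 2 first.
  - exact: (b_fl bG).
  - apply/setP => X; rewrite in_set1; apply/in_fac/eqP => [[XG XZ mX]|->]; first by rewrite (mX Z).
    by split=> // Y _ h1 h2; apply/eqP; rewrite eqEsubset h1.
  by rewrite /M.up (negPf nZ) (setUidPl WZ) (cl_eq M (subxx _)) // (b_fl bG).
have [h1 h2 _ _] := pair_fac ZG WG nZ WZ hn; split=> //.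
by rewrite /M.up (negPf nZ) (cl_eq M (subxx _)) // setDUl setDv setU0.
Qed.

(** Equal images give the same flat Z ∪ W, in which both sets are the factor other than W. *)
Lemma up_inj Z1 Z2 : Z1 \in G -> Z2 \in G -> ~~ (Z1 \subset W) -> ~~ (Z2 \subset W) ->
  nst2 D r G Z1 W -> nst2 D r G Z2 W -> up Z1 = up Z2 -> Z1 = Z2.
Proof.
move=> G1 G2 n1 n2 s1 s2; have [e1 _ m1] := up_nst G1 n1 s1; have [e2 _ m2] := up_nst G2 n2 s2.
rewrite e1 e2 => e; have eF : Z1 :|: W = Z2 :|: W.
  by (apply/setP => x; have := congr1 (fun X : {set E} => x \in X) e; rewrite !inE; case: (x \in W); rewrite ?orbT ?orbF).
have : Z1 \in maxG_le G (Z2 :|: W) by rewrite -eF m1; case: ifP; rewrite !inE eqxx.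
rewrite m2; case: ifP => _; rewrite !inE; first by move/eqP.
by case/orP => /eqP // e'; rewrite e' subxx in n1.
Qed.

(** An arbitrary preimage need not be nested with W; the factor over it in its join with W is. *)
Lemma up_lift V Z' : Z' \in GW -> V \in G -> ~~ (V \subset W) -> up V \subset Z' ->
  exists Z, [/\ Z \in G, V \subset Z, ~~ (Z \subset W), nst2 D r G Z W & up Z = Z'].
Proof.
move=> hZ VG nV VZ.
have upV : up V = clD D r (V :|: W) :\: W by rewrite /M.up (negPf nV).
have VWD : V :|: W \subset D by rewrite subUset !(b_subD bG).
have [x xV xW] : exists2 x, x \in V & x \notin W by apply/subsetPn.
have xup : x \in up V by rewrite upV inE xW (subsetP (sub_clD r VWD)) // inE xV.
have [Z0 Z0G eZ] := imsetP hZ.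
have nZ0 : ~~ (Z0 \subset W).
  apply: contra xW => h; have := subsetP VZ _ xup; rewrite eZ /M.up h; exact: (subsetP h).
have ZWD : Z0 :|: W \subset D by rewrite subUset !(b_subD bG).
set F := clD D r (Z0 :|: W); have fF : fl D r F := fl_cl M ZWD.
have sF : Z0 :|: W \subset F := sub_clD r ZWD.
have WF : W \subset F := subset_trans (subsetUr _ _) sF.
have [A [hA ZA nA _ eA]] := fac_of M bG fW fF WF Z0G (subset_trans (subsetUl _ _) sF) nZ0.
have /in_fac[AG AF mA] := hA.
have eF : F = A :|: W.
  apply/eqP; rewrite eqEsubset subUset AF WF !andbT.
  by apply: (cl_min M _ (sub_flat_fac M bG fW fF WF hA)); rewrite setSU.
have eZ' : Z' = F :\: W by rewrite eZ /M.up (negPf nZ0).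
have VF : V \subset F.
  apply/subsetP => y yV; case: (boolP (y \in W)) => [/(subsetP WF)//|yW].
  have : y \in up V by rewrite upV inE yW (subsetP (sub_clD r VWD)) // inE yV.
  by move/(subsetP VZ); rewrite eZ' inE => /andP[].
exists A; split=> //; last by rewrite eA eZ' eF setDUl setDv setU0.
  have [Y hY VY] := fac_above VG VF; have xF := subsetP VF _ xV.
  have xA : x \in A by move: xF; rewrite eF inE (negPf xW) orbF.
  by rewrite (fac_eq M bG fF hA hY xA (subsetP VY _ xV)).
rewrite /nst2 (negPf nA) /=; case: (boolP (W \subset A)) => //= nW.
rewrite -eF (cl_eq M (subxx _) fF) //; apply: contra nW => FG.
by rewrite -(mA F FG (subxx _) AF).
Qed.

(** Suppose the images of an antichain B joined to a member outside W coming from V. The join F of B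
    and W would then be covered by W and the factor of F over V, while [nst_fac] shows that F has at
    least two factors other than W, or one of them containing W and another one beside it. *)
Lemma nst_star S : nst D r G S -> W \in S -> nst D (rs r W) GW [set up X | X in S :\ W].
Proof.
move=> nS WS; have /nstP[SG hS] := nS; have M' := mat_star M fW.
have bG' := built_star M bG fW.
apply/nstP; split.
  by apply/subsetP => _ /imsetP[X /setD1P[_ hX] ->]; apply: imset_f; apply: (subsetP SG).
move=> B' B'S aB' cB'; apply/negP; set V' := clD D _ _ => V'G.
have upE X : X \in S -> ~~ (X \subset W) -> up X = X :\: W.
  by move=> hX nX; have [] := up_nst (subsetP SG _ hX) nX (nst_pair nS hX WS).
have B'G X : X \in B' -> X \in GW.
  by move/(subsetP B'S)/imsetP => [Y /setD1P[_ hY] ->]; apply: imset_f; apply: (subsetP SG).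
have UD : \bigcup_(X in B') X \subset D by apply/bigcupsP => X /B'G/(b_subD bG').
have UV : \bigcup_(X in B') X \subset V' := sub_clD _ UD.
have B'V X : X \in B' -> X \subset V' by move=> hX; apply: subset_trans UV; apply: bigcup_sup.
have rV : rs r W V' = rs r W (\bigcup_(X in B') X) := r_cl M' UD.
have V'D : V' \subset D := cl_subD _ _ _.
have [[VG VW]|[V [VG nV eV dV]]] := in_Gs V'G.
  have B'S' : B' \subset S.
    apply/subsetP => X' hX'; have /imsetP[X /setD1P[_ hX] e] := subsetP B'S _ hX'.
    case: (boolP (X \subset W)) => XW; first by rewrite e up_in.
    have /set0Pn[x xX] := b_n0 bG' (B'G _ hX'); have xW := subsetP VW _ (subsetP (B'V _ hX') _ xX).
    by move: xX; rewrite e upE // inE xW.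
  have := hS B' B'S' aB' cB'; rewrite (cl_eq M UV (b_fl bG VG)) ?VG //.
  by move: rV; rewrite !rs_in ?(subset_trans UV VW) // => ->.
pose B := [set X in S :\ W | up X \in B'].
have inB X : X \in B -> [/\ X \in S, X \in G, X != W, up X \in B' & ~~ (X \subset W)].
  rewrite inE => /andP[/setD1P[h1 h2] h3]; split=> //; first exact: (subsetP SG).
  apply/negP => XW; have /set0Pn[x xX] := b_n0 bG (subsetP SG _ h2).
  have xV : x \in V' by apply: (subsetP (B'V _ h3)); rewrite up_in.
  by have : x \in V' :&: W; [rewrite inE xV (subsetP XW) | rewrite dV inE].
have BS : B \subset S by apply/subsetP => X /inB[].
have eB : B' = [set up X | X in B].
  apply/setP => X'; apply/idP/imsetP => [h|[X /inB[_ _ _ h _] -> //]].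
  by have /imsetP[X hX e] := subsetP B'S _ h; exists X => //; rewrite inE hX -e.
have aB : antichain B.
  apply/antiP => X Y hX hY XY; have [X1 X2 X3 X4 X5] := inB X hX; have [Y1 Y2 Y3 Y4 Y5] := inB Y hY.
  apply: up_inj => //; [exact: nst_pair nS X1 WS | exact: nst_pair nS Y1 WS|].
  by apply: (antiP _ aB') => //; rewrite !upE // setSD.
have cB : 1 < #|B| by apply: leq_trans cB' _; rewrite eB leq_imset_card.
have VWD : V :|: W \subset D by rewrite subUset !(b_subD bG).
set F := clD D r (V :|: W) in eV; have fF : fl D r F := fl_cl M VWD.
have sF : V :|: W \subset F := sub_clD r VWD.
have WF : W \subset F := subset_trans (subsetUr _ _) sF.
have VF : V \subset F := subset_trans (subsetUl _ _) sF.
have eU : \bigcup_(X in B') X :|: W = \bigcup_(X in B) X :|: W.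
  apply/setP => x; rewrite !inE; case: (boolP (x \in W)) => xW; rewrite ?orbT ?orbF //.
  apply/bigcupP/bigcupP => [[X']|[X hX xX]].
    rewrite eB => /imsetP[X hX ->]; have [X1 _ _ _ X5] := inB X hX; rewrite upE // => /setDP[xX _].
    by exists X.
  have [X1 _ _ X4 X5] := inB X hX; exists (up X) => //; by rewrite upE // inE xW.
have UF : \bigcup_(X in B) X :|: W \subset F.
  rewrite -eU subUset WF andbT; apply: subset_trans UV _; by rewrite eV subsetDl.
have rF : clD D r (\bigcup_(X in B) X :|: W) = F.
  apply: (cl_eq M) => //; rewrite -eU.
  have h1 : rs r W V' = r F - r W by rewrite eV (rs_DZ M WF).
  have h2 : rs r W (\bigcup_(X in B') X) = r (\bigcup_(X in B') X :|: W) - r W.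
    apply: (rs_out M); apply/eqP; rewrite -subset0; apply: subset_trans (setSI W UV) _; by rewrite dV.
  have h3 := m_mono M WF; have h4 : r W <= r (\bigcup_(X in B') X :|: W) by rewrite (m_mono M) // subsetUr.
  move: rV h1 h2 h3 h4; clear; lia.
have FY Y : V \subset Y -> Y \in maxG_le G F -> F \subset Y :|: W.
  move=> VY hY; apply: (cl_min M _ (sub_flat_fac M bG fW fF WF hY)); by rewrite setSU.
have other Y : exists2 X, X \in B & X != Y.
  have [X1 [X2 [h1 h2 ne]]] := card_gt1P cB; case: (eqVneq X1 Y) => [e|h]; last by exists X1.
  by exists X2 => //; rewrite -e eq_sym.
(* If some member of B contains W then B is the set of factors of F; otherwise W can be added to the
   antichain. *)
case: (boolP [exists X in B, W \subset X]) => [/exists_inP[X0 hX0 WX]|no].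
  have eUB : \bigcup_(X in B) X :|: W = \bigcup_(X in B) X.
    by apply/setUidPl; apply: subset_trans WX _; apply: bigcup_sup.
  have B0 : B != set0 by rewrite -cards_eq0 -lt0n; apply: ltnW.
  have := nst_fac nS BS aB B0; rewrite -eUB rF => mF.
  have [Y hY VY] := fac_above VG VF; have YB : Y \in B by rewrite -mF.
  have sFY := FY Y VY hY; have [_ X0G X0W _ nX0] := inB _ hX0.
  case: (eqVneq Y X0) => [e|ne].
    have [X hX neX] := other X0; have XF : X \subset F by apply: subset_trans UF; apply: subset_trans (subsetUl _ _); apply: bigcup_sup.
    case/eqP: neX; apply: (antiP _ aB) => //; apply: subset_trans XF _; apply: subset_trans sFY _.
    by rewrite e subUset subxx WX.
  case/negP: nX0; apply/subsetP => x xX.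
  have xF : x \in F by apply: (subsetP UF); rewrite inE; apply/orP; left; apply/bigcupP; exists X0.
  have := subsetP sFY _ xF; rewrite inE => /orP[xY|//].
  by case/eqP: ne; apply: (fac_eq M bG fF hY _ xY xX); rewrite mF.
have noW X : X \in B -> ~~ (W \subset X) by move=> hX; apply: contra no => h; apply/exists_inP; exists X.
have WB : W \notin B by apply: contraL (subxx W) => /noW.
have aB1 : antichain (W |: B).
  apply/antiP => X Y /setU1P[->|hX] /setU1P[->|hY] //.
  - by rewrite (negPf (noW _ hY)).
  - by have [_ _ _ _ h] := inB X hX; rewrite (negPf h).
  exact: (antiP _ aB).
have B1S : W |: B \subset S by rewrite subUset sub1set WS.
have B10 : W |: B != set0 by apply/set0Pn; exists W; rewrite !inE eqxx.
have := nst_fac nS B1S aB1 B10; rewrite big_setU1 //= setUC rF => mF.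
have [Y hY VY] := fac_above VG VF; have sFY := FY Y VY hY.
have [X hX neX] := other Y; have [_ XG XW _ _] := inB X hX.
have hXF : X \in maxG_le G F by rewrite mF inE hX orbT.
have hWF : W \in maxG_le G F by rewrite mF !inE eqxx.
have /set0Pn[x xX] := b_n0 bG XG.
have xF : x \in F by apply: (subsetP UF); rewrite inE; apply/orP; left; apply/bigcupP; exists X.
have := subsetP sFY _ xF; rewrite inE => /orP[xY|xW].
  by case/eqP: neX; apply: (fac_eq M bG fF hXF hY xX xY).
by case/eqP: XW; apply: (fac_eq M bG fF hXF hWF xX xW).
Qed.

End Star.
End One.
End Nested.

End Nested.
Import Nested.

Import Order.TTheory GRing.Theory Num.Theory.

(** * Hodge-Riemann forms on graded spaces and the gamma decomposition *)

Module Forms.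
Local Open Scope ring_scope.

(** Replaces letting s tend to infinity: it isolates the coefficient of the class being split
    off. *)
Lemma slope_ge0 (R : realFieldType) (a b : R) : (forall s, 0 < s -> 0 <= a + s * b) -> 0 <= b.
Proof.
move=> h; rewrite leNgt; apply/negP => b0.
have s0 : 0 < (`|a| + 1) / (- b) by rewrite divr_gt0 ?oppr_gt0 // ltr_wpDl.
have := h _ s0; have -> : (`|a| + 1) / (- b) * b = - (`|a| + 1) by field; lra.
have := ler_norm a; lra.
Qed.

(** The discriminant argument: a null vector of a semidefinite form is orthogonal to everything. *)
Lemma quad_ge0 (R : realFieldType) (b c : R) : (forall t, 0 <= t * b *+ 2 + t ^+ 2 * c) -> b = 0.
Proof.
move=> h; apply/eqP/negP => /negP b0.
have m0 : 0 < `|c| + 1 by rewrite ltr_wpDl.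
set m := `|c| + 1 in m0; have x0 : 0 < b ^+ 2 / m by rewrite divr_gt0 // lt_def sqrf_eq0 b0 sqr_ge0.
have := h (- (b / m)).
have -> : - (b / m) * b *+ 2 + (- (b / m)) ^+ 2 * c = b ^+ 2 / m * (c / m - 2%:R) by field; lra.
rewrite pmulr_rge0 // leNgt; apply/negP; rewrite negbK.
have : c / m <= 1 by rewrite ler_pdivrMr // mul1r (le_trans (ler_norm _)) // lerDl ler01.
lra.
Qed.

Section Piece.
Variables (R : realFieldType) (n : nat).
Implicit Types (K : nat -> 'M[R]_n) (P L N H : 'M[R]_n) (u v w : 'rV[R]_n) (hs : seq 'M[R]_n).

Definition form P u v : R := (u *m P *m v^T) 0 0.

Lemma formDl P u v w : form P (u + v) w = form P u w + form P v w.
Proof. by rewrite /form !mulmxDl mxE. Qed.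
Lemma formDr P u v w : form P u (v + w) = form P u v + form P u w.
Proof. by rewrite /form linearD /= mulmxDr mxE. Qed.
Lemma formZl P a u v : form P (a *: u) v = a * form P u v.
Proof. by rewrite /form -!scalemxAl mxE. Qed.
Lemma formZr P a u v : form P u (a *: v) = a * form P u v.
Proof. by rewrite /form linearZ /= -scalemxAr mxE. Qed.
Lemma formNl P u v : form P (- u) v = - form P u v.
Proof. by rewrite -scaleN1r formZl mulN1r. Qed.
Lemma formNr P u v : form P u (- v) = - form P u v.
Proof. by rewrite -scaleN1r formZr mulN1r. Qed.
Lemma formBl P u v w : form P (u - v) w = form P u w - form P v w.
Proof. by rewrite formDl formNl. Qed.
Lemma formBr P u v w : form P u (v - w) = form P u v - form P u w.
Proof. by rewrite formDr formNr. Qed.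
Lemma form0l P v : form P 0 v = 0.
Proof. by rewrite /form !mul0mx mxE. Qed.
Lemma form0r P v : form P v 0 = 0.
Proof. by rewrite /form trmx0 mulmx0 mxE. Qed.
Lemma formC P u v : P^T = P -> form P u v = form P v u.
Proof.
move=> sP; rewrite /form -[in LHS](trmxK (u *m P *m v^T)) mxE.
by rewrite !trmx_mul trmxK sP mulmxA.
Qed.
Lemma form_adj P H u v : H *m P = P *m H^T -> form P (u *m H) v = form P u (v *m H).
Proof. by move=> sH; rewrite /form trmx_mul -!mulmxA (mulmxA H) sH -!mulmxA. Qed.
Lemma formM P N u v : form (N *m P) u v = form P (u *m N) v.
Proof. by rewrite /form !mulmxA. Qed.

Lemma mulmxXS u L e : u *m L ^+ e *m L = u *m L ^+ e.+1.
Proof. by rewrite -mulmxA exprSr. Qed.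
Lemma mulmxXSl u L e : u *m L *m L ^+ e = u *m L ^+ e.+1.
Proof. by rewrite -mulmxA exprS. Qed.

(** The row space of [K k] is the piece of degree k. Graded subspaces are obtained by changing K
    alone, and the radical replaces passing to a quotient. *)
Definition rd K P u := forall l v, (v <= K l)%MS -> form P u v = 0.

Lemma rd0 K P : rd K P 0. Proof. by move=> l v _; rewrite form0l. Qed.
Lemma rdD K P u v : rd K P u -> rd K P v -> rd K P (u + v).
Proof. by move=> hu hv l w hw; rewrite formDl (hu l) // (hv l) // addr0. Qed.
Lemma rdZ K P a u : rd K P u -> rd K P (a *: u).
Proof. by move=> hu l w hw; rewrite formZl (hu l) // mulr0. Qed.
Lemma rdN K P u : rd K P u -> rd K P (- u).
Proof. by move=> hu; rewrite -scaleN1r; apply: rdZ. Qed.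
Lemma rdB K P u v : rd K P u -> rd K P v -> rd K P (u - v).
Proof. by move=> hu hv; apply: rdD => //; apply: rdN. Qed.

Record piece K P (d : nat) hs : Prop := Piece {
  pc_sym : P^T = P;
  pc_gr : forall k l u v, (u <= K k)%MS -> (v <= K l)%MS -> (k + l)%N <> d -> form P u v = 0;
  pc_st : forall H k u, H \in hs -> (u <= K k)%MS -> (u *m H <= K k.+1)%MS;
  pc_adj : forall H, H \in hs -> H *m P = P *m H^T;
  pc_comm : forall H H', H \in hs -> H' \in hs -> H *m H' = H' *m H }.

Fixpoint cone hs L : Prop :=
  if hs is h :: hs' then exists2 s : R, 0 < s & exists2 L', cone hs' L' & L = s *: h + L'
  else L = 0.

(** Definiteness on primitive classes modulo the radical: a null value puts the class in the
    radical. All coefficients of the Lefschetz class are strictly positive. *)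
Definition HR K P d hs := forall L, cone hs L -> forall k u, (k.*2 <= d)%N -> (u <= K k)%MS ->
  rd K P (u *m L ^+ (d - k.*2).+1) ->
  0 <= (-1) ^+ k * form P (u *m L ^+ (d - k.*2)) u /\
  (form P (u *m L ^+ (d - k.*2)) u = 0 -> rd K P u).

Section Basic.
Variables (K : nat -> 'M[R]_n) (P : 'M[R]_n) (d : nat) (hs : seq 'M[R]_n).
Hypothesis pc : piece K P d hs.

(* L commuting with the operators, self-adjoint and raising degrees by one. *)
Record good L : Prop := Good {
  gd_st : forall k u, (u <= K k)%MS -> (u *m L <= K k.+1)%MS;
  gd_adj : L *m P = P *m L^T;
  gd_comm : forall H, H \in hs -> L *m H = H *m L }.

Lemma good0 : good 0.
Proof.
split=> [k u _||H _]; first by rewrite mulmx0 sub0mx.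
- by rewrite trmx0 mulmx0 mul0mx.
- by rewrite mulmx0 mul0mx.
Qed.

Lemma good_op H : H \in hs -> good H.
Proof. by case: pc => _ _ st ad cm hH; split=> [k u|//|H' hH']; [apply: st | apply: ad| apply: cm]. Qed.

Lemma goodD L1 L2 : good L1 -> good L2 -> good (L1 + L2).
Proof.
move=> [s1 a1 c1] [s2 a2 c2]; split=> [k u hu||H hH].
- by rewrite mulmxDr addmx_sub ?s1 ?s2.
- by rewrite linearD /= mulmxDl mulmxDr a1 a2.
- by rewrite mulmxDl mulmxDr c1 ?c2.
Qed.

Lemma goodZ a L : good L -> good (a *: L).
Proof.
move=> [s1 a1 c1]; split=> [k u hu||H hH].
- by rewrite -scalemxAr scalemx_sub ?s1.
- by rewrite linearZ /= -scalemxAl -scalemxAr a1.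
- by rewrite -scalemxAl -scalemxAr c1.
Qed.

Lemma good_cone hs' L : {subset hs' <= hs} -> cone hs' L -> good L.
Proof.
elim: hs' L => [|h hs' IH] L /= hsub; first by move=> ->; apply: good0.
move=> [s s0 [L' hL' ->]]; apply: goodD.
  by apply/goodZ/good_op/hsub; rewrite inE eqxx.
by apply: IH => // x hx; apply: hsub; rewrite inE hx orbT.
Qed.

Lemma good_comm_cone L hs' L' : good L -> {subset hs' <= hs} -> cone hs' L' -> L *m L' = L' *m L.
Proof.
move=> gL; elim: hs' L' => [|h hs' IH] L' /= hsub; first by move=> ->; rewrite mulmx0 mul0mx.
move=> [s s0 [L'' hL'' ->]]; rewrite mulmxDr mulmxDl -scalemxAr -scalemxAl.
rewrite (@gd_comm _ gL h) ?hsub ?inE ?eqxx // (IH L'') // => x hx.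
by apply: hsub; rewrite inE hx orbT.
Qed.

Lemma good_X L e k u : good L -> (u <= K k)%MS -> (u *m L ^+ e <= K (k + e))%MS.
Proof.
move=> gL hu; elim: e => [|e IH]; first by rewrite expr0 mulmx1 addn0.
by rewrite exprSr mulmxA addnS; apply: gd_st.
Qed.

Lemma adj_X L e u v : good L -> form P (u *m L ^+ e) v = form P u (v *m L ^+ e).
Proof.
move=> gL; elim: e u v => [|e IH] u v; first by rewrite expr0 !mulmx1.
rewrite exprSr !mulmxA (form_adj _ _ (gd_adj gL)) IH -!mulmxA.
by congr (form P u (v *m _)); exact: etrans (esym (exprS L e)) (exprSr L e).
Qed.

Lemma rd_st L u : good L -> rd K P u -> rd K P (u *m L).
Proof.
move=> gL hu l v hv; rewrite (form_adj _ _ (gd_adj gL)).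
exact: (hu l.+1 _ (gd_st gL hv)).
Qed.

Lemma rd_X L e u : good L -> rd K P u -> rd K P (u *m L ^+ e).
Proof.
move=> gL hu; elim: e => [|e IH]; first by rewrite expr0 mulmx1.
by rewrite exprSr mulmxA; apply: rd_st.
Qed.

Lemma rdP k u : (k <= d)%N -> (u <= K k)%MS ->
  (forall v, (v <= K (d - k))%MS -> form P u v = 0) -> rd K P u.
Proof.
move=> hk hu h l v hv; case: (eqVneq (k + l)%N d) => [e|/eqP ne]; last exact: (pc_gr pc hu hv).
by apply: h; rewrite -e addKn.
Qed.

Lemma rd_big k u : (d < k)%N -> (u <= K k)%MS -> rd K P u.
Proof. by move=> hk hu l v hv; apply: (pc_gr pc hu hv); lia. Qed.

Lemma rd_mx k u : (k <= d)%N -> (u <= K k)%MS ->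
  (u *m P *m (K (d - k)%N)^T = 0) <-> rd K P u.
Proof.
move=> hk hu; split=> [h|h].
  apply: (rdP hk hu) => v /submxP[D ->].
  by rewrite /form trmx_mul mulmxA h mul0mx mxE.
apply/matrixP=> i j; rewrite ord1 [RHS]mxE.
apply: etrans (h (d - k)%N (row j (K (d - k)%N)) (row_sub _ _)).
by rewrite /form !mxE; apply: eq_bigr => x _; rewrite !mxE.
Qed.

(** The dimension of the piece of degree k modulo the radical, as the rank of its pairing with
    degree d - k. *)
Definition qk k := if (k <= d)%N then \rank (K k *m P *m (K (d - k)%N)^T) else 0%N.

Lemma qk_sym k : (k <= d)%N -> qk (d - k) = qk k.
Proof.
move=> hk; rewrite /qk leq_subr hk subKn // -mxrank_tr !trmx_mul trmxK (pc_sym pc).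
by rewrite mulmxA.
Qed.


Definition HLin L := forall k u, (k.*2 <= d)%N -> (u <= K k)%MS ->
  rd K P (u *m L ^+ (d - k.*2)) -> rd K P u.

Lemma HLinj hs' L : {subset hs' <= hs} -> HR K P d hs' -> cone hs' L -> HLin L.
Proof.
move=> hsub hr cL k u hk hu h; have gL := good_cone hsub cL.
have [|_ h2] := hr _ cL k u hk hu; first by rewrite exprSr mulmxA; apply: rd_st.
by apply: h2; apply: (h k).
Qed.

(** Injectivity of the Lefschetz map modulo the radical becomes surjectivity, because degrees k and
    d - k have the same rank [qk]. *)
Lemma HLsurj L k v : good L -> HLin L -> (k.*2 <= d)%N -> (v <= K (d - k))%MS ->
  exists2 u, (u <= K k)%MS & rd K P (v - u *m L ^+ (d - k.*2)).
Proof.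
move=> gL hli hk hv.
have kd : (k <= d)%N by lia.
have kk : (k + (d - k.*2) = d - k)%N by lia.
have mx' u : (u <= K (d - k))%MS -> u *m P *m (K k)^T = 0 <-> rd K P u.
  by have := @rd_mx (d - k) u (leq_subr _ _); rewrite subKn.
set A := K (d - k)%N *m P *m (K k)^T; set B := K k *m L ^+ (d - k.*2) *m P *m (K k)^T.
have sKK : (K k *m L ^+ (d - k.*2) <= K (d - k))%MS.
  apply/row_subP => i; rewrite row_mul -kk; apply: good_X => //; exact: row_sub.
have sBA : (B <= A)%MS by rewrite /A /B !submxMr.
have rB : \rank B = qk k.
  have e1 := mxrank_mul_ker (K k) (P *m (K (d - k)%N)^T).
  have e2 := mxrank_mul_ker (K k) (L ^+ (d - k.*2) *m P *m (K k)^T).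
  rewrite /qk kd; move: e1 e2; rewrite !mulmxA -/B => e1 e2.
  have /eqmx_rank hh : (K k :&: kermx (P *m (K (d - k)%N)^T) ==
      K k :&: kermx (L ^+ (d - k.*2) *m P *m (K k)^T))%MS; last first.
    by move: e2; rewrite -hh -e1 => /addIn.
  apply/andP; split; apply/rV_subP => u; rewrite !sub_capmx => /andP[uK /sub_kermxP h]; rewrite uK /=;
    apply/sub_kermxP; move: h; rewrite !mulmxA => h.
    have /(rd_X (d - k.*2) gL) hr' : rd K P u by apply/(rd_mx kd uK).
    by apply/mx' => //; rewrite -kk; apply: good_X.
  apply/(rd_mx kd uK); apply: (hli k) => //.
  by apply/mx' => //; rewrite -kk; apply: good_X.
have rA : \rank A = qk k by rewrite -(qk_sym kd) /qk leq_subr subKn.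
have sAB : (A <= B)%MS by rewrite -(mxrank_leqif_sup sBA) rA rB.
case/submxP: (hv) => D eD.
have : (v *m P *m (K k)^T <= B)%MS.
  by apply: submx_trans sAB; rewrite eD /A -!mulmxA submxMl.
case/submxP => C eC; exists (C *m K k); first exact: submxMl.
apply/mx'; last by rewrite !mulmxBl eC /B !mulmxA subrr.
rewrite addmx_sub // eqmx_opp -mulmxA; apply: submx_trans sKK; exact: submxMl.
Qed.

Lemma rd_qk0 k : (forall u, (u <= K k)%MS -> rd K P u) -> qk k = 0%N.
Proof.
move=> h; rewrite /qk; case: leqP => // hk; apply/eqP; rewrite mxrank_eq0; apply/eqP.
apply/row_matrixP => i; rewrite row0 !row_mul.
by apply/(rd_mx hk); [apply: row_sub | apply: h; apply: row_sub].
Qed.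

End Basic.

Lemma ker_col m p (T : 'M[R]_(m, p)) (x : 'cV[R]_m) : kermx T *m x = 0 -> exists c, x = T *m c.
Proof.
move=> h; have : (x^T <= T^T)%MS.
  rewrite submxE; apply/eqP/trmx_inj; rewrite trmx_mul trmxK trmx0.
  have /sub_kermxP/submxP[D ->] : (cokermx T^T)^T *m T = 0.
    by apply: trmx_inj; rewrite trmx_mul trmxK mulmx_coker trmx0.
  by rewrite -mulmxA h mulmx0.
by case/submxP => D /(congr1 trmx); rewrite trmx_mul !trmxK => ->; exists D^T.
Qed.

Section Gr.
Variables (K : nat -> 'M[R]_n) (P : 'M[R]_n) (d : nat) (hs todo : seq 'M[R]_n) (N : 'M[R]_n).
Hypothesis d0 : (0 < d)%N.
Hypothesis pc : piece K P d hs.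
Hypothesis hN : N \in hs.
Hypothesis htodo : {subset todo <= hs}.
Hypothesis NN : forall k u, (u <= K k)%MS -> rd K P (u *m N *m N).
Hypothesis hr : HR K P d (N :: todo).

Let gN : good K P hs N. Proof. exact: (good_op pc hN). Qed.

Lemma piece_g : piece K (N *m P) d.-1 hs.
Proof.
case: pc => sy gr st ad cm; split=> //.
- by rewrite trmx_mul sy (ad _ hN).
- move=> k l u v hu hv hkl; rewrite formM; apply: (gr k.+1 l) => //; last by lia.
  exact: st.
- by move=> H hH; rewrite mulmxA (cm _ _ hH hN) -!mulmxA (ad _ hH).
Qed.

Lemma rd_gP u : rd K (N *m P) u <-> rd K P (u *m N).
Proof. by split=> h l v hv; move: (h l v hv); rewrite formM. Qed.

(** The annihilator of N modulo the radical. From degree d on the condition is automatic, and the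
    subtraction in the index would be truncated. *)
Definition Kw k := if (k < d)%N then (K k :&: kermx (N *m P *m (K (d.-1 - k)%N)^T))%MS else K k.

Lemma KwP k u : (u <= Kw k)%MS <-> (u <= K k)%MS /\ rd K P (u *m N).
Proof.
rewrite /Kw; case: ltnP => hk; last first.
  split=> [hu|[]//]; split=> //; apply: (rd_big pc (k := k.+1)); [lia | exact: (gd_st gN hu)].
have e : (d.-1 - k = d - k.+1)%N by lia.
rewrite sub_capmx e; split=> [/andP[uK /sub_kermxP h]|[uK h]].
  split=> //; apply/(rd_mx pc hk); first exact: (gd_st gN).
  by rewrite -[RHS]h !mulmxA.
rewrite uK; apply/sub_kermxP; rewrite !mulmxA; apply/(rd_mx pc hk) => //; exact: (gd_st gN).
Qed.

Lemma KwS k u : (u <= Kw k)%MS -> (u <= K k)%MS. Proof. by case/KwP. Qed.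

Lemma rd_w u : rd K P u -> rd Kw P u.
Proof. by move=> h l v /KwS; apply: h. Qed.

Lemma piece_w : piece Kw P d hs.
Proof.
case: (pc) => sy gr st ad cm; split=> //.
- by move=> k l u v /KwS hu /KwS hv; apply: gr.
- move=> H k u hH /KwP[uK h]; apply/KwP; split; first exact: st.
  by rewrite -mulmxA cm // mulmxA; apply: (rd_st (good_op pc hH)).
Qed.

(** Double orthogonality: the annihilator of N is the orthogonal of its image, so what is orthogonal
    to it comes from the image, modulo the radical. *)
Lemma dperp k u : (0 < k <= d)%N -> (u <= Kw k)%MS -> rd Kw P u ->
  exists2 b, (b <= K k.-1)%MS & rd K P (u - b *m N).
Proof.
move=> /andP[k0 kd] hu h; have uK := KwS hu.
set T := K (d - k)%N *m P *m (K k.-1 *m N)^T.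
have [c hc] : exists c, K (d - k)%N *m P *m u^T = T *m c.
  apply: ker_col; apply/row_matrixP => i; rewrite row0 row_mul.
  set z := row i _; have hz : z *m T = 0 by apply/sub_kermxP/row_sub.
  have hv : (z *m K (d - k)%N <= Kw (d - k))%MS.
    apply/KwP; split; first exact: submxMl.
    have hd : (d - k < d)%N by lia.
    apply/(rd_mx pc hd); first by apply: (gd_st gN); apply: submxMl.
    have -> : (d - (d - k).+1 = k.-1)%N by lia.
    rewrite -[RHS]hz /T trmx_mul !mulmxA -!mulmxA; congr (_ *m (_ *m _)).
    by rewrite !mulmxA (pc_adj pc hN).
  apply/matrixP => a b; rewrite !ord1 [RHS]mxE.
  have := h _ _ hv; rewrite (formC _ _ (pc_sym pc)) /form => <-.
  by rewrite !mulmxA.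
exists (c^T *m K k.-1); first exact: submxMl.
have hb : (c^T *m K k.-1 *m N <= K k)%MS.
  by have := gd_st gN (submxMl c^T (K k.-1)); rewrite prednK.
apply/(rd_mx pc kd); first by rewrite addmx_sub // eqmx_opp.
apply: trmx_inj; rewrite trmx0 !trmx_mul trmxK (pc_sym pc) linearB /= !mulmxBr mulmxA hc /T.
by rewrite !trmx_mul trmxK !mulmxA subrr.
Qed.

(** N squares to zero modulo the radical, so the binomial expansion stops after the linear term. *)
Lemma pow_cone L s m k u : good K P hs L -> L *m N = N *m L -> (u <= K k)%MS ->
  rd K P (u *m (s *: N + L) ^+ m - (u *m L ^+ m + (m%:R * s) *: (u *m N *m L ^+ m.-1))).
Proof.
move=> gL cLN hu.
have gSL : good K P hs (s *: N + L) by apply: goodD => //; apply: goodZ.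
have hN' e : L ^+ e *m N = N *m L ^+ e.
  elim: e => [|e IH]; first by rewrite expr0 mulmx1 mul1mx.
  by rewrite exprS -[_ * _]/(L *m _) -mulmxA IH !mulmxA cLN.
elim: m => [|m IH].
  by rewrite !expr0 !mulmx1 !mul0r scale0r addr0 subrr; apply: rd0.
have := rd_st gSL IH; rewrite mulmxBl mulmxXS.
have h2 := rd_X m.-1 gL (NN hu).
move=> h1; have := rdD h1 (rdZ (m%:R * s * s) h2).
congr (rd K P _); rewrite !mulmxDr !mulmxDl -!scalemxAl -!scalemxAr mulmxXS.
have -> : u *m L ^+ m *m N = u *m N *m L ^+ m by rewrite -mulmxA hN' mulmxA.
have -> : u *m N *m L ^+ m.-1 *m N = u *m N *m N *m L ^+ m.-1 by rewrite -mulmxA hN' !mulmxA.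
case: m {IH h1 h2} => [|m] /=.
  by apply/matrixP=> i j; rewrite !mxE; ring.
rewrite mulmxXS -natr1; apply/matrixP=> i j; rewrite !mxE -natr1; ring.
Qed.

Section OneL.
Variable L : 'M[R]_n.
Hypothesis cL : cone todo L.
Let gL : good K P hs L. Proof. exact: (good_cone pc htodo cL). Qed.
Let gLg : good K (N *m P) hs L. Proof. exact: (good_cone piece_g htodo cL). Qed.
Let gLw : good Kw P hs L. Proof. exact: (good_cone piece_w htodo cL). Qed.
Let cLN : L *m N = N *m L. Proof. by rewrite (good_comm_cone gN htodo cL). Qed.
Let cLNe e : L ^+ e *m N = N *m L ^+ e.
Proof.
elim: e => [|e IH]; first by rewrite expr0 mulmx1 mul1mx.
by rewrite exprS -[_ * _]/(L *m _) -mulmxA IH !mulmxA cLN.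
Qed.

Let mLN u e : u *m L ^+ e *m N = u *m N *m L ^+ e.
Proof. by rewrite -mulmxA cLNe mulmxA. Qed.

(** The class u N has degree k + 1 and is primitive for N + L, which acts on it like L. Its
    Hodge-Riemann value contains N twice, hence is zero. *)
Lemma HLg : HLin K (N *m P) d.-1 L.
Proof.
move=> k u hk hu /rd_gP; rewrite -mulmxA cLNe mulmxA => h; apply/rd_gP.
(* Here d = 2 k + 1: the Lefschetz power is trivial and nothing remains to be shown. *)
case: (ltnP d k.+1.*2) => h2.
  move: h; have -> : (d.-1 - k.*2 = 0)%N by lia.
  by rewrite expr0 mulmx1.

have vK : (u *m N <= K k.+1)%MS := gd_st gN hu.
have pw m : rd K P (u *m N *m (1 *: N + L) ^+ m - u *m N *m L ^+ m).
  have := pow_cone 1 m gL cLN vK; rewrite opprD addrA => h3.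
  have h4 : rd K P ((m%:R * 1) *: (u *m N *m N *m L ^+ m.-1)).
    by apply: rdZ; apply: (rd_X _ gL (NN hu)).
  by have := rdD h3 h4; rewrite subrK.
have [||_] := @hr (1 *: N + L) _ k.+1 (u *m N) h2 vK.
- by exists 1 => //; exists L.
- have e1 : (d.-1 - k.*2 = (d - k.+1.*2).+1)%N by lia.
  by rewrite e1 in h; have := rdD (pw (d - k.+1.*2).+1) h; rewrite subrK.
apply; rewrite -(subrK (u *m N *m L ^+ (d - k.+1.*2)) (_ *m (_ + _) ^+ _)) formDl.
rewrite (pw _ _ _ vK) add0r -(form_adj _ _ (gd_adj gN)) -mulmxA cLNe mulmxA.
by rewrite (rd_X _ gL (NN hu) hu).
Qed.

(** A class of the annihilator that is primitive there becomes primitive for the whole space after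
    subtracting some c N; as the image of N is orthogonal to the annihilator, no value of the form
    changes. *)
Lemma HRw k u : (k.*2 <= d)%N -> (u <= Kw k)%MS ->
  rd Kw P (u *m L ^+ (d - k.*2).+1) ->
  0 <= (-1) ^+ k * form P (u *m L ^+ (d - k.*2)) u /\
  (form P (u *m L ^+ (d - k.*2)) u = 0 -> rd Kw P u).
Proof.
move=> hk hu h; have [uK uN] := (KwP _ _).1 hu.
(* The failure of u to be primitive is orthogonal to the annihilator, so it is some b N, and hard
   Lefschetz for the form of [N *m P] in degree k - 1 reaches b. *)
have [c [cK NcN cN hc]] : exists c, [/\ (c *m N <= K k)%MS, rd K P (c *m N *m N), forall l v, (v <= Kw l)%MS -> form P (c *m N) v = 0
    & rd K P ((u - c *m N) *m L ^+ (d - k.*2).+1)].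
  case: (posnP k) => k0.
    exists 0; rewrite !mul0mx sub0mx subr0; split=> // [|l v _|]; first exact: rd0.
      by rewrite form0l.
    apply: (rd_big pc (k := (k + (d - k.*2).+1))); [lia | exact: (good_X _ gL uK)].
  have hx : (u *m L ^+ (d - k.*2).+1 <= Kw (d - k).+1)%MS.
    have e1 : (k + (d - k.*2).+1 = (d - k).+1)%N by lia.
    by have := good_X (d - k.*2).+1 gLw hu; rewrite e1.
  have [|b bK hb] := dperp _ hx h; first lia.
  have [||c cK hc] := HLsurj piece_g gLg HLg (k := k.-1) (v := b); [lia| |].
    by have -> : (d.-1 - k.-1 = (d - k).+1.-1)%N by lia.
  exists c; split.
  - by have := gd_st gN cK; rewrite prednK.
  - exact: NN cK.
  - move=> l v /KwP[vK vN]; rewrite (form_adj _ _ (gd_adj gN)) (formC _ _ (pc_sym pc)).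
    exact: (vN k.-1).
  have e1 : (d.-1 - k.-1.*2 = (d - k.*2).+1)%N by lia.
  have := rdD hb ((rd_gP _).1 hc); rewrite e1; congr (rd K P _); rewrite !mulmxBl addrA subrK; congr (_ - _).
  by rewrite -!mulmxA cLNe.
set w := u - c *m N.
have wK : (w <= K k)%MS by rewrite addmx_sub // eqmx_opp.
have wN : rd K P (w *m N) by rewrite mulmxBl; apply: rdB.
have pw m : rd K P (w *m (1 *: N + L) ^+ m - w *m L ^+ m).
  have := pow_cone 1 m gL cLN wK; rewrite opprD addrA => h3.
  have h4 : rd K P ((m%:R * 1) *: (w *m N *m L ^+ m.-1)).
    by apply: rdZ; apply: (rd_X _ gL wN).
  by have := rdD h3 h4; rewrite subrK.
have [||p1 p2] := @hr (1 *: N + L) _ k w hk wK.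
- by exists 1 => //; exists L.
- by have := rdD (pw (d - k.*2).+1) hc; rewrite subrK.
have eq1 : form P (w *m (1 *: N + L) ^+ (d - k.*2)) w = form P (u *m L ^+ (d - k.*2)) u.
  rewrite -(subrK (w *m L ^+ (d - k.*2)) (w *m (_ + _) ^+ _)) formDl (pw _ _ _ wK) add0r.
  have wLw : (w *m L ^+ (d - k.*2) <= Kw (k + (d - k.*2)))%MS.
    by apply: (good_X _ gLw); apply/KwP.
  have uLw : (u *m L ^+ (d - k.*2) <= Kw (k + (d - k.*2)))%MS by apply: (good_X _ gLw).
  rewrite {2}/w formBr (formC _ (c *m N) (pc_sym pc)) (cN _ _ wLw) subr0.
  rewrite (adj_X _ _ _ gL) (formC _ _ (pc_sym pc)) /w formBr (formC _ (c *m N) (pc_sym pc)) (cN _ _ uLw) subr0 //.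
rewrite -eq1; split=> // e l v hv; move: (p2 e l v (KwS hv)).
by rewrite formBl (cN _ _ hv) subr0.
Qed.

Lemma HLw : HLin Kw P d L.
Proof.
move=> k u hk hu h; have [|_ h2] := HRw hk hu.
  by rewrite -mulmxXS; apply: (rd_st gLw).
by apply: h2; apply: (h k).
Qed.

(** The class u L^(e+2), with e = d - 1 - 2 k, is annihilated by N. Hard Lefschetz on the
    annihilator and on the image writes it as c L^(e+2) with c itself annihilated by N. *)
Lemma kerN_corr k u : (k.*2 <= d.-1)%N -> (u <= K k)%MS ->
  rd K (N *m P) (u *m L ^+ (d.-1 - k.*2).+1) ->
  exists c, [/\ (c <= K k)%MS, rd K P (c *m N) & rd K P ((u - c) *m L ^+ (d.-1 - k.*2).+2)].
Proof.
move=> hk hu /rd_gP hp.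
have xK : (u *m L ^+ (d.-1 - k.*2).+2 <= K (k + (d.-1 - k.*2).+2))%MS by apply: (good_X _ gL).
case: (posnP k) => k0.
  exists 0; split; [exact: sub0mx | by rewrite mul0mx; exact: rd0 | rewrite subr0].
  by apply: (rd_big pc _ xK); lia.
have xw : (u *m L ^+ (d.-1 - k.*2).+2 <= Kw (d - k.-1))%MS.
  apply/KwP; split; first by have -> : (d - k.-1 = k + (d.-1 - k.*2).+2)%N by lia.
  by have := rd_st gL hp; rewrite -mulmxA -cLN mulmxA mulmxXS.
have [|a aK ha] := HLsurj piece_w gLw HLw (k := k.-1) _ xw; first lia.
have aKw : (a *m L ^+ (d - k.-1.*2) <= Kw (d - k.-1))%MS.
  by have -> : (d - k.-1 = k.-1 + (d - k.-1.*2))%N; [lia | apply: (good_X _ gLw)].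
have [||b bK hb] := dperp (k := d - k.-1) _ _ ha; first lia.
  by rewrite addmx_sub // eqmx_opp.
have [||c cK hc] := HLsurj piece_g gLg HLg (k := k.-1) (v := b); first lia.
  by have -> : (d.-1 - k.-1 = (d - k.-1).-1)%N by lia.
have [aK' aN] := (KwP _ _).1 aK.
exists (a *m L + c *m N); split.
- by rewrite -(prednK k0) addmx_sub ?(gd_st gL) ?(gd_st gN).
- rewrite mulmxDl -mulmxA cLN mulmxA; apply: rdD; first exact: (rd_st gL).
  exact: NN cK.
have := rdD hb ((rd_gP _).1 hc).
have -> : (d - k.-1.*2 = (d.-1 - k.*2).+3)%N by lia.
have -> : (d.-1 - k.-1.*2 = (d.-1 - k.*2).+2)%N by lia.
congr (rd K P _); rewrite !mulmxBl !mulmxDl mulmxXSl mLN.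
by rewrite opprD !addrA subrK.
Qed.

(** After the correction of [kerN_corr], the value for s N + L is linear in s and its slope is the
    value wanted; positivity for all s > 0 makes the slope nonnegative. *)
Lemma HRg k u : (k.*2 <= d.-1)%N -> (u <= K k)%MS ->
  rd K (N *m P) (u *m L ^+ (d.-1 - k.*2).+1) ->
  0 <= (-1) ^+ k * form (N *m P) (u *m L ^+ (d.-1 - k.*2)) u /\
  (form (N *m P) (u *m L ^+ (d.-1 - k.*2)) u = 0 -> rd K (N *m P) u).
Proof.
have pos v : (k.*2 <= d.-1)%N -> (v <= K k)%MS -> rd K (N *m P) (v *m L ^+ (d.-1 - k.*2).+1) ->
    0 <= (-1) ^+ k * form (N *m P) (v *m L ^+ (d.-1 - k.*2)) v.
  move=> hk hv hp; have [c [cK cN hc]] := kerN_corr hk hv hp.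
  set e := (d.-1 - k.*2)%N in hp hc *; have de : (d - k.*2 = e.+1)%N by rewrite /e; lia.
  have wK : (v - c <= K k)%MS by rewrite addmx_sub // eqmx_opp.
  have rg : rd K (N *m P) c by apply/rd_gP.
  have wN : rd K P ((v - c) *m N *m L ^+ e.+1).
    rewrite mulmxBl mulmxBl; apply: rdB; last exact: (rd_X _ gL).
    by move/rd_gP: hp; rewrite mLN.
  have -> : form (N *m P) (v *m L ^+ e) v = form (N *m P) ((v - c) *m L ^+ e) (v - c).
    rewrite mulmxBl formBl (rd_X _ gLg rg wK) subr0 formBr.
    by rewrite (formC _ c (pc_sym piece_g)) (rg _ _ (good_X _ gL hv)) subr0.
  have key s : 0 < s -> 0 <= (-1) ^+ k * (form P ((v - c) *m L ^+ e.+1) (v - c) +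
      s * form (N *m P) ((v - c) *m L ^+ e) (v - c)).
    (* Dividing s by e + 1 absorbs the binomial coefficient of the linear term. *)
    move=> s0; have e0 : 0 < e.+1%:R :> R by rewrite ltr0n.
    have s1 : 0 < s / e.+1%:R by rewrite divr_gt0.
    have [|||p1 _] := @hr (s / e.+1%:R *: N + L) _ k (v - c) _ wK.
    - by exists (s / e.+1%:R) => //; exists L.
    - lia.
    - have := rdD (pow_cone (s / e.+1%:R) e.+2 gL cLN wK)
        (rdD hc (rdZ (e.+2%:R * (s / e.+1%:R)) wN)).
      by rewrite de subrK.
    move: p1; rewrite de -(subrK ((v - c) *m L ^+ e.+1 + (e.+1%:R * (s / e.+1%:R)) *:
      ((v - c) *m N *m L ^+ e)) (_ *m (_ + _) ^+ _)) formDl.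
    rewrite (pow_cone _ e.+1 gL cLN wK wK) add0r formDl formZl mulrCA mulfV ?gt_eqF // mulr1.
    by rewrite formM mLN.
  by apply: slope_ge0 (_ : R) _ _ => s /key; rewrite mulrDr mulrCA; apply.
move=> hk hu hp; split; first exact: pos.
move=> h0; set e := (d.-1 - k.*2)%N in h0 hp pos.
(* A null primitive class is orthogonal to primitive classes by semidefiniteness and to multiples of
   L by primitivity, hence to the whole degree; [HLg] then applies. *)
have prim0 v : (v <= K k)%MS -> rd K (N *m P) (v *m L ^+ e.+1) -> form (N *m P) (u *m L ^+ e) v = 0.
  move=> hv hpv; set B := form _ _ _.
  suff : (-1) ^+ k * B = 0 by move/eqP; rewrite mulf_eq0 signr_eq0 => /eqP.
  apply: (@quad_ge0 _ _ ((-1) ^+ k * form (N *m P) (v *m L ^+ e) v)) => t.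
  have := pos (u + t *: v) hk; rewrite addmx_sub ?scalemx_sub // => /(_ isT).
  rewrite mulmxDl -scalemxAl => /(_ (rdD hp (rdZ t hpv))).
  rewrite mulmxDl -scalemxAl formDl !formDr !formZl !formZr h0 add0r.
  have -> : form (N *m P) (v *m L ^+ e) u = B.
    by rewrite (adj_X _ _ _ gLg) (formC _ _ (pc_sym piece_g)).
  rewrite -/B; congr (_ <= _); ring.
have all0 v : (v <= K k)%MS -> form (N *m P) (u *m L ^+ e) v = 0.
  move=> hv; case: (posnP k) => k0.
    apply: prim0 => //; apply: (rd_big piece_g _ (good_X _ gL hv)); rewrite /e; lia.
  have [||z zK hz] := HLsurj piece_g gLg HLg (k := k.-1) (v := v *m L ^+ e.+1); first lia.
    have -> : (d.-1 - k.-1 = k + e.+1)%N by rewrite /e; lia.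
    exact: (good_X _ gL).
  have ez : (d.-1 - k.-1.*2 = e.+2)%N by rewrite /e; lia.
  have zL : (z *m L <= K k)%MS by rewrite -(prednK k0) (gd_st gL).
  rewrite -(subrK (z *m L) v) formDr prim0 ?add0r.
  - rewrite -(form_adj _ _ (gd_adj gLg)) mulmxXS; exact: (hp k.-1).
  - by rewrite addmx_sub // eqmx_opp.
  - by rewrite mulmxBl mulmxXSl -ez.
apply: (HLg hk hu); apply: (rdP piece_g (k := k + e)); [rewrite /e; lia| exact: (good_X _ gL)|].
by have -> : (d.-1 - (k + e) = k)%N by rewrite /e; lia.
Qed.
End OneL.

Lemma gr_g : HR K (N *m P) d.-1 todo.
Proof. by move=> L cL k u; apply: HRg. Qed.

Lemma gr_w : HR Kw P d todo.
Proof. by move=> L cL k u; apply: HRw. Qed.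

Let Im k := if k is k'.+1 then K k' *m N else 0 : 'M[R]_n.

Lemma rank_Im k : (k <= d)%N ->
  \rank (Im k *m (P *m (K (d - k)%N)^T)) = if k is k'.+1 then qk K (N *m P) d.-1 k' else 0%N.
Proof.
case: k => [|k] hk /=; first by rewrite mul0mx mxrank0.
rewrite /qk; have -> : (k <= d.-1)%N by lia.
have -> : (d.-1 - k = d - k.+1)%N by lia.
by rewrite !mulmxA.
Qed.

Lemma sub_Im k u : (u <= Im k)%MS -> exists2 b, (b <= K k.-1)%MS /\ (0 < k)%N \/ b = 0 & u = b *m N.
Proof.
case: k => [|k] /=; first by rewrite submx0 => /eqP->; exists 0; [right|rewrite mul0mx].
by case/submxP => D ->; exists (D *m K k); [left; rewrite submxMl | rewrite mulmxA].
Qed.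

(** Rank and nullity: K modulo the annihilator gives degree k of the image form, and the radical of
    the annihilator is the radical of K plus the image of N, which gives degree k - 1. *)
Lemma qk_gr k : (k <= d)%N -> qk K P d k =
  (qk K (N *m P) d.-1 k + (if k is k'.+1 then qk K (N *m P) d.-1 k' else 0) + qk Kw P d k)%N.
Proof.
move=> hk; set Q := P *m (K (d - k)%N)^T; set Rad := (K k :&: kermx Q)%MS.
have RadP u : (u <= Rad)%MS <-> (u <= K k)%MS /\ rd K P u.
  rewrite sub_capmx; split=> [/andP[uK /sub_kermxP]|[uK /(rd_mx pc hk uK)]].
    by rewrite mulmxA => h; split=> //; apply/(rd_mx pc hk uK).
  by move=> h; rewrite uK; apply/sub_kermxP; rewrite mulmxA.
have R1 : (qk K P d k + \rank Rad = \rank (K k))%N.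
  by rewrite /qk hk -mulmxA mxrank_mul_ker.
have R2 : (\rank (Kw k) + qk K (N *m P) d.-1 k = \rank (K k))%N.
  rewrite /Kw /qk; case: ltnP => h.
    have -> : (k <= d.-1)%N by lia.
    by rewrite addnC -mulmxA mxrank_mul_ker.
  have -> : (k <= d.-1)%N = false by lia.
  exact: addn0.
set Qw := P *m (Kw (d - k)%N)^T.
have R3 : (qk Kw P d k + \rank (Kw k :&: kermx Qw) = \rank (Kw k))%N.
  by rewrite /qk hk -mulmxA mxrank_mul_ker.
have ImK u : (u <= Im k)%MS -> (u <= K k)%MS /\ forall l v, (v <= Kw l)%MS -> form P u v = 0.
  case/sub_Im => b [[bK k0]|->] ->; last first.
    by rewrite mul0mx sub0mx; split=> // l v _; rewrite form0l.
  split; first by rewrite -(prednK k0) (gd_st gN).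
  move=> l v /KwP[vK vN]; rewrite (form_adj _ _ (gd_adj gN)) (formC _ _ (pc_sym pc)); exact: (vN k.-1).
have ImN u : (u <= Im k)%MS -> rd K P (u *m N).
  case/sub_Im => b [[bK k0]|->] ->; first exact: NN bK.
  by rewrite !mul0mx; exact: rd0.
have RadN u : (u <= Rad)%MS -> rd K P (u *m N) by case/RadP => _; apply: (rd_st gN).
have /eqmx_rank R4 : (Kw k :&: kermx Qw == Im k + Rad)%MS.
  apply/andP; split; apply/rV_subP => u.
    rewrite sub_capmx => /andP[uK /sub_kermxP]; rewrite mulmxA => /(rd_mx piece_w hk uK) h.
    case: (posnP k) => k0.
      apply: submx_trans (addsmxSr _ _); apply/RadP; split; first exact: KwS uK.
      apply: (rdP pc hk (KwS uK)) => v hv; apply: (h (d - k)%N).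
      rewrite /Kw; have -> // : (d - k < d)%N = false by lia.
    have [|b bK hb] := dperp (k := k) _ uK h; first by rewrite k0.
    rewrite -(subrK (b *m N) u) addrC; apply: addmx_sub_adds.
      by rewrite /Im -(prednK k0); apply: submxMr.
    apply/RadP; split=> //; rewrite addmx_sub ?eqmx_opp ?(KwS uK) //.
    by rewrite -(prednK k0) (gd_st gN).
  case/sub_addsmxP => -[D D'] /= ->; have hD : (D *m Im k <= Im k)%MS := submxMl _ _.
  have hD' : (D' *m Rad <= Rad)%MS := submxMl _ _.
  have [h1 h2] := ImK _ hD; have [h3 h4] := (RadP _).1 hD'.
  have hK : ((D *m Im k + D' *m Rad)%R <= Kw k)%MS.
    apply/KwP; split; first by rewrite addmx_sub.
    by rewrite mulmxDl; apply: rdD; [apply: ImN | apply: RadN].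
  rewrite sub_capmx hK; apply/sub_kermxP; rewrite mulmxA; apply/(rd_mx piece_w hk hK).
  by move=> l v hv; rewrite formDl (h2 l) // (h4 l) ?addr0 ?(KwS hv).
have R5 := mxrank_mul_ker (Im k + Rad)%MS Q.
have /eqmx_rank R6 : ((Im k + Rad) :&: kermx Q == Rad)%MS.
  apply/andP; split; apply/rV_subP => u; last first.
    move=> h; rewrite sub_capmx (submx_trans h) ?addsmxSr //.
    by move: h; rewrite sub_capmx => /andP[].
  rewrite sub_capmx => /andP[/sub_addsmxP[[D D']] /= -> h]; rewrite sub_capmx h andbT.
  by rewrite addmx_sub // ?(ImK _ (submxMl _ _)).1 // ((RadP _).1 (submxMl _ _)).1.
have /eqmx_rank R7 : ((Im k + Rad)%MS *m Q == Im k *m Q)%MS.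
  apply/eqmxP; apply: eqmx_trans (addsmxMr _ _ _) _.
  have -> : Rad *m Q = 0 by apply/sub_kermxP; apply: capmxSr.
  exact: addsmx0.
move: R5; rewrite R6 R7 rank_Im // => R5.
rewrite -R4 in R5.
move: R1 R2 R3 R5; set x := (if k is _.+1 then _ else _); lia.
Qed.

End Gr.

Definition gampos d (f : nat -> nat) := exists2 g : nat -> nat,
  (forall i, (d < i.*2)%N -> g i = 0%N) &
  forall k, f k = (\sum_(i < k.+1) g i * 'C(d - i.*2, k - i))%N.

(** Multiplication by 1 + t moves the center of symmetry from d - 1 to d and keeps the gamma vector,
    by Pascal's rule. *)
Lemma gampos_gr d f f1 f2 : (0 < d)%N -> gampos d.-1 f1 -> gampos d f2 ->
  (forall k, f k = f1 k + (if k is k'.+1 then f1 k' else 0) + f2 k)%N -> gampos d f.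
Proof.
move=> d0 [g1 z1 e1] [g2 z2 e2] e; exists (fun i => g1 i + g2 i)%N => [i hi|k].
  by rewrite z1 ?z2 //; lia.
rewrite e e2; under [RHS]eq_bigr do rewrite mulnDl; rewrite big_split /=; congr addn.
have pas i : (i < k)%N -> (g1 i * 'C(d - i.*2, k - i) =
    g1 i * 'C(d.-1 - i.*2, k - i) + g1 i * 'C(d.-1 - i.*2, k.-1 - i))%N.
  move=> ik; case: (ltnP d.-1 i.*2) => h; first by rewrite z1.
  have -> : (d - i.*2 = (d.-1 - i.*2).+1)%N by lia.
  have -> : (k - i = (k.-1 - i).+1)%N by lia.
  by rewrite binS mulnDr.
case: k pas => [|k] pas; first by rewrite e1 !big_ord1 subn0 !bin0 addn0.
rewrite !e1 !(big_ord_recr k.+1) /= !subnn !bin0 addnAC; congr addn.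
by rewrite -big_split /=; apply: eq_bigr => i _; rewrite pas.
Qed.

Lemma gampos_ext d f f' : f =1 f' -> gampos d f -> gampos d f'.
Proof. by move=> e [g z h]; exists g => // k; rewrite -e. Qed.

Lemma gampos_mid d f : (forall k, f k <> 0%N -> k.*2 = d) -> gampos d f.
Proof.
move=> h; exists (fun i => if i.*2 == d then f i else 0)%N => [i hi|k].
  by case: eqP => //; lia.
rewrite big_ord_recr /= subnn bin0 muln1 big1 ?add0n => [|i _].
  by case: eqP => // ne; apply/eqP/negP => /negP/eqP/h.
case: eqP => [e|_]; last by rewrite mul0n.
by rewrite e subnn bin0n; have -> : (k - i == 0)%N = false; [have := ltn_ord i; lia | rewrite muln0].
Qed.

(** The order matters: once A and B act as zero, the relation for N reads N² = 0. *)
Fixpoint sqz K P (done todo : seq 'M[R]_n) : Prop :=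
  if todo is N :: todo' then
    ((forall k u, (u <= K k)%MS -> rd K P (u *m N)) \/
     exists A B, [/\ A \in done, B \in done &
       forall k u, (u <= K k)%MS -> rd K P (u *m (N - A) *m (N - B))]) /\
    sqz K P (N :: done) todo'
  else True.

Lemma sqz_sub K P K' P' done todo :
  (forall u, rd K P u -> rd K' P' u) -> (forall k u, (u <= K' k)%MS -> (u <= K k)%MS) ->
  sqz K P done todo -> sqz K' P' done todo.
Proof.
move=> hr hs; elim: todo done => //= N todo IH done [h1 h2]; split; last exact: IH.
case: h1 => [h|[A [B [hA hB h]]]]; [left|right; exists A, B; split=> //] => k u /hs hu; apply: hr; exact: h hu.
Qed.

(** After N is split off it acts as zero on both new pieces, on the image because N² = 0 and on the
    annihilator by definition, so it joins the classes already done. *)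
Theorem gamma_of_HR todo : forall K P d hs done,
  piece K P d hs -> {subset todo <= hs} -> {subset done <= hs} ->
  (forall A k u, A \in done -> (u <= K k)%MS -> rd K P (u *m A)) ->
  sqz K P done todo -> HR K P d todo -> gampos d (qk K P d).
Proof.
elim: todo => [|N todo IH] K P d hs done pc sub1 sub2 kill /=.
  (* No class is left: every u is primitive for L = 0, and below the middle degree its value is
     zero, so it lies in the radical. *)
  move=> _ hr; have zero k : (k.*2 < d)%N -> qk K P d k = 0%N.
    move=> hk; apply: (rd_qk0 pc) => u hu.
    have [|_] := hr 0 (erefl _) k u (ltnW hk) hu; first by rewrite expr0n mulmx0; exact: rd0.
    apply; rewrite expr0n; have -> : (d - k.*2 == 0)%N = false by lia.
    by rewrite mulmx0 form0l.
  apply: gampos_mid => k hk; apply/eqP/negP => /negP ne; apply: hk.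
  case: (leqP k d) => kd; last by rewrite /qk leqNgt kd.
  case: (ltnP k.*2 d) => h; first exact: zero.
  by rewrite -(qk_sym pc kd) zero //; lia.
move=> [sq1 sq2] hr.
have hN : N \in hs by apply: sub1; rewrite inE eqxx.
have sub1' : {subset todo <= hs} by move=> x hx; apply: sub1; rewrite inE hx orbT.
have gN := good_op pc hN.
have NN k u : (u <= K k)%MS -> rd K P (u *m N *m N).
  move=> hu; case: sq1 => [h|[A [B [hA hB h]]]]; first exact: (rd_st gN (h _ _ hu)).
  have gA := good_op pc (sub2 _ hA); have gB := good_op pc (sub2 _ hB).
  have h1 := h k u hu; have h2 := rd_st gN (kill A k u hA hu); have h3 := rd_st gB (kill A k u hA hu).
  have h4 := kill B _ _ hB (gd_st gN hu).
  have := rdD (rdD h1 h2) (rdB h4 h3); congr (rd K P _).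
  rewrite !mulmxBr !mulmxBl; apply/matrixP => i j; rewrite !mxE; ring.
case: (posnP d) => d0.
  apply: gampos_mid => k; rewrite /qk d0 leqn0; by case: eqP => // ->.
have pg := piece_g d0 pc hN; have pw := piece_w d0 pc hN.
have sub2' : {subset N :: done <= hs} by move=> x; rewrite inE => /predU1P[->//|/sub2].
apply: (gampos_gr d0 (f1 := qk K (N *m P) d.-1) (f2 := qk (Kw K P d N) P d)).
- apply: (IH _ _ _ hs (N :: done)) => //.
  + move=> A k u; rewrite inE => /predU1P[->|hA] hu; apply/rd_gP; first exact: NN hu.
    rewrite -mulmxA (pc_comm pc) ?mulmxA //; last exact: sub2.
    exact: (kill A _ _ hA (gd_st gN hu)).
  + apply: sqz_sub sq2 => // u hu; apply/rd_gP; exact: (rd_st gN hu).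
  + exact: (gr_g d0 pc hN sub1' NN hr).
- apply: (IH _ _ _ hs (N :: done)) => //.
  + move=> A k u; rewrite inE => hA /(KwP d0 pc hN)[hu hu']; apply: (rd_w d0 pc hN).
    case/predU1P: hA => [->//|hA]; exact: (kill _ _ _ hA hu).
  + apply: sqz_sub sq2; [move=> u; exact: (rd_w d0 pc hN) | move=> k u; exact: (KwS d0 pc hN)].
  + exact: (gr_w d0 pc hN sub1' NN hr).
move=> k; case: (leqP k d) => kd; first exact: (qk_gr d0 pc hN NN kd).
have z K' P' d' k' : (d' < k')%N -> qk K' P' d' k' = 0%N by rewrite /qk; case: leqP.
rewrite !z //; last by lia.
by case: k kd => // k kd; rewrite z //; lia.
Qed.

End Piece.

End Forms.
Import Forms.

(** * Definiteness along polynomial paths of nondegenerate forms *)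

Module Paths.
Local Open Scope ring_scope.

Section Path.
Variable R : rcfType.

Definition pd n (A : 'M[R]_n) := forall u : 'rV[R]_n, u != 0 -> 0 < form A u u.
Definition nondeg n (A : 'M[R]_n) := forall u : 'rV[R]_n, u *m A = 0 -> u = 0.
Definition at_mx m n (A : 'M[{poly R}]_(m, n)) (t : R) : 'M[R]_(m, n) := map_mx (horner_eval t) A.

(** Stands in for the compactness argument: a polynomial that changes sign has a first root. *)
Lemma first_root (p : {poly R}) x t : x <= t -> 0 < p.[x] -> p.[t] <= 0 ->
  exists r, [/\ x < r, r <= t, p.[r] = 0 & forall s, x <= s -> s < r -> 0 < p.[s]].
Proof.
move=> xt px pt.
have gt0 r : (forall s, x < s -> s < r -> ~~ root p s) -> forall s, x <= s -> s < r -> 0 < p.[s].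
  move=> hr s xs sr; rewrite ltNge; apply/negP => ps.
  have [|c] := @polyrcf.poly_ivt _ p x s xs; first by rewrite pmulr_rle0.
  rewrite itv_boundlr /= => /andP[]; rewrite /Order.le /= => xc cs rc.
  have xc' : x < c by rewrite lt_neqAle xc andbT; apply: contraTneq rc => <-; rewrite /root gt_eqF.
  by move: (hr c xc' (le_lt_trans cs sr)); rewrite rc.
have [|r] := @polyrcf.poly_ivt _ p x t xt; first by rewrite pmulr_rle0.
rewrite itv_boundlr /= => /andP[]; rewrite /Order.le /= => xr rt rr.
have xr' : x < r by rewrite lt_neqAle xr andbT; apply: contraTneq rr => <-; rewrite /root gt_eqF.
have := next_rootP p x r; case=> [p0|y np0 py hy hno|c np0 _ hno].
- by move: px; rewrite p0 horner0 ltxx.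
- have /andP[xy yr] : (x < y) && (y < r) by move: hy; rewrite in_itv.
  exists y; split=> //; first exact: le_trans (ltW yr) rt.
  by apply: gt0 => s xs sy; apply: hno; rewrite in_itv /= xs.
- exists r; split=> //; first exact/eqP.
  by apply: gt0 => s xs sy; apply: hno; rewrite in_itv /= xs.
Qed.

Lemma at_mxM m n p (A : 'M[{poly R}]_(m, n)) (B : 'M_(n, p)) t : at_mx (A *m B) t = at_mx A t *m at_mx B t.
Proof. exact: map_mxM. Qed.

Lemma form_poly n (A : 'M[{poly R}]_n) u : exists p : {poly R}, forall t, p.[t] = form (at_mx A t) u u.
Proof.
exists ((map_mx polyC u *m A *m (map_mx polyC u)^T) 0 0) => t.
rewrite /form -[LHS]/(horner_eval t _); have e : at_mx (map_mx polyC u) t = u.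
  by apply/matrixP => i j; rewrite !mxE /horner_eval hornerC.
by rewrite -{3 4}e /at_mx !matrix.map_trmx -!map_mxM [RHS]mxE.
Qed.

Lemma psd_pd n (A : 'M[R]_n) : A^T = A -> nondeg A -> (forall u, 0 <= form A u u) -> pd A.
Proof.
move=> sA nA pA u u0; rewrite lt_def pA andbT; apply: contra u0 => /eqP h; apply/eqP/nA.
apply/rowP => j; rewrite [RHS]mxE.

set v : 'rV[R]_n := delta_mx 0 j.
have fB : form A u v = (u *m A) 0 j by rewrite /form trmx_delta -colE mxE.
rewrite -fB; apply: (@quad_ge0 _ _ (form A v v)) => t.
have := pA (u + t *: v); rewrite formDl !formDr !formZl !formZr h add0r (formC v u sA).
congr (_ <= _); ring.
Qed.

Lemma add00 (X Y : 'M[R]_1) : (X + Y) 0 0 = X 0 0 + Y 0 0. Proof. by rewrite mxE. Qed.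
Lemma opp00 (X : 'M[R]_1) : (- X) 0 0 = - X 0 0. Proof. by rewrite mxE. Qed.
Lemma scale00 a (X : 'M[R]_1) : (a *: X) 0 0 = a * X 0 0. Proof. by rewrite mxE. Qed.
Lemma scalar00 a : (a%:M : 'M[R]_1) 0 0 = a. Proof. by rewrite mxE. Qed.

(* Schur complement of the top left entry, multiplied by that entry. *)
Definition schur (S : comPzRingType) n (A : 'M[S]_(1 + n)) : 'M[S]_n :=
  A 0 0 *: drsubmx A - (ursubmx A)^T *m ursubmx A.

Section Schur.
Variables (n : nat) (A : 'M[R]_(1 + n)).
Hypothesis sA : A^T = A.
Let a := A 0 0.
Let b := ursubmx A.
Let C := drsubmx A.

Lemma ulsubmx00 : ulsubmx A = a%:M.
Proof.
apply/matrixP => i j; rewrite !mxE !ord1 eqxx mulr1n /a.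
by congr (A _ _); apply: val_inj.
Qed.

Lemma dlsubmxT : dlsubmx A = b^T.
Proof. by rewrite /b trmx_ursub sA. Qed.

Lemma row_mulA (s : R) (w : 'rV[R]_n) : row_mx s%:M w *m A =
  row_mx (s * a + (w *m b^T) 0 0)%:M (s *: b + w *m C).
Proof.
rewrite -[A in LHS]submxK mul_row_block ulsubmx00 dlsubmxT -/b -/C -scalar_mxM mul_scalar_mx.
by congr row_mx; rewrite [w *m b^T in LHS]mx11_scalar -raddfD.
Qed.

Lemma form_schur (s : R) (w : 'rV[R]_n) : a * form A (row_mx s%:M w) (row_mx s%:M w) =
  (a * s + (w *m b^T) 0 0) ^+ 2 + form (schur A) w w.
Proof.
have wb : (b *m w^T) 0 0 = (w *m b^T) 0 0.
  rewrite !mxE; apply: eq_bigr => i _; rewrite !mxE; exact: mulrC.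
have e1 : form A (row_mx s%:M w) (row_mx s%:M w) =
    s * (s * a + (w *m b^T) 0 0) + (s * (w *m b^T) 0 0 + form C w w).
  rewrite /form row_mulA tr_row_mx mul_row_col tr_scalar_mx -scalar_mxM mulmxDl -scalemxAl.
  by rewrite add00 scalar00 add00 scale00 wb [_ * s]mulrC.
have e2 : form (schur A) w w = a * form C w w - (w *m b^T) 0 0 ^+ 2.
  rewrite /form /schur -/a -/b -/C mulmxBr mulmxBl -scalemxAr -scalemxAl !mulmxA -(mulmxA _ b).
  by rewrite [w *m b^T in LHS]mx11_scalar mul_scalar_mx add00 opp00 !scale00 wb expr2.
rewrite e1 e2; ring.
Qed.

Lemma pd_entry : pd A -> 0 < a.
Proof.
move=> h; have := h (row_mx 1%:M 0); have -> : row_mx 1%:M 0 != 0 :> 'rV[R]_(1 + n).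
  apply/eqP => /(congr1 (fun u : 'rV_(1 + n) => lsubmx u)); rewrite row_mxKl linear0.
  by move/matrixP/(_ 0 0)/eqP; rewrite !mxE eqxx oner_eq0.
move/(_ isT); rewrite /form row_mulA tr_row_mx trmx0 mul_row_col mulmx0 addr0 tr_scalar_mx mulmx1.
by rewrite mul0mx !mxE eqxx mulr1n mul1r addr0.
Qed.

Lemma pd_schur : 0 < a -> pd A -> pd (schur A).
Proof.
move=> a0 h w w0; have := form_schur (- (w *m b^T) 0 0 / a) w.
rewrite [a * (_ / a)]mulrC divfK ?gt_eqF // addNr expr0n add0r => <-.
rewrite pmulr_rgt0 //; apply: h; apply: contra w0 => /eqP.
by move=> /(congr1 (fun u : 'rV_(1 + n) => rsubmx u)); rewrite row_mxKr linear0 => ->.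
Qed.

Lemma pd_of_schur : 0 < a -> pd (schur A) -> pd A.
Proof.
move=> a0 h u u0; rewrite -(pmulr_rgt0 _ a0) -[u]hsubmxK [lsubmx u]mx11_scalar form_schur.
have [w0|w0] := eqVneq (rsubmx u) 0; last by rewrite ltr_wpDl ?sqr_ge0 // h.
rewrite w0 mul0mx form0l addr0 [X in _ + X]mxE addr0 lt_def sqr_ge0 andbT sqrf_eq0 mulf_neq0 //; first by rewrite gt_eqF.
apply: contra u0 => /eqP s0; rewrite -[u]hsubmxK w0 [lsubmx u]mx11_scalar s0 -scalemx1 scale0r.
by rewrite row_mx0.
Qed.

Lemma nondeg_schur : a != 0 -> nondeg A -> nondeg (schur A).
Proof.
move=> a0 h w hw; have := h (row_mx (- (w *m b^T) 0 0 / a)%:M w).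
rewrite row_mulA divfK // addNr => /(_ _)/(congr1 (fun u : 'rV_(1 + n) => rsubmx u)).
rewrite row_mxKr linear0; apply.
have -> : (- (w *m b^T) 0 0 / a) *: b + w *m C = 0.
  apply: (scalerI a0); rewrite scaler0 -[RHS]hw scalerDr scalerA mulrC divfK // /schur -/a -/b -/C.
  by rewrite mulmxBr -scalemxAr mulmxA [w *m b^T in RHS]mx11_scalar mul_scalar_mx scaleNr addrC.
by rewrite -scalemx1 scale0r row_mx0.
Qed.
End Schur.

Lemma at_schur n (A : 'M[{poly R}]_(1 + n)) t : at_mx (schur A) t = schur (at_mx A t).
Proof.
apply/matrixP => i j; rewrite /schur !mxE /horner_eval hornerD hornerN hornerM.
by rewrite !big_ord1 !mxE hornerM.
Qed.

(** Induction on the size through Schur complements, valid as long as the corner entry is positive.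
    At a first root of that entry the form would be semidefinite and nondegenerate, hence definite
    with a zero diagonal entry. *)
Theorem pd_path n (A : 'M[{poly R}]_n) x y : x <= y -> A^T = A ->
  (forall t, x <= t -> t <= y -> nondeg (at_mx A t)) -> pd (at_mx A x) -> pd (at_mx A y).
Proof.
elim: n A x y => [|n IH] A x y; first by move=> _ _ _ _ u; rewrite thinmx0 eqxx.
move: A; rewrite -[n.+1]/(1 + n)%N => A xy sA nA px.
have sAt t : (at_mx A t)^T = at_mx A t by rewrite /at_mx matrix.map_trmx sA.
have aE t : (at_mx A t) 0 0 = (A 0 0).[t] by rewrite mxE.
have main s : x <= s -> s <= y -> (forall t, x <= t -> t <= s -> 0 < (A 0 0).[t]) -> pd (at_mx A s).
  move=> xs sy pos; apply: pd_of_schur => //; first by rewrite aE pos.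
  rewrite -at_schur; apply: (IH _ x s) => //.
  - rewrite /schur linearB linearZ /= trmx_mul trmxK; congr (_ *: _ - _).
    by rewrite trmx_drsub sA.
  - move=> t xt ts; rewrite at_schur; apply: nondeg_schur => //.
      by rewrite aE gt_eqF // pos.
    by apply: nA => //; apply: le_trans sy.
  - by rewrite at_schur; apply: pd_schur => //; rewrite aE pos.
have a0 : 0 < (A 0 0).[x] by rewrite -aE; apply: (pd_entry (sAt x)).
apply: (main y) => // t xt ty; rewrite ltNge; apply/negP => at0.
have [r [xr rt ar hpos]] := first_root xt a0 at0.
have ry := le_trans rt ty.
(* A vector of negative value at r would already have a null value at some earlier s, where the form
   is known to be definite. *)
suff h : pd (at_mx A r) by have := pd_entry (sAt r) h; rewrite aE ar ltxx.
apply: psd_pd => [||u]; [exact: sAt | by apply: nA => //; apply: ltW |].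
have [->|u0] := eqVneq u 0; first by rewrite form0l.
have [p hp] := form_poly A u; rewrite leNgt -hp; apply/negP => pr.
have p0 : 0 < p.[x] by rewrite hp; apply: px.
have [s [xs sr ps _]] := first_root (ltW xr) p0 (ltW pr).
have sr' : s < r by rewrite lt_neqAle sr andbT; apply: contraTneq pr => <-; rewrite ps ltxx.
have : pd (at_mx A s).
  apply: (main s) => [||v xv vs]; [exact: ltW|exact: le_trans sr ry|].
  by apply: hpos => //; apply: le_lt_trans sr'.
by move/(_ u u0); rewrite -hp ps ltxx.
Qed.

Section Lefschetz.
Variables (m n : nat) (Q : 'M[{poly R}]_n) (L : 'M[{poly R}]_(m, n)).
Let D := L *m Q *m L^T.
Let M := Q *m L^T.
(** The orthogonal projection that kills the rows of L, multiplied by the determinant so that it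
    stays polynomial. *)
Let Pr : 'M_n := (\det D)%:M - M *m \adj D *m L.
Variable e : R.
Let S := e%:P *: (Pr *m Q *m Pr^T) + M *m M^T.

(* The form [S] is [e Q] on the Q-orthogonal complement of the rows of [L], up to a
   square, and is positive on the rows of [L], so that [e Q] is positive on that
   complement iff [S] is positive definite. *)
Theorem primitive_path x y : x <= y -> Q^T = Q -> e != 0 ->
  (forall t, x <= t -> t <= y -> nondeg (at_mx Q t) /\ nondeg (at_mx D t)) ->
  (forall u, u *m at_mx M x = 0 -> u != 0 -> 0 < e * form (at_mx Q x) u u) ->
  forall u, u *m at_mx M y = 0 -> u != 0 -> 0 < e * form (at_mx Q y) u u.
Proof.
move=> xy sQ e0 nd hx.
have atP t : at_mx Pr t = (\det (at_mx D t))%:M - at_mx M t *m \adj (at_mx D t) *m at_mx L t.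
  by rewrite /at_mx /Pr map_mxB map_scalar_mx !map_mxM map_mx_adj -det_map_mx /D /M !map_mxM.
have atS t : at_mx S t = e *: (at_mx Pr t *m at_mx Q t *m (at_mx Pr t)^T) + at_mx M t *m (at_mx M t)^T.
  rewrite /at_mx !matrix.map_trmx /S map_mxD map_mxZ !map_mxM.
  by congr (_ *: _ + _); apply: hornerC.
have sQt t : (at_mx Q t)^T = at_mx Q t by rewrite /at_mx matrix.map_trmx sQ.
have atD t : at_mx D t = at_mx L t *m at_mx M t by rewrite -at_mxM /M mulmxA.
have atM t : at_mx M t = at_mx Q t *m (at_mx L t)^T by rewrite at_mxM {2}/at_mx matrix.map_trmx.
have sDt t : (at_mx D t)^T = at_mx D t.
  by rewrite /D !at_mxM !trmx_mul sQt mulmxA /at_mx !matrix.map_trmx trmxK.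
have detD t : nondeg (at_mx D t) -> \det (at_mx D t) != 0.
  move=> h; rewrite -unitfE -[_ \is a GRing.unit]/(at_mx D t \in unitmx) -row_free_unit -kermx_eq0.
  apply/eqP/row_matrixP => i; rewrite row0; apply: h; apply/sub_kermxP/row_sub.
have PM t : at_mx Pr t *m at_mx M t = 0.
  by rewrite atP mulmxBl mul_scalar_mx -!mulmxA -atD mul_adj_mx mul_mx_scalar subrr.
have LP t : at_mx L t *m at_mx Pr t = 0.
  by rewrite atP mulmxBr mul_mx_scalar !mulmxA -atD mul_mx_adj mul_scalar_mx subrr.
have Pu t u : u *m at_mx M t = 0 -> u *m at_mx Pr t = \det (at_mx D t) *: u.
  by move=> h; rewrite atP mulmxBr mul_mx_scalar !mulmxA h !mul0mx subr0.
have MM m' (w : 'rV[R]_m') : (w *m w^T) 0 0 = 0 -> w = 0.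
  rewrite mxE => h; apply/rowP => j; rewrite [RHS]mxE; apply/eqP; rewrite -sqrf_eq0.
  move/eqP: h; rewrite psumr_eq0; last by move=> i _; rewrite !mxE -expr2 sqr_ge0.
  by move/allP/(_ j (mem_index_enum _)); rewrite !mxE -expr2.
have MM0 m' (w : 'rV[R]_m') : 0 <= (w *m w^T) 0 0.
  by rewrite mxE sumr_ge0 // => i _; rewrite !mxE -expr2 sqr_ge0.
have fS t u v : form (at_mx S t) u v = e * form (at_mx Q t) (u *m at_mx Pr t) (v *m at_mx Pr t)
    + (u *m at_mx M t *m (v *m at_mx M t)^T) 0 0.
  rewrite atS /form mulmxDr mulmxDl mxE -scalemxAr -scalemxAl mxE !trmx_mul !mulmxA //.
have dt t : x <= t -> t <= y -> \det (at_mx D t) != 0 by move=> h1 h2; apply/detD/(nd t h1 h2).2.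
have : pd (at_mx S y).
  apply: (pd_path xy).
  - by rewrite /S linearD linearZ /= !trmx_mul !trmxK sQ mulmxA.
  - move=> t xt ty u hu; have [nQ nD] := nd t xt ty.
    have h0 v : form (at_mx S t) u v = 0 by rewrite /form hu mul0mx mxE.
    have uM : u *m at_mx M t = 0.
      apply: nD; rewrite atD; apply/rowP => j; rewrite [RHS]mxE.
      have := h0 (delta_mx 0 j *m at_mx L t).
      rewrite fS -(mulmxA _ (at_mx L t) (at_mx Pr t)) LP mulmx0 form0r mulr0 add0r.
      rewrite -(mulmxA _ (at_mx L t) (at_mx M t)) -atD trmx_mul sDt mulmxA -mulmxA.
      by rewrite trmx_delta mulmxA -colE mxE atD mulmxA.
    have detu := Pu _ _ _ uM.
    have nz : \det (at_mx D t) * e != 0 by rewrite mulf_neq0 // dt.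
    have uQL : forall w, form (at_mx Q t) u (w *m at_mx L t) = 0.
      by move=> w; rewrite /form trmx_mul mulmxA -(mulmxA u) -atM uM mul0mx mxE.
    apply: nQ; apply/rowP => j; rewrite [RHS]mxE.
    have fq : form (at_mx Q t) u (delta_mx 0 j) = (u *m at_mx Q t) 0 j.
      by rewrite /form trmx_delta -colE mxE.
    have := h0 (delta_mx 0 j); rewrite fS uM mul0mx [X in _ + X]mxE addr0 detu formZl.
    rewrite mulrCA mulrA => /eqP; rewrite mulf_eq0 (negPf nz) /= atP mulmxBr mul_mx_scalar mulmxA.
    rewrite formBr uQL subr0 formZr fq mulf_eq0 (negPf (dt t xt ty)) => /eqP //.
  move=> u u0; rewrite fS.
  have [uM|uM] := eqVneq (u *m at_mx M x) 0.
    rewrite uM mul0mx mxE addr0 Pu // formZl formZr mulrCA (mulrCA e) mulrA -expr2 mulr_gt0 ?hx //.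
    by rewrite exprn_even_gt0 //= dt.
  have PrM : u *m at_mx Pr x *m at_mx M x = 0 by rewrite -mulmxA PM mulmx0.
  rewrite ltr_wpDl //; last by rewrite lt_def MM0 andbT; apply: contra uM => /eqP/MM->.
  have [->|h] := eqVneq (u *m at_mx Pr x) 0; first by rewrite form0l mulr0.
  by apply: ltW; apply: hx.
move=> h u uM u0; have := h u u0; rewrite fS uM mul0mx mxE addr0 Pu // formZl formZr.
set dd := \det _; rewrite mulrCA (mulrCA e) mulrA -expr2 pmulr_rgt0 //.
by rewrite exprn_even_gt0 //= dt.
Qed.
End Lefschetz.
End Path.

End Paths.
Import Paths.

(** * Transport of Hodge-Riemann relations along a segment *)

Module PiecePaths.
Local Open Scope ring_scope.

Section PathPiece.
Variables (R : rcfType) (n : nat) (K : nat -> 'M[R]_n) (P : 'M[R]_n) (d : nat) (hs : seq 'M[R]_n).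
Hypothesis pc : piece K P d hs.
Implicit Types (u v w : 'rV[R]_n).

Definition HRat L := forall k u, (k.*2 <= d)%N -> (u <= K k)%MS ->
  rd K P (u *m L ^+ (d - k.*2).+1) ->
  0 <= (-1) ^+ k * form P (u *m L ^+ (d - k.*2)) u /\
  (form P (u *m L ^+ (d - k.*2)) u = 0 -> rd K P u).

Definition Radk k : 'M[R]_n := (K k :&: kermx (P *m (K (d - k)%N)^T))%MS.

Lemma RadkP k u : (k <= d)%N -> (u <= Radk k)%MS <-> (u <= K k)%MS /\ rd K P u.
Proof.
move=> hk; rewrite sub_capmx; split=> [/andP[uK /sub_kermxP]|[uK /(rd_mx pc hk uK)]].
  by rewrite mulmxA => h; split=> //; apply/(rd_mx pc hk uK).
by move=> h; rewrite uK; apply/sub_kermxP; rewrite mulmxA.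
Qed.

Definition Ck k := row_base (K k :\: Radk k)%MS.

Lemma Ck_sub k m (u : 'M_(m, \rank (K k :\: Radk k)%MS)) : (u *m Ck k <= K k)%MS.
Proof.
apply: submx_trans (submxMl _ _) _; rewrite eq_row_base; exact: diffmxSl.
Qed.

Lemma Ck_rad k (u : 'rV_(\rank (K k :\: Radk k)%MS)) : (k <= d)%N -> rd K P (u *m Ck k) -> u = 0.
Proof.
move=> hk h; have : (u *m Ck k <= (K k :\: Radk k) :&: Radk k)%MS.
  by rewrite sub_capmx -(eq_row_base (K k :\: Radk k)%MS) submxMl; apply/RadkP => //; rewrite Ck_sub.
rewrite capmx_diff submx0 => /eqP h0.
by apply: (row_free_inj (row_base_free (K k :\: Radk k)%MS)); rewrite mul0mx.
Qed.

Lemma Ck_span k m (v : 'M_(m, n)) : (v <= K k)%MS ->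
  exists2 c, (v - c *m Ck k <= Radk k)%MS & (c *m Ck k <= K k)%MS.
Proof.
move=> hv; have : (v <= Ck k + Radk k)%MS.
  apply: submx_trans hv _; have := addsmx_diff_cap_eq (K k) (Radk k) => h.
  rewrite -h; apply: addsmxS; first by rewrite eq_row_base.
  exact: capmxSr.
case/sub_addsmxP => -[D D'] /= ->; exists D; last exact: Ck_sub.
by rewrite addrC addKr submxMl.
Qed.


(** Working in a basis modulo the radical makes the forms along the path nondegenerate matrices of a
    fixed size. *)
Lemma basis_mx k : (k <= d)%N -> exists q (C : 'M[R]_(q, n)),
  [/\ forall w : 'rV_q, rd K P (w *m C) -> w = 0, forall w : 'rV_q, (w *m C <= K k)%MS &
      forall v, (v <= K k)%MS -> exists w : 'rV_q, rd K P (v - w *m C)].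
Proof.
move=> hk; exists _, (Ck k); split=> [w|w|v vK]; [exact: Ck_rad | exact: Ck_sub|].
by have [c /(RadkP _ hk)[_ h] _] := Ck_span vK; exists c.
Qed.

Section Line.
Variables (L0 H : 'M[R]_n).
Hypotheses (g0 : good K P hs L0) (gH : good K P hs H).
Let Lt t := L0 + t *: H.
Let gL t : good K P hs (Lt t). Proof. by apply: goodD => //; apply: goodZ. Qed.
Let cp m p (A : 'M[R]_(m, p)) : 'M[{poly R}]_(m, p) := map_mx polyC A.
Let Lp : 'M[{poly R}]_n := cp L0 + 'X *: cp H.

Lemma at_cp m p (A : 'M[R]_(m, p)) t : at_mx (cp A) t = A.
Proof. by apply/matrixP => i j; rewrite !mxE /horner_eval hornerC. Qed.

Lemma at_line m p (A B : 'M[R]_(m, p)) t : at_mx (cp A + 'X *: cp B) t = A + t *: B.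
Proof. by apply/matrixP => i j; rewrite !mxE /horner_eval hornerD hornerM hornerX !hornerC. Qed.

Lemma at_Lp e t : at_mx (Lp ^+ e) t = Lt t ^+ e.
Proof.
elim: e => [|e IH]; first by rewrite !expr0 /at_mx map_mx1.
by rewrite !exprS -[_ * _ ^+ e]/(_ *m _) at_mxM IH /Lp at_line.
Qed.

Lemma Lp_adj e : (Lp ^+ e *m cp P)^T = Lp ^+ e *m cp P.
Proof.
have sP : (cp P)^T = cp P by rewrite /cp matrix.map_trmx (pc_sym pc).
have aL : Lp *m cp P = cp P *m Lp^T.
  rewrite /Lp linearD linearZ /= mulmxDl mulmxDr -scalemxAl -scalemxAr /cp.
  by rewrite !matrix.map_trmx -!map_mxM (gd_adj g0) (gd_adj gH).
rewrite trmx_mul sP; elim: e => [|e IH]; first by rewrite expr0 trmx1 mulmx1 mul1mx.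
rewrite exprSr -[in LHS]/(Lp ^+ e *m Lp) trmx_mul mulmxA -aL -mulmxA IH mulmxA.
by congr (_ *m _); apply: etrans (esym (exprS Lp e)) (exprSr Lp e).
Qed.

(** Primitive classes of degree k are the orthogonal of L times degree k - 1. Hard Lefschetz in
    degrees k and k - 1 says that the form is nondegenerate on the whole degree and on that
    subspace, all along the segment. *)
Theorem HR_path : (forall t, 0 <= t -> t <= 1 -> HLin K P d (Lt t)) -> HRat L0 -> HRat (L0 + H).
Proof.
move=> hl hr k u hk uK hu; have kd : (k <= d)%N by lia.
set e := (d - k.*2)%N in hu *.
(* For k = 0 there is no degree k - 1, and the empty family replaces the basis of degree 0 that
   [k.-1] would designate. *)
have [m [C' [hC' hA hB]]] : exists m (C' : 'M[R]_(m, n)),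
  [/\ forall w : 'rV_m, rd K P (w *m C') -> w = 0,
      forall w : 'rV_m, (w *m C' <= K k.-1)%MS /\ (k = 0%N -> w = 0) &
      forall v, (0 < k)%N -> (v <= K k.-1)%MS -> exists w : 'rV_m, rd K P (v - w *m C')].
  case: (posnP k) => k0.
    exists 0%N, 0; split=> [w _|w|v]; rewrite ?thinmx0 ?mul0mx ?sub0mx // k0 //.
  have [|q [C [h1 h2 h3]]] := @basis_mx k.-1; first by lia.
  by exists q, C; split=> // [w|v _]; [split=> // k00; rewrite k00 in k0 | exact: h3].
have [q [C [hC CK hCs]]] := basis_mx kd.
have stepC (L : 'M[R]_n) : good K P hs L -> exists A : 'M[R]_(m, q),
    forall w : 'rV_m, rd K P (w *m C' *m L - w *m A *m C).
  move=> gL'; have hK i : (row i C' *m L <= K k)%MS.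
    have [h1 h2] := hA (delta_mx 0 i); rewrite -rowE in h1.
    case: (posnP k) => k0; last by rewrite -(prednK k0) (gd_st gL').
    have := h2 k0 => /rowP/(_ i); rewrite !mxE !eqxx => /eqP; by rewrite oner_eq0.
  have hi i : exists c : 'rV_q, rd K P (row i C' *m L - c *m C).
    exact: hCs (hK i).
  have [f hf] := fin_all_exists hi; exists (\matrix_i f i) => w.
  have -> : w *m C' *m L - w *m (\matrix_i f i) *m C = \sum_i w 0 i *: (row i C' *m L - f i *m C).
    rewrite -!mulmxA -mulmxBr mulmx_sum_row; apply: eq_bigr => i _; congr (_ *: _).
    by rewrite linearB /= !row_mul rowK.
  by elim/big_ind: _ => [|x y|i _]; [exact: rd0 | exact: rdD | apply: rdZ].
have [A0 hA0] := stepC _ g0; have [A1 hA1] := stepC _ gH.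
pose Q : 'M[{poly R}]_q := cp C *m (Lp ^+ e *m cp P) *m (cp C)^T.
pose LL : 'M[{poly R}]_(m, q) := cp A0 + 'X *: cp A1.
have QE t x y : form (at_mx Q t) x y = form P (x *m C *m Lt t ^+ e) (y *m C).
  rewrite /form /Q !at_mxM at_Lp !at_cp /at_mx matrix.map_trmx -/(at_mx _ t) at_cp.
  by rewrite trmx_mul !mulmxA.
have LLE t (w : 'rV_m) : rd K P (w *m C' *m Lt t - w *m at_mx LL t *m C).
  rewrite /LL at_line /Lt !mulmxDr -!scalemxAr mulmxDl -scalemxAl.
  have := rdD (hA0 w) (rdZ t (hA1 w)); congr (rd K P _).
  by apply/matrixP => i j; rewrite !mxE; ring.
have eK t (x : 'rV_q) : (x *m C *m Lt t ^+ e <= K (d - k))%MS.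
  by have -> : (d - k = k + e)%N; [rewrite /e; lia | apply: (good_X _ (gL t))].
have fM t (x : 'rV_q) (w : 'rV_m) : form (at_mx Q t) x (w *m at_mx LL t) = form P (x *m C *m Lt t ^+ e.+1) (w *m C').
  rewrite QE; have h1 := LLE t w _ _ (eK t x); rewrite formBl in h1.
  rewrite (formC _ _ (pc_sym pc)) -(subr0_eq h1) (formC _ _ (pc_sym pc)).
  by rewrite -(form_adj _ _ (gd_adj (gL t))) mulmxXS.
(* Identifies the primitive classes of the segment at t with a kernel whose matrix is polynomial in
   t. *)
have primP t (x : 'rV_q) : x *m at_mx (Q *m LL^T) t = 0 <-> rd K P (x *m C *m Lt t ^+ e.+1).
  rewrite at_mxM /at_mx -matrix.map_trmx -/(at_mx Q t) -/(at_mx LL t).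
  have fE (w : 'rV_m) : form (at_mx Q t) x (w *m at_mx LL t) = (x *m (at_mx Q t *m (at_mx LL t)^T) *m w^T) 0 0.
    by rewrite /form trmx_mul !mulmxA.
  split=> [h|h]; last first.
    apply/rowP => i; rewrite [RHS]mxE; have := h _ _ (hA (delta_mx 0 i)).1.
    by rewrite -fM fE trmx_delta -colE mxE.
  have xK1 : (x *m C *m Lt t ^+ e.+1 <= K (k + e.+1))%MS by apply: (good_X _ (gL t)).
  case: (posnP k) => k0; first by apply: (rd_big pc _ xK1); rewrite /e; lia.
  apply: (rdP pc _ xK1); first by rewrite /e; lia.
  have -> : (d - (k + e.+1) = k.-1)%N by rewrite /e; lia.
  move=> v vK; have [w hw] := hB v k0 vK.
  rewrite -(subrK (w *m C') v) formDr (formC _ (v - _) (pc_sym pc)) (hw _ _ xK1) add0r.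
  by rewrite -fM fE h mul0mx mxE.
have pp (x : 'rV_q) : x *m at_mx (Q *m LL^T) 1 = 0 -> x != 0 -> 0 < (-1) ^+ k * form (at_mx Q 1) x x.
  apply: (@primitive_path R m _ Q LL ((-1) ^+ k) 0 1 ler01 _ _ _ _ x).
  - by rewrite /Q trmx_mul trmxK trmx_mul Lp_adj mulmxA.
  - by rewrite signr_eq0.
  - move=> t t0 t1; split=> z hz.
      apply: hC; apply: (hl t t0 t1 k) => //; rewrite -/e.
      apply: (rdP pc (k := d - k) (leq_subr _ _) (eK t z)); rewrite subKn // => v vK.
      have [c hc] := hCs v vK.
      rewrite -(subrK (c *m C) v) formDr (formC _ (v - _) (pc_sym pc)) (hc _ _ (eK t z)) add0r.
      by rewrite -QE /form hz mul0mx mxE.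
    apply: hC'; case: (posnP k) => k0; first by rewrite ((hA z).2 k0) mul0mx; exact: rd0.
    have [zK _] := hA z.
    have e2 : (d - k.-1.*2 = e.+2)%N by rewrite /e; lia.
    apply: (hl t t0 t1 k.-1) => //; first lia.
    have zL : (z *m C' *m Lt t ^+ e.+2 <= K (k.-1 + e.+2))%MS by apply: (good_X _ (gL t)).
    rewrite e2; apply: (rdP pc _ zL); first by rewrite /e; lia.
    have -> : (d - (k.-1 + e.+2) = k.-1)%N by rewrite /e; lia.
    move=> v vK; have [w hw] := hB v k0 vK.
    rewrite -(subrK (w *m C') v) formDr (formC _ (v - _) (pc_sym pc)) (hw _ _ zL) add0r.
    have : form (at_mx Q t) (z *m at_mx LL t) (w *m at_mx LL t) = 0.
      rewrite /form trmx_mul; move: hz; rewrite (at_mxM _ LL^T) (at_mxM LL Q) !mulmxA => hz.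
      by move: hz; rewrite /at_mx -matrix.map_trmx => ->; rewrite mul0mx mxE.
    rewrite fM; have h1 := rd_X e.+1 (gL t) (LLE t z) (hA w).1.
    move: h1; rewrite mulmxBl formBl => /subr0_eq <-.
    by rewrite mulmxXSl.
  - move=> z /primP; rewrite /Lt scale0r addr0 => hz z0.
    have [p1 p2] := hr k _ hk (CK z) hz.
    have h0 : form (at_mx Q 0) z z = form P (z *m C *m L0 ^+ e) (z *m C).
      by rewrite QE /Lt scale0r addr0.
    rewrite h0 lt_def p1 andbT mulf_eq0 signr_eq0 /=; apply: contra z0 => /eqP/p2 hz0.
    by apply/eqP/hC.
have [c hc] := hCs u uK.
have gg : good K P hs (L0 + H) by apply: goodD.
have e1 : Lt 1 = L0 + H by rewrite /Lt scale1r.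
have uC : form P (u *m (L0 + H) ^+ e) u = form (at_mx Q 1) c c.
  rewrite QE e1 -(subrK (c *m C) u); set w := u - _ in hc *.
  rewrite mulmxDl formDl (rd_X e gg hc (_ : _ <= K k)%MS) ?add0r; last by rewrite /w subrK.
  rewrite formDr (formC _ w (pc_sym pc)) (hc _ _ (_ : _ <= K (d - k))%MS) ?add0r //.
  by rewrite -e1; apply: eK.
have hcu : rd K P (c *m C *m (L0 + H) ^+ e.+1).
  have := rdB hu (rd_X e.+1 gg hc); congr (rd K P _).
  by rewrite -mulmxBl opprB addrCA subrr addr0.
have [c0|c0] := eqVneq c 0.
  rewrite uC c0 form0l mulr0; split=> // _.
  by move: hc; rewrite c0 mul0mx subr0.
have := pp c; rewrite primP e1 => /(_ hcu c0) hpos; rewrite uC; split; first exact: ltW.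
by move=> h; rewrite h mulr0 ltxx in hpos.
Qed.
End Line.
End PathPiece.

End PiecePaths.
Import PiecePaths.

(** * Functionals on polynomials, their radicals and their matrices *)

Module Functionals.
Local Open Scope ring_scope.

Section Functional.
Variables (R : rcfType) (N : nat).
Local Notation P := {mpoly R[N]}.

Record fnl := Fnl { fn :> P -> R; fn_lin : forall a p q, fn (a *: p + q) = a * fn p + fn q }.
Implicit Types (f g : fnl) (p q : P).

Lemma fn0 f : f 0 = 0.
Proof. by have := fn_lin f (-1) 0 0; rewrite scaler0 addr0 mulN1r addNr. Qed.
Lemma fnD f p q : f (p + q) = f p + f q.
Proof. by have := fn_lin f 1 p q; rewrite scale1r mul1r. Qed.
Lemma fnZ f a p : f (a *: p) = a * f p.
Proof. by have := fn_lin f a p 0; rewrite fn0 !addr0. Qed.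
Lemma fnN f p : f (- p) = - f p.
Proof. by rewrite -scaleN1r fnZ mulN1r. Qed.
Lemma fnB f p q : f (p - q) = f p - f q.
Proof. by rewrite fnD fnN. Qed.
Lemma fn_sum f I (s : seq I) (Q : pred I) F : f (\sum_(i <- s | Q i) F i) = \sum_(i <- s | Q i) f (F i).
Proof. by apply: (big_morph f (fnD f) (fn0 f)). Qed.

Lemma fnl_ext f g : (forall m, f 'X_[m] = g 'X_[m]) -> f =1 g.
Proof. by move=> h p; rewrite (mpolyE p) !fn_sum; apply: eq_bigr => m _; rewrite !fnZ h. Qed.

Definition graded f d := forall m, mdeg m != d -> f 'X_[m] = 0.

Lemma gradedP f d k p : graded f d -> p \is k.-homog -> k != d -> f p = 0.
Proof.
move=> gf /dhomogP hp hk; rewrite (mpolyE p) fn_sum big_seq big1 // => m hm.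
by rewrite fnZ gf ?mulr0 // hp.
Qed.

Definition rad f (u : P) := forall v, f (u * v) = 0.

Lemma rad0 f : rad f 0. Proof. by move=> v; rewrite mul0r fn0. Qed.
Lemma radD f u v : rad f u -> rad f v -> rad f (u + v).
Proof. by move=> hu hv w; rewrite mulrDl fnD hu hv addr0. Qed.
Lemma radZ f a u : rad f u -> rad f (a *: u).
Proof. by move=> hu w; rewrite -scalerAl fnZ hu mulr0. Qed.
Lemma radN f u : rad f u -> rad f (- u).
Proof. by move=> hu w; rewrite mulNr fnN hu oppr0. Qed.
Lemma radB f u v : rad f u -> rad f v -> rad f (u - v).
Proof. by move=> hu hv; apply: radD => //; apply: radN. Qed.
Lemma radMr f u v : rad f u -> rad f (u * v).
Proof. by move=> hu w; rewrite -mulrA hu. Qed.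
Lemma radMl f u v : rad f u -> rad f (v * u).
Proof. by move=> hu; rewrite mulrC; apply: radMr. Qed.
Lemma rad_sum f I (s : seq I) (Q : pred I) F : (forall i, Q i -> rad f (F i)) -> rad f (\sum_(i <- s | Q i) F i).
Proof. by move=> h; elim/big_ind: _ => //; [exact: rad0 | exact: radD]. Qed.

Definition HRf f d l := forall k (u : P), (k.*2 <= d)%N -> u \is k.-homog ->
  (forall v, f (u * l ^+ (d - k.*2).+1 * v) = 0) ->
  0 <= (-1) ^+ k * f (u * l ^+ (d - k.*2) * u) /\ (f (u * l ^+ (d - k.*2) * u) = 0 -> rad f u).

Definition HLf f d l := forall k (u : P), (k.*2 <= d)%N -> u \is k.-homog ->
  (forall v, f (u * l ^+ (d - k.*2) * v) = 0) -> rad f u.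

Lemma HRf_HLf f d l : HRf f d l -> HLf f d l.
Proof.
move=> hr k u hk hu h; have [|_] := hr k u hk hu; last by apply; exact: h.
by move=> v; rewrite exprSr mulrA -mulrA h.
Qed.

Lemma HRf_eq f g d l : f =1 g -> HRf f d l -> HRf g d l.
Proof.
move=> e h k u hk hu hp; have [|h1 h2] := h k u hk hu; first by move=> v; rewrite e.
by rewrite -e; split=> // /h2 h3 v; rewrite -e.
Qed.

Section Coord.
Variable d : nat.
Local Notation n := #|{: 'X_{1..N < d.+1}}|.
Implicit Types (u v : 'rV[R]_n).
(** The monomials of degree at most d are coordinates for everything that a functional of degree d
    can see. *)
Definition mon (i : 'I_n) : 'X_{1..N} := bmnm (enum_val i).
Definition pol (u : 'rV[R]_n) : P := \sum_i u 0 i *: 'X_[mon i].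
Definition rv p : 'rV[R]_n := \row_i p@_(mon i).

Lemma mdeg_mon i : (mdeg (mon i) <= d)%N.
Proof. by rewrite /mon; case: (enum_val i). Qed.

Lemma mon_inj : injective mon.
Proof. by move=> i j /val_inj/enum_val_inj. Qed.

Lemma mon_surj m : (mdeg m <= d)%N -> exists i, mon i = m.
Proof.
move=> h; pose b : 'X_{1..N < d.+1} := BMultinom (h : (mdeg m < d.+1)%N).
by exists (enum_rank b); rewrite /mon enum_rankK.
Qed.

Lemma mcoeff_pol u i : (pol u)@_(mon i) = u 0 i.
Proof.
rewrite /pol linear_sum /= (bigD1 i) //= linearZ /= mcoeffX eqxx mulr1 big1 ?addr0 // => j ji.
by rewrite linearZ /= mcoeffX (inj_eq mon_inj) (negPf ji) mulr0.
Qed.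

Lemma mcoeff_pol0 u m : (d < mdeg m)%N -> (pol u)@_m = 0.
Proof.
move=> h; rewrite /pol linear_sum big1 //= => j _; rewrite linearZ /= mcoeffX.
by case: eqP => e; rewrite ?mulr0 //; move: h; rewrite -e ltnNge mdeg_mon.
Qed.

Lemma polK u : rv (pol u) = u.
Proof. by apply/rowP => i; rewrite mxE mcoeff_pol. Qed.

Lemma rvK_coeff p m : (mdeg m <= d)%N -> (pol (rv p))@_m = p@_m.
Proof. by case/mon_surj => i <-; rewrite mcoeff_pol mxE. Qed.

Lemma polD u v : pol (u + v) = pol u + pol v.
Proof. by rewrite /pol -big_split; apply: eq_bigr => i _; rewrite mxE scalerDl. Qed.
Lemma polZ a u : pol (a *: u) = a *: pol u.
Proof. by rewrite /pol scaler_sumr; apply: eq_bigr => i _; rewrite mxE scalerA. Qed.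
Lemma rvD p q : rv (p + q) = rv p + rv q.
Proof. by apply/rowP => i; rewrite !mxE mcoeffD. Qed.
Lemma rvZ a p : rv (a *: p) = a *: rv p.
Proof. by apply/rowP => i; rewrite !mxE mcoeffZ. Qed.

(** The terms cut off have degree above d, and so have their multiples. *)
Lemma rvM p h : rv (pol (rv p) * h) = rv (p * h).
Proof.
apply/rowP => i; rewrite !mxE !mcoeffM; apply: eq_bigr => -[k1 k2] /= /eqP e.
rewrite rvK_coeff //; have := congr1 mdeg e; rewrite mdegD => e'.
have := mdeg_mon i; lia.
Qed.

Lemma fn_rv f p : graded f d -> f (pol (rv p)) = f p.
Proof.
move=> gf; have lin a p1 q1 : f (pol (rv (a *: p1 + q1))) = a * f (pol (rv p1)) + f (pol (rv q1)).
  by rewrite rvD rvZ polD polZ fnD fnZ.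
apply: (@fnl_ext (Fnl lin) f) => m /=; case: (leqP (mdeg m) d) => hm; last first.
  rewrite (_ : rv _ = 0) ?gf ?gtn_eqF //; last first.
    apply/rowP => i; rewrite !mxE mcoeffX; case: eqP => // e.
    by move: hm; rewrite e ltnNge mdeg_mon.
  by rewrite -(scale0r 0) polZ scale0r fn0.
congr (f _); apply/mpolyP => m'; case: (leqP (mdeg m') d) => hm'; first by rewrite rvK_coeff.
by rewrite mcoeff_pol0 // mcoeffX; case: eqP => // e; move: hm'; rewrite -e ltnNge hm.
Qed.

Definition Kk k : 'M[R]_n := \matrix_(i, j) ((i == j) && (mdeg (mon i) == k))%:R.
Definition gram f : 'M[R]_n := \matrix_(i, j) f ('X_[mon i] * 'X_[mon j]).
Definition op h : 'M[R]_n := \matrix_i rv (h * 'X_[mon i]).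

Lemma KkP k u : (u <= Kk k)%MS <-> pol u \is k.-homog.
Proof.
split=> [/submxP[D ->]|/dhomogP h].
  have -> : D *m Kk k = \row_j (D 0 j * (mdeg (mon j) == k)%:R).
    apply/rowP => j; rewrite !mxE (bigD1 j) //= mxE eqxx big1 ?addr0 // => i ij.
    by rewrite mxE (negPf ij) mulr0.
  rewrite /pol rpred_sum // => i _; rewrite mxE.
  by case: eqP => e; rewrite ?mulr0 ?scale0r ?rpred0 // rpredZ // dhomogX; exact/eqP.
suff -> : u = u *m Kk k by apply: submxMl.
apply/rowP => j; rewrite mxE (bigD1 j) //= mxE eqxx big1 ?addr0 => [|i ij]; last first.
  by rewrite mxE (negPf ij) mulr0.
case: eqP => e; rewrite ?mulr1 // mulr0 -mcoeff_pol; apply/eqP; rewrite mcoeff_eq0.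
by apply/negP => /h.
Qed.

Lemma rvX_delta i : rv 'X_[mon i] = delta_mx 0 i.
Proof. by apply/rowP => j; rewrite !mxE eqxx mcoeffX (inj_eq mon_inj) eq_sym. Qed.

Lemma row_op u h : u *m op h = rv (pol u * h).
Proof.
rewrite mulmx_sum_row; under eq_bigr do rewrite rowK mulrC.
rewrite /pol mulr_suml; elim/big_rec2: _ => [|i p1 p2 _ ->].
  by apply/rowP => j; rewrite !mxE mcoeff0.
by rewrite rvD -scalerAl rvZ.
Qed.

Lemma row_opX u h e : u *m op h ^+ e = rv (pol u * h ^+ e).
Proof.
elim: e => [|e IH]; first by rewrite !expr0 mulmx1 mulr1 polK.
by rewrite -mulmxXS IH row_op rvM exprSr mulrA.
Qed.

Lemma form_gram f u v : form (gram f) u v = f (pol u * pol v).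
Proof.
rewrite /form /pol mulr_suml fn_sum mxE.
under eq_bigr => j _ do rewrite !mxE mulr_suml; rewrite exchange_big; apply: eq_bigr => i _.
rewrite mulr_sumr fn_sum; apply: eq_bigr => j _.
by rewrite !mxE -scalerAl -scalerAr !fnZ mulrA mulrAC.
Qed.

Lemma homog_rv k p : (k <= d)%N -> p \is k.-homog -> pol (rv p) = p.
Proof.
move=> hk /dhomogP hp; apply/mpolyP => m; case: (leqP (mdeg m) d) => hm; first by rewrite rvK_coeff.
rewrite mcoeff_pol0 //; apply/esym/eqP; rewrite mcoeff_eq0; apply/negP => /hp e.
by move: hm; rewrite e ltnNge hk.
Qed.

Lemma homog_trunc k p : p \is k.-homog -> pol (rv p) \is k.-homog.
Proof.
move=> hp; case: (leqP k d) => hk; first by rewrite (homog_rv hk).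
rewrite (_ : rv p = 0); first by rewrite -(scale0r 0) polZ scale0r rpred0.
apply/rowP => i; rewrite !mxE; apply/eqP; rewrite mcoeff_eq0; apply/negP => /(dhomogP _ _ _ hp) e.
by move: hk; rewrite -e ltnNge mdeg_mon.
Qed.

Section Piece.
Variable f : fnl.
Hypothesis gf : graded f d.

Lemma fn_trunc p q : f (pol (rv p) * q) = f (p * q).
Proof. by rewrite -fn_rv // rvM fn_rv. Qed.

Lemma rd_gram u : rd Kk (gram f) u <-> rad f (pol u).
Proof.
split=> [h v|h l v _]; last by rewrite form_gram.
rewrite (mpolyE v) mulr_sumr fn_sum big1 // => m _; rewrite -scalerAr fnZ.
case: (leqP (mdeg m) d) => hm.
  have [i hi] := mon_surj hm; have := h (mdeg m) (rv 'X_[m]).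
  rewrite form_gram (homog_rv hm) ?dhomogX // => ->; rewrite ?mulr0 //.
  by apply/KkP; rewrite (homog_rv hm) ?dhomogX.
rewrite /pol mulr_suml fn_sum big1 ?mulr0 // => i _.
rewrite -scalerAl fnZ -mpolyXD gf ?mulr0 //; rewrite mdegD; apply/eqP => e.
by move: hm; rewrite -e ltnNge leq_addl.
Qed.

Lemma op_adj h : op h *m gram f = gram f *m (op h)^T.
Proof.
apply/matrixP => i j.
have e u v : form (gram f) (u *m op h) v = form (gram f) u (v *m op h).
  by rewrite !form_gram !row_op fn_trunc [pol u * pol (rv _)]mulrC fn_trunc; congr (f _); ring.
have ent (A : 'M[R]_n) : (delta_mx 0 i *m A *m (delta_mx 0 j)^T : 'M_1) 0 0 = A i j.
  by rewrite trmx_delta -rowE -colE !mxE.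
have := e (delta_mx 0 i) (delta_mx 0 j).
by rewrite -(ent (op h *m gram f)) -(ent (gram f *m (op h)^T)) /form trmx_mul !mulmxA.
Qed.

Lemma op_comm h h' : op h *m op h' = op h' *m op h.
Proof.
apply/row_matrixP => i; rewrite !rowE !mulmxA !row_op !rvM; congr (rv _); ring.
Qed.

Lemma op_st h k u : h \is 1.-homog -> (u <= Kk k)%MS -> (u *m op h <= Kk k.+1)%MS.
Proof.
move=> hh /KkP hu; apply/KkP; rewrite row_op; apply: homog_trunc; rewrite -addn1; exact: dhomogM.
Qed.

Lemma piece_of hs : (forall h, h \in hs -> h \is 1.-homog) -> piece Kk (gram f) d (map op hs).
Proof.
move=> hh; split.
- by apply/matrixP => i j; rewrite !mxE mulrC.
- move=> k l u v /KkP hu /KkP hv hkl; rewrite form_gram.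
  by apply: (gradedP gf (dhomogM hu hv)); apply/eqP.
- by move=> _ k u /mapP[h /hh h1 ->]; apply: op_st.
- by move=> _ /mapP[h _ ->]; apply: op_adj.
- by move=> _ _ /mapP[h _ ->] /mapP[h' _ ->]; apply: op_comm.
Qed.

Lemma HRf_HRat l : HRf f d l <-> HRat Kk (gram f) d (op l).
Proof.
split=> h k u hk hu hp.
  have [|h1 h2] := h k (pol u) hk ((KkP _ _).1 hu).
    by move=> v; move: hp => /rd_gram/(_ v); rewrite row_opX fn_trunc.
  by rewrite form_gram row_opX fn_trunc; split=> // /h2/rd_gram.
have kd : (k <= d)%N by lia.
have e : pol (rv u) = u := homog_rv kd hu.
have [||h1 h2] := h k (rv u) hk.
- by apply/KkP; rewrite e.
- by apply/rd_gram => v; rewrite row_opX fn_trunc e.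
by move: h1 h2; rewrite form_gram row_opX fn_trunc e rd_gram e.
Qed.

Lemma HLf_HLin l : HLf f d l <-> HLin Kk (gram f) d (op l).
Proof.
split=> h k u hk hu hp.
  apply/rd_gram; apply: (h k) => //; first by apply/KkP.
  by move=> v; move: hp => /rd_gram/(_ v); rewrite row_opX fn_trunc.
have kd : (k <= d)%N by lia.
have e : pol (rv u) = u := homog_rv kd hu.
rewrite -e; apply/rd_gram; apply: (h k) => //; first by apply/KkP; rewrite e.
by apply/rd_gram => v; rewrite row_opX fn_trunc e.
Qed.

Lemma opD h h' : op (h + h') = op h + op h'.
Proof. by apply/row_matrixP => i; rewrite linearD /= !rowK mulrDl rvD. Qed.
Lemma opZ a h : op (a *: h) = a *: op h.
Proof. by apply/row_matrixP => i; rewrite linearZ /= !rowK -scalerAl rvZ. Qed.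
Lemma op0 : op 0 = 0.
Proof. by rewrite -(scale0r 0) opZ scale0r. Qed.

Theorem HRf_path l0 h : l0 \is 1.-homog -> h \is 1.-homog ->
  (forall t, 0 <= t -> t <= 1 -> HLf f d (l0 + t *: h)) -> HRf f d l0 -> HRf f d (l0 + h).
Proof.
move=> hl0 hh hl hr.
have pc : piece Kk (gram f) d (map op [:: l0; h]).
  by apply: piece_of => x; rewrite !inE => /orP[] /eqP->.
have g0 : good Kk (gram f) (map op [:: l0; h]) (op l0) by apply: (good_op pc); rewrite !inE eqxx.
have gh : good Kk (gram f) (map op [:: l0; h]) (op h) by apply: (good_op pc); rewrite !inE eqxx orbT.
apply/HRf_HRat; rewrite opD; apply: (HR_path pc g0 gh).
  by move=> t t0 t1; rewrite -opZ -opD; apply/HLf_HLin/hl.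
by apply/HRf_HRat.
Qed.

(** Coefficients are functions of the class, hence the list must be free of repetitions. *)
Lemma HR_of hs : (forall c : P -> R, (forall h, 0 < c h) -> HRf f d (\sum_(h <- hs) c h *: h)) ->
  uniq hs -> HR Kk (gram f) d (map op hs).
Proof.
move=> hr us L cL; suff [c [c0 ->]] : exists c : P -> R, (forall h, 0 < c h) /\ L = op (\sum_(h <- hs) c h *: h).
  by move: (hr c c0) => /HRf_HRat.
elim: hs us L cL {hr} => [|h hs IH] /=.
  by move=> _ _ ->; exists (fun=> 1); split=> [_|]; [exact: ltr01 | rewrite big_nil op0].
move=> /andP[nh us] L [s s0 [L' /(IH us)[c [c0 ->]] ->]].
exists (fun x => if x == h then s else c x); split=> [x|]; first by case: eqP.
rewrite big_cons eqxx opD opZ; congr (_ + op _); apply: eq_big_seq => x hx.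
by case: eqP => // e; move: nh; rewrite -e hx.
Qed.
End Piece.
End Coord.

(** The map s need not be onto: against its image, every test class can be exchanged for one in the
    image, which is enough to move primitivity and radicals. *)
Theorem HRf_pullback f f' d l l' (s : P -> P) (c : R) :
  0 < c -> (forall q, f' q = c * f (s q)) ->
  {morph s : p q / p * q} -> s 1 = 1 -> (forall k u, u \is k.-homog -> s u \is k.-homog) ->
  s l = l' -> (forall v', exists v, forall u, f (s u * v') = f (s u * s v)) ->
  HRf f d l' -> HRf f' d l.
Proof.
move=> c0 ff sM s1 sh sl ss hr k u hk hu hp.
have sX p e : s (p ^+ e) = s p ^+ e by elim: e => [|e IH]; rewrite ?expr0 // !exprS sM IH.
have [|h1 h2] := hr k (s u) hk (sh _ _ hu).
  move=> v'; have [v hv] := ss v'; rewrite -sl -sX -sM hv -sM.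
  by apply: (mulfI (lt0r_neq0 c0)); rewrite -ff hp mulr0.
rewrite ff !sM sX sl mulrCA; split; first exact: mulr_ge0 (ltW c0) h1.
move=> /eqP; rewrite mulf_eq0 gt_eqF //= => /eqP/h2 h3 v.
by rewrite ff sM h3 mulr0.
Qed.

(* Positivity of the [w i] turns the Hodge-Riemann inequalities of the [F i] into
   vanishing of all of them. *)
Theorem HLf_local (I : finType) f (F : I -> fnl) d l (w : I -> R) (y : I -> P) (ht : 'I_N -> I -> R) :
  (forall i, 0 < w i) -> (forall i q, F i q = f (y i * q)) ->
  (forall q, f (l * q) = \sum_i w i * F i q) ->
  (forall j q, f ('X_j * q) = \sum_i ht j i * F i q) ->
  (forall i, HRf (F i) d.-1 l) -> graded f d -> HLf f d l.
Proof.
move=> w0 yF lF hF hr gf k u hk hu hp.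
case: (ltnP k.*2 d) => h; last first.
  have e0 : (d - k.*2 = 0)%N by lia.
  by move=> v; move: (hp v); rewrite e0 expr0 mulr1.
have e : (d - k.*2 = (d.-1 - k.*2).+1)%N by lia.
have k1 : (k.*2 <= d.-1)%N by lia.
have prim i v : F i (u * l ^+ (d.-1 - k.*2).+1 * v) = 0.
  by rewrite yF -e mulrCA hp.
have pos i := hr i k u k1 hu (prim i).
have sum0 : \sum_i w i * ((-1) ^+ k * F i (u * l ^+ (d.-1 - k.*2) * u)) = 0.
  under eq_bigr do rewrite mulrCA; rewrite -mulr_sumr -lF.
  have -> : l * (u * l ^+ (d.-1 - k.*2) * u) = u * l ^+ (d - k.*2) * u by rewrite e exprS; ring.
  by rewrite hp mulr0.
have all0 i : rad (F i) u.
  apply: (pos i).2; move/eqP: sum0; rewrite psumr_eq0.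
    move/allP/(_ i (mem_index_enum _)); rewrite /= !mulf_eq0 gt_eqF //= signr_eq0 /=.
    by move/eqP.
  by move=> j _; apply: mulr_ge0; [exact: ltW | exact: (pos j).1].
move=> v; rewrite (mpolyE v) mulr_sumr fn_sum big1_seq // => m _; rewrite -scalerAr fnZ.
have [m0|[j mj]] : m = 0%MM \/ exists j, (0 < m j)%N.
  case: (pickP (fun j => (0 < m j)%N)) => [j hj|h0]; [by right; exists j | left].
  by apply/mnmP => j; rewrite mnm0E; move: (h0 j); case: (m j).
  rewrite m0 mpolyX0 mulr1 (gradedP gf hu) ?mulr0 //; apply/eqP; lia.
have -> : m = (U_(j) + (m - U_(j)))%MM.
  by rewrite addmC submK //; apply/mnm_lepP => i; rewrite mnm1E; case: eqP => // <-.
rewrite mpolyXD mulrCA hF big1 ?mulr0 // => i _.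
by rewrite all0 mulr0.
Qed.
End Functional.

End Functionals.
Import Functionals.

(** * The dragon condition and its behavior in stars *)

Module Dragon.
Local Open Scope ring_scope.

Section Monomials.
Variable E : finType.
Local Notation N := #|{: {set E}}|.
Implicit Types (A X Y Z F T W : {set E}) (G : {set {set E}}) (r : {set E} -> nat) (m q : 'X_{1..N}).

Definition sv m X : nat := m (enum_rank X).
Definition um X : 'X_{1..N} := U_(enum_rank X)%MM.
Definition cnt m F : nat := \sum_(X : {set E} | X \subset F) sv m X.
Definition supp m G := [forall X, (0 < sv m X)%N ==> (X \in G)].
(** Postnikov's dragon condition for a matroid, over all subsets; [drag_built] reduces it to the
    members of the building set. *)
Definition drag r m := [forall F : {set E}, (cnt m F <= (r F).-1)%N].
Definition okm d r G m := [&& mdeg m == d, supp m G & drag r m].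
Definition push (rho : {set E} -> {set E}) m : 'X_{1..N} :=
  [multinom (\sum_(X : {set E} | rho X == enum_val i) sv m X)%N | i < N].

Lemma svD m q X : sv (m + q)%MM X = (sv m X + sv q X)%N.
Proof. exact: mnmDE. Qed.
Lemma sv_um X Y : sv (um X) Y = (X == Y).
Proof. by rewrite /sv mnm1E (inj_eq enum_rank_inj). Qed.
Lemma cntD m q F : cnt (m + q)%MM F = (cnt m F + cnt q F)%N.
Proof. by rewrite /cnt -big_split; apply: eq_bigr => X _; rewrite svD. Qed.
Lemma cnt_um X F : cnt (um X) F = (X \subset F).
Proof.
rewrite /cnt; case: (boolP (X \subset F)) => h.
  rewrite (bigD1 X) //= sv_um eqxx big1 // => Y /andP[_ ne]; by rewrite sv_um eq_sym (negPf ne).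
by rewrite big1 // => Y YF; rewrite sv_um; case: eqP => // e; rewrite e YF in h.
Qed.
Lemma suppP m G : reflect (forall X, (0 < sv m X)%N -> X \in G) (supp m G).
Proof. by apply: (iffP forallP) => h X; [move/implyP: (h X) | apply/implyP/h]. Qed.
Lemma suppD m q G : supp (m + q)%MM G = supp m G && supp q G.
Proof.
apply/suppP/andP => [h|[/suppP h1 /suppP h2] X].
  by split; apply/suppP => X hX; apply: h; rewrite svD addn_gt0 hX ?orbT.
by rewrite svD addn_gt0 => /orP[/h1|/h2].
Qed.
Lemma supp_um X G : supp (um X) G = (X \in G).
Proof.
apply/suppP/idP => [h|XG Y]; first by apply: h; rewrite sv_um eqxx.
by rewrite sv_um; case: eqP => // <-.
Qed.
Lemma dragP r m : reflect (forall F, (cnt m F <= (r F).-1)%N) (drag r m).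
Proof. exact: forallP. Qed.

Lemma sum_sv m : (\sum_(X : {set E}) sv m X = mdeg m)%N.
Proof.
rewrite mdegE (reindex (@enum_val _ (mem {: {set E}}))) /=; last by apply: onW_bij; apply: enum_val_bij.
by apply: eq_bigr => i _; rewrite /sv enum_valK.
Qed.

Lemma eq_cnt m (P Q : pred {set E}) : (forall X, (0 < sv m X)%N -> P X = Q X) ->
  (\sum_(X | P X) sv m X = \sum_(X | Q X) sv m X)%N.
Proof.
move=> h; rewrite big_mkcond [RHS]big_mkcond; apply: eq_bigr => X _.
by case: (posnP (sv m X)) => [->|/h->//]; rewrite !if_same.
Qed.

Lemma leq_cnt m (P Q : pred {set E}) : (forall X, (0 < sv m X)%N -> P X -> Q X) ->
  (\sum_(X | P X) sv m X <= \sum_(X | Q X) sv m X)%N.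
Proof.
move=> h; rewrite big_mkcond [leqRHS]big_mkcond; apply: leq_sum => X _.
case: (posnP (sv m X)) => [->|/h]; first by rewrite !if_same.
by case: (P X) => // /(_ isT)->.
Qed.

Lemma sv_push rho m Y : sv (push rho m) Y = (\sum_(X | rho X == Y) sv m X)%N.
Proof. by rewrite /sv mnmE enum_rankK. Qed.

Lemma cnt_push rho m A : cnt (push rho m) A = (\sum_(X | rho X \subset A) sv m X)%N.
Proof.
rewrite /cnt [RHS](partition_big rho (fun Y => Y \subset A)) //=; apply: eq_bigr => Y YA.
by rewrite sv_push; apply: eq_bigl => X; case: eqP => [->|]; rewrite ?YA // andbF.
Qed.

Lemma mdeg_push rho m : mdeg (push rho m) = mdeg m.
Proof.
rewrite -!sum_sv [RHS](partition_big rho xpredT) //=; apply: eq_bigr => Y _; by rewrite sv_push.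
Qed.

Lemma supp_push rho m G G' : (forall X, X \in G -> rho X \in G') -> supp m G -> supp (push rho m) G'.
Proof.
move=> h /suppP hm; apply/suppP => Y; rewrite sv_push lt0n sum_nat_eq0 negb_forall.
by case/existsP => X; rewrite negb_imply -lt0n => /andP[/eqP <- /hm/h].
Qed.

Section Built.
Variables (D : {set E}) (r : {set E} -> nat) (G : {set {set E}}).
Hypothesis M : mat D r.
Hypothesis bG : built D r G.

Lemma cnt_fac m F X : supp m G -> fl D r F -> X \in maxG_le G F ->
  cnt m F = (cnt m X + cnt m (F :\: X))%N.
Proof.
move=> /suppP sm fF hX; have /in_fac[XG XF _] := hX.
rewrite /cnt (bigID (fun Y => Y \subset X)) /=; congr addn; apply: eq_cnt => Y /sm YG.
  by case: (boolP (Y \subset X)) => h; rewrite ?andbF // (subset_trans h XF).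
rewrite subsetD -setI_eq0; case: (boolP (Y \subset F)) => //= YF.
have [x xY] := set0Pn _ (b_n0 bG YG).
have [h|h] := fac_dich M bG fF hX YG YF; last first.
  by rewrite h eqxx; apply/subsetPn; exists x => //; move/setP/(_ x): h; rewrite !inE xY /= => ->.
rewrite h; apply/esym/negP => /eqP/setP/(_ x); by rewrite !inE xY (subsetP h).
Qed.

Lemma cnt0 m : supp m G -> cnt m set0 = 0%N.
Proof.
move=> /suppP sm; rewrite /cnt big1 // => X; rewrite subset0 => /eqP->.
by apply/eqP; rewrite -leqn0 leqNgt; apply/negP => /sm/(b_n0 bG); rewrite eqxx.
Qed.

Lemma drag_flat m : supp m G -> (forall F, fl D r F -> (cnt m F <= (r F).-1)%N) -> drag r m.
Proof.
move=> /suppP sm h; apply/dragP => F; have FD : F :&: D \subset D := subsetIr _ _.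
have := h _ (fl_cl M FD); rewrite (r_cl M FD) (m_out M); apply: leq_trans.
apply: leq_cnt => X /sm XG XF; apply: (subset_trans _ (sub_clD r FD)).
by rewrite subsetI XF (b_subD bG XG).
Qed.

(** Counts and ranks add up over the factors of a flat, and every factor brings its own unit of
    slack. *)
Lemma drag_built m : supp m G -> (forall X, X \in G -> (cnt m X <= (r X).-1)%N) -> drag r m.
Proof.
move=> sm h; apply: drag_flat => // F; have [n] := ubnP #|F|; elim: n F => // n IH F hn fF.
have [->|[x xF]] := set_0Vmem F; first by rewrite (cnt0 sm).
have [X hX xX] := fac_pt M bG fF xF; have /in_fac[XG XF _] := hX.
have s := b_sep bG fF hX; have /andP[_ /eqP e] := s.
have k1 := h X XG; have k2 : (cnt m (F :\: X) <= (r (F :\: X)).-1)%N.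
  apply: IH (fl_sepD M fF s); rewrite -ltnS; apply: leq_trans hn; rewrite ltnS.
  by apply: proper_card; apply/properP; split; [exact: subsetDl | exists x => //; rewrite inE xX].
rewrite (cnt_fac sm fF hX) e; move: k1 k2 (b_rgt0 M bG XG); clear; lia.
Qed.

Lemma mdeg_top m : supp m G -> mdeg m = (\sum_(X in maxset G) cnt m X)%N.
Proof.
move=> /suppP sm; have cC := comps_max M bG.
rewrite -sum_sv /cnt [RHS](exchange_big_dep xpredT) //=; apply: eq_bigr => X _.
case: (posnP (sv m X)) => [->|/sm XG]; first by rewrite big1.
have [Y hY XY] := maxset_above XG; rewrite (big_pred1 Y) // => Y'; rewrite /= andbC.
apply/andP/eqP => [[XY' hY']|->//]; have [x xX] := set0Pn _ (b_n0 bG XG).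
exact: (c_disj cC hY' hY (subsetP XY' _ xX) (subsetP XY _ xX)).
Qed.

(** In top degree the bounds on the maximal elements add up to the degree, so each of them is
    attained. *)
Lemma okm_top m X : okm (topdeg r G) r G m -> X \in maxset G -> cnt m X = (r X).-1.
Proof.
case/and3P => /eqP dm sm /dragP dr hX; apply/eqP; rewrite eqn_leq dr leqNgt; apply/negP => h.
have := mdeg_top sm; rewrite dm /topdeg (bigD1 X) //= [in RHS](bigD1 X) //=.
move=> e; have hs : (\sum_(Y in maxset G | Y != X) cnt m Y <= \sum_(Y in maxset G | Y != X) (r Y).-1)%N by apply: leq_sum.
have : (cnt m X + \sum_(Y in maxset G | Y != X) cnt m Y < (r X).-1 + \sum_(Y in maxset G | Y != X) (r Y).-1)%N.
  by rewrite -addSn leq_add.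
by rewrite -e ltnn.
Qed.

Lemma cnt_join m F1 F2 : (cnt m F1 + cnt m F2 <= cnt m (F1 :|: F2) + cnt m (F1 :&: F2))%N.
Proof.
rewrite /cnt big_mkcond [X in (_ + X)%N]big_mkcond [X in (_ <= X + _)%N]big_mkcond.
rewrite [X in (_ <= _ + X)%N]big_mkcond -!big_split; apply: leq_sum => X _ /=; rewrite subsetI.
case: (boolP (X \subset F1)) => h1; case: (boolP (X \subset F2)) => h2 //=; rewrite ?addn0 ?add0n //.
- by rewrite (subset_trans h1 (subsetUl _ _)).
- by rewrite (subset_trans h1 (subsetUl _ _)).
- by rewrite (subset_trans h2 (subsetUr _ _)).
Qed.

Lemma cnt_cl m A : supp m G -> A \subset D -> (cnt m A <= cnt m (clD D r A))%N.
Proof. by move=> _ AD; apply: leq_cnt => X _ h; apply: subset_trans h (sub_clD r AD). Qed.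

Lemma cnt_mono m A A' : A \subset A' -> (cnt m A <= cnt m A')%N.
Proof. by move=> h; apply: leq_cnt => X _ h'; apply: subset_trans h' h. Qed.

Lemma drag_addP m (s : 'X_{1..N}) : supp m G -> supp s G ->
  reflect (forall F, fl D r F -> (cnt s F + cnt m F <= (r F).-1)%N) (drag r (s + m)%MM).
Proof.
move=> sm ss; apply: (iffP idP) => [/dragP h F _|h]; first by rewrite -cntD.
by apply: drag_flat => [|F fF]; rewrite ?suppD ?ss // cntD h.
Qed.

(* The slack [(r F).-1 - cnt m F] is submodular up to one unit, so tight flats over T1
   and over T2 cannot coexist when all flats over T have slack two. *)
Lemma okm_square d m T T1 T2 : T \in G -> T1 \in G -> T2 \in G -> clD D r (T1 :|: T2) = T ->
  (okm d r G (um T + (um T + m))%MM + okm d r G (um T1 + (um T2 + m))%MM =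
   okm d r G (um T + (um T1 + m))%MM + okm d r G (um T + (um T2 + m))%MM :> nat)%N.
Proof.
move=> TG T1G T2G eT; rewrite /okm !mdegD !suppD !supp_um TG T1G T2G !mdeg1 /=.
case: eqP => //= _; case: (boolP (supp m G)) => //= sm.
have su X : X \in G -> supp (um X) G by rewrite supp_um.
have red X Y : X \in G -> Y \in G ->
    reflect (forall F, fl D r F -> ((X \subset F) + ((Y \subset F) + cnt m F) <= (r F).-1)%N) (drag r (um X + (um Y + m))%MM).
  move=> XG YG; apply: (iffP (drag_addP _ _)); rewrite ?suppD ?su //.
    by move=> h F fF; have := h F fF; rewrite cntD !cnt_um.
  by move=> h F fF; rewrite cntD !cnt_um h.
have sD : T1 :|: T2 \subset D by rewrite subUset !(b_subD bG).
have TF F : fl D r F -> (T \subset F) = (T1 \subset F) && (T2 \subset F).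
  move=> fF; rewrite -subUset; apply/idP/idP => h.
    by apply: subset_trans h; rewrite -eT sub_clD.
  by rewrite -eT; apply: (cl_min M).
have [a|na] := red _ _ TG TG; last first.
  have nodrag X Y : X \in G -> Y \in G -> (forall F, fl D r F -> T \subset F -> (X \subset F) && (Y \subset F)) ->
      drag r (um X + (um Y + m))%MM = false.
    move=> XG YG h; apply/negbTE/negP => /(red _ _ XG YG) h'; apply: na => F fF.
    have := h' F fF; case: (boolP (T \subset F)) => hT; last by lia.
    by have /andP[-> ->] := h F fF hT.
  rewrite !nodrag // => F fF; rewrite TF // => /andP[h1 h2]; by rewrite ?TF ?h1 ?h2.
have sl F : fl D r F -> T \subset F -> (2 + cnt m F <= (r F).-1)%N.
  by move=> fF hT; have := a F fF; rewrite hT.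
pose bad (Ta : {set E}) := [exists F : {set E}, [&& fl D r F, Ta \subset F & cnt m F == (r F).-1]].
have one Ta : Ta \in G -> Ta \subset T -> drag r (um T + (um Ta + m))%MM = ~~ bad Ta.
  move=> TaG TaT; apply/red/idP => // [h|nb F fF].
    apply/existsP => -[F /and3P[fF hF /eqP e]]; have := h F fF; rewrite hF e; lia.
  have := a F fF; case: (boolP (T \subset F)) => hT; first by rewrite (subset_trans TaT hT).
  case: (boolP (Ta \subset F)) => hF //= h; move: nb; rewrite negb_exists => /forallP/(_ F).
  rewrite fF hF /= add0n; move: h; clear; lia.
have [s1 s2] : T1 \subset T /\ T2 \subset T.
  by rewrite -eT; split; apply: subset_trans (sub_clD r sD); rewrite ?subsetUl ?subsetUr.
have two : drag r (um T1 + (um T2 + m))%MM = ~~ bad T1 && ~~ bad T2.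
  rewrite -!one //; apply/red/andP => // [h|[/red h1 /red h2] F fF].
    split; apply/red => // F fF; have := h F fF; have := a F fF; rewrite TF //.
      by case: (T1 \subset F); case: (T2 \subset F); rewrite /= ?addn0 ?add0n //; clear; lia.
    by case: (T1 \subset F); case: (T2 \subset F); rewrite /= ?addn0 ?add0n //; clear; lia.
  have := h1 TG T1G F fF; have := h2 TG T2G F fF; have := a F fF; rewrite TF //.
  by case: (T1 \subset F); case: (T2 \subset F); rewrite /= ?addn0 ?add0n //; clear; lia.
rewrite two !one //; case: (boolP (bad T1)) => //= /existsP[F1 /and3P[f1 h1 /eqP e1]].
case: (boolP (bad T2)) => //= /existsP[F2 /and3P[f2 h2 /eqP e2]]; exfalso.
have sF : F1 :|: F2 \subset D by rewrite subUset !(@fl_sub _ D r).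
have TU : T \subset clD D r (F1 :|: F2).
  by rewrite -eT; apply: (cl_min M) (fl_cl M sF); apply: subset_trans (sub_clD r sF); apply: setUSS.
have k1 := sl _ (fl_cl M sF) TU; have k2 := cnt_cl sm sF; rewrite (r_cl M sF) in k1.
have k3 := cnt_join m F1 F2; have k4 := m_sub M F1 F2.
have k5 := a _ (flI M f1 f2).
have r1 : (0 < r F1)%N by apply: leq_trans (b_rgt0 M bG T1G) (m_mono M h1).
have r2 : (0 < r F2)%N by apply: leq_trans (b_rgt0 M bG T2G) (m_mono M h2).
move: k1 k2 k3 k4 k5 e1 e2 r1 r2; clear; lia.
Qed.

End Built.

Section Built2.
Variables (D : {set E}) (r : {set E} -> nat) (G : {set {set E}}).
Hypothesis M : mat D r.
Hypothesis bG : built D r G.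

Section StarMon.
Variables (Z : {set E}).
Hypothesis ZG : Z \in G.
Let fZ : fl D r Z. Proof. exact: (b_fl bG ZG). Qed.
Local Notation uZ := (up D r Z).

Lemma push_in m A : supp m G -> A \subset Z -> cnt (push uZ m) A = cnt m A.
Proof.
move=> /suppP sm AZ; rewrite cnt_push; apply: eq_cnt => X /sm XG.
have [h|h] := boolP (X \subset Z); first by rewrite up_in.
have : uZ X :&: Z = set0 by rewrite /up (negPf h) DZI.
have [x xU] := set0Pn _ (b_n0 (built_star M bG fZ) (imset_f uZ XG)).
move=> /setP/(_ x); rewrite !inE xU /= => xZ; transitivity false.
  by apply/negP => /subsetP/(_ x xU)/(subsetP AZ); rewrite xZ.
by apply/esym/negP => XA; move/negP: h; apply; apply: subset_trans XA AZ.
Qed.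

Lemma up_subP X W : X \in G -> ~~ (X \subset Z) -> fl D r W -> Z \subset W -> (uZ X \subset W :\: Z) = (X \subset W).
Proof.
move=> XG h fW ZW; rewrite /up (negPf h); apply/idP/idP => [s|XW].
  apply/subsetP => x xX; case: (boolP (x \in Z)) => xZ; first exact: (subsetP ZW).
  have : x \in clD D r (X :|: Z) :\: Z.
    by rewrite in_setD xZ (subsetP (sub_clD r (XZD bG fZ XG))) // inE xX.
  by move/(subsetP s); rewrite inE => /andP[].
by apply: setSD; apply: (cl_min M _ fW); rewrite subUset XW.
Qed.

Lemma push_out m W : supp m G -> fl D r W -> Z \subset W ->
  (cnt (push uZ m) (W :\: Z) + cnt m Z = cnt m W)%N.
Proof.
move=> /suppP sm fW ZW; rewrite cnt_push /cnt [RHS](bigID (fun X => X \subset Z)) /= addnC; congr addn.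
  by apply: eq_cnt => X _; case: (boolP (X \subset Z)) => h; rewrite ?andbF // (subset_trans h ZW).
apply: eq_cnt => X /sm XG; have [h|h] := boolP (X \subset Z); last by rewrite andbT up_subP.
rewrite up_in // andbF subsetD -setI_eq0 (setIidPl h) (negPf (b_n0 bG XG)) andbF //.
Qed.

Variable Ej : {set E}.
Hypothesis hE : Ej \in maxset G.
Hypothesis ZE : Z \proper Ej.

Let EG : Ej \in G. Proof. by case/in_maxset: hE. Qed.

(* Reading off the dragon condition of the star: Z is tight, and it is the largest tight
   element of G meeting Z. *)
Lemma star_ok_tight m : supp m G -> okm (topdeg (rs r Z) (Gs D r G Z)) (rs r Z) (Gs D r G Z) (push uZ m) ->
  [/\ cnt m Z = (r Z).-1, forall F, F \in G -> (cnt m F <= (r F).-1)%N &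
      forall F, F \in G -> ~~ (F \subset Z) -> F :&: Z != set0 -> (cnt m F + 2 <= r F)%N].
Proof.
move=> sm ok; have Z0 := b_n0 bG ZG; have bS := built_star M bG fZ; have MS := mat_star M fZ.
have hZ : Z \in maxset (Gs D r G Z).
  rewrite (maxset_star M bG fZ hE ZE) inE; apply/orP; left; apply/in_fac; split=> // Y _ YZ ZY.
  by apply/eqP; rewrite eqEsubset YZ.
have tZ : cnt m Z = (r Z).-1.
  by rewrite -(push_in sm (subxx Z)) (okm_top MS bS ok hZ) rs_in.
have /and3P[_ _ /dragP dr] := ok.
have inZ A : A \subset Z -> (cnt m A <= (r A).-1)%N.
  by move=> AZ; rewrite -(push_in sm AZ) -(rs_in r AZ).
have outZ F : F \in G -> ~~ (F \subset Z) -> (cnt m F + (r Z).+1 <= cnt m (F :&: Z) + r (F :|: Z))%N.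
  move=> FG nF; have FZD := XZD bG fZ FG; set W := clD D r (F :|: Z).
  have fW : fl D r W := fl_cl M FZD; have sW : F :|: Z \subset W := sub_clD r FZD.
  have ZW : Z \subset W := subset_trans (subsetUr _ _) sW.
  have := dr (W :\: Z); rewrite (rs_DZ M) //; have := push_out sm fW ZW.
  have := cnt_join m F Z; have := cnt_mono m sW; have e := r_cl M FZD; rewrite -/W in e; rewrite e tZ.
  have lt : (r Z < r W)%N.
    rewrite ltn_neqAle (m_mono M) // andbT; apply/eqP => eZ.
    have := fl_eq M fZ ZW (cl_subD D r (F :|: Z)); rewrite -/W -eZ => /(_ (leqnn _)) eWZ.
    by move/negP: nF; apply; rewrite -eWZ; apply: subset_trans sW; apply: subsetUl.
  by rewrite e in lt; move: lt (b_rgt0 M bG ZG); clear; lia.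
split=> // F FG.
  have [FZ|nF] := boolP (F \subset Z); first exact: inZ.
  have := outZ F FG nF; have := inZ _ (subsetIr F Z); have := m_sub M F Z; have := b_rgt0 M bG ZG.
  by clear; lia.
move=> nF /set0Pn[x /setIP[xF xZ]].
have := outZ F FG nF; have := inZ _ (subsetIr F Z); have := m_sub M F Z; have := b_rgt0 M bG ZG.
have : (0 < r (F :&: Z))%N by apply: (r_gt0 M (x := x)); rewrite ?inE ?xF // (subsetP (b_subD bG ZG)).
by clear; lia.
Qed.

(** What is needed is slack two on every flat W = X ∨ Z. Either Z is a factor of W and the rest of W
    brings a second unit, or the factor over Z is strictly larger and has slack two by
    hypothesis. *)
Lemma star_ok m : supp m G -> (forall F, F \in G -> (cnt m F <= (r F).-1)%N) ->
  mdeg m = topdeg (rs r Z) (Gs D r G Z) -> cnt m Z = (r Z).-1 ->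
  (forall F, F \in G -> Z \proper F -> (cnt m F + 2 <= r F)%N) ->
  okm (topdeg (rs r Z) (Gs D r G Z)) (rs r Z) (Gs D r G Z) (push uZ m).
Proof.
move=> sm dm em tZ mxl; have bS := built_star M bG fZ; have MS := mat_star M fZ.
have sp : supp (push uZ m) (Gs D r G Z) by apply: supp_push sm => X XG; apply: imset_f.
apply/and3P; split=> //; first by rewrite mdeg_push em.
apply: (drag_built MS bS sp) => _ /imsetP[X XG ->].
have [h|h] := boolP (X \subset Z); first by rewrite up_in // push_in // rs_in // dm.
have eU : uZ X = clD D r (X :|: Z) :\: Z by rewrite /up (negPf h).
rewrite eU; set W := clD D r (X :|: Z).
have fW : fl D r W := fl_cl M (XZD bG fZ XG); have sW : X :|: Z \subset W := sub_clD r (XZD bG fZ XG).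
have ZW : Z \subset W := subset_trans (subsetUr _ _) sW.
rewrite (rs_DZ M) //; have := push_out sm fW ZW; rewrite tZ.
have [A hA ZA] := fac_above ZG ZW; have /in_fac[AG AW _] := hA.
have sA := b_sep bG fW hA; have /andP[_ /eqP eW] := sA; have cW := cnt_fac M bG sm fW hA.
have cWA : (cnt m (W :\: A) <= (r (W :\: A)).-1)%N.
  have /dragP := drag_built M bG sm dm; exact.
have gZ := b_rgt0 M bG ZG; have dA := dm A AG; have gA := b_rgt0 M bG AG.
have [eA|nA] := eqVneq A Z.
  have lt : (0 < r (W :\: A))%N.
    have [x xX xZ] := subsetPn h.
    apply: (r_gt0 M (x := x)); last exact: (subsetP (b_subD bG XG)).
    by rewrite in_setD eA xZ (subsetP sW) // inE xX.
  rewrite eA in eW cW cWA lt; move: eW cW cWA lt tZ gZ; clear; lia.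
have := mxl A AG; rewrite properEneq eq_sym nA ZA => /(_ isT).
move: eW cW cWA gZ dA gA; clear; lia.
Qed.
End StarMon.

(* Exactly one star term survives when h_Ej q is a nonzero monomial and h_T q vanishes:
   that of the largest tight element over T. *)
Lemma okm_D m T Ej d : Ej \in maxset G -> T \in G -> T \subset Ej -> topdeg r G = d.+1 -> supp m G ->
  (okm d.+1 r G (um Ej + m)%MM = okm d.+1 r G (um T + m)%MM +
    \sum_(Z in G | (T \subset Z) && (Z \proper Ej)) okm d (rs r Z) (Gs D r G Z) (push (up D r Z) m) :> nat)%N.
Proof.
move=> hE TG TE td sm; have EG : Ej \in G by case/in_maxset: hE.
have mE F : F \in G -> Ej \subset F -> F = Ej by case/in_maxset: hE => _ h FG; apply: h.
have su X : X \in G -> supp (um X) G by rewrite supp_um.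
have T0 := b_n0 bG TG.
have topS Z : Z \in G -> Z \proper Ej -> topdeg (rs r Z) (Gs D r G Z) = d.
  by move=> ZG ZE; have := topdeg_star1 M bG hE ZE ZG; rewrite td => -[].
have [dm|dm] := eqVneq (mdeg m) d; last first.
  rewrite /okm !mdegD !mdeg1 !add1n !eqSS (negPf dm) big1 // => Z _.
  by rewrite mdeg_push (negPf dm).
have red X : X \in G -> reflect (forall F, F \in G -> ((X \subset F) + cnt m F <= (r F).-1)%N)
    (okm d.+1 r G (um X + m)%MM).
  move=> XG; rewrite /okm mdegD mdeg1 dm add1n eqxx suppD supp_um XG sm /=.
  apply: (iffP idP) => [/dragP h F _|h]; first by have := h F; rewrite cntD cnt_um.
  by apply: (drag_built M bG) => [|F FG]; rewrite ?suppD ?su // cntD cnt_um h.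
case: (red T TG) => [hT|hT] /=.
  have hE' : okm d.+1 r G (um Ej + m)%MM.
    apply/red => // F FG; have := hT F FG; case: (boolP (Ej \subset F)) => [h|_]; last by clear; lia.
    by rewrite (subset_trans TE h).
  rewrite hE' big1 // => Z /andP[ZG /andP[TZ ZE]]; apply/eqP; rewrite eqb0; apply/negP => ok.
  rewrite -(topS Z ZG ZE) in ok; have [tZ _ _] := star_ok_tight ZG hE ZE sm ok.
  have := hT Z ZG; rewrite TZ tZ; move: (b_rgt0 M bG ZG); clear; lia.
case: (red Ej EG) => [hJ|hJ] /=; last first.
  rewrite big1 // => Z /andP[ZG /andP[TZ ZE]]; apply/eqP; rewrite eqb0; apply/negP => ok.
  rewrite -(topS Z ZG ZE) in ok; have [tZ dmm big] := star_ok_tight ZG hE ZE sm ok.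
  apply: hJ => F FG; case: (boolP (Ej \subset F)) => h; last exact: dmm.
  have e := mE F FG h; have := big F FG; have := proper_sub ZE; rewrite e => ZsE.
  rewrite (setIidPr ZsE) (b_n0 bG ZG) => hh; have := hh _ isT.
  have -> : ~~ (Ej \subset Z) by move: ZE; rewrite properE => /andP[].
  move/(_ isT); clear; lia.
have dmm F : F \in G -> (cnt m F <= (r F).-1)%N by move=> FG; have := hJ F FG; clear; lia.
have [Z0 hZ0] : exists Z0, [&& Z0 \in G, T \subset Z0 & cnt m Z0 == (r Z0).-1].
  apply/existsP; apply: contraT; rewrite negb_exists => /forallP h; exfalso; apply: hT => F FG.
  case: (boolP (T \subset F)) => TF; last exact: dmm.
  by have := h F; rewrite FG TF /= => ne; rewrite add1n ltn_neqAle ne dmm.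
case: (@arg_maxnP _ Z0 (fun Z => [&& Z \in G, T \subset Z & cnt m Z == (r Z).-1]) (fun Z => #|Z|) hZ0).
move=> Z /and3P[ZG TZ /eqP tZ] Zmax.
have cC := comps_max M bG.
have ZE : Z \proper Ej.
  have [c hc Zc] := maxset_above ZG; have [x xT] := set0Pn _ T0.
  have e : c = Ej by apply: (c_disj cC hc hE (subsetP Zc _ (subsetP TZ _ xT)) (subsetP TE _ xT)).
  rewrite properEneq -{2}e Zc andbT; apply/eqP => eZ; have := hJ Z ZG; rewrite eZ subxx.
  by rewrite eZ in tZ; rewrite tZ add1n ltnn.
have mxl F : F \in G -> Z \proper F -> (cnt m F + 2 <= r F)%N.
  move=> FG ZF; have TF := subset_trans TZ (proper_sub ZF).
  have : cnt m F != (r F).-1.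
    apply/negP => e; have : (#|F| <= #|Z|)%N by apply: Zmax; rewrite /= FG TF.
    by rewrite leqNgt proper_card.
  have := dmm F FG; have := b_rgt0 M bG FG; clear; lia.
have okZ : okm d (rs r Z) (Gs D r G Z) (push (up D r Z) m).
  by rewrite -(topS Z ZG ZE); apply: (star_ok ZG sm dmm) => //; rewrite topS.
rewrite (bigD1 Z) ?ZG ?TZ //= okZ big1 ?addn0 // => Z' /andP[/andP[Z'G /andP[TZ' Z'E]] ne].
apply/eqP; rewrite eqb0; apply/negP => ok.
rewrite -(topS Z' Z'G Z'E) in ok; have [tZ' _ big] := star_ok_tight Z'G hE Z'E sm ok.
have [x xT] := set0Pn _ T0; have xI : Z :&: Z' != set0.
  by apply/set0Pn; exists x; rewrite inE (subsetP TZ) ?(subsetP TZ').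
have [h|h] := boolP (Z \subset Z').
  have := mxl Z' Z'G; rewrite properEneq eq_sym ne h => /(_ isT); rewrite tZ'; clear; lia.
have := big Z ZG h xI; rewrite tZ; clear; lia.
Qed.

End Built2.
End Monomials.

End Dragon.
Import Dragon.

(** * Orthogonal decompositions, the functional of a building set, and local hard Lefschetz *)

Module HR.
Local Open Scope ring_scope.

Section Edge.
Variables (R : rcfType) (N : nat).
Local Notation P := {mpoly R[N]}.
Implicit Types (f fc ft : fnl R N) (u v a b : P).

Lemma HRf_rad f d l x : rad f x -> HRf f d l -> HRf f d (l + x).
Proof.
move=> rx hr; have e m : rad f ((l + x) ^+ m - l ^+ m).
  elim: m => [|m IH]; first by rewrite !expr0 subrr; apply: rad0.
  have -> : (l + x) ^+ m.+1 - l ^+ m.+1 = (l + x) * ((l + x) ^+ m - l ^+ m) + x * l ^+ m.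
    by rewrite !exprS; ring.
  by apply: radD; [apply: radMl | apply: radMr].
have e' m u v : f (u * (l + x) ^+ m * v) = f (u * l ^+ m * v).
  rewrite -(subrK (l ^+ m) ((l + x) ^+ m)) mulrDr mulrDl fnD.
  by rewrite [u * _]mulrC -[X in f X + _]mulrA e add0r.
move=> k u hk hu hp; rewrite (e' (d - k.*2)%N u u); apply: (hr k u hk hu) => v.
exact: etrans (esym (e' _ u v)) (hp v).
Qed.

Section Transfer.
Variables (f fc ft : fnl R N) (d : nat) (kp : P -> P) (y l : P).
Hypothesis kp0 : kp 0 = 0.
Hypothesis kpM : {morph kp : p q / p * q}.
Hypothesis kpH : forall k u, u \is k.-homog -> kp u \is k.-homog.
Hypothesis kpl : forall e, kp (l ^+ e) = l ^+ e.
Hypothesis fk : forall a, f (kp a) = fc a.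
Hypothesis fyk : forall a, f (y * kp a) = 0.
Hypothesis fyyk : forall a, f (y * y * kp a) = - ft a.
Hypothesis dec : forall k u, u \is k.-homog -> exists a b,
  [/\ a \is k.-homog, if k is k'.+1 then b \is k'.-homog else b = 0 & rad f (u - (kp a + y * kp b))].

Let F2 a b a' b' : f ((kp a + y * kp b) * (kp a' + y * kp b')) = fc (a * a') - ft (b * b').
Proof.
have -> : (kp a + y * kp b) * (kp a' + y * kp b') =
    kp a * kp a' + (y * (kp a * kp b') + y * (kp b * kp a')) + y * y * (kp b * kp b') by ring.
by rewrite -!kpM !fnD fk !fyk fyyk !addr0.
Qed.

Let F3 a b a' b' e : f ((kp a + y * kp b) * l ^+ e * (kp a' + y * kp b')) =
  fc (a * l ^+ e * a') - ft (b * l ^+ e * b').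
Proof.
rewrite -F2; congr (f (_ * _)); rewrite !kpM kpl; ring.
Qed.

Lemma radW u w : rad f (u - w) -> forall v, f (u * v) = f (w * v).
Proof. by move=> h v; apply/eqP; rewrite -subr_eq0 -fnB -mulrBl h. Qed.

Let dec0 k v : v \is k.-homog -> exists a b, rad f (v - (kp a + y * kp b)).
Proof. by move=> /dec[a [b [_ _ h]]]; exists a, b. Qed.

Lemma vanish_all (p : P) : (forall a b, f (p * (kp a + y * kp b)) = 0) -> rad f p.
Proof.
move=> h v; rewrite (mpolyE v) mulr_sumr fn_sum big1 // => m _; rewrite -scalerAr fnZ.
have hm : ('X_[m] : P) \is (mdeg m).-homog by rewrite dhomogX.
have [a [b /radW e]] := dec0 hm.
by rewrite [p * _]mulrC e [_ * p]mulrC h mulr0.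
Qed.

(** The hypotheses make f the orthogonal sum of [fc] and, shifted by y, of the negative of [ft];
    that sign compensates for the change of (-1)^k under the shift. *)
Lemma HRf_edge : HRf fc d.+2 l -> HRf ft d l -> HRf f d.+2 l.
Proof.
move=> hc ht k u hk hu hp; have [a [b [ha hb hr]]] := dec hu.
set e := (d.+2 - k.*2)%N in hp *.
have hrE m v : f (u * l ^+ m * v) = f ((kp a + y * kp b) * l ^+ m * v).
  by rewrite -!mulrA; apply: radW.
have pa w : fc (a * l ^+ e.+1 * w) = 0.
  have := hp (kp w + y * kp 0); rewrite hrE F3 mulr0 fn0 subr0; apply.
have pb w : ft (b * l ^+ e.+1 * w) = 0.
  have := hp (kp 0 + y * kp w); rewrite hrE F3 mulr0 fn0 sub0r => /eqP; rewrite oppr_eq0 => /eqP.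
  exact.
have val : f (u * l ^+ e * u) = fc (a * l ^+ e * a) - ft (b * l ^+ e * b).
  by rewrite hrE mulrC (radW hr) mulrC F3.
have [a1 a2] := hc k a hk ha pa; rewrite -/e in a1 a2.
have [b1 b2] : 0 <= (-1) ^+ k * - ft (b * l ^+ e * b) /\ (ft (b * l ^+ e * b) = 0 -> rad ft b).
  case: k hb hk @e hp hrE pa pb val a1 a2 {hu ha} => [|k] hb hk e hp hrE pa pb val a1 a2.
    by rewrite hb !mul0r fn0 oppr0 mulr0; split=> // _; apply: rad0.
  have ee : e = (d - k.*2)%N by rewrite /e; lia.
  have hk' : (k.*2 <= d)%N by lia.
  have [|b1 b2] := ht k b hk' hb; first by rewrite -ee.
  by rewrite exprS mulN1r mulrNN ee.
split; first by rewrite val mulrDr addr_ge0.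
move=> h0; have : (-1) ^+ k * fc (a * l ^+ e * a) + (-1) ^+ k * - ft (b * l ^+ e * b) = 0.
  by rewrite -mulrDr -val h0 mulr0.
move/eqP; rewrite paddr_eq0 // !mulf_eq0 !signr_eq0 /= oppr_eq0 => /andP[/eqP/a2 ra /eqP/b2 rb].
have rk : rad f (kp a + y * kp b).
  by apply: vanish_all => a' b'; rewrite F2 ra rb subr0.
by rewrite -(subrK (kp a + y * kp b) u); apply: radD.
Qed.

Lemma HLf_edge : HLf fc d.+2 l -> HLf ft d l -> HLf f d.+2 l.
Proof.
move=> hc ht k u hk hu hp; have [a [b [ha hb hr]]] := dec hu.
set e := (d.+2 - k.*2)%N in hp *.
have hrE m v : f (u * l ^+ m * v) = f ((kp a + y * kp b) * l ^+ m * v).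
  by rewrite -!mulrA; apply: radW.
have pa w : fc (a * l ^+ e * w) = 0.
  have := hp (kp w + y * kp 0); rewrite hrE F3 mulr0 fn0 subr0; apply.
have pb w : ft (b * l ^+ e * w) = 0.
  have := hp (kp 0 + y * kp w); rewrite hrE F3 mulr0 fn0 sub0r => /eqP; rewrite oppr_eq0 => /eqP.
  exact.
have ra := hc k a hk ha pa.
have rb : rad ft b.
  case: k hb hk @e hp hrE pa pb {hu ha} => [|k] hb hk e hp hrE pa pb; first by rewrite hb; apply: rad0.
  exact: (ht k).
have rk : rad f (kp a + y * kp b).
  by apply: vanish_all => a' b'; rewrite F2 ra rb subr0.
by rewrite -(subrK (kp a + y * kp b) u); apply: radD.
Qed.

Lemma HRf_edge_sub : HRf f d.+2 l -> HRf fc d.+2 l.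
Proof.
move=> h k u hk hu hp; have ku : kp u = kp u + y * kp 0 by rewrite kp0 mulr0 addr0.
have [|h1 h2] := h k (kp u) hk (kpH hu).
  by apply: vanish_all => a b; rewrite ku F3 hp !mul0r fn0 subr0.
have e m v : f (kp u * l ^+ m * kp v) = fc (u * l ^+ m * v) by rewrite -fk !kpM kpl.
rewrite -e; split=> // /h2 hr v; by rewrite -fk kpM hr.
Qed.
End Transfer.
End Edge.

Section Phi.
Variables (R : rcfType) (E : finType).
Local Notation N := #|{: {set E}}|.
Local Notation P := {mpoly R[N]}.
Implicit Types (A X Y Z F T W : {set E}) (G : {set {set E}}) (r : {set E} -> nat) (m : 'X_{1..N}) (f : fnl R N).

Definition evfun d (Q : pred 'X_{1..N}) (p : P) : R := \sum_(m : 'X_{1..N < d.+1} | (mdeg m == d) && Q m) p@_m.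
Lemma evf_lin d Q a p q : evfun d Q (a *: p + q) = a * evfun d Q p + evfun d Q q.
Proof.
rewrite /evfun mulr_sumr -big_split; apply: eq_bigr => m _.
by rewrite mcoeffD mcoeffZ.
Qed.
Definition evf d Q : fnl R N := Fnl (@evf_lin d Q).

Lemma evfX d Q m : evf d Q 'X_[m] = ((mdeg m == d) && Q m)%:R.
Proof.
rewrite -[LHS]/(evfun d Q 'X_[m]) /evfun; case: (boolP ((mdeg m == d) && Q m)) => h; last first.
  rewrite big1 // => b hb; rewrite mcoeffX; case: eqP => // e.
  by rewrite e hb in h.
have hb : (mdeg m < d.+1)%N by case/andP: h => /eqP ->.
rewrite (bigD1 (BMultinom hb)) //= mcoeffX eqxx big1 ?addr0 // => b /andP[_ ne].
by rewrite mcoeffX; case: eqP => // e; move/eqP: ne; case; apply: val_inj.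
Qed.

Arguments evf : simpl never.

(** The degree map of the Chow ring in simplicial generators; with d = [topdeg r G] it is
    nonzero. *)
Definition phi d r G := evf d (fun m => supp m G && drag r m).

Arguments phi : simpl never.

Lemma phiX d r G m : phi d r G 'X_[m] = (okm d r G m)%:R.
Proof. exact: evfX. Qed.

Lemma phi_graded d r G : graded (phi d r G) d.
Proof. by move=> m hm; rewrite phiX /okm (negPf hm). Qed.

Definition hv X : P := 'X_(enum_rank X).
Lemma hvE X : hv X = 'X_[um X]. Proof. by []. Qed.
Lemma hvX X m : hv X * 'X_[m] = 'X_[(um X + m)%MM]. Proof. by rewrite hvE mpolyXD. Qed.
Lemma hv_homog X : hv X \is 1.-homog. Proof. by rewrite dhomogX; apply/eqP; apply: mdeg1. Qed.

Definition lc (c : {set E} -> R) G : P := \sum_(X in G) c X *: hv X.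
Lemma lc_homog c G : lc c G \is 1.-homog.
Proof. by rewrite rpred_sum // => X _; rewrite rpredZ // hv_homog. Qed.

Definition HRall r G d := forall c, (forall X, 0 < c X) -> HRf (phi d r G) d (lc c G).

Definition fmul f (a : P) : fnl R N.
Proof. by refine (@Fnl R N (fun q => f (a * q)) _) => b p q; rewrite mulrDr -scalerAr fn_lin. Defined.
Definition fzero : fnl R N.
Proof. by refine (@Fnl R N (fun=> 0) _) => b p q; rewrite mulr0 addr0. Defined.
Definition fadd (f g : fnl R N) : fnl R N.
Proof. by refine (@Fnl R N (fun q => f q + g q) _) => b p q; rewrite !fn_lin mulrDr addrACA. Defined.
Definition fscale (a : R) f : fnl R N.
Proof. by refine (@Fnl R N (fun q => a * f q) _) => b p q; rewrite fn_lin mulrDr mulrCA. Defined.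
Definition fsum (I : finType) (Q : pred I) (F : I -> fnl R N) : fnl R N.
Proof.
refine (@Fnl R N (fun q => \sum_(i | Q i) F i q) _) => b p q.
by rewrite mulr_sumr -big_split; apply: eq_bigr => i _; rewrite fn_lin.
Defined.

(** Renames the variables of G along [rho] and kills all others, which turns every change of matroid
    or building set into a ring map of one fixed ring. *)
Definition sb (rho : {set E} -> {set E}) G (p : P) : P :=
  p \mPo [tuple (if enum_val i \in G then hv (rho (enum_val i)) else 0) | i < N].

Lemma sbM rho G : {morph sb rho G : p q / p * q}.
Proof. by move=> p q; rewrite /sb rmorphM. Qed.
Lemma sb1 rho G : sb rho G 1 = 1.
Proof. exact: rmorph1. Qed.
Lemma sbD rho G : {morph sb rho G : p q / p + q}.
Proof. by move=> p q; rewrite /sb rmorphD. Qed.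
Lemma sbZ rho G a p : sb rho G (a *: p) = a *: sb rho G p.
Proof. exact: linearZ. Qed.
Lemma sb_sum rho G I (s : seq I) (Q : pred I) (H : I -> P) :
  sb rho G (\sum_(i <- s | Q i) H i) = \sum_(i <- s | Q i) sb rho G (H i).
Proof. by rewrite /sb rmorph_sum. Qed.

Definition fsb f (rho : {set E} -> {set E}) G : fnl R N.
Proof. by refine (@Fnl R N (fun q => f (sb rho G q)) _) => b p q; rewrite sbD sbZ fn_lin. Defined.

Lemma sbX rho G m : sb rho G 'X_[m] = if supp m G then 'X_[push rho m] else 0.
Proof.
rewrite /sb comp_mpolyX; case: (boolP (supp m G)) => [/suppP h|]; last first.
  rewrite negb_forall => /existsP[X]; rewrite negb_imply => /andP[h XG].
  rewrite (bigD1 (enum_rank X)) //= tnth_mktuple enum_rankK (negPf XG) expr0n.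
  by move: h; rewrite /sv lt0n => /negPf->; rewrite mul0r.
transitivity (\prod_(i < N) 'X_[(U_(enum_rank (rho (enum_val i))) *+ m i)%MM] : P).
  apply: eq_bigr => i _; rewrite tnth_mktuple; case: (posnP (m i)) => [->|hm].
    by rewrite expr0 mulm0n mpolyX0.
  by rewrite h ?mpolyXn // /sv enum_valK.
rewrite -(big_morph _ (@mpolyXD N R) (@mpolyX0 N R)); congr 'X_[_].
apply/mnmP => j; rewrite mnm_sumE mnmE.
rewrite (reindex (@enum_rank {set E})) /=; last by apply: onW_bij; apply: enum_rank_bij.
rewrite [RHS]big_mkcond; apply: eq_bigr => X _; rewrite mulmnE mnm1E enum_rankK.
have -> : (enum_rank (rho X) == j) = (rho X == enum_val j).
  by rewrite -(inj_eq enum_val_inj) enum_rankK.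
by case: eqP; rewrite ?mul1n ?mul0n.
Qed.

Lemma sb_homog rho G k (p : P) : p \is k.-homog -> sb rho G p \is k.-homog.
Proof.
move=> /dhomogP hp; rewrite (mpolyE p) sb_sum big_seq rpred_sum // => m hm.
rewrite sbZ rpredZ // sbX; case: ifP => _; last exact: rpred0.
by rewrite dhomogX; apply/eqP; apply: etrans (mdeg_push _ _) (hp _ hm).
Qed.

Lemma sb_hv rho G X : sb rho G (hv X) = if X \in G then hv (rho X) else 0.
Proof.
rewrite hvE sbX supp_um; case: ifP => // _; congr 'X_[_]; apply/mnmP => j.
rewrite mnmE mnm1E -(inj_eq enum_val_inj) enum_rankK.
rewrite big_mkcond (bigD1 X) //= big1 => [|Y ne]; last by rewrite sv_um [X == Y]eq_sym (negPf ne) if_same.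
by rewrite addn0 sv_um eqxx; case: eqP.
Qed.

Lemma push_comp rho rho' m : push rho (push rho' m) = push (rho \o rho') m.
Proof.
apply/mnmP => j; rewrite !mnmE.
under eq_bigr do rewrite sv_push; rewrite (exchange_big_dep xpredT) //= [RHS]big_mkcond.
apply: eq_bigr => X _; case: eqP => h.
  by rewrite (big_pred1 (rho' X)) // => Y /=; rewrite eq_sym andb_idl // => /eqP <-; rewrite -h.
by rewrite big1 // => Y /andP[/eqP h1 /eqP h2]; case: h; rewrite h2.
Qed.

Lemma push_eq rho m : (forall X, (0 < sv m X)%N -> rho X = X) -> push rho m = m.
Proof.
move=> h; apply/mnmP => j; rewrite mnmE (eq_cnt (Q := pred1 (enum_val j))) => [|X /h ->//].
by rewrite big_pred1_eq /sv enum_valK.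
Qed.

(* Monomials involving sets outside [G] lie in the radical. *)
Lemma phi_kill d r G p (v : P) : phi d r G (p * v) = phi d r G (p * sb id G v).
Proof.
rewrite (mpolyE v) sb_sum !mulr_sumr !fn_sum; apply: eq_bigr => m _.
rewrite sbZ -!scalerAr !fnZ sbX; case: ifPn => h; first by rewrite push_eq.
rewrite mulr0 fn0; congr (_ * _); rewrite (mpolyE p) mulr_suml fn_sum big1 // => m' _.
by rewrite -scalerAl fnZ -mpolyXD phiX /okm suppD (negPf h) !andbF mulr0.
Qed.

(** Variables with the same image add their coefficients, so a positive combination maps to a
    positive one, and test monomials lift along a choice of preimages. *)
Lemma HR_sub d r' G G' rho f : G' = [set rho X | X in G] ->
  (forall q, f q = phi d r' G' (sb rho G q)) -> HRall r' G' d ->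
  forall c, (forall X, 0 < c X) -> HRf f d (lc c G).
Proof.
move=> eG fE hr c c0.
(* The value 1 outside the image only keeps the coefficients positive everywhere. *)
pose c' Y := if Y \in G' then \sum_(X in G | rho X == Y) c X else 1.
have c'0 Y : 0 < c' Y.
  rewrite /c'; case: ifP => //; rewrite eG => /imsetP[X XG ->].
  rewrite (bigD1 X) ?XG ?eqxx //= ltr_pwDl ?c0 // sumr_ge0 // => X' _; exact: ltW.
apply: (HRf_pullback ltr01 _ (@sbM rho G) (sb1 rho G) (@sb_homog rho G) _ _ (hr c' c'0)).
- by move=> q; rewrite mul1r.
- rewrite /lc sb_sum (partition_big rho (mem G')) /=; last by move=> X XG; rewrite eG imset_f.
  apply: eq_bigr => Y YG'; rewrite /c' YG' scaler_suml; apply: eq_bigr => X /andP[XG /eqP <-].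
  by rewrite sbZ sb_hv XG.
- move=> v'; pose s Y := odflt set0 [pick X in G | rho X == Y].
  have sP Y : Y \in G' -> s Y \in G /\ rho (s Y) = Y.
    rewrite eG => /imsetP[X XG ->]; rewrite /s; case: pickP => [X' /andP[h /eqP e]//|/(_ X)].
    by rewrite XG eqxx.
  exists (sb s G' v') => u; rewrite [LHS]phi_kill; congr (phi _ _ _ (_ * _)).
  rewrite (mpolyE v') (sb_sum id) (sb_sum s) (sb_sum rho); apply: eq_bigr => m _; rewrite !sbZ !sbX; congr (_ *: _).
  case: ifPn => [h|_]; last by rewrite /sb rmorph0.
  rewrite sbX (supp_push _ h) => [|Y /sP[]//]; rewrite push_comp; congr 'X_[_].
  by rewrite !push_eq // => X /(suppP _ _ h)/sP[].
Qed.


Section OneBuilt.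
Variables (D : {set E}) (r : {set E} -> nat) (G : {set {set E}}).
Hypothesis M : mat D r.
Hypothesis bG : built D r G.

Definition phs d Z G0 : fnl R N := fsb (phi d (rs r Z) (Gs D r G0 Z)) (up D r Z) G0.

Arguments phs : simpl never.

Lemma phsX d Z m : phs d Z G 'X_[m] = (supp m G && okm d (rs r Z) (Gs D r G Z) (push (up D r Z) m))%:R.
Proof.
rewrite -[LHS]/(phi d (rs r Z) (Gs D r G Z) (sb (up D r Z) G 'X_[m])) sbX.
by case: ifP => _; rewrite ?phiX ?fn0.
Qed.

Lemma HR_star d Z c : HRall (rs r Z) (Gs D r G Z) d -> (forall X, 0 < c X) -> HRf (phs d Z G) d (lc c G).
Proof. by move=> hr c0; apply: (HR_sub (erefl _) _ hr c0). Qed.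

Variable d : nat.
Hypothesis td : topdeg r G = d.+1.
Local Notation F := (phi d.+1 r G).

(** With h_T equal to minus the sum of the x_Z over Z ⊇ T, this is the difference of two such sums;
    the star of Z evaluates multiplication by x_Z. *)
Lemma phi_D T Ej q : Ej \in maxset G -> T \in G -> T \subset Ej ->
  F (hv Ej * q) = F (hv T * q) + \sum_(Z in G | (T \subset Z) && (Z \proper Ej)) phs d Z G q.
Proof.
move=> hE TG TE; pose g := fadd (fmul F (hv T)) (fsum (fun Z => (Z \in G) && ((T \subset Z) && (Z \proper Ej))) (fun Z => phs d Z G)).
rewrite -[RHS]/(g q) -[LHS]/(fmul F (hv Ej) q); apply: fnl_ext => m.
change (F (hv Ej * 'X_[m]) = F (hv T * 'X_[m]) + \sum_(Z in G | (T \subset Z) && (Z \proper Ej)) phs d Z G 'X_[m]).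
rewrite !hvX !phiX; under eq_bigr do rewrite phsX.
case: (boolP (supp m G)) => sm; last first.
  rewrite big1 // /okm !suppD (negPf sm) !andbF; first by rewrite addr0.
by rewrite (okm_D M bG hE TG TE td sm) natrD natr_sum.
Qed.

Lemma phi_pt T q : T \in G -> r T = 1%N -> F (hv T * q) = 0.
Proof.
move=> TG rT; rewrite (mpolyE q) mulr_sumr fn_sum big1 // => m _; rewrite -scalerAr fnZ hvX phiX.
case: (boolP (okm _ _ _ _)) => h; last by rewrite mulr0.
by have /and3P[_ _ /dragP/(_ T)] := h; rewrite cntD cnt_um subxx rT.
Qed.

Lemma phi_notin X q : X \notin G -> F (hv X * q) = 0.
Proof.
move=> XG; rewrite mulrC phi_kill sb_hv (negPf XG) mulr0 fn0 //.
Qed.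

(** For each point i of X, h_X is the sum of the x_Z over nonmaximal Z through i not containing X.
    Averaging over i gives these coefficients, which are nonnegative and are positive when X is the
    maximal element over Z. *)
Definition wgt X Z : R := if (X \in G) && (Z \in G) && (Z \notin maxset G) && ~~ (X \subset Z)
  then #|X :&: Z|%:R / #|X|%:R else 0.

Lemma phi_wgt X q : F (hv X * q) = \sum_Z wgt X Z * phs d Z G q.
Proof.
have cC := comps_max M bG.
case: (boolP (X \in G)) => XG; last first.
  by rewrite phi_notin // big1 // => Z _; rewrite /wgt (negPf XG) mul0r.
have [Ej hE XE] := maxset_above XG; have EG : Ej \in G by case/in_maxset: hE.
have X0 : (#|X|%:R : R) != 0 by rewrite pnatr_eq0 cards_eq0 (b_n0 bG XG).
have one i : i \in X -> F (hv X * q) =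
    \sum_Z (((Z \in G) && (Z \notin maxset G) && ~~ (X \subset Z)) && (i \in Z))%:R * phs d Z G q.
  move=> iX; have iD : i \in D by apply: (subsetP (b_subD bG XG)).
  (* The rank-one member T at i has h_T = 0. Comparing its relation with that of X cancels the sets
     containing X and leaves those through i. *)
  have [T TG /andP[iT /eqP rT]] := b_pt bG iD.
  have TX := pt_sub M bG (b_fl bG XG) TG rT iT iX.
  have h1 := phi_D q hE XG XE; have h2 := phi_D q hE TG (subset_trans TX XE).
  rewrite (phi_pt _ TG rT) add0r (bigID (fun Z => X \subset Z)) in h2.
  cbv beta in h2.
  have e1 : \sum_(Z in G | (T \subset Z) && (Z \proper Ej) && (X \subset Z)) phs d Z G q =
      \sum_(Z in G | (X \subset Z) && (Z \proper Ej)) phs d Z G q.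
    apply: eq_bigl => Z; case: (Z \in G) => //=; case: (boolP (X \subset Z)) => h; rewrite ?andbF //.
    by rewrite (subset_trans TX h) andbT.
  have e2 : \sum_(Z in G | (T \subset Z) && (Z \proper Ej) && ~~ (X \subset Z)) phs d Z G q = F (hv X * q).
    apply: (addrI (\sum_(Z in G | (X \subset Z) && (Z \proper Ej)) phs d Z G q)).
    rewrite [RHS]addrC -h1 h2; congr (_ + _); first rewrite -e1; by apply: eq_bigl => Z; rewrite !andbA.
  rewrite -e2 big_mkcond; apply: eq_bigr => Z _.
  case: (boolP (Z \in G)) => ZG /=; last by rewrite mul0r.
  have iT' : (T \subset Z) = (i \in Z).
    apply/idP/idP => [/subsetP|iZ]; first exact.
    exact: (pt_sub M bG (b_fl bG ZG) TG rT iT iZ).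
  have iE : i \in Ej := subsetP XE _ iX.
  have pE : i \in Z -> (Z \proper Ej) = (Z \notin maxset G).
    move=> iZ; apply/idP/idP => [ZE|nZ].
      apply/negP => /in_maxset[_ mZ]; have e := mZ Ej EG (proper_sub ZE).
      by rewrite e properxx in ZE.
    have [c hc Zc] := maxset_above ZG; have e := c_disj cC hc hE (subsetP Zc _ iZ) iE.
    by rewrite properEneq -{2}e Zc andbT; apply: contra nZ => /eqP ->.
  rewrite iT'; case: (boolP (i \in Z)) => iZ; last by rewrite !andbF mul0r.
  by rewrite pE //= andbT; case: ifP; rewrite ?mul1r ?mul0r.
have e : #|X|%:R * F (hv X * q) = \sum_(i in X) \sum_Z
   (((Z \in G) && (Z \notin maxset G) && ~~ (X \subset Z)) && (i \in Z))%:R * phs d Z G q.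
  by rewrite -(eq_bigr _ one) sumr_const mulr_natl.
apply: (mulfI X0); rewrite e exchange_big mulr_sumr; apply: eq_bigr => Z _ /=.
rewrite -mulr_suml mulrA; congr (_ * _); rewrite /wgt XG /=.
case: ifP => h /=; last by rewrite big1 ?mulr0 // => i _; rewrite h.
rewrite mulrCA mulfV // mulr1 -natr_sum; congr _%:R.
by rewrite -sum1_card big_mkcond [RHS]big_mkcond /=; apply: eq_bigr => i _; rewrite inE /=; case: (i \in X); case: (i \in Z).
Qed.

(* Coefficients expressing restriction to the star of [Z] as multiplication by a class. *)
Lemma phs_mul Z : Z \in G -> Z \notin maxset G ->
  exists b : {set E} -> R, forall q, phs d Z G q = F ((- hv Z + \sum_(W in G | Z \proper W) b W *: hv W) * q).
Proof.
have [n] := ubnP (#|E| - #|Z|); elim: n Z => // n IH Z hn ZG nZ.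
have [Ej hE ZE] := maxset_above ZG; have EG : Ej \in G by case/in_maxset: hE.
have ZEp : Z \proper Ej by rewrite properEneq ZE andbT; apply: contra nZ => /eqP ->.
have hb W : exists b : {set E} -> R, (W \in G) && ((Z \proper W) && (W \proper Ej)) ->
    forall q, phs d W G q = F ((- hv W + \sum_(Y in G | W \proper Y) b Y *: hv Y) * q).
  case: (boolP ((W \in G) && _)) => [/and3P[WG ZW WE]|_]; last by exists (fun=> 0).
  have [||b hb] := IH W _ WG; last by exists b.
    have h1 := proper_card ZW; have h2 : (#|W| <= #|E|)%N := max_card _; move: hn h1 h2; clear; lia.
  by apply/negP => /in_maxset[_ mW]; have e := mW Ej EG (proper_sub WE); rewrite e properxx in WE.
have [b hb'] := fin_all_exists hb.
(* [phi_D] is solved for the term of Z, the stars strictly between Z and [Ej] being already given by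
   classes above them. *)
pose c W := (W == Ej)%:R - \sum_(V in G | (Z \proper V) && (V \proper Ej)) (- (W == V)%:R + (V \proper W)%:R * b V W).
exists c => q; have := phi_D q hE ZG ZE; rewrite (bigD1 Z); last by rewrite ZG subxx ZEp.
have eS : \sum_(W | (W \in G) && ((Z \subset W) && (W \proper Ej)) && (W != Z)) phs d W G q =
    F ((\sum_(V in G | (Z \proper V) && (V \proper Ej)) (- hv V + \sum_(W in G | V \proper W) b V W *: hv W)) * q).
  rewrite mulr_suml fn_sum; apply: eq_big => [W|W].
    case: (W \in G) => //=; rewrite (properEneq Z W) [W == Z]eq_sym; by case: (Z \subset W); case: (W \proper Ej); case: (Z != W).
  case/andP=> /andP[WG /andP[ZW WE]] ne; apply: hb'; by rewrite WG WE andbT properEneq eq_sym ne ZW.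
rewrite eS => h.
have {h} -> : phs d Z G q = F ((hv Ej - hv Z - \sum_(V in G | (Z \proper V) && (V \proper Ej)) (- hv V + \sum_(W in G | V \proper W) b V W *: hv W)) * q).
  by rewrite !mulrBl !fnB h [F (hv Z * q) + _]addrC addrK addrK.
congr (F (_ * _)); rewrite [hv Ej - _]addrC -addrA; congr (_ + _).
have sumE (a : {set E} -> {set E} -> R) V : V \in G -> Z \proper V ->
    \sum_(W in G | V \proper W) a V W *: hv W = \sum_(W in G | Z \proper W) ((V \proper W)%:R * a V W) *: hv W.
  move=> VG ZV; rewrite big_mkcond [RHS]big_mkcond; apply: eq_bigr => W _; case: (W \in G) => //=.
  case: (boolP (V \proper W)) => h; first by rewrite (proper_trans ZV h) mul1r.
  by rewrite mul0r scale0r if_same.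
have one V : V \in G -> Z \proper V -> hv V = \sum_(W in G | Z \proper W) (W == V)%:R *: hv W.
  move=> VG ZV; rewrite (bigD1 V) ?VG ?ZV //= eqxx scale1r big1 ?addr0 // => W /andP[_ /negPf ->].
  by rewrite scale0r.
rewrite {1}(one Ej EG ZEp) /c.
have -> : \sum_(V in G | (Z \proper V) && (V \proper Ej)) (- hv V + \sum_(W in G | V \proper W) b V W *: hv W) =
   \sum_(W in G | Z \proper W) (\sum_(V in G | (Z \proper V) && (V \proper Ej)) (- (W == V)%:R + (V \proper W)%:R * b V W)) *: hv W.
  under [RHS]eq_bigr do rewrite scaler_suml; rewrite exchange_big /=; apply: eq_bigr => V /and3P[VG ZV _].
  rewrite (sumE b) // {1}(one V) // -sumrN -big_split /=; apply: eq_bigr => W _.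
  by rewrite scalerDl scaleNr.
by rewrite -sumrB; apply: eq_bigr => W _; rewrite scalerBl.
Qed.

(** A positive combination of the h_X is a combination of all star functionals with positive
    weights, so the relations in the stars suffice. *)
Theorem HL_local c : (forall Z, Z \in G -> Z \notin maxset G -> HRall (rs r Z) (Gs D r G Z) d) ->
  (forall X, 0 < c X) -> HLf F d.+1 (lc c G).
Proof.
move=> hr c0; pose ok Z := (Z \in G) && (Z \notin maxset G).
(* Sets that carry no star get the zero functional, for which the relations are trivial, so that the
   index can be the type of all subsets. *)
pose FZ Z := if ok Z then phs d Z G else fzero.
have [y hy] : exists y : {set E} -> P, forall Z q, FZ Z q = F (y Z * q).
  have h Z : exists y : P, forall q, FZ Z q = F (y * q).
    rewrite /FZ /ok; case: ifP => [/andP[ZG nZ]|_]; last by exists 0 => q; rewrite mul0r fn0.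
    by have [b hb] := phs_mul ZG nZ; exists (- hv Z + \sum_(W in G | Z \proper W) b W *: hv W).
  by have [y hy] := fin_all_exists h; exists y.
have wF X q : F (hv X * q) = \sum_Z wgt X Z * FZ Z q.
  rewrite phi_wgt; apply: eq_bigr => Z _; rewrite /FZ /ok /wgt.
  by case: (X \in G); case: (Z \in G) => //=; rewrite ?mul0r //; case: (Z \in maxset G) => //=; rewrite !mul0r.
pose w Z := if ok Z then \sum_(X in G) c X * wgt X Z else 1.
have wg0 X Z : 0 <= wgt X Z by rewrite /wgt; case: ifP => // _; rewrite divr_ge0 ?ler0n.
apply: (@HLf_local R N {set E} F FZ d.+1 (lc c G) w y (fun j Z => wgt (enum_val j) Z)).
- move=> Z; rewrite /w; case: ifP => // /andP[ZG nZ].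
  have [Ej hE ZE] := maxset_above ZG; have EG : Ej \in G by case/in_maxset: hE.
  rewrite (bigD1 Ej) //=; apply: ltr_pwDl; last first.
    by apply: sumr_ge0 => X _; apply: mulr_ge0; [exact: ltW | exact: wg0].
  have nE : ~~ (Ej \subset Z).
    by apply: contra nZ => h; rewrite (_ : Z = Ej) //; apply/eqP; rewrite eqEsubset ZE.
  rewrite mulr_gt0 // /wgt EG ZG nZ nE /= (setIidPr ZE) divr_gt0 // ltr0n lt0n cards_eq0.
    exact: (b_n0 bG).
  exact: (b_n0 bG).
- exact: hy.
- move=> q; rewrite /lc mulr_suml fn_sum; under eq_bigr do rewrite -scalerAl fnZ wF mulr_sumr.
  rewrite exchange_big; apply: eq_bigr => Z _ /=; rewrite /w /FZ; case: ifP => _.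
    by rewrite mulr_suml; apply: eq_bigr => X _; rewrite mulrA.
  by rewrite big1 ?mulr0 // => X _; rewrite /= !mulr0.
- by move=> j q; rewrite -wF /hv enum_valK.
- move=> Z; rewrite /FZ; case: ifP => [/andP[ZG nZ]|_].
    by apply: HR_star => //; apply: hr.
  by move=> k u _ _ _; rewrite /= mulr0; split.
- exact: phi_graded.
Qed.

End OneBuilt.
End Phi.

End HR.
Import HR.

(** * Adding one flat to a building set *)

Module Flips.
Local Open Scope ring_scope.

Section Flip.
Variables (R : rcfType) (E : finType).
Local Notation N := #|{: {set E}}|.
Local Notation P := {mpoly R[N]}.
Local Notation hv := (@hv R E).
Implicit Types (A X Y Z F T W : {set E}) (m : 'X_{1..N}).

Lemma okm_supp d (r : {set E} -> nat) (G G' : {set {set E}}) m :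
  G \subset G' -> supp m G -> okm d r G' m = okm d r G m.
Proof.
move=> GG sm; rewrite /okm sm; have -> // : supp m G'.
by apply/suppP => X /(suppP _ _ sm); apply: (subsetP GG).
Qed.

Lemma sb_idX (G : {set {set E}}) m : sb id G ('X_[m] : P) = if supp m G then 'X_[m] else 0.
Proof. by rewrite sbX push_eq. Qed.

Lemma sb_id_lc c (G : {set {set E}}) e : sb id G ((lc c G : P) ^+ e) = lc c G ^+ e.
Proof.
have e0 : sb id G (lc c G : P) = lc c G.
  by rewrite /lc sb_sum; apply: eq_bigr => X XG; rewrite sbZ sb_hv XG.
by elim: e => [|e IH]; rewrite ?expr0 ?sb1 // !exprS sbM e0 IH.
Qed.

Lemma phi_square d D r (G : {set {set E}}) T T1 T2 : mat D r -> built D r G ->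
  T \in G -> T1 \in G -> T2 \in G -> clD D r (T1 :|: T2) = T ->
  rad (phi R d r G) ((hv T - hv T1) * (hv T - hv T2)).
Proof.
move=> M bG TG T1G T2G eT v; rewrite (mpolyE v) mulr_sumr fn_sum big1 // => m _; rewrite -scalerAr fnZ.
have -> : (hv T - hv T1) * (hv T - hv T2) * 'X_[m] =
  hv T * (hv T * 'X_[m]) - hv T * (hv T2 * 'X_[m]) - hv T * (hv T1 * 'X_[m]) + hv T1 * (hv T2 * 'X_[m]) by ring.
rewrite !fnD !fnN !hvX !phiX; have := okm_square M bG d m TG T1G T2G eT.
move/(congr1 (fun n : nat => n%:R : R)); rewrite !natrD => h.
by rewrite (_ : _ - _ - _ + _ = 0) ?mulr0 //; move: h; lra.
Qed.

Variables (D : {set E}) (r : {set E} -> nat) (G : {set {set E}}) (T Ej T1 T2 : {set E}) (d : nat).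
Hypothesis M : mat D r.
Hypothesis bG : built D r G.
Hypothesis hE : Ej \in maxset G.
Hypothesis TE : T \proper Ej.
Hypothesis TG : T \notin G.
Hypothesis fT : fl D r T.
Hypothesis facT : maxG_le G T = [set T1; T2].
Hypothesis neT : T1 != T2.
Hypothesis rT : r T = (r T1 + r T2)%N.
Hypothesis eT : T = T1 :|: T2.
Hypothesis bGp : built D r (T |: G).
Hypothesis td : topdeg r G = d.+2.

Let hT1 : T1 \in maxG_le G T. Proof. by rewrite facT !inE eqxx. Qed.
Let hT2 : T2 \in maxG_le G T. Proof. by rewrite facT !inE eqxx orbT. Qed.
Let T1G : T1 \in G. Proof. by case/in_fac: hT1. Qed.
Let T2G : T2 \in G. Proof. by case/in_fac: hT2. Qed.
Let T0 : T != set0.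
Proof. by have [x xT] := set0Pn _ (b_n0 bG T1G); apply/set0Pn; exists x; rewrite eT inE xT. Qed.
Let Gp := T |: G.
Let TGp : T \in Gp. Proof. exact: setU11. Qed.
Let GGp : G \subset Gp. Proof. exact: subsetUr. Qed.
Let inGp X : X \in G -> X \in Gp. Proof. exact: (subsetP GGp). Qed.
Let mxE : maxset Gp = maxset G. Proof. exact: (maxset_flip M bG TG hE TE T0). Qed.
Let hEp : Ej \in maxset Gp. Proof. by rewrite mxE. Qed.
Let tdp : topdeg r Gp = d.+2. Proof. by rewrite /topdeg mxE. Qed.
Let nTmax : T \notin maxset Gp. Proof. by rewrite mxE; apply/negP => /in_maxset[]; rewrite (negPf TG). Qed.
Let DT : T :\: T1 = T2.
Proof.
rewrite eT setDUl setDv set0U; apply/setDidPl; rewrite -setI_eq0; apply: contraT => /set0Pn[x /setIP[x2 x1]].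
by move/eqP: neT => []; apply: (fac_eq M bG fT hT1 hT2 x1 x2).
Qed.
Let clT : clD D r (T1 :|: T2) = T. Proof. by rewrite -eT; apply: (cl_eq M). Qed.

Let f := phi R d.+2 r Gp.
Let fc := phi R d.+2 r G.
Let ft := phs R D r d T G.
Let fz := phs R D r d.+1 T Gp.
Let kp := sb (R := R) id G.

Let fk a : f (kp a) = fc a.
Proof.
rewrite -[LHS]/(fsb f id G a); apply: fnl_ext => m; rewrite -[LHS]/(f (kp 'X_[m])) /kp sb_idX.
case: (boolP (supp m G)) => sm; first by rewrite !phiX (okm_supp _ _ GGp).
by rewrite fn0 phiX /okm (negPf sm) andbF.
Qed.

Let tdz : topdeg (rs r T) (Gs D r Gp T) = d.+1.
Proof. by have := topdeg_star1 M bGp hEp TE TGp; rewrite tdp => -[]. Qed.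

Let tdt : topdeg (rs r T) (Gs D r G T) = d.
Proof. by have := topdeg_star2 M bG hE TE fT facT neT rT; rewrite td => -[]. Qed.

(** Without the variable of T, the count of T is the sum of those of T1 and T2, at most r T - 2,
    whereas the star of T requires r T - 1. *)
Let fzk a : fz (kp a) = 0.
Proof.
rewrite (mpolyE a) /kp sb_sum fn_sum big1 // => m _; rewrite sbZ fnZ sb_idX.
case: (boolP (supp m G)) => sm; last by rewrite fn0 mulr0.
rewrite phsX; case: (boolP (okm _ _ _ _)) => h; last by rewrite andbF mulr0.
have smp : supp m Gp by apply/suppP => X /(suppP _ _ sm)/inGp.
have h' := h; rewrite -tdz in h'; have [tZ dmm _] := star_ok_tight M bGp TGp hEp TE smp h'.
have := cnt_fac M bG sm fT hT1; rewrite DT tZ rT.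
have := dmm _ (inGp T1G); have := dmm _ (inGp T2G); have := b_rgt0 M bG T1G; have := b_rgt0 M bG T2G.
by clear; lia.
Qed.

(** One factor h_T supplies the missing unit; T is then tight exactly when T1 and T2 are, which is
    the condition in the star of T taken in the smaller building set. *)
Let fzT a : fz (hv T * kp a) = ft a.
Proof.
rewrite -[LHS]/(fsb (fmul fz (hv T)) id G a); apply: fnl_ext => m.
rewrite -[LHS]/(fz (hv T * kp 'X_[m])) /kp sb_idX phsX.
case: (boolP (supp m G)) => sm; last by rewrite mulr0 fn0.
have smp : supp m Gp by apply/suppP => X /(suppP _ _ sm)/inGp.
have smT : supp (um T + m)%MM Gp by rewrite suppD supp_um TGp.
rewrite hvX phsX smT /=; congr (_%:R); congr nat_of_bool.
have bS := built_star M bG fT; have bSp := built_star M bGp fT; have MS := mat_star M fT.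
have pE A : cnt (push (up D r T) (um T + m)%MM) A = ((T \subset A) + cnt (push (up D r T) m) A)%N.
  rewrite !cnt_push -cnt_um /cnt; under eq_bigr do rewrite svD; rewrite big_split /=; congr addn.
  apply: eq_cnt => X; rewrite sv_um lt0b => /eqP <-; by rewrite up_in.
have sp : supp (push (up D r T) m) (Gs D r G T) by apply: supp_push sm => X XG; apply: imset_f.
have spp : supp (push (up D r T) (um T + m)%MM) (Gs D r Gp T).
  by apply: supp_push smT => X XG; apply: imset_f.
rewrite /okm sp spp !mdeg_push mdegD mdeg1 add1n eqSS /=; case: (boolP (mdeg m == d)) => //= dm.
apply/idP/idP => [/dragP h|h].
  by apply/dragP => A; apply: leq_trans (h A); rewrite pE leq_addl.
have ok : okm (topdeg (rs r T) (Gs D r G T)) (rs r T) (Gs D r G T) (push (up D r T) m).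
  by rewrite /okm sp h mdeg_push tdt dm.
have top X : X \in maxG_le G T -> cnt (push (up D r T) m) X = (r X).-1.
  move=> hX; have /in_fac[_ XT _] := hX.
  rewrite (okm_top MS bS ok) ?rs_in // (maxset_star M bG fT hE TE) inE hX //.
apply: (drag_built MS bSp spp) => A AG; rewrite pE; case: (boolP (T \subset A)) => TA; last first.
  by move/dragP: h; apply.
have eA : A = T.
  have [x xT] := set0Pn _ T0; case: (in_Gs AG) => [[_ AT]|[X [_ _ _ e]]].
    by apply/eqP; rewrite eqEsubset AT.
  by move/setP/(_ x): e; rewrite !inE xT (subsetP TA).
rewrite eA rs_in //.
have e1 : cnt (push (up D r T) m) T = (cnt (push (up D r T) m) T1 + cnt (push (up D r T) m) T2)%N.
  rewrite -DT; apply: (cnt_fac MS bS sp).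
    apply/(fl_star M fT); rewrite setIid setUid; split=> //; exact: fl_sub fT.
  have : T1 \in maxset (Gs D r G T) by rewrite (maxset_star M bG fT hE TE) inE hT1.
  case/in_maxset => h1 h2; apply/in_fac; split=> //; first by rewrite eT subsetUl.
  by move=> Y hY _; apply: h2.
have r1 := b_rgt0 M bG T1G; have r2 := b_rgt0 M bG T2G.
rewrite e1 !top // rT; move: r1 r2; clear; lia.
Qed.

Let yex : exists b : {set E} -> R, forall q, fz q = f ((- hv T + \sum_(W in Gp | T \proper W) b W *: hv W) * q).
Proof. exact: (phs_mul R M bGp tdp TGp nTmax). Qed.

Section WithY.
Variable b : {set E} -> R.
Let Y' := \sum_(W in Gp | T \proper W) b W *: hv W.
Let y := - hv T + Y'.
Hypothesis hy : forall q, fz q = f (y * q).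

Let kpM : {morph kp : p q / p * q}. Proof. exact: sbM. Qed.
Let kp0 : kp 0 = 0. Proof. by rewrite /kp /sb rmorph0. Qed.
Let kpY a : kp (Y' * a) = Y' * kp a.
Proof.
rewrite kpM; congr (_ * _); rewrite /kp /Y' sb_sum; apply: eq_bigr => W /andP[WG TW].
rewrite sbZ sb_hv; have -> // : W \in G.
by move: WG; rewrite in_setU1 => /orP[/eqP e|//]; rewrite e properxx in TW.
Qed.

(** The class y is -h_T plus terms in the variables of G; [fzk] removes the latter and [fzT]
    evaluates the former, whence the sign. *)
Let fyyk a : f (y * y * kp a) = - ft a.
Proof.
rewrite -mulrA -hy {1}/y mulrDl mulNr fnD fnN fzT -kpY fzk addr0 //.
Qed.

Definition decp k u := exists a b' : P,
  [/\ a \is k.-homog, if k is k'.+1 then b' \is k'.-homog else b' = 0 & rad f (u - (kp a + y * kp b'))].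

Lemma decpD k u v : decp k u -> decp k v -> decp k (u + v).
Proof.
move=> [a1 [b1 [h1 k1 r1]]] [a2 [b2 [h2 k2 r2]]]; exists (a1 + a2), (b1 + b2); split.
- exact: rpredD.
- by case: k k1 k2 {h1 h2} => [|k] k1 k2; [rewrite k1 k2 addr0 | apply: rpredD].
have := radD r1 r2; congr (rad f _); rewrite /kp !sbD; ring.
Qed.

Lemma decpZ k c u : decp k u -> decp k (c *: u).
Proof.
move=> [a1 [b1 [h1 k1 r1]]]; exists (c *: a1), (c *: b1); split.
- exact: rpredZ.
- by case: k k1 {h1} => [|k] k1; [rewrite k1 scaler0 | apply: rpredZ].
have := radZ c r1; congr (rad f _); by rewrite /kp !sbZ scalerBr scalerDr scalerAr.
Qed.

Lemma decp0 k : decp k 0.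
Proof.
exists 0, 0; split; rewrite ?rpred0 //; first by case: k => [|k]; rewrite ?rpred0.
by rewrite kp0 mulr0 addr0 subr0; apply: rad0.
Qed.

Lemma decp_rad k u v : rad f (u - v) -> decp k v -> decp k u.
Proof.
move=> h [a [b' [h1 h2 h3]]]; exists a, b'; split=> //.
by have := radD h h3; rewrite addrA subrK.
Qed.

(** Induction on the exponent of T: the square relation lowers an exponent of at least two, and a
    single h_T is exchanged for -y plus variables of G. *)
Lemma decpX m : decp (mdeg m) 'X_[m].
Proof.
have [n] := ubnP (sv m T); elim: n m => // n IH m hn.
case: (boolP (supp m Gp)) => smp; last first.
  apply: (decp_rad _ (decp0 _)); rewrite subr0 => v.
  by rewrite mulrC phi_kill sb_idX (negPf smp) mulr0 fn0.
case: (posnP (sv m T)) => hT.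
  have sm : supp m G.
    apply/suppP => X hX; have := suppP _ _ smp X hX; rewrite in_setU1 => /orP[/eqP e|//].
    by move: hX; rewrite e hT.
  exists 'X_[m], 0; split; first by rewrite dhomogX.
    by case: (mdeg m) => [|k]; rewrite ?rpred0.
  by rewrite /kp sb_idX sm -/kp kp0 mulr0 addr0 subrr; apply: rad0.
have em X : (0 < sv m X)%N -> exists m1, m = (um X + m1)%MM.
  move=> hX; exists (m - um X)%MM; rewrite addmC submK //; apply/mnm_lepP => i.
  by rewrite mnm1E; case: eqP => // <-.
have [m1 e1] := em T hT; have s1 : sv m T = (sv m1 T).+1 by rewrite e1 svD sv_um eqxx.
have hom1 X : mdeg (um X + m1)%MM = (mdeg m1).+1 by rewrite mdegD mdeg1 add1n.
have sp1 : supp m1 Gp by move: smp; rewrite e1 suppD => /andP[].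
case: (posnP (sv m1 T)) => h1.
  have sm1 : supp m1 G.
    apply/suppP => X hX; have := suppP _ _ sp1 X hX; rewrite in_setU1 => /orP[/eqP e|//].
    by move: hX; rewrite e h1.
  have kX : kp 'X_[m1] = 'X_[m1] by rewrite /kp sb_idX sm1.
  rewrite e1 hom1; exists (Y' * 'X_[m1]), (- 'X_[m1]); split.
  - rewrite -add1n; apply: dhomogM; last by rewrite dhomogX.
    by rewrite rpred_sum // => W _; rewrite rpredZ // hv_homog.
  - by rewrite rpredN dhomogX.
  have kN : kp (- 'X_[m1]) = - 'X_[m1] by rewrite -scaleN1r /kp sbZ -/kp kX.
  rewrite kpY kN kX -hvX /y (_ : _ - _ = 0); first exact: rad0.
  by ring.
have [m2 e2] : exists m2, m1 = (um T + m2)%MM.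
  exists (m1 - um T)%MM; rewrite addmC submK //; apply/mnm_lepP => i.
  by rewrite mnm1E; case: eqP => // <-.
have s2 : sv m1 T = (sv m2 T).+1 by rewrite e2 svD sv_um eqxx.
have nT X : X \in G -> sv (um X) T = 0%N.
  by move=> XG; rewrite sv_um; case: eqP => // e; move: TG; rewrite -e XG.
have dm X Y : mdeg (um X + (um Y + m2))%MM = mdeg m by rewrite e1 e2 !mdegD !mdeg1.
have i1 : decp (mdeg m) 'X_[(um T + (um T1 + m2))%MM].
  by rewrite -(dm T T1); apply: IH; rewrite !svD (nT _ T1G) sv_um eqxx; move: hn; rewrite s1 s2; clear; lia.
have i2 : decp (mdeg m) 'X_[(um T + (um T2 + m2))%MM].
  by rewrite -(dm T T2); apply: IH; rewrite !svD (nT _ T2G) sv_um eqxx; move: hn; rewrite s1 s2; clear; lia.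
have i3 : decp (mdeg m) 'X_[(um T1 + (um T2 + m2))%MM].
  by rewrite -(dm T1 T2); apply: IH; rewrite !svD (nT _ T1G) (nT _ T2G); move: hn; rewrite s1 s2; clear; lia.
apply: decp_rad (decpD (decpD i1 i2) (decpZ (-1) i3)).
have := radMr 'X_[m2] (phi_square d.+2 M bGp TGp (inGp T1G) (inGp T2G) clT).
congr (rad f _); rewrite e1 e2 -!hvX scaleN1r; ring.
Qed.

Lemma decp_all k u : u \is k.-homog -> decp k u.
Proof.
move=> /dhomogP hu; rewrite (mpolyE u) big_seq; elim/big_ind: _ => [||m hm].
- exact: decp0.
- by move=> p q; apply: decpD.
by apply: decpZ; rewrite -(hu m hm); apply: decpX.
Qed.

Let fyk a : f (y * kp a) = 0. Proof. by rewrite -hy fzk. Qed.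
Let kpH k (u : P) : u \is k.-homog -> kp u \is k.-homog. Proof. exact: sb_homog. Qed.

Lemma flip_HRf c : HRf fc d.+2 (lc c G) -> HRf ft d (lc c G) -> HRf f d.+2 (lc c G).
Proof. exact: (HRf_edge kpM (sb_id_lc c G) fk fyk fyyk decp_all). Qed.
Lemma flip_HLf c : HLf fc d.+2 (lc c G) -> HLf ft d (lc c G) -> HLf f d.+2 (lc c G).
Proof. exact: (HLf_edge kpM (sb_id_lc c G) fk fyk fyyk decp_all). Qed.
Lemma flip_HRf_sub c : HRf f d.+2 (lc c G) -> HRf fc d.+2 (lc c G).
Proof. exact: (HRf_edge_sub kp0 kpM kpH (sb_id_lc c G) fk fyk fyyk decp_all). Qed.
End WithY.

(** The two Lefschetz classes differ by a multiple of h_T. On the segment between them, hard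
    Lefschetz comes from the stars of the larger building set, except at the end without h_T, where
    it comes from the orthogonal decomposition. *)
Theorem flip_HRall :
  (forall Z, Z \in G -> Z \notin maxset G -> HRall R (rs r Z) (Gs D r G Z) d.+1) ->
  (forall Z, Z \in Gp -> Z \notin maxset Gp -> HRall R (rs r Z) (Gs D r Gp Z) d.+1) ->
  HRall R (rs r T) (Gs D r G T) d ->
  HRall R r G d.+2 <-> HRall R r Gp d.+2.
Proof.
move=> sG sGp hrt; have [b hy] := yex.
have lE c : lc c Gp = lc c G + c T *: hv T by rewrite /lc big_setU1 //= addrC.
have lE' c t : lc c G + t *: hv T = lc (fun X => if X == T then t else c X) Gp :> P.
  rewrite lE eqxx; congr (_ + _); apply: eq_bigr => X XG.
  by case: eqP => // e; move: TG; rewrite -e XG.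
have hft c : (forall X, 0 < c X) -> HRf ft d (lc c G).
  by move=> c0; apply: (HR_sub (erefl _) _ hrt c0).
have hl c t : (forall X, 0 < c X) -> 0 <= t -> HLf f d.+2 (lc c G + t *: hv T).
  move=> c0; rewrite le_eqVlt => /predU1P[<-|t0].
    rewrite scale0r addr0; apply: (flip_HLf hy); last exact/HRf_HLf/hft.
    exact: (HL_local M bG td sG c0).
  rewrite lE'; apply: (HL_local M bGp tdp sGp) => X; by case: ifP.
have gr : graded f d.+2 by apply: phi_graded.
split=> h c c0.
  rewrite lE; apply: (HRf_path gr) => [|||]; rewrite ?lc_homog ?rpredZ ?hv_homog //.
    by move=> t t0 t1; rewrite scalerA; apply: hl => //; rewrite mulr_ge0 // ltW.
  by apply: (flip_HRf hy); [apply: h | apply: hft].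
apply: (flip_HRf_sub hy).
(* The same segment run backwards: the coefficient of h_T is (1 - t) times a positive number. *)
have -> : lc c G = lc c Gp + (- c T) *: hv T by rewrite lE scaleNr addrK.
apply: (HRf_path gr) => [|||]; rewrite ?lc_homog ?rpredZ ?hv_homog //; last exact: h.
move=> t t0 t1; rewrite scalerA lE -addrA -scalerDl; apply: hl => //.
by rewrite mulrN -{1}[c T]mul1r -mulrBl mulr_ge0 ?subr_ge0 // ltW.
Qed.
End Flip.

End Flips.
Import Flips.

(** * Products with a projective line *)

Module ProjectiveLine.
Local Open Scope ring_scope.

Section P1.
Variables (R : rcfType) (N : nat).
Local Notation P := {mpoly R[N]}.
Implicit Types (f g : fnl R N) (u v a b : P).

Lemma HLf_surj g d l k v : graded g d -> l \is 1.-homog -> HLf g d l -> (k.*2 <= d)%N ->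
  v \is (d - k).-homog -> exists2 u, u \is k.-homog & rad g (v - u * l ^+ (d - k.*2)).
Proof.
move=> gg hl hr hk hv.
have pc : piece (Kk R N d) (gram d g) d (map (op d) [:: l]).
  by apply: (piece_of gg) => x; rewrite inE => /eqP ->.
have gl : good (Kk R N d) (gram d g) (map (op d) [:: l]) (op d l).
  by apply: (good_op pc); rewrite !inE eqxx.
have kd : (d - k <= d)%N by apply: leq_subr.
have ev : pol (rv d v) = v := homog_rv kd hv.
have [|u uK hu] := HLsurj pc gl (((HLf_HLin gg l).1 hr)) hk (v := rv d v).
  by apply/KkP; rewrite ev.
exists (pol u); first exact/KkP.
move/(rd_gram gg): hu => hu w; rewrite -(hu w).
have -> : pol (rv d v - u *m op d l ^+ (d - k.*2)) = v - pol (rv d (pol u * l ^+ (d - k.*2))).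
  by rewrite row_opX -scaleN1r polD polZ ev scaleN1r.
by rewrite !mulrBl !fnB (fn_trunc gg).
Qed.

Section Product.
Variables (f g : fnl R N) (d : nat) (kp : P -> P) (h l : P) (c : R).
Hypothesis gg : graded g d.
Hypothesis hl : l \is 1.-homog.
Hypothesis kpM : {morph kp : p q / p * q}.
Hypothesis kpD : {morph kp : p q / p + q}.
Hypothesis kpl : forall e, kp (l ^+ e) = l ^+ e.
Hypothesis fk : forall a, f (kp a) = 0.
Hypothesis fhk : forall a, f (h * kp a) = g a.
Hypothesis hh : rad f (h * h).
Hypothesis dec : forall k u, u \is k.-homog -> exists a b,
  [/\ a \is k.-homog, if k is k'.+1 then b \is k'.-homog else b = 0 & rad f (u - (kp a + h * kp b))].
Hypothesis c0 : 0 < c.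

Let F3 a b a' b' : f ((kp a + h * kp b) * (kp a' + h * kp b')) = g (a * b') + g (b * a').
Proof.
have -> : (kp a + h * kp b) * (kp a' + h * kp b') =
    kp a * kp a' + (h * (kp a * kp b') + h * (kp b * kp a')) + h * h * (kp b * kp b') by ring.
by rewrite -!kpM !fnD fk !fhk hh add0r addr0.
Qed.

Let powE e : rad f ((l + c *: h) ^+ e - (l ^+ e + (e%:R * c) *: (h * l ^+ e.-1))).
Proof.
elim: e => [|e IH]; first by rewrite !expr0 mul0r scale0r addr0 subrr; apply: rad0.
have := radD (radMl (l + c *: h) IH) (radMr ((e%:R * c * c) *: l ^+ e.-1) hh); congr (rad f _).
rewrite -!mul_mpolyC; case: e {IH} => [|e]; rewrite ?exprS /=; last rewrite -!natr1 !rmorphM !rmorphD /= !rmorph1 ?rmorphM; ring.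
Qed.

Let F4 a b e a' b' : f ((kp a + h * kp b) * (l + c *: h) ^+ e * (kp a' + h * kp b')) =
  g (a * l ^+ e * b') + g (b * l ^+ e * a') + e%:R * c * g (a * l ^+ e.-1 * a').
Proof.
transitivity (f ((kp a + h * kp b) * (l ^+ e + (e%:R * c) *: (h * l ^+ e.-1)) * (kp a' + h * kp b'))).
  by apply/eqP; rewrite -subr_eq0 -fnB -mulrBl -mulrBr [_ * (_ - _)]mulrC -mulrA powE.
rewrite [(kp a + _) * (_ + _)]mulrDr mulrDl fnD; congr (_ + _).
  rewrite -F3; congr (f (_ * _)); rewrite !kpM kpl; ring.
rewrite -scalerAr -scalerAl fnZ; congr (_ * _).
have -> : (kp a + h * kp b) * (h * l ^+ e.-1) * (kp a' + h * kp b') =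
   h * (kp a * l ^+ e.-1 * kp a') + h * h * (kp b * l ^+ e.-1 * (kp a' + h * kp b') + kp a * l ^+ e.-1 * kp b') by ring.
have -> : kp a * l ^+ e.-1 * kp a' = kp (a * l ^+ e.-1 * a') by rewrite !kpM kpl.
by rewrite fnD fhk hh addr0.
Qed.

Let vanish (p : P) : (forall a b, f (p * (kp a + h * kp b)) = 0) -> rad f p.
Proof.
move=> hp v; rewrite (mpolyE v) mulr_sumr fn_sum big1 // => m _; rewrite -scalerAr fnZ.
have hm : ('X_[m] : P) \is (mdeg m).-homog by rewrite dhomogX.
have [a [b [_ _ e]]] := dec hm.
by rewrite [p * _]mulrC (radW e) [_ * p]mulrC hp mulr0.
Qed.

(** Write u = a + h b. Primitivity for l + c h forces a = p + l q and b = -(e+1) c q modulo the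
    radical, with p and q primitive of degrees k and k - 1; their opposite signs give the relations
    for u. *)
Lemma HRf_P1 : HRf g d l -> HRf f d.+1 (l + c *: h).
Proof.
move=> hr k u hk hu hp; have hlf := HRf_HLf hr.
have [a [b [ha hb hu']]] := dec hu.
set e := (d.+1 - k.*2)%N in hp *.
have uE m v : f (u * (l + c *: h) ^+ m * v) = f ((kp a + h * kp b) * (l + c *: h) ^+ m * v).
  by rewrite -!mulrA; apply: radW.
have val : f (u * (l + c *: h) ^+ e * u) = g (a * l ^+ e * b) + g (b * l ^+ e * a) + e%:R * c * g (a * l ^+ e.-1 * a).
  by rewrite uE mulrC (radW hu') mulrC F4.
have kp0 : kp 0 = 0.
  by apply: (addIr (kp 0)); rewrite -kpD !add0r.
have A1 w : g (a * l ^+ e.+1 * w) = 0.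
  have := hp (kp 0 + h * kp w); rewrite uE F4 /= !mulr0 !fn0 mulr0 !addr0; apply.
have A2 : rad g (b * l ^+ e.+1 + (e.+1%:R * c) *: (a * l ^+ e)).
  move=> w; have := hp (kp w + h * kp 0); rewrite uE F4 /= !mulr0 !fn0 add0r mulrDl fnD.
  by rewrite -scalerAl fnZ.
(* Hard Lefschetz of g in degree k - 1 solves a l^e = q l^(e+1), so that p = a - l q is
   primitive. *)
have [q [hq hq2 hpq]] : exists q, [/\ (if k is k'.+1 then q \is k'.-homog else q = 0),
    (l * q) \is k.-homog & rad g ((a - l * q) * l ^+ e)].
  case: (k) hk @e hp ha uE val A1 A2 {hb hu} => [|k'] hk e hp ha uE val A1 A2.
    exists 0; split=> //; first by rewrite mulr0 rpred0.
    rewrite mulr0 subr0 => v; rewrite (mpolyE v) mulr_sumr fn_sum big1 // => m _; rewrite -scalerAr fnZ.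
    have hom : a * l ^+ e * 'X_[m] \is (0 + 1 * e + mdeg m).-homog.
      by rewrite !dhomogM // ?dhomogMn // dhomogX.
    by rewrite (gradedP gg hom) ?mulr0 // /e; apply/eqP; lia.
  have k2 : (k'.*2 <= d)%N by lia.
  have hv : a * l ^+ e \is (d - k').-homog.
    have -> : (d - k' = k'.+1 + 1 * e)%N by rewrite /e; lia.
    by rewrite dhomogM // dhomogMn.
  have [q hq hrq] := HLf_surj gg hl hlf k2 hv; exists q; split=> //.
    by rewrite -add1n dhomogM.
  have e1 : (d - k'.*2 = e.+1)%N by rewrite /e; lia.
  by move: hrq; rewrite e1 exprS; congr (rad g _); ring.
set p := a - l * q in hpq; have ea : a = p + l * q by rewrite subrK.
have hpp : p \is k.-homog by rewrite rpredB.
have B1 : rad g (b + (e.+1%:R * c) *: q).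
  case: (k) hk @e hp hb hq hpp uE val A1 A2 hpq {ha hu hq2} => [|k'] hk e hp hb hq hpp uE val A1 A2 hpq.
    by rewrite hb hq scaler0 addr0; apply: rad0.
  apply: (hlf k'); first by lia.
    by rewrite rpredD // rpredZ.
  have -> : (d - k'.*2 = e.+1)%N by rewrite /e; lia.
  move=> w; have := radB A2 (radZ (e.+1%:R * c) hpq) => /(_ w) <-; congr (g _).
  rewrite /p -!mul_mpolyC exprS; ring.
have prq w : g (q * l ^+ e.+2 * w) = 0.
  have h1 := A1 w; rewrite ea in h1.
  have h2 := hpq (l * w); rewrite -h1 -[RHS]addr0 -[X in _ = _ + X]oppr0 -{1}h2 -fnN -fnD; congr (g _).
  rewrite !exprS; ring.
have gq x : g (b * x) = - (e.+1%:R * c) * g (q * x).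
  have := B1 x; rewrite mulrDl fnD -scalerAl fnZ => /eqP; rewrite addr_eq0 => /eqP ->; by rewrite mulNr.
have gpq : g (p * l ^+ e * q) = 0 by exact: hpq.
have [y1 y2] : 0 <= (-1) ^+ k * - (e.+2%:R * c * g (q * l ^+ e.+1 * q)) /\ (e.+2%:R * c * g (q * l ^+ e.+1 * q) = 0 -> rad g q).
  have ec : 0 < e.+2%:R * c by rewrite mulr_gt0 // ltr0n.
  case: (k) hk @e hp hb hq uE val A1 A2 hpq B1 prq gq gpq ec {ha hu hq2 hpp} => [|k'] hk e hp hb hq uE val A1 A2 hpq B1 prq gq gpq ec.
    by rewrite hq !mul0r fn0 mulr0 oppr0 mulr0; split=> // _; apply: rad0.
  have k2 : (k'.*2 <= d)%N by lia.
  have e1 : (d - k'.*2 = e.+1)%N by rewrite /e; lia.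
  have [|z1 z2] := hr k' q k2 hq; first by rewrite e1.
  rewrite e1 in z1 z2; rewrite exprS mulN1r mulrNN mulrCA; split; first by apply: mulr_ge0; [exact: ltW|].
  by move=> /eqP; rewrite mulf_eq0 gt_eqF //= => /eqP.
set X := g (p * l ^+ e.-1 * p); set Y := g (q * l ^+ e.+1 * q) in y1 y2 *.
have eS : (0 < e)%N -> l ^+ e = l * l ^+ e.-1 by move=> he; rewrite -exprS prednK.
(* The cross terms contribute -2 (e+1) c Y, the h-term of the power contributes e c (X + Y). *)
have val2 : f (u * (l + c *: h) ^+ e * u) = e%:R * c * X - (e.+2%:R * c) * Y.
  rewrite val; have -> : g (a * l ^+ e * b) = g (b * (a * l ^+ e)) by congr (g _); ring.
  rewrite -[b * l ^+ e * a]mulrA !gq.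
  have e1 : g (q * (a * l ^+ e)) = Y.
    rewrite ea /Y -[RHS]add0r -gpq -fnD; congr (g _); rewrite exprS; ring.
  have -> : q * (l ^+ e * a) = q * (a * l ^+ e) by ring.
  rewrite e1; case: (posnP e) => he.
    by rewrite he !mul0r -natr1 -natr1; ring.
  have -> : g (a * l ^+ e.-1 * a) = X + Y.
    have -> : a * l ^+ e.-1 * a = p * l ^+ e.-1 * p + (p * (l * l ^+ e.-1) * q + (p * (l * l ^+ e.-1) * q + q * (l * (l * l ^+ e.-1)) * q)).
      by rewrite ea; ring.
    by rewrite -eS // -exprS !fnD gpq !add0r.
  rewrite -!natr1; ring.
have [x1 x2] : 0 <= (-1) ^+ k * (e%:R * c * X) /\ (e%:R * c * X = 0 -> rad g p).
  case: (posnP e) => he.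
    rewrite he !mul0r mulr0; split=> // _; move: hpq; by rewrite he expr0 mulr1.
  have k2 : (k.*2 <= d)%N by move: he; rewrite /e; lia.
  have e1 : (d - k.*2 = e.-1)%N by rewrite /e; lia.
  have [|z1 z2] := hr k p k2 hpp; first by rewrite e1 prednK.
  have ec : 0 < e%:R * c by rewrite mulr_gt0 // ltr0n.
  rewrite mulrCA; split; first by apply: mulr_ge0; [exact: ltW | rewrite /X -e1].
  by move=> /eqP; rewrite mulf_eq0 gt_eqF //= => /eqP; rewrite /X -e1.
split; first by rewrite val2 mulrDr addr_ge0.
move=> v0; have : (-1) ^+ k * (e%:R * c * X) + (-1) ^+ k * - (e.+2%:R * c * Y) = 0.
  by rewrite -mulrDr -val2 v0 mulr0.
move/eqP; rewrite paddr_eq0 // => /andP[]; rewrite !mulf_eq0 !signr_eq0 !orFb oppr_eq0 -!mulf_eq0.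
move=> /eqP/x2 rp /eqP/y2 rq.
have ra : rad g a by rewrite ea; apply: radD => //; apply: radMl.
have rb : rad g b by move=> w; rewrite gq rq mulr0.
have rk : rad f (kp a + h * kp b).
  by apply: vanish => a' b'; rewrite F3 ra rb addr0.
by rewrite -(subrK (kp a + h * kp b) u); apply: radD.
Qed.
End Product.
End P1.

Section Boolean.
Variables (R : rcfType) (E : finType).
Local Notation N := #|{: {set E}}|.
Local Notation P := {mpoly R[N]}.
Local Notation hv := (@hv R E).
Implicit Types (A B S X Y : {set E}) (C G : {set {set E}}) (m : 'X_{1..N}).

Definition sings S : {set {set E}} := [set [set x] | x in S].
Definition mset S : 'X_{1..N} := (\sum_(x in S) um [set x])%MM.
(** The degree map of a product of projective lines indexed by S: the only surviving monomial uses
    each point once. *)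
Definition psi S : fnl R N := evf R #|S| (pred1 (mset S)).
Definition ls (a : E -> R) S : P := \sum_(x in S) a x *: hv [set x].

Lemma sv_mset S X : sv (mset S) X = [exists x in S, X == [set x]].
Proof.
rewrite /sv /mset mnm_sumE; case: (boolP [exists x in S, X == [set x]]) => [/exists_inP[x xS /eqP e]|].
  rewrite (bigD1 x) //= -/(sv _ X) sv_um e eqxx big1 // => y /andP[_ ne].
  by rewrite -/(sv _ _) sv_um (inj_eq set1_inj) (negPf ne).
rewrite negb_exists_in => /forall_inP h; rewrite big1 // => x xS.
by rewrite -/(sv _ X) sv_um eq_sym (negPf (h x xS)).
Qed.

Lemma sv_mset1 S x : sv (mset S) [set x] = (x \in S).
Proof.
rewrite sv_mset; congr nat_of_bool; apply/exists_inP/idP => [[y yS]|xS]; last by exists x.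
by rewrite (inj_eq set1_inj) => /eqP ->.
Qed.

Lemma mdeg_mset S : mdeg (mset S) = #|S|.
Proof. by rewrite /mset mdeg_sum -sum1_card; apply: eq_bigr => x _; rewrite mdeg1. Qed.

Lemma psiX S m : psi S 'X_[m] = (m == mset S)%:R.
Proof. by rewrite evfX /= andb_idl // => /eqP ->; rewrite mdeg_mset. Qed.

Lemma psi_graded S : graded (psi S) #|S|.
Proof. by move=> m hm; rewrite psiX; case: eqP => // e; move: hm; rewrite e mdeg_mset eqxx. Qed.

Lemma svP m m' : (forall X, sv m X = sv m' X) -> m = m'.
Proof. by move=> h; apply/mnmP => i; have := h (enum_val i); rewrite /sv enum_valK. Qed.

Lemma mset0 : mset set0 = 0%MM.
Proof. by rewrite /mset big_set0. Qed.

Lemma msetU x S : x \notin S -> mset (x |: S) = (um [set x] + mset S)%MM.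
Proof. by move=> xS; rewrite /mset big_setU1. Qed.

Lemma psi_sq S x : rad (psi S) (hv [set x] * hv [set x]).
Proof.
move=> v; rewrite (mpolyE v) mulr_sumr fn_sum big1 // => m _; rewrite -scalerAr fnZ -mulrA !hvX psiX.
case: eqP => [e|]; last by rewrite mulr0.
have := congr1 (fun q => sv q [set x]) e; rewrite !svD !sv_um eqxx sv_mset1; by case: (x \in S).
Qed.

Lemma supp_mset S : supp (mset S) (sings S).
Proof. by apply/suppP => X; rewrite sv_mset lt0b => /exists_inP[x xS /eqP ->]; apply: imset_f. Qed.

Lemma sv_sub m X : (0 < sv m X)%N -> exists m1, m = (um X + m1)%MM.
Proof.
move=> hX; exists (m - um X)%MM; rewrite addmC submK //; apply/mnm_lepP => i.
by rewrite mnm1E; case: eqP => // <-.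
Qed.

Lemma HR_psi (a : E -> R) S : (forall x, 0 < a x) -> HRf (psi S) #|S| (ls a S).
Proof.
move=> a0; have [n] := ubnP #|S|; elim: n S => // n IH S hn.
have [->|[x xS]] := set_0Vmem S.
  move=> k u hk /dhomogP hu _; rewrite cards0 in hk *; case: k hk hu => // _ hu.
  have eu : u = u@_0%MM *: 1.
    apply/mpolyP => m; rewrite mcoeffZ mcoeff1; case: eqP => [->|m0]; first by rewrite mulr1.
    by rewrite mulr0; apply/eqP; rewrite mcoeff_eq0; apply/negP => /hu/eqP; rewrite mdeg_eq0 => /eqP.
  have v1 : psi set0 1 = 1 by rewrite -mpolyX0 psiX mset0 eqxx.
  have e : psi set0 (u * ls a set0 ^+ 0 * u) = u@_0%MM ^+ 2.
    by rewrite expr0 mulr1 {1 2}eu -scalerAl -scalerAr mulr1 !fnZ v1 mulr1 -expr2.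
  rewrite e expr0 mul1r sqr_ge0; split=> // /eqP; rewrite sqrf_eq0 => /eqP z.
  by rewrite eu z scale0r; apply: rad0.
set S' := S :\ x; have cS : #|S| = #|S'|.+1 by rewrite (cardsD1 x) xS.
have eS : S = x |: S' by rewrite setD1K.
have xS' : x \notin S' by rewrite !inE eqxx.
have eL : ls a S = ls a S' + a x *: hv [set x] by rewrite /ls {1}eS big_setU1 //= addrC.
rewrite eL cS; pose kp := sb (R := R) id (sings S').
have n1 : [set x] \notin sings S' by apply/imsetP => -[y yS' /set1_inj e]; rewrite e yS' in xS'.
have kpm m : kp 'X_[m] = if supp m (sings S') then 'X_[m] else 0 by rewrite /kp sb_idX.
have m0 m : supp m (sings S') -> sv m [set x] = 0%N.
  by move=> /suppP h; apply/eqP; rewrite -leqn0 leqNgt; apply/negP => /h; rewrite (negPf n1).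
apply: (@HRf_P1 R N (psi S) (psi S') #|S'| kp (hv [set x])).
- exact: psi_graded.
- by rewrite rpred_sum // => y _; rewrite rpredZ // hv_homog.
- exact: sbM.
- exact: sbD.
- move=> e; have e0 : kp (ls a S') = ls a S'.
    by rewrite /kp /ls sb_sum; apply: eq_bigr => y yS'; rewrite sbZ sb_hv imset_f.
  by elim: e => [|e IHe]; rewrite ?expr0 /kp ?sb1 // !exprS sbM -/kp e0 IHe.
- move=> p; rewrite (mpolyE p) /kp sb_sum fn_sum big1 // => m _; rewrite sbZ fnZ -/kp kpm.
  case: ifP => sm; last by rewrite fn0 mulr0.
  rewrite psiX; case: eqP => [e|]; last by rewrite mulr0.
  by have := m0 _ sm; rewrite e sv_mset1 xS.
- move=> p; rewrite (mpolyE p) /kp sb_sum mulr_sumr !fn_sum; apply: eq_bigr => m _.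
  rewrite sbZ -scalerAr !fnZ -/kp kpm; congr (_ * _); rewrite psiX.
  case: ifPn => sm; last first.
    rewrite mulr0 fn0; case: eqP => // e; by rewrite e supp_mset in sm.
  rewrite hvX psiX {1}eS msetU //; congr (_ %:R); congr nat_of_bool.
  by apply/eqP/eqP => [/addmI|->].
- exact: psi_sq.
- move=> k u /dhomogP hu; pose dp k (u : P) := exists p q : P, [/\ p \is k.-homog,
     if k is k'.+1 then q \is k'.-homog else q = 0 & rad (psi S) (u - (kp p + hv [set x] * kp q))].
  have dpR p : rad (psi S) p -> dp k p.
    move=> rp; exists 0, 0; split; rewrite ?rpred0 //; first by case: (k) => // k'; rewrite rpred0.
    by rewrite /kp /sb rmorph0 mulr0 addr0 subr0.
  have dp0 : dp k 0 by apply: dpR; apply: rad0.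
  have dpD p q : dp k p -> dp k q -> dp k (p + q).
    move=> [a1 [b1 [h1 k1 r1]]] [a2 [b2 [h2 k2 r2]]]; exists (a1 + a2), (b1 + b2); split.
    + exact: rpredD.
    + by case: (k) k1 k2 => [k1 k2|k'] ; [rewrite k1 k2 addr0 | apply: rpredD].
    by have := radD r1 r2; congr (rad _ _); rewrite /kp !sbD; ring.
  have dpZ c p : dp k p -> dp k (c *: p).
    move=> [a1 [b1 [h1 k1 r1]]]; exists (c *: a1), (c *: b1); split.
    + exact: rpredZ.
    + by case: (k) k1 => [k1|k']; [rewrite k1 scaler0 | apply: rpredZ].
    by have := radZ c r1; congr (rad _ _); rewrite /kp !sbZ scalerBr scalerDr scalerAr.
  rewrite -[exists _, _]/(dp k u) (mpolyE u) big_seq; elim/big_ind: _ => // m hm.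
  apply: (dpZ); have {hu}hm : mdeg m = k by apply: hu.
  have killm : ~~ supp m (sings S) -> rad (psi S) 'X_[m].
    move=> sm v; rewrite (mpolyE v) mulr_sumr fn_sum big1 // => m' _; rewrite -scalerAr fnZ -mpolyXD psiX.
    by case: eqP => [e|]; rewrite ?mulr0 //; move: sm; have := supp_mset S; rewrite -e suppD => /andP[->].
  case: (boolP (supp m (sings S))) => sm; last first.
    apply: (dpR); exact: killm.
  case: (posnP (sv m [set x])) => hx.
    have sm' : supp m (sings S').
      apply/suppP => X hX; have /imsetP[y yS e] := suppP _ _ sm X hX.
      by rewrite e imset_f // !inE yS andbT; apply/eqP => exy; rewrite e exy hx in hX.
    exists 'X_[m], 0; split; first by rewrite -hm dhomogX.
      by case: (k) => // k'; rewrite rpred0.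
    by rewrite kpm sm' /kp /sb rmorph0 mulr0 addr0 subrr; apply: rad0.
  have [m1 e1] := sv_sub hx; case: (posnP (sv m1 [set x])) => hx1.
    have sm' : supp m1 (sings S').
      apply/suppP => X hX; move: sm; rewrite e1 suppD => /andP[_ /suppP/(_ X hX)/imsetP[y yS e]].
      by rewrite e imset_f // !inE yS andbT; apply/eqP => exy; rewrite e exy hx1 in hX.
    exists 0, 'X_[m1]; split; first by rewrite rpred0.
      have -> : k = (mdeg m1).+1 by rewrite -hm e1 mdegD mdeg1.
      by rewrite dhomogX.
    by rewrite kpm sm' e1 -hvX /kp /sb rmorph0 add0r subrr; apply: rad0.
  have [m2 e2] := sv_sub hx1; apply: (dpR); rewrite e1 e2 -!hvX mulrA; apply: radMr; exact: psi_sq.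
- exact: a0.
- by apply: IH; rewrite -ltnS -cS.
Qed.
End Boolean.

End ProjectiveLine.
Import ProjectiveLine.

(** * Boolean matroids as products of projective spaces *)

Module BooleanCase.
Local Open Scope ring_scope.

Section Base.
Variables (R : rcfType) (E : finType).
Local Notation N := #|{: {set E}}|.
Local Notation P := {mpoly R[N]}.
Local Notation hv := (@hv R E).
Implicit Types (A B S X Y c : {set E}) (C G : {set {set E}}) (m : 'X_{1..N}).

Section Tau.
Variables (C : {set {set E}}) (S : {set E}).
Hypothesis covS : forall x, x \in S -> exists2 c, c \in C & x \in c.
Hypothesis disC : forall X Y x, X \in C -> Y \in C -> x \in X -> x \in Y -> X = Y.

Definition ls1 c : P := \sum_(x in S :&: c) hv [set x].
(** Pulls the hyperplane class of the block c back to the sum of the point classes of the lines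
    indexed by S ∩ c. *)
Definition tau (p : P) : P := p \mPo [tuple (if enum_val i \in C then ls1 (enum_val i) else 0) | i < N].
Definition fits m A := supp m C && [forall c in C, (sv m c + #|A :&: c| == #|S :&: c|)%N].
Definition facts m : nat := (\prod_(c in C) (sv m c)`!)%N.

Lemma tauM : {morph tau : p q / p * q}. Proof. by move=> p q; rewrite /tau rmorphM. Qed.
Lemma tau1 : tau 1 = 1. Proof. exact: rmorph1. Qed.
Lemma tauD : {morph tau : p q / p + q}. Proof. by move=> p q; rewrite /tau rmorphD. Qed.
Lemma tauZ a p : tau (a *: p) = a *: tau p. Proof. exact: linearZ. Qed.
Lemma tau_sum I (s : seq I) (Q : pred I) (H : I -> P) :
  tau (\sum_(i <- s | Q i) H i) = \sum_(i <- s | Q i) tau (H i).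
Proof. by rewrite /tau rmorph_sum. Qed.
Lemma tau_hv X : tau (hv X) = if X \in C then ls1 X else 0.
Proof. by rewrite /tau /HR.hv comp_mpolyXU -tnth_nth tnth_mktuple enum_rankK. Qed.

Lemma ls1_homog c : ls1 c \is 1.-homog.
Proof. by rewrite rpred_sum // => x _; apply: hv_homog. Qed.

Lemma tau_homog k (p : P) : p \is k.-homog -> tau p \is k.-homog.
Proof.
move=> /dhomogP hp; rewrite (mpolyE p) tau_sum big_seq rpred_sum // => m hm.
rewrite tauZ rpredZ // /tau comp_mpolyX.
have -> : k = (\sum_(i < N) (1 * m i))%N.
  transitivity (mdeg m); first by rewrite -(hp m hm).
  by rewrite mdegE; apply: eq_bigr => i _; rewrite mul1n.
apply: (big_ind2 (fun (q : P) (j : nat) => q \is j.-homog)); first exact: dhomog1.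
  by move=> *; apply: dhomogM.
move=> i _; rewrite tnth_mktuple; apply: dhomogMn.
by case: ifP => _; [apply: ls1_homog | rewrite rpred0].
Qed.

Lemma card_IU x A c : x \notin A -> #|(x |: A) :&: c| = (#|A :&: c| + (x \in c))%N.
Proof.
move=> xA; case: (boolP (x \in c)) => xc.
  have -> : (x |: A) :&: c = x |: (A :&: c).
    by apply/setP => y; rewrite !inE; case: eqP => [->|_] //=; rewrite xc.
  by rewrite cardsU1 inE (negPf xA) addnC.
rewrite addn0; apply: eq_card => y; rewrite !inE; case: eqP => [->|_] //=.
by rewrite (negPf xc) (negPf xA).
Qed.

(** Squares vanish, so each factor h_c must choose a point of S ∩ c that is still free; the numbers
    of choices multiply to factorials. *)
Lemma psi_tau m A : A \subset S ->
  psi R S (tau 'X_[m] * 'X_[mset A]) = (fits m A)%:R * (facts m)%:R.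
Proof.
have [n] := ubnP (mdeg m); elim: n m A => // n IH m A hn AS.
case: (boolP [exists X, (0 < sv m X)%N]) => [/existsP[c hc]|]; last first.
  rewrite negb_exists => /forallP h; have {h} em : m = 0%MM.
    by apply: svP => X; have := h X; rewrite -leqNgt leqn0 => /eqP ->; rewrite /sv mnm0E.
  have s0 X : sv (0%MM : 'X_{1..N}) X = 0%N by rewrite /sv mnm0E.
  rewrite em mpolyX0 tau1 mul1r psiX.
  have -> : facts 0%MM = 1%N by rewrite /facts big1 // => c _; rewrite s0.
  rewrite mulr1; congr ((_ : bool)%:R).
  apply/eqP/andP => [e|[_ /forall_inP h]].
    split; first by apply/suppP => X; rewrite s0.
    have -> : A = S by apply/setP => x; have := congr1 (fun q => sv q [set x]) e; rewrite !sv_mset1; do 2 case: (_ \in _).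
    by apply/forall_inP => c _; rewrite s0.
  congr mset; apply/eqP; rewrite eqEsubset AS /=; apply/subsetP => x xS.
  have [c cC xc] := covS xS; have := h c cC; rewrite s0 add0n => /eqP e.
  have : A :&: c == S :&: c by rewrite eqEcard setSI //= e.
  by move/eqP/setP/(_ x); rewrite !inE xS xc !andbT.
have [m1 em] := sv_sub hc; rewrite em -hvX tauM tau_hv.
case: (boolP (c \in C)) => cC; last first.
  by rewrite !mul0r fn0 /fits suppD supp_um (negPf cC) mul0r.
have hm1 : (mdeg m1 < n)%N by move: hn; rewrite em mdegD mdeg1 ltnS.
rewrite /ls1 !mulr_suml fn_sum.
have dX c' : c' \in C -> sv (um c + m1)%MM c' = (sv m1 c' + (c' == c))%N.
  by move=> _; rewrite svD sv_um addnC eq_sym.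
have fE : facts (um c + m1)%MM = ((sv m1 c).+1 * facts m1)%N.
  rewrite /facts (bigD1 c) //= [in RHS](bigD1 c) //= dX // eqxx addn1 factS mulnA; congr (_ * _)%N.
  by apply: eq_bigr => c' /andP[h ne]; rewrite dX // (negPf ne) addn0.
transitivity (\sum_(x in (S :&: c) :\: A) (fits (um c + m1)%MM A)%:R * (facts m1)%:R : R).
  rewrite big_mkcond [RHS]big_mkcond; apply: eq_bigr => x _; rewrite in_setD.
  case: (boolP (x \in S :&: c)) => [/setIP[xS xc]|_]; last by rewrite andbF.
  rewrite andbT; case: (boolP (x \in A)) => xA /=.
    rewrite -(setD1K xA) msetU ?inE ?eqxx // -hvX.
    have -> : hv [set x] * tau 'X_[m1] * (hv [set x] * 'X_[mset (A :\ x)]) =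
      hv [set x] * hv [set x] * (tau 'X_[m1] * 'X_[mset (A :\ x)]) by ring.
    exact: psi_sq.
  have -> : hv [set x] * tau 'X_[m1] * 'X_[mset A] = tau 'X_[m1] * 'X_[mset (x |: A)].
    by rewrite msetU // -hvX; ring.
  rewrite -[LHS]/(psi R S (tau 'X_[m1] * 'X_[(mset (x |: A))])) IH ?subUset ?sub1set ?xS //; congr ((_ : bool)%:R * _).
  rewrite /fits suppD supp_um cC /=; congr (_ && _).
  apply: eq_forallb => c'; case: (boolP (c' \in C)) => //= hc'.
  rewrite dX // card_IU //; have -> : (x \in c') = (c' == c).
    by apply/idP/eqP => [h|->//]; apply: (disC hc' cC h xc).
  by congr (_ == _); rewrite addnAC -addnA.
rewrite sumr_const -[_ *+ #|_|]mulr_natr fE; case: (boolP (fits _ A)) => [/andP[_ /forall_inP/(_ c cC)]|]; last by rewrite !mul0r.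
rewrite dX // eqxx => /eqP e; rewrite !mul1r natrM mulrC; congr (_%:R * _).
rewrite cardsD; have -> : S :&: c :&: A = A :&: c.
  by apply/setP => x; rewrite !inE; case: (boolP (x \in A)) => [/(subsetP AS) ->|]; rewrite ?andbF ?andbT.
by move: e; clear; lia.
Qed.

Definition mcomp A : 'X_{1..N} := (\sum_(c in C) um c *+ #|A :&: c|)%MM.
Lemma sv_mcomp A X : sv (mcomp A) X = if X \in C then #|A :&: X| else 0%N.
Proof.
rewrite /sv /mcomp mnm_sumE; have h c : ((um c *+ #|A :&: c|)%MM : 'X_{1..N}) (enum_rank X) = ((c == X) * #|A :&: c|)%N.
  by rewrite mulmnE -/(sv _ X) sv_um mulnC.
case: ifP => XC.
  rewrite (bigD1 X) //= h eqxx mul1n big1 ?addn0 // => c /andP[_ /negPf ne].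
  by rewrite h ne.
by rewrite big1 // => c cC; rewrite h; case: eqP => // e; rewrite -e cC in XC.
Qed.

(** Classes in the image are symmetric in the points of a block, so a squarefree test monomial acts
    through its numbers of points only. A multiple of a monomial in the h_c does the same, with the
    ratio [K A] of factorials as factor. *)
Lemma tau_adj (v' : P) : exists v, forall u, psi R S (tau u * v') = psi R S (tau u * tau v).
Proof.
pose K A : R := (\prod_(c in C) (#|S :&: c| - #|A :&: c|)`!)%:R / (\prod_(c in C) (#|S :&: c|)`!)%:R.
have K0 : ((\prod_(c in C) (#|S :&: c|)`!)%N%:R : R) != 0.
  by rewrite pnatr_eq0 -lt0n prodn_gt0 // => c; apply: fact_gt0.
have one m' : exists v : P, forall u, psi R S (tau u * 'X_[m']) = psi R S (tau u * tau v).
  case: (boolP [exists A : {set E}, (A \subset S) && (m' == mset A)]) => [/existsP[A /andP[AS /eqP ->]]|h].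
    exists (K A *: 'X_[mcomp A]) => u; rewrite (mpolyE u) tau_sum !mulr_suml !fn_sum.
    apply: eq_bigr => m _; rewrite tauZ -!scalerAl !fnZ; congr (_ * _).
    rewrite psi_tau // tauZ -scalerAr fnZ -tauM -mpolyXD -[tau _]mulr1 -(mpolyX0 _ R) -mset0 psi_tau ?sub0set //.
    have -> : fits (m + mcomp A)%MM set0 = fits m A.
      rewrite /fits suppD; have -> : supp (mcomp A) C.
        by apply/suppP => X; rewrite sv_mcomp; case: ifP.
      rewrite andbT; congr (_ && _); apply: eq_forallb => c; case: (boolP (c \in C)) => //= cC.
      by rewrite svD sv_mcomp cC set0I cards0 addn0.
    case: (boolP (fits m A)) => [/andP[_ /forall_inP hf]|]; last by rewrite !mul0r mulr0.
    rewrite !mul1r /K; have -> : facts (m + mcomp A)%MM = (\prod_(c in C) (#|S :&: c|)`!)%N.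
      by apply: eq_bigr => c cC; rewrite svD sv_mcomp cC (eqP (hf c cC)).
    rewrite mulfVK //; congr _%:R; apply: eq_bigr => c cC.
    by rewrite -(eqP (hf c cC)) addnK.
  exists 0 => u; have -> : tau 0 = 0 by rewrite /tau rmorph0.
  rewrite mulr0 fn0 (mpolyE (tau u)) mulr_suml fn_sum big1 // => m _; rewrite -scalerAl fnZ -mpolyXD psiX.
  case: eqP => e; last by rewrite mulr0.
  case/existsP: h; pose A := [set x in S | sv m' [set x] == 1%N].
  exists A; apply/andP; split; first by apply/subsetP => x; rewrite inE => /andP[].
  apply/eqP/svP => X.
  have eX Y : (sv m Y + sv m' Y = sv (mset S) Y)%N by rewrite -e svD.
  have := eX X; rewrite !sv_mset; case: (boolP [exists x in S, _]) => [/exists_inP[x xS /eqP ->]|hn] /= e1.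
    have -> : [exists x0 in A, [set x] == [set x0]] = (sv m' [set x] == 1%N).
      apply/exists_inP/idP => [[y]|h]; first by rewrite inE => /andP[_ h] /eqP ->.
      by exists x => //; rewrite inE xS.
    by move: e1; case: (sv m' _) => [|[]] //; lia.
  have -> : [exists x in A, X == [set x]] = false.
    apply: contraNF hn => /exists_inP[x]; rewrite inE => /andP[xS _] h; by apply/exists_inP; exists x.
  by move: e1; clear; lia.
have [v hv'] := fin_all_exists (fun i : 'I_(size (msupp v')) => one (nth 0%MM (msupp v') i)).
exists (\sum_i v'@_(nth 0%MM (msupp v') (nat_of_ord i)) *: v i) => u.
rewrite {1}(mpolyE v') (big_nth 0%MM) big_mkord tau_sum !mulr_sumr !fn_sum; apply: eq_bigr => i _.
by rewrite tauZ -!scalerAr !fnZ hv'.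
Qed.

Lemma tau_lc (a : {set E} -> R) G : C \subset G -> (forall c, 0 < a c) -> exists b : E -> R,
  (* The coefficients b must be positive on every point, including those outside all blocks, where
     the value 1 will be taken. *)
  (forall x, 0 < b x) /\ tau (lc a G) = ls b S.
Proof.
move=> CG a0; pose b x := \sum_(c in C | x \in c) a c + (x \notin cover C)%:R.
have bE c x : c \in C -> x \in c -> b x = a c.
  move=> cC xc; rewrite /b (bigD1 c) ?cC //= big1 => [|c' /andP[/andP[h1 h2] ne]]; last first.
    by move: ne; rewrite (disC h1 cC h2 xc) eqxx.
  have -> : x \in cover C by apply/bigcupP; exists c.
  by rewrite !addr0.
exists b; split=> [x|].
  case: (boolP (x \in cover C)) => [/bigcupP[c cC xc]|h]; first by rewrite (bE c).
  by rewrite /b h big1 ?add0r ?ltr01 // => c /andP[cC xc]; case/bigcupP: h; exists c.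
rewrite /lc tau_sum (bigID (mem C)) /= addrC big1 ?add0r => [|c /andP[_ h]]; last first.
  by rewrite tauZ tau_hv (negPf h) scaler0.
rewrite /ls (partition_big (fun x => odflt set0 [pick c in C | x \in c]) (mem C)) /=; last first.
  move=> x xS; case: pickP => [c /andP[]//|h]; have [c cC xc] := covS xS.
  by have := h c; rewrite cC xc.
apply: eq_big => [c|c /andP[_ cC]]; first by rewrite andb_idl // => /(subsetP CG).
rewrite tauZ tau_hv cC /ls1 scaler_sumr; apply: eq_big => [x|x].
  rewrite inE; case: (boolP (x \in S)) => //= xS; case: pickP => [c' /andP[h1 h2]|h] /=.
    by apply/idP/eqP => [h|<-//]; apply: (disC h1 cC h2 h).
  by have [c' h1 h2] := covS xS; have := h c'; rewrite h1 h2.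
by rewrite inE => /andP[_ xc]; rewrite (bE c).
Qed.
End Tau.

(** The singletons and the blocks form a building set. Rank one kills the variables of the
    singletons, and each block contributes a projective space of dimension one less than its
    size. *)
Theorem HR_boolean D r C : mat D r -> (forall A, r A = #|A :&: D|) -> comps D r C ->
  exists G, [/\ built D r G, maxset G = C & HRall R r G (topdeg r G)].
Proof.
move=> M rE cC; pose G := sings D :|: C.
have flA A : A \subset D -> fl D r A.
  move=> AD; apply: flP => // x xD; rewrite !rE (setIidPl AD) (setIidPl _) ?subUset ?sub1set ?xD //.
  by rewrite cardsU1; case: (x \in A) => //; lia.
have CD c : c \in C -> c \subset D by move=> /(c_sep cC)/andP[].
have inG X : X \in G -> (exists2 x, x \in D & X = [set x]) \/ X \in C.
  by rewrite in_setU => /orP[/imsetP[x xD ->]|]; [left; exists x | right].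
have GD X : X \in G -> X \subset D by move=> /inG[[x xD ->]|/CD//]; rewrite sub1set.
have CG c : c \in C -> c \in G by rewrite in_setU orbC => ->.
have G0 X : X \in G -> X != set0.
  by move=> /inG[[x xD ->]|/(c_n0 cC)//]; apply/set0Pn; exists x; rewrite inE.
have maxC X Y : X \in C -> Y \in G -> X \subset Y -> Y = X.
  move=> hX /inG[[y yD ->]|hY] s; have [x xX] := set0Pn _ (c_n0 cC hX).
    have /set1P e := subsetP s _ xX; apply/eqP; rewrite eqEsubset s sub1set -e xX //.
  exact: (c_disj cC hY hX (subsetP s _ xX) xX).
have bG : built D r G.
  split=> //.
  - by move=> X /GD/flA.
  - move=> x xD; exists [set x]; last by rewrite rE (setIidPl _) ?sub1set // cards1 !inE eqxx.
    by rewrite in_setU imset_f.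
  - move=> X Y hX hY /set0Pn[x /setIP[xX xY]].
    have clA A : A \in G -> clD D r A \in G by move=> h; rewrite (cl_eq M (subxx _) (flA _ (GD _ h))).
    have /inG[[y yD e]|XC] := hX.
      by rewrite (setUidPr _) ?clA //; move: xX; rewrite e => /set1P <-; rewrite sub1set.
    have /inG[[y yD e]|YC] := hY.
      by rewrite (setUidPl _) ?clA //; move: xY; rewrite e => /set1P <-; rewrite sub1set.
    by rewrite (c_disj cC XC YC xX xY) setUid clA.
  - move=> F X /fl_sub FD /in_fac[_ XF _]; rewrite /sep XF !rE (setIidPl FD) (setIidPl (subset_trans XF FD)).
    rewrite (setIidPl (subset_trans (subsetDl _ _) FD)) cardsD (setIidPr XF).
    by have := subset_leq_card XF => h /=; apply/eqP; move: h; clear; lia.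
have mG : maxset G = C.
  apply/setP => X; apply/in_maxset/idP => [[XG mX]|XC]; last by split; [exact: CG | move=> Y; apply: maxC].
  have [x xX] := set0Pn _ (G0 X XG); have [c hc xc] := c_cov cC (subsetP (GD _ XG) _ xX).
  have /inG[[y _ e]|//] := XG; rewrite -(mX c) ?CG // e; move: xX; rewrite e => /set1P <-; by rewrite sub1set.
exists G; split=> // a a0.
(* One point of each block is left out, so that the number of lines is the dimension of the
   projective space. *)
pose T := [set x in D | [exists c in C, [pick y in c] == Some x]].
pose S := D :\: T.
have cardS c : c \in C -> #|S :&: c| = #|c|.-1.
  move=> hc; have [x xc] := set0Pn _ (c_n0 cC hc).
  case e: [pick y in c] => [y|]; last by move: e; case: pickP => // /(_ x); rewrite xc.
  have yc : y \in c by move: e; case: pickP => // y' h [<-].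
  rewrite (cardsD1 y c) yc /=; apply: eq_card => z; rewrite !inE.
  case: (boolP (z \in c)) => zc; last by rewrite !andbF.
  have zD := subsetP (CD _ hc) _ zc; rewrite zD !andbT; congr (~~ _).
  apply/exists_inP/eqP => [[c' hc' /eqP e']|->]; last by exists c => //; rewrite e.
  have zc' : z \in c' by move: e'; case: pickP => // y' h [<-].
  by move: e'; rewrite (c_disj cC hc' hc zc' zc) e => -[].
have covS x : x \in S -> exists2 c, c \in C & x \in c by rewrite !inE => /andP[_ /(c_cov cC)].
have disC := c_disj cC.
pose d := topdeg r G.
have rC c : c \in C -> r c = #|c| by move=> hc; rewrite rE (setIidPl (CD _ hc)).
have cntC m X : supp m C -> X \in G -> cnt m X = sv m X.
  move=> sm XG; rewrite /cnt (eq_bigl (fun Y => Y \subset X)) // (@eq_cnt _ m _ (pred1 X)) => [|Y hY /=].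
    by rewrite big_pred1_eq.
  by apply/idP/eqP => [h|->//]; rewrite (maxC Y X) // (suppP _ _ sm).
have okE m : okm d r G m = fits C S m set0.
  apply/idP/andP => [h|[sm /forall_inP hs]].
    have /and3P[_ sG /dragP dr] := h; have sm : supp m C.
      apply/suppP => X hX; have /inG[[x xD e]|//] := suppP _ _ sG X hX.
      have := dr X; rewrite e rE (setIidPl _) ?sub1set // cards1 /= leqn0 /cnt (bigD1 [set x]) //=.
      by rewrite -e; move: hX; clear; lia.
    split=> //; apply/forall_inP => c hc; rewrite set0I cards0 addn0 cardS //.
    by rewrite -rC // -(okm_top M bG h) ?mG // cntC ?CG.
  have hs' c : c \in C -> sv m c = (r c).-1.
    by move=> hc; have := hs c hc; rewrite set0I cards0 addn0 cardS // rC // => /eqP.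
  have sG : supp m G by apply/suppP => X /(suppP _ _ sm); apply: CG.
  apply/and3P; split=> //.
    by rewrite (mdeg_top M bG sG) /d /topdeg mG; apply/eqP/eq_bigr => c hc; rewrite cntC ?CG ?hs'.
  apply: (drag_built M bG sG) => X XG; rewrite cntC //; case: (boolP (X \in C)) => [/hs' ->//|XC].
  by rewrite leqNgt; apply/negP => h; move: XC; rewrite (suppP _ _ sm) //; move: h; clear; lia.
have dS : d = #|S|.
  rewrite /d /topdeg mG -sum1_card (partition_big (fun x => odflt set0 [pick c in C | x \in c]) (mem C)) /=.
    apply: eq_bigr => c hc; rewrite rC // -cardS // -sum1_card; apply: eq_bigl => x.
    rewrite [x \in S :&: c]inE; case: (boolP (x \in S)) => //= xS; case: pickP => [c' /andP[h1 h2]|h] /=.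
      by apply/idP/eqP => [h|<-//]; apply: (disC _ _ _ h1 hc h2 h).
    by have [c' h1 h2] := covS _ xS; have := h c'; rewrite h1 h2.
  move=> x xS; case: pickP => [c /andP[]//|h]; have [c hc xc] := covS _ xS.
  by have := h c; rewrite hc xc.
pose K : R := (\prod_(c in C) (#|S :&: c|)`!)%N%:R.
have K0 : 0 < K by rewrite ltr0n prodn_gt0 // => c; apply: fact_gt0.
have sCG : C \subset G by apply/subsetP => c; apply: CG.
have [b [b0 eb]] := tau_lc covS disC sCG a0.
have Ki : 0 < K^-1 by rewrite invr_gt0.
rewrite -/d; apply: (@HRf_pullback R N (psi R S) (phi R d r G) d (lc a G) (ls b S) (tau C S) K^-1 Ki _ (@tauM C S) (@tau1 C S) (@tau_homog C S) eb (tau_adj covS disC)).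
  move=> q; pose g := fscale K^-1 (fmul (psi R S) 1).
  pose g' : fnl R N -> P -> R := fun f p => f p.
  rewrite (mpolyE q) tau_sum !fn_sum mulr_sumr; apply: eq_bigr => m _; rewrite tauZ !fnZ mulrCA; congr (_ * _).
  rewrite phiX okE -[tau _ _ _]mulr1 -(mpolyX0 _ R) -(mset0 E) psi_tau ?sub0set //.
  case: (boolP (fits _ _ _ _)) => [/andP[_ /forall_inP hf]|]; last by rewrite mul0r mulr0.
  rewrite mul1r; have -> : facts C m = (\prod_(c in C) (#|S :&: c|)`!)%N.
    by apply: eq_bigr => c hc; have := hf c hc; rewrite set0I cards0 addn0 => /eqP ->.
  by rewrite mulVf // gt_eqF.
by rewrite dS; apply: HR_psi.
Qed.
End Base.

End BooleanCase.
Import BooleanCase.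

(** * The induction for the Hodge-Riemann relations *)

Module HodgeRiemann.
Local Open Scope ring_scope.

Section Main.
Variables (R : rcfType) (E : finType).
Local Notation N := #|{: {set E}}|.
Local Notation P := {mpoly R[N]}.
Local Notation hv := (@hv R E).
Implicit Types (A B D S X Y Z T : {set E}) (C G : {set {set E}}) (r : {set E} -> nat) (m : 'X_{1..N}).

Lemma HR0 r G : HRall R r G 0.
Proof.
move=> c _ k u hk /dhomogP hu _; case: k hk hu => // _ hu.
have eu : u = u@_0%MM *: 1.
  apply/mpolyP => m; rewrite mcoeffZ mcoeff1; case: eqP => [->|m0]; first by rewrite mulr1.
  by rewrite mulr0; apply/eqP; rewrite mcoeff_eq0; apply/negP => /hu/eqP; rewrite mdeg_eq0 => /eqP.
have v1 : phi R 0 r G 1 = (okm 0 r G 0%MM)%:R by rewrite -mpolyX0 phiX.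
have e : phi R 0 r G (u * lc c G ^+ 0 * u) = u@_0%MM ^+ 2 * (okm 0 r G 0%MM)%:R.
  by rewrite expr0 mulr1 {1 2}eu -scalerAl -scalerAr mulr1 !fnZ v1 expr2 mulrA.
rewrite e expr0 mul1r mulr_ge0 ?ler0n ?sqr_ge0 //; split=> // /eqP.
rewrite mulf_eq0 sqrf_eq0 => /orP[/eqP z|ok0].
  by rewrite eu z scale0r; apply: rad0.
move=> v; rewrite eu -scalerAl mul1r fnZ (mpolyE v) fn_sum big1 ?mulr0 // => m _.
rewrite fnZ phiX; case: (boolP (okm _ _ _ _)) => [h|]; last by rewrite mulr0.
have /and3P[m0 _ _] := h; move: ok0; move: m0 h; rewrite mdeg_eq0 => /eqP -> ->.
by rewrite pnatr_eq0.
Qed.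

Definition HRbelow d := forall d' D r G, (d' < d)%N -> mat D r -> built D r G -> topdeg r G = d' -> HRall R r G d'.

Section Chain.
Variables (D : {set E}) (r : {set E} -> nat) (d : nat).
Hypothesis M : mat D r.
Hypothesis IH : HRbelow d.

Lemma HR_stars G Z d' : d = d'.+1 -> built D r G -> topdeg r G = d -> Z \in G -> Z \notin maxset G ->
  HRall R (rs r Z) (Gs D r G Z) d'.
Proof.
move=> ed bG td ZG nZ; have fZ := b_fl bG ZG; have [Ej hE ZE] := maxset_above ZG.
have ZEp : Z \proper Ej by rewrite properEneq ZE andbT; apply: contra nZ => /eqP ->.
apply: (IH (D := D)); first by rewrite ed.
- exact: mat_star.
- exact: built_star.
have := topdeg_star1 M bG hE ZEp ZG; rewrite td ed; lia.
Qed.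

(** An equivalence, so that any two building sets with the same maximal elements can be compared
    through the largest one. The stars used by each flip have smaller degree. *)
Lemma HR_chain G : built D r G -> topdeg r G = d ->
  HRall R r G d <-> HRall R r (flatsin D r (maxset G)) d.
Proof.
have [n] := ubnP #|flatsin D r (maxset G) :\: G|; elim: n G => [G|n IHn G hn bG td]; first by rewrite ltn0.
case: (eqVneq G (flatsin D r (maxset G))) => [e|ne]; first by rewrite -e; exact: iff_refl.
have [T [Ej [T1 [T2 [[Tin TG hE TE] [facT neT rT eT bGp]]]]]] := flip M bG ne.
have fT : fl D r T by move: Tin; rewrite inE => /and3P[].
have T0 : T != set0 by move: Tin; rewrite inE => /and3P[].
have mG := maxset_flip M bG TG hE TE T0.
have tdp : topdeg r (T |: G) = d by rewrite /topdeg mG.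
have h1 : (0 < r T1)%N.
  have : T1 \in maxG_le G T by rewrite facT !inE eqxx.
  by case/in_fac => T1G _ _; apply: (b_rgt0 M bG).
have h2 : (0 < r T2)%N.
  have : T2 \in maxG_le G T by rewrite facT !inE eqxx orbT.
  by case/in_fac => T1G _ _; apply: (b_rgt0 M bG).
have tds := topdeg_star2 M bG hE TE fT facT neT rT.
have [d' ed] : exists d', d = d'.+2 by exists (topdeg (rs r T) (Gs D r G T)); rewrite -td tds; lia.
have hrt : HRall R (rs r T) (Gs D r G T) d'.
  apply: (IH (D := D)); first by rewrite ed.
  - exact: mat_star.
  - exact: built_star.
  by move: tds; rewrite td ed; lia.
have tdG : topdeg r G = d'.+2 by rewrite td.
have sG Z : Z \in G -> Z \notin maxset G -> HRall R (rs r Z) (Gs D r G Z) d'.+1 by apply: HR_stars.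
have sGp Z : Z \in T |: G -> Z \notin maxset (T |: G) -> HRall R (rs r Z) (Gs D r (T |: G) Z) d'.+1.
  by apply: HR_stars.
have := flip_HRall M bG hE TE TG fT facT neT rT eT bGp tdG sG sGp hrt; rewrite -ed => ->.
rewrite -mG; apply: IHn => //; rewrite mG -ltnS; apply: leq_trans hn.
rewrite ltnS; apply: proper_card; apply/properP; split; first by apply: setDS; apply: subsetUr.
by exists T; rewrite !inE ?eqxx ?TG //; move: Tin; rewrite inE.
Qed.

Lemma HR_same G G' : built D r G -> built D r G' -> maxset G = maxset G' -> topdeg r G = d ->
  HRall R r G d -> HRall R r G' d.
Proof.
move=> bG bG' mG td h; have td' : topdeg r G' = d by rewrite /topdeg -mG.
by apply: ((HR_chain bG' td').2); rewrite -mG; exact: ((HR_chain bG td).1 h).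
Qed.
End Chain.

Lemma setD1id (I : finType) (W : {set I}) j : j \notin W -> W :\ j = W.
Proof. by move=> h; apply/setDidPl; rewrite disjoint_sym disjoints1. Qed.

Section Deletion.
Variables (D : {set E}) (r : {set E} -> nat) (C : {set {set E}}) (i : E).
Hypothesis M : mat D r.
Hypothesis cC : comps D r C.
Hypothesis iD : i \in D.
Hypothesis ri : r (D :\ i) = r D.
Local Notation D' := (D :\ i).
Definition rdel (A : {set E}) := r (A :\ i).
Local Notation C' := [set c :\ i | c in C].
Local Notation G1 := (Gm D r C i).
Local Notation G' := (flatsin D' rdel C').
Local Notation G0 := (G1 :\ [set i]).
Local Notation rho := (fun X => X :\ i).

Lemma mat_del : mat D' rdel.
Proof.
split; rewrite /rdel.
- by move=> A; apply: leq_trans (m_card M _) _; apply: subset_leq_card; apply: subsetDl.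
- by move=> A B AB; apply: (m_mono M); apply: setSD.
- by move=> A B; rewrite setDUl setDIl; apply: (m_sub M).
- move=> x; rewrite !inE => /andP[xi xD]; rewrite (_ : [set x] :\ i = [set x]) ?(m_sing M) //.
  by apply/setP => y; rewrite !inE; case: (eqVneq y x) => [->|]; rewrite ?andbF ?xi.
- move=> A; rewrite -(m_out M (A :\ i)); congr r; apply/setP => y; rewrite !inE.
  by case: (y == i); rewrite ?andbF // andbA.
Qed.

Lemma r_delc c : c \in C -> r (c :\ i) = r c.
Proof.
move=> hc; case: (boolP (i \in c)) => ic; last by rewrite setD1id.
have sc := c_sep cC hc; have /andP[cD /eqP e] := sc.
have := sep_split M sc (subsetDl D [set i]); rewrite ri e.
have -> : D' :&: c = c :\ i.
  by apply/setP => y; rewrite !inE; case: (boolP (y \in c)) => [/(subsetP cD) ->|]; rewrite ?andbF ?andbT.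
have -> : D' :\: c = D :\: c.
  by apply/setP => y; rewrite !inE; case: (eqVneq y i) => [->|]; rewrite ?ic.
lia.
Qed.

Lemma nocl c : c \in C -> ~~ coloop r c i.
Proof. by move=> hc; apply/negP => /and3P[_ _]; rewrite r_delc ?ltnn. Qed.

Lemma c_del_n0 c : c \in C -> c :\ i != set0.
Proof.
move=> hc; apply/eqP => e; have := r_delc hc; rewrite e (r0 M).
have [x xc] := set0Pn _ (c_n0 cC hc).
have xD : x \in D by have /andP[/subsetP s _] := c_sep cC hc; apply: s.
by have := r_gt0 M xc xD; case: (r c).
Qed.

Lemma comps_del : comps D' rdel C'.
Proof.
split.
- by move=> _ /imsetP[c hc ->]; apply: c_del_n0.
- move=> _ /imsetP[c hc ->]; have /andP[cD /eqP e] := c_sep cC hc.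
  rewrite /sep setSD //= /rdel; have id2 A : A :\ i :\ i = A :\ i by rewrite setDDl setUid.
  have -> : D' :\: (c :\ i) :\ i = (D :\: c) :\ i.
    by apply/setP => y; rewrite !inE; case: (y == i); rewrite ?andbF ?andbT.
  rewrite !id2 (r_delc hc) ri; have h1 : (r ((D :\: c) :\ i) <= r (D :\: c))%N by rewrite (m_mono M) ?subsetDl.
  have h2 := rU M (c :\ i) ((D :\: c) :\ i).
  have e2 : (c :\ i) :|: ((D :\: c) :\ i) = D'.
    apply/setP => y; rewrite !inE; case: (boolP (y \in c)) => [/(subsetP cD) ->|]; by rewrite ?andbF ?andbT ?orbF.
  rewrite e2 ri (r_delc hc) in h2; move: h1 h2 e; clear; lia.
- move=> x; rewrite !inE => /andP[xi xD]; have [c hc xc] := c_cov cC xD.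
  by exists (c :\ i); [apply: imset_f | rewrite !inE xi].
- move=> _ _ x /imsetP[c hc ->] /imsetP[c' hc' ->]; rewrite !inE => /andP[_ h1] /andP[_ h2].
  by rewrite (c_disj cC hc hc' h1 h2).
Qed.

Lemma flatsin_Gm : G' = Gm D' rdel C' i.
Proof.
apply/setP => X; rewrite !inE; case: (boolP (fl _ _ _)) => //= fX; congr (_ && _).
rewrite (_ : ~~ coloop _ _ _) ?andbT //; apply/negP => /andP[iX _].
by have := subsetP (fl_sub fX) _ iX; rewrite !inE eqxx.
Qed.

Lemma built_del : built D' rdel G'.
Proof. by rewrite flatsin_Gm; apply: built_Gm; [apply: mat_del | apply: comps_del]. Qed.

Lemma max_del : maxset G' = C'.
Proof.
rewrite flatsin_Gm; apply: max_Gm; [apply: mat_del | apply: comps_del|].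
by move=> _ /imsetP[c hc ->]; apply/negP => /andP[]; rewrite !inE eqxx.
Qed.

Lemma topdeg_del : topdeg rdel G' = topdeg r G1.
Proof.
rewrite /topdeg max_del (max_Gm M cC nocl) big_imset /= => [|c c' hc hc' e].
  by apply: eq_bigr => c hc; rewrite /rdel setDDl setUid r_delc.
have [x xc] := set0Pn _ (c_del_n0 hc); have xc' : x \in c' :\ i by rewrite -e.
by move: xc xc'; rewrite !inE => /andP[_ h1] /andP[_ h2]; apply: (c_disj cC hc hc' h1 h2).
Qed.

Let GmP X : X \in G1 -> [/\ fl D r X, X != set0, exists2 c, c \in C & X \subset c & ~~ coloop r X i].
Proof. by rewrite inE => /and4P[h1 h2 /exists_inP h3 h4]. Qed.

Lemma cl_delG Y : Y \in G' -> [/\ clD D r Y \in G0, clD D r Y :\ i = Y, Y \subset D & i \notin Y].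
Proof.
rewrite inE => /and3P[fY Y0 /exists_inP[_ /imsetP[c hc ->] Yc]].
have YD' := fl_sub fY; have iY : i \notin Y by apply/negP => /(subsetP YD'); rewrite !inE eqxx.
have YD : Y \subset D by apply: subset_trans YD' (subsetDl _ _).
have YW := sub_clD r YD; set W := clD D r Y in YW *.
have Yi : Y :\ i = Y by apply: setD1id.
have eW : W :\ i = Y.
  apply/eqP; rewrite eqEsubset; apply/andP; split; apply/subsetP => x.
    rewrite !inE => /and3P[xi xD /eqP h]; apply: (fl_in fY); first by rewrite !inE xi.
    rewrite /rdel Yi -h; congr r; apply/setP => y; rewrite !inE.
    by case: (eqVneq y i) => [->|] //=; rewrite (negPf iY) orbF eq_sym (negPf xi).
  move=> xY; rewrite !inE (subsetP YD _ xY) (setUidPr _) ?sub1set // eqxx !andbT.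
  by apply: contraNneq iY => <-.
have [x xY] := set0Pn _ Y0; have xW := subsetP YW _ xY.
split=> //; rewrite in_setD1; apply/andP; split.
  by apply/eqP => e; move: xW; rewrite e => /set1P e'; move: iY; rewrite -e' xY.
rewrite inE (fl_cl M YD) /=; apply/and3P; split; first by apply/set0Pn; exists x.
  apply/exists_inP; exists c => //; apply: (cl_min M _ (fl_comp M cC hc)).
  exact: subset_trans Yc (subsetDl _ _).
by apply/negP => /and3P[_ _]; rewrite -/W eW /W (r_cl M YD) ltnn.
Qed.

Lemma rho_G0 X : X \in G0 -> X :\ i \in G'.
Proof.
rewrite in_setD1 => /andP[Xi /GmP[fX X0 [c hc Xc] _]]; rewrite inE; apply/and3P; split.
- apply: flP; first by rewrite setSD // (fl_sub fX).
  move=> x; rewrite !inE => /andP[xi xD]; rewrite /rdel setDDl setUid => h.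
  rewrite xi /=; apply: (fl_in fX xD); apply: (r_addmono M (subsetDl X [set i])).
  rewrite -h; congr r; apply/setP => y; rewrite !inE.
  by case: (eqVneq y i) => [->|] //=; rewrite orbF eq_sym (negPf xi).
- apply: contra Xi => /eqP e; rewrite eqEsubset; apply/andP; split; first by rewrite -setD_eq0 e.
  have [x xX] := set0Pn _ X0; rewrite sub1set; case: (eqVneq x i) => [<-//|xi].
  have : x \in X :\ i by rewrite !inE xi.
  by rewrite e inE.
by apply/exists_inP; exists (c :\ i); [apply: imset_f | apply: setSD].
Qed.

Lemma image_G0 : G' = [set rho X | X in G0].
Proof.
apply/setP => Y; apply/idP/imsetP => [/cl_delG[h1 h2 _ _]|[X hX ->]]; last exact: rho_G0.
by exists (clD D r Y).
Qed.

(** Closure matches the sets of the deletion with those of G1 without changing ranks. If X \ i lies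
    below Y then X lies below the closure of Y, since i is not a coloop of X. *)
Lemma okm_del d m : okm d r G1 m = supp m G0 && okm d rdel G' (push rho m).
Proof.
have bG1 := built_Gm i M cC.
case: (boolP (supp m G0)) => s0 /=; last first.
  apply/negP => /and3P[_ s1 /dragP dr]; have H := dr [set i]; case/negP: s0; apply/suppP => X hX.
  rewrite in_setD1 (suppP _ _ s1 _ hX) andbT; apply/eqP => e; move: H; rewrite (m_sing M iD) /= leqn0.
  by rewrite /cnt (bigD1 [set i]) //= -e; move: hX; clear; lia.
have s1 : supp m G1 by apply/suppP => X /(suppP _ _ s0); rewrite in_setD1 => /andP[].
have sp : supp (push rho m) G' by apply: supp_push s0 => X; apply: rho_G0.
rewrite /okm mdeg_push s1 sp; congr (_ && _); rewrite /=; apply/idP/idP => [/dragP dr|/dragP dr].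
  apply: (drag_built mat_del built_del sp) => Y YG; have [h1 h2 YD iY] := cl_delG YG.
  have Yi : Y :\ i = Y by apply: setD1id.
  rewrite /rdel Yi -(r_cl M YD); apply: leq_trans (dr _).
  rewrite cnt_push; apply: leq_cnt => X hX XY.
  have := suppP _ _ s0 X hX; rewrite in_setD1 => /andP[Xi /GmP[fX X0 _ nc]].
  have XYi : X :\ i \subset clD D r Y by apply: subset_trans XY (sub_clD r YD).
  case: (boolP (i \in X)) => iX; last by rewrite (setD1id iX) in XYi.
  rewrite -(setD1K iX) subUset XYi sub1set andbT inE iD /=; apply/eqP.
  apply: (r_addmono M XY); rewrite setD1K //.
  have : (r X <= r (X :\ i))%N by rewrite leqNgt; move: nc; rewrite /coloop iX Xi.
  by have := m_mono M (subsetDl X [set i]); clear; lia.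
apply: (drag_built M bG1 s1) => X XG; apply: leq_trans (leq_trans (dr (X :\ i)) _).
  by rewrite cnt_push; apply: leq_cnt => W _ WX; apply: setSD.
by rewrite /rdel setDDl setUid; have := m_mono M (subsetDl X [set i]); clear; lia.
Qed.

(** The deletion sees every variable of G1 except that of {i}; when present, the latter has rank one
    and lies in the radical, so adding it changes nothing. *)
Lemma HR_del d : HRall R rdel G' d.+1 -> topdeg r G1 = d.+1 -> HRall R r G1 d.+1.
Proof.
move=> hr td a a0; have bG1 := built_Gm i M cC.
have e q : phi R d.+1 r G1 q = phi R d.+1 rdel G' (sb rho G0 q).
  rewrite (mpolyE q) sb_sum !fn_sum; apply: eq_bigr => m _; rewrite sbZ !fnZ sbX phiX okm_del.
  by case: ifP => _; rewrite ?phiX ?fn0.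
have h := HR_sub image_G0 e hr a0.
case: (boolP ([set i] \in G1)) => hi; last first.
  by move: h; rewrite (setD1id hi).
have -> : lc a G1 = lc a G0 + a [set i] *: hv [set i].
  by rewrite /lc -{1}(setD1K hi) big_setU1 ?inE ?eqxx //= addrC.
apply: HRf_rad h; apply: radZ => v; apply: phi_pt => //; exact: (m_sing M iD).
Qed.
End Deletion.

(** Induction on the degree, then on the ground set: deleting a non-coloop keeps the degree, and
    [HR_same] allows the building set to be chosen in both cases. *)
Theorem HR_main d D r G : mat D r -> built D r G -> topdeg r G = d -> HRall R r G d.
Proof.
have [n] := ubnP d; elim: n d D r G => // n IHn d D r G hd M bG td.
have IH : HRbelow d by move=> d' D' r' G'' hd'; apply: IHn; apply: leq_trans hd' _.
case: d hd td IH => [|d] hd td IH; first by move=> *; apply: HR0.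
have [q] := ubnP #|D|; elim: q D r G M bG td => // q IHq D r G M bG td hq.
have cC := comps_max M bG.
case: (boolP [exists i in D, r (D :\ i) == r D]) => [/exists_inP[i iD /eqP ri]|no].
  have mG := max_Gm M cC (nocl M cC iD ri).
  have tdm : topdeg r (Gm D r (maxset G) i) = d.+1 by rewrite /topdeg mG.
  apply: (HR_same M IH (built_Gm i M cC) bG mG tdm).
  apply: (HR_del M cC iD ri) => //; apply: (IHq (D :\ i)).
  - exact: mat_del.
  - exact: built_del.
  - by rewrite topdeg_del.
  by move: hq; rewrite (cardsD1 i D) iD.
(* Every point is a coloop, so removing points one at a time drops the rank each time and the
   matroid is Boolean. *)
have rE A : r A = #|A :&: D|.
  rewrite -(m_out M); apply/eqP; rewrite eqn_leq (m_card M) /=.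
  have [k] := ubnP #|A :&: D|; elim: k (A :&: D) (subsetIr A D) => // k IHk B BD hk.
  have [->|[x xB]] := set_0Vmem B; first by rewrite cards0.
  have BxD : B :\ x \subset D by apply: subset_trans (subsetDl _ _) BD.
  have hx : (#|B :\ x| < k)%N by move: hk; rewrite (cardsD1 x B) xB.
  rewrite (cardsD1 x B) xB add1n; apply: leq_ltn_trans (IHk _ BxD hx) _.
  rewrite ltn_neqAle (m_mono M) ?subsetDl // andbT; apply/eqP => e.
  have xD := subsetP BD _ xB; case/negP: no; apply/exists_inP; exists x => //; apply/eqP.
  by have := @r_addmono _ _ _ M (B :\ x) (D :\ x) x (setSD _ BD); rewrite !setD1K // => ->.
have [GB [bB mB hB]] := HR_boolean R M rE cC.
have tB : topdeg r GB = d.+1 by rewrite /topdeg mB.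
by apply: (HR_same M IH bB bG mB tB); rewrite -tB.
Qed.
End Main.

End HodgeRiemann.
Import HodgeRiemann.

(** * Star classes and their restriction to other stars *)

Module StarClasses.
Local Open Scope ring_scope.

Arguments HR.phs : simpl never.
Arguments HR.phi : simpl never.
Arguments HR.sb : simpl never.

Section Classes.
Variables (R : rcfType) (E : finType).
Local Notation N := #|{: {set E}}|.
Local Notation P := {mpoly R[N]}.
Local Notation hv := (@hv R E).
Local Notation phi := (@phi R E).
Local Notation phs := (@phs R E).
Local Notation sb := (@sb R E).
Implicit Types (A D S T V W X Y Z : {set E}) (B G : {set {set E}}) (r : {set E} -> nat) (m : 'X_{1..N}).

(* [y Z] represents restriction to the star of [Z]. *)
Definition starcl D r d G (y : {set E} -> P) := forall Z, Z \in G -> Z \notin maxset G ->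
  forall q, phs D r d Z G q = phi d.+1 r G (y Z * q).

Lemma starcl_exists D r d G : mat D r -> built D r G -> topdeg r G = d.+1 ->
  exists y, starcl D r d G y /\ forall Z, y Z \is 1.-homog.
Proof.
move=> M bG td; have h Z : exists y : P, (Z \in G -> Z \notin maxset G -> forall q, phs D r d Z G q = phi d.+1 r G (y * q)) /\ y \is 1.-homog.
  case: (boolP ((Z \in G) && (Z \notin maxset G))) => [/andP[ZG nZ]|no]; last first.
    by exists 0; split=> [h1 h2|]; [rewrite h1 h2 in no | apply: rpred0].
  have [b hb] := phs_mul R M bG td ZG nZ.
  exists (- hv Z + \sum_(W in G | Z \proper W) b W *: hv W); split=> //.
  by rewrite rpredD ?rpredN ?hv_homog // rpred_sum // => W _; rewrite rpredZ // hv_homog.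
have [y hy] := fin_all_exists h; exists y; split=> [Z ZG nZ q|Z]; first exact: (hy Z).1.
exact: (hy Z).2.
Qed.

Lemma setD1idN (I : finType) (U : {set I}) j : j \notin U -> U :\ j = U.
Proof. by move=> h; apply/setDidPl; rewrite disjoint_sym disjoints1. Qed.

(** Variables outside the image are killed, so a test polynomial of the star may be lifted along a
    choice of preimages. *)
Lemma lift_kill d r (rho : {set E} -> {set E}) G (v' : P) :
  exists v, forall u, phi d r [set rho X | X in G] (u * v') = phi d r [set rho X | X in G] (u * sb rho G v).
Proof.
set G' := [set rho X | X in G]; pose s Y := odflt set0 [pick X in G | rho X == Y].
have sP Y : Y \in G' -> s Y \in G /\ rho (s Y) = Y.
  move=> /imsetP[X XG ->]; rewrite /s; case: pickP => [X' /andP[h /eqP e]//|/(_ X)].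
  by rewrite XG eqxx.
exists (sb s G' v') => u; rewrite [LHS]phi_kill; congr (phi _ _ _ (_ * _)).
rewrite (mpolyE v') (sb_sum id) (sb_sum s) (sb_sum rho); apply: eq_bigr => m _; rewrite !sbZ !sbX; congr (_ *: _).
case: ifPn => [h|_]; last by rewrite /HR.sb rmorph0.
rewrite sbX (supp_push _ h) => [|Y /sP[]//]; rewrite push_comp; congr 'X_[_].
by rewrite !push_eq // => X /(suppP _ _ h)/sP[].
Qed.

Section Pull.
Variables (D : {set E}) (r : {set E} -> nat) (G : {set {set E}}) (d : nat) (y : {set E} -> P) (W : {set E}).
Hypothesis M : mat D r.
Hypothesis bG : built D r G.
Hypothesis td : topdeg r G = d.+2.
Hypothesis hy : starcl D r d.+1 G y.
Hypothesis WG : W \in G.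
Hypothesis nW : W \notin maxset G.
Local Notation up := (up D r W).
Local Notation r' := (rs r W).
Local Notation G' := (Gs D r G W).
Local Notation F' := (phi d.+1 r' G').
Let fW : fl D r W. Proof. exact: (b_fl bG). Qed.
Let M' : mat D r'. Proof. exact: mat_star. Qed.
Let bG' : built D r' G'. Proof. exact: built_star. Qed.

Lemma proper_nmax Z (Ej : {set E}) : Z \proper Ej -> Ej \in G -> Z \notin maxset G.
Proof. by move=> h hE; apply/negP => /in_maxset[_ mZ]; have := h; rewrite (mZ Ej hE (proper_sub h)) properxx. Qed.

Lemma up_mono V Z : V \in G -> Z \in G -> ~~ (V \subset W) -> V \subset Z -> up V \subset up Z.
Proof.
move=> VG ZG nV VZ; have nZ : ~~ (Z \subset W) by apply: contra nV; apply: subset_trans.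
rewrite /M.up (negPf nV) (negPf nZ) setSD //.
apply: (cl_min M _ (fl_cl M (XZD bG fW ZG))).
exact: subset_trans (setSU _ VZ) (sub_clD r (XZD bG fW ZG)).
Qed.

Lemma in_comp V Z Ej : Z \in G -> Ej \in maxset G -> V \subset Z -> V \subset Ej -> V != set0 -> Z \subset Ej.
Proof.
move=> ZG hE VZ VE /set0Pn[x xV]; have [c hc Zc] := maxset_above ZG.
by rewrite (c_disj (comps_max M bG) hE hc (subsetP VE _ xV) (subsetP Zc _ (subsetP VZ _ xV))).
Qed.

Lemma max_nst Ej : Ej \in maxset G -> nst2 D r G Ej W.
Proof.
move=> hE; have /in_maxset[EG mE] := hE; rewrite /nst2; case: (boolP (W \subset Ej)) => h; rewrite ?orbT //=.
apply/orP; right; apply: contra h => cG; have s := sub_clD r (XZD bG fW EG).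
by rewrite -(mE _ cG (subset_trans (subsetUl _ _) s)) (subset_trans (subsetUr _ _) s).
Qed.

Lemma max_nsub Ej : Ej \in maxset G -> ~~ (Ej \subset W).
Proof. by move=> hE; apply: contra nW => h; have /in_maxset[_ mE] := hE; rewrite (mE _ WG h). Qed.

Lemma max_up Ej : Ej \in maxset G -> up Ej \in maxset G'.
Proof.
move=> hE; have /in_maxset[EG _] := hE; have [Ew hw WE] := maxset_above WG.
have [-> _ _] := up_nst M bG WG EG (max_nsub hE) (max_nst hE).
have WEp : W \proper Ew by rewrite properEneq WE andbT; apply: contra nW => /eqP ->.
by rewrite (maxset_star M bG fW hw WEp); apply/setUP; right; apply: imset_f.
Qed.

Lemma W_max : W \in maxset G'.
Proof.
have [Ew hw WE] := maxset_above WG.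
have WEp : W \proper Ew by rewrite properEneq WE andbT; apply: contra nW => /eqP ->.
rewrite (maxset_star M bG fW hw WEp); apply/setUP; left.
by apply/in_fac; split=> // Y _ h1 h2; apply/eqP; rewrite eqEsubset h1.
Qed.

Lemma td' : topdeg r' G' = d.+1.
Proof.
have [Ew hw WE] := maxset_above WG.
have WEp : W \proper Ew by rewrite properEneq WE andbT; apply: contra nW => /eqP ->.
by have := topdeg_star1 M bG hw WEp WG; rewrite td => -[].
Qed.

Let a Z q := phs D r d.+1 W G (y Z * q).
Let b Z' q := phs D r' d Z' G' (sb up G q).

Let phsE q : phs D r d.+1 W G q = F' (sb up G q). Proof. by []. Qed.

(** [phi_D] multiplied by the class of W; exchanging the two star classes moves the sum into the
    star of W. *)
Lemma phi_D_star V Ej q : V \in G -> Ej \in maxset G -> V \subset Ej ->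
  F' (hv (up Ej) * sb up G q) = F' (hv (up V) * sb up G q) + \sum_(Z in G | (V \subset Z) && (Z \proper Ej)) a Z q.
Proof.
move=> VG hE VE; have /in_maxset[EG mE] := hE; have := phi_D M bG td (y W * q) hE VG VE.
have sw p : phi d.+2 r G (p * (y W * q)) = phs D r d.+1 W G (p * q).
  by rewrite (hy WG nW); congr (phi _ _ _ _); ring.
have sE X : X \in G -> phs D r d.+1 W G (hv X * q) = F' (hv (up X) * sb up G q).
  by move=> XG; rewrite (phsE (hv X * q)) sbM sb_hv XG.
rewrite (sw (hv Ej)) (sw (hv V)) (sE Ej EG) (sE V VG) => ->; congr (_ + _); apply: eq_bigr => Z /andP[ZG /andP[_ ZE]].
have nZ : Z \notin maxset G by exact: proper_nmax ZE EG.
rewrite /a (hy WG nW (y Z * q)) (hy ZG nZ (y W * q)); congr (phi _ _ _ _); ring.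
Qed.

(** Going from large V to small, the unknown values are determined by a triangular system,
    [phi_D_star], and the expected values solve the same system by [phi_D] in the star of W. *)
Lemma pull_phs V q : V \in G -> V \notin maxset G -> V != W ->
  phs D r d.+1 W G (y V * q) = if nst2 D r G V W then phs D r' d (up V) G' (sb up G q) else 0.
Proof.
have [n] := ubnP (#|E| - #|V|); elim: n V => // n IH V hn VG nV neV; rewrite -/(a V q) -/(b (up V) q).
have [Ej hE VE] := maxset_above VG; have /in_maxset[EG mE] := hE.
have VEp : V \proper Ej by rewrite properEneq VE andbT; apply: contra nV => /eqP ->.
have IH' Z : Z \in G -> V \subset Z -> Z \proper Ej -> Z != V -> Z != W -> a Z q = if nst2 D r G Z W then b (up Z) q else 0.
  move=> ZG VZ ZE ne neW; apply: IH => //.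
    have h1 : (#|V| < #|Z|)%N by apply: proper_card; rewrite properEneq eq_sym ne.
    have h2 : (#|Z| <= #|E|)%N := max_card _; move: hn h1 h2; clear; lia.
  exact: proper_nmax ZE EG.
have hA := phi_D_star q VG hE VE.
have V0 := b_n0 bG VG.
case: (boolP (V \subset W)) => VW; last first.
  have upVG : up V \in G' by apply: imset_f.
  have hB := phi_D M' bG' td' (sb up G q) (max_up hE) upVG (up_mono VG EG VW VE).
  move: hA; rewrite hB => /addrI; pose A0 := [set Z in G | [&& V \subset Z, Z \proper Ej & nst2 D r G Z W]].
  have nsW Z : V \subset Z -> ~~ (Z \subset W) by move=> h; apply: contra VW; apply: subset_trans.
  have eA : [set Z' in G' | (up V \subset Z') && (Z' \proper up Ej)] = [set up Z | Z in A0].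
    apply/setP => Z'; rewrite inE; apply/andP/imsetP => [[ZG' /andP[VZ ZE]]|[Z]].
      have [Z [ZG VZ' nZ sZ eZ]] := up_lift M bG WG ZG' VG VW VZ; exists Z => //.
      rewrite inE ZG VZ' sZ andbT /= properEneq (in_comp ZG hE VZ' VE V0) andbT.
      by apply/eqP => e; move: ZE; rewrite -eZ e properxx.
    rewrite inE => /andP[ZG /and3P[VZ ZE sZ]] ->; split; first exact: imset_f.
    rewrite (up_mono VG ZG VW VZ) properEneq (up_mono ZG EG (nsW Z VZ) (proper_sub ZE)) andbT /=.
    apply/eqP => e; move: ZE; rewrite (up_inj M bG WG ZG EG (nsW Z VZ) (max_nsub hE) sZ (max_nst hE) e).
    by rewrite properxx.
  have -> : \sum_(Z in G' | (up V \subset Z) && (Z \proper up Ej)) phs D r' d Z G' (sb up G q) =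
     \sum_(Z in [set up Z | Z in A0]) b Z q.
    by rewrite -eA; apply: eq_bigl => Z; rewrite in_set.
  rewrite (big_imset (fun Z => b Z q)) /=; last first.
    move=> Z1 Z2; rewrite !inE => /andP[G1 /and3P[h1 _ s1]] /andP[G2 /and3P[h2 _ s2]].
    by apply: (up_inj M bG WG) => //; apply: nsW.
  rewrite [RHS](bigD1 V) /=; last by rewrite VG subxx.
  have -> : \sum_(Z | (Z \in G) && ((V \subset Z) && (Z \proper Ej)) && (Z != V)) a Z q =
      \sum_(Z in A0 :\ V) b (up Z) q.
    rewrite big_mkcond [RHS]big_mkcond; apply: eq_bigr => Z _; rewrite in_setD1 inE.
    case: (boolP (Z \in G)) => //= ZG; rewrite ?andbF //; case: (boolP (V \subset Z)) => //= VZ; rewrite ?andbF //.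
    case: (boolP (Z \proper Ej)) => //= ZE; rewrite ?andbF //; case: (boolP (Z == V)) => //= ne.
    by rewrite IH' //; apply: contraNneq VW => <-.
  case: (boolP (nst2 D r G V W)) => sV.
    have VA : V \in A0 by rewrite inE VG subxx VEp sV.
    by rewrite (big_setD1 V VA) => /addIr <-.
  have -> : A0 :\ V = A0 by apply: setD1idN; rewrite inE (negPf sV) !andbF.
  by move/eqP; rewrite -subr_eq0 opprD addrCA subrr addr0 oppr_eq0 => /eqP.
(* In the star, W is maximal, so the relation for V below W stops at W; it is compared with the
   difference of the relations for V and for W. *)
have sVW : nst2 D r G V W by rewrite /nst2 VW.
rewrite sVW (up_in D r VW).
have WE := in_comp WG hE VW VE V0.
have hA' := phi_D_star q WG hE WE; rewrite (up_in D r (subxx W)) in hA'.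
rewrite (up_in D r VW) in hA.
have VG' : V \in G' by rewrite -(up_in D r VW) imset_f.
have hB := phi_D M' bG' td' (sb up G q) W_max VG' VW.
move: hA; rewrite hA' hB -addrA => /addrI.
rewrite [RHS](bigID (fun Z => W \subset Z)) /= [X in _ + X = _](_ : _ = \sum_(Z | (Z \in G) && ((V \subset Z) && (Z \proper Ej)) && (W \subset Z)) a Z q); last first.
  apply: eq_bigl => Z; case: (Z \in G) => //=; case: (boolP (W \subset Z)) => h; rewrite ?andbF ?andbT //.
  by rewrite (subset_trans VW h).
rewrite [LHS]addrC => /addrI.
have VWp : V \proper W by rewrite properEneq neV.
have WEp : W \proper Ej by rewrite properEneq WE andbT; apply: contra nW => /eqP ->.
rewrite (bigD1 V) /=; last by rewrite VG' subxx VWp.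
rewrite [RHS](bigD1 V) /=; last by rewrite VG subxx VEp; move: VWp; rewrite properE => /andP[].
have -> : \sum_(Z | (Z \in G) && ((V \subset Z) && (Z \proper Ej)) && ~~ (W \subset Z) && (Z != V)) a Z q =
  \sum_(Z | (Z \in G') && ((V \subset Z) && (Z \proper W)) && (Z != V)) phs D r' d Z G' (sb up G q).
  rewrite big_mkcond [RHS]big_mkcond; apply: eq_bigr => Z _.
  case: (boolP (V \subset Z)) => VZ; rewrite ?andbF // andTb; case: (eqVneq Z V) => ne; rewrite ?andbF // !andbT.
  case: (boolP (Z \proper W)) => ZW.
    have ZWs := proper_sub ZW; have -> : (Z \in G') = (Z \in G).
      apply/idP/idP => [h|h]; last by rewrite -(up_in D r ZWs) imset_f.
      have [[//]|[Z0 [_ _ _ e]]] := in_Gs h; case/eqP: V0; apply/eqP; rewrite -subset0 -e subsetI VZ.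
      exact: VW.
    case: (boolP (Z \in G)) => //= ZG; rewrite (proper_trans ZW WEp) /= -/(b Z q).
    have -> /= : ~~ (W \subset Z) by move: ZW; rewrite properE => /andP[].
    rewrite IH' ?(proper_trans ZW WEp) //; first by rewrite /nst2 ZWs (up_in D r ZWs).
    by apply: contraTneq ZW => ->; rewrite properxx.
  have -> : [&& Z \in G', true & false] = false by rewrite !andbF.
  case: ifP => // /andP[/andP[ZG ZE] WZ].
  have neW : Z != W by apply: contraNneq WZ => ->.
  have nZW : ~~ (Z \subset W) by apply: contra ZW => h; rewrite properEneq neW.
  rewrite IH' // /nst2 (negPf nZW) (negPf WZ) /= (b_join bG ZG WG) //.
  have /set0Pn[x xV] := V0; apply/set0Pn; exists x; by rewrite inE (subsetP VZ) // (subsetP VW).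
by move/addIr <-.
Qed.

Lemma pull_rad (y' : {set E} -> P) V : starcl D r' d G' y' -> V \in G -> V \notin maxset G -> V != W ->
  (nst2 D r G V W -> up V \notin maxset G') ->
  rad F' (sb up G (y V) - (nst2 D r G V W)%:R *: y' (up V)).
Proof.
move=> hy' VG nV neV nmax p'; have [q hq] := lift_kill d.+1 r' up G p'.
rewrite hq mulrBl fnB -sbM -phsE pull_phs // -scalerAl fnZ.
by case: ifP => hn; rewrite ?mul0r ?subrr // mul1r (hy' (up V)) ?subrr ?imset_f ?nmax.
Qed.

Lemma up_nmax V : V \in G -> V \notin maxset G -> V != W -> nst2 D r G V W -> up V \notin maxset G'.
Proof.
move=> VG nV neV hn; have /set0Pn[x xu] := b_n0 bG' (imset_f up VG).
have [Ew hw WE] := maxset_above WG.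
have WEp : W \proper Ew by rewrite properEneq WE andbT; apply: contra nW => /eqP ->.
apply/negP; rewrite (maxset_star M bG fW hw WEp) => /setUP[/in_fac[h1 h2 h3]|/imsetP[X hX e]].
  have e := h3 W WG (subxx _) h2; case: (boolP (V \subset W)) => VW.
    by move: e neV; rewrite (up_in D r VW) => ->; rewrite eqxx.
  have [e' _ _] := up_nst M bG WG VG VW hn.
  by move: (subsetP h2 _ xu); move: xu; rewrite e' inE => /andP[/negP].
have /in_maxset[XG _] := hX; have [eX _ _] := up_nst M bG WG XG (max_nsub hX) (max_nst hX).
case: (boolP (V \subset W)) => VW.
  by move: xu; rewrite e inE; move: (up_in D r VW) e => -> e; rewrite -in_setD -e => xV; have := xV; rewrite e inE (subsetP VW).
have eV : V = X by apply: (up_inj M bG WG VG XG VW (max_nsub hX) hn (max_nst hX)); rewrite e eX.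
by move: nV; rewrite eV hX.
Qed.

Lemma up_injS V1 V2 : V1 \in G -> V2 \in G -> nst2 D r G V1 W -> nst2 D r G V2 W -> up V1 = up V2 -> V1 = V2.
Proof.
move=> G1 G2 s1 s2 e.
have key A (B : {set E}) : A \in G -> B \in G -> A \subset W -> ~~ (B \subset W) -> nst2 D r G B W -> up A = up B -> False.
  move=> AG BG AW BW sB; have [-> _ _] := up_nst M bG WG BG BW sB; rewrite (up_in D r AW) => eAB.
  have /set0Pn[x xA] := b_n0 bG AG; have := xA; rewrite eAB inE => /andP[/negP h _]; apply: h.
  exact: (subsetP AW).
case: (boolP (V1 \subset W)) => h1; case: (boolP (V2 \subset W)) => h2.
- by move: e; rewrite !up_in.
- by case: (key V1 V2).
- by case: (key V2 V1).
exact: (up_inj M bG WG).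
Qed.

Lemma rad_prod (I : finType) (Q : {pred I}) (f : fnl R N) (s t : I -> P) : (forall i, i \in Q -> rad f (s i - t i)) ->
  rad f (\prod_(i in Q) s i - \prod_(i in Q) t i).
Proof.
move=> h; apply: (big_ind2 (fun u v => rad f (u - v))) => //; first by rewrite subrr; apply: rad0.
move=> x1 x2 y1 y2 h1 h2; have -> : x1 * y1 - x2 * y2 = (x1 - x2) * y1 + x2 * (y1 - y2) by ring.
by apply: radD; [apply: radMr | apply: radMl].
Qed.

Lemma pull_prod (y' : {set E} -> P) B : starcl D r' d G' y' ->
  (forall V, V \in B -> [/\ V \in G, V \notin maxset G & V != W]) ->
  rad F' (sb up G (\prod_(V in B) y V) - \prod_(V in B) ((nst2 D r G V W)%:R *: y' (up V))).
Proof.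
move=> hy' hB; rewrite (big_morph _ (@sbM R E up G) (@sb1 R E up G)); apply: rad_prod => V hV.
by have [h1 h2 h3] := hB V hV; apply: pull_rad => // hn; apply: up_nmax.
Qed.

Lemma star_mul B q : phi d.+2 r G (y W * \prod_(V in B) y V * q) = F' (sb up G (\prod_(V in B) y V) * sb up G q).
Proof. by rewrite -mulrA -(hy WG nW) phsE sbM. Qed.

(** All pairs of a nested set are nested, so each class restricts to a class and distinct members
    keep distinct images. *)
Lemma face_step (y' : {set E} -> P) (S : {set {set E}}) q : starcl D r' d G' y' -> nst D r G S ->
  (forall V, V \in S -> V \notin maxset G) -> W \in S ->
  phi d.+2 r G (\prod_(V in S) y V * q) = F' (\prod_(V in [set up V | V in S :\ W]) y' V * sb up G q).
Proof.
move=> hy' nS nm WS; have /nstP[/subsetP SG _] := nS.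
have hB V : V \in S :\ W -> [/\ V \in G, V \notin maxset G & V != W].
  by rewrite in_setD1 => /andP[ne hV]; split; [apply: SG | apply: nm |].
have n2 V : V \in S :\ W -> nst2 D r G V W by rewrite in_setD1 => /andP[_ hV]; apply: (nst_pair nS).
have e0 := @big_setD1 P 1 *%R _ W S y WS; rewrite e0 star_mul (radW (pull_prod hy' hB)); congr (F' (_ * _)).
rewrite big_imset /=; last first.
  move=> V1 V2 h1 h2; have [g1 _ _] := hB _ h1; have [g2 _ _] := hB _ h2; apply: up_injS => //; exact: n2.
by apply: eq_bigr => V hV; rewrite n2 // scale1r.
Qed.
End Pull.

(** Restrict to the star of one member W. Either some other member is not nested with W and
    restricts to zero, or the other members are unchanged and their join, the old join minus W, is
    again a member there, in smaller degree. *)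
Theorem nonface_rad d D r G y B : mat D r -> built D r G -> topdeg r G = d.+1 -> starcl D r d G y ->
  (forall Z, y Z \is 1.-homog) -> (forall V, V \in B -> V \in G /\ V \notin maxset G) ->
  antichain B -> (1 < #|B|)%N -> clD D r (\bigcup_(V in B) V) \in G -> rad (phi d.+1 r G) (\prod_(V in B) y V).
Proof.
elim: d D r G y B => [|d IH] D r G y B M bG td hy hom hB /antiP aB cB JG.
  (* The functional has degree one here, while the product has at least two factors. *)
  have hp : (\prod_(V in B) y V) \is #|B|.-homog.
    rewrite -sum1_card; apply: (big_ind2 (fun (q : P) (j : nat) => q \is j.-homog)) => //; first exact: dhomog1.
    by move=> *; apply: dhomogM.
  move=> v; rewrite (mpolyE v) mulr_sumr fn_sum big1 // => m _; rewrite -scalerAr fnZ.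
  have hom' : \prod_(V in B) y V * 'X_[m] \is (#|B| + mdeg m).-homog by rewrite dhomogM // dhomogX.
  by rewrite (gradedP (phi_graded _ _ _) hom') ?mulr0 //; move: cB; clear; lia.
have [W WB] : exists W, W \in B by apply/set0Pn; rewrite -card_gt0; apply: ltnW.
have [WG nW] := hB W WB; have fW := b_fl bG WG.
have M' := mat_star M fW; have bG' := built_star M bG fW.
have [y' [hy' hom']] := starcl_exists M' bG' (td' M bG td WG nW).
have hB' V : V \in B :\ W -> [/\ V \in G, V \notin maxset G & V != W].
  by rewrite in_setD1 => /andP[ne /hB[]].
have e0 := @big_setD1 P 1 *%R _ W B y WB; rewrite e0 => q; rewrite (star_mul hy WG nW) (radW (pull_prod M bG td hy WG nW hy' hB')).
case: (boolP [forall V in B :\ W, nst2 D r G V W]) => [/forall_inP hn|]; last first.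
  rewrite negb_forall_in => /exists_inP[V hV hn].
  have -> : \prod_(V0 in B :\ W) ((nst2 D r G V0 W)%:R *: y' (up D r W V0)) = 0.
    by rewrite (bigD1 V) //= (negPf hn) scale0r mul0r.
  rewrite mul0r; exact: fn0.
have inc V : V \in B :\ W -> ~~ (V \subset W) /\ ~~ (W \subset V).
  rewrite in_setD1 => /andP[ne hV]; split; apply: contra ne => h; apply/eqP; first exact: aB.
  by rewrite (aB W V).
have pf V (hV : V \in B :\ W) := pair_fac M bG (let: And3 g _ _ := hB' V hV in g) WG (inc V hV).1 (inc V hV).2 (hn V hV).
have upV V : V \in B :\ W -> up D r W V = V.
  move=> hV; have [VG _ _] := hB' V hV; have [-> _ _] := up_nst M bG WG VG (inc V hV).1 (hn V hV).
  by have [_ _ _ h] := pf V hV; apply/setDidPl; rewrite -setI_eq0 h.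
rewrite (eq_bigr (fun V => y' V)) => [|V hV]; last by rewrite hn // scale1r upV.
have cB1 : #|B| = #|B :\ W|.+1 by rewrite (cardsD1 W B) WB.
set A := \bigcup_(V in B :\ W) V.
have eJ : \bigcup_(V in B) V = A :|: W by rewrite (big_setD1 W WB) /= setUC.
rewrite eJ in JG; set J := clD D r (A :|: W) in JG.
have AWD : A :|: W \subset D by rewrite -eJ; apply/bigcupsP => V /hB[/(b_subD bG)].
have AWJ : A :|: W \subset J := sub_clD r AWD.
have cB2 : (1 < #|B :\ W|)%N.
  rewrite ltnNge; apply/negP => c1; have /cards1P[V eV] : #|B :\ W| == 1%N by move: c1 cB1 cB; clear; lia.
  have hV : V \in B :\ W by rewrite eV inE.
  have := hn V hV; rewrite /nst2 (negPf (inc V hV).1) (negPf (inc V hV).2) /=.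
  by move: JG; rewrite /J /A eV big_set1 => ->.
have dW : A :&: W = set0.
  apply/setP => x; rewrite !inE; apply/negP => /andP[/bigcupP[V hV xV] xW].
  by have [_ _ _ /setP/(_ x)] := pf V hV; rewrite !inE xV xW.
have WJ : W \subset J := subset_trans (subsetUr _ _) AWJ.
have AJ : A \subset J :\: W.
  apply/subsetP => x xA; rewrite in_setD (subsetP AWJ) ?inE ?xA // andbT; apply/negP => xW.
  have : x \in A :&: W by rewrite inE xA.
  by rewrite dW inE.
have J'G : J :\: W \in Gs D r G W.
  apply/imsetP; exists J => //; rewrite /up; case: ifP => [h|_]; last first.
    by rewrite (setUidPl WJ) (cl_eq M (subxx _)) // (b_fl bG JG).
  have [V hV] : exists V, V \in B :\ W by apply/set0Pn; rewrite -card_gt0; apply: ltnW.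
  by case/negP: (inc V hV).1; apply: subset_trans h; apply: subset_trans AWJ; apply: subset_trans (subsetUl _ _); apply: bigcup_sup.
have VJ V : V \in B :\ W -> V \subset J :\: W by move=> hV; apply: subset_trans AJ; apply: bigcup_sup.
apply: (IH D (rs r W) (Gs D r G W) y' (B :\ W) M' bG' (td' M bG td WG nW) hy' hom') => //.
- move=> V hV; have [VG _ _] := hB' V hV; split; first by rewrite -(upV V hV) imset_f.
  apply/negP => /in_maxset[_ mV]; have [V1 [V2 [h1 h2 ne]]] := card_gt1P cB2.
  have eV := mV _ J'G (VJ V hV).
  have sub V' : V' \in B :\ W -> V' = V.
    move=> hV'; apply: aB; first by case/setD1P: hV'.
      by case/setD1P: hV.
    by rewrite -eV VJ.
  by move: ne; rewrite (sub V1) // (sub V2) // eqxx.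
- by apply/antiP => X Y; rewrite !in_setD1 => /andP[_ h1] /andP[_ h2]; apply: aB.
rewrite (cl_star_eq M fW AJ (b_fl bG' J'G)) //.
by rewrite (rs_out M dW) (rs_DZ M WJ) (r_cl M AWD).
Qed.
End Classes.

End StarClasses.
Import StarClasses.

(** * Independence of the admissible monomials *)

Module Independence.
Local Open Scope ring_scope.

Arguments HR.phs : simpl never.
Arguments HR.phi : simpl never.
Arguments HR.sb : simpl never.

Section Ind.
Variables (R : rcfType) (E : finType).
Local Notation N := #|{: {set E}}|.
Local Notation P := {mpoly R[N]}.
Local Notation phi := (@phi R E).
Local Notation phs := (@phs R E).
Local Notation sb := (@sb R E).
Implicit Types (A D S T V W X Y Z c : {set E}) (B G K : {set {set E}}) (r : {set E} -> nat) (m n : 'X_{1..N}).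

Definition SU m : {set {set E}} := [set X | (0 < sv m X)%N].
(** The condition of Feichtner and Yuzvinsky: nested support, each exponent below the rank gained
    over the smaller members of the support. *)
Definition adm D r G m := nst D r G (SU m) &&
  [forall X in SU m, (sv m X < r X - r (\bigcup_(Y in SU m | Y \proper X) Y))%N].
Definition mK r K : 'X_{1..N} := (\sum_(c in K) um c *+ (r c).-1)%MM.

Lemma sv_muln m e X : sv (m *+ e)%MM X = (sv m X * e)%N.
Proof. by rewrite /sv mulmnE. Qed.

Lemma sv_mK r K X : sv (mK r K) X = if X \in K then (r X).-1 else 0%N.
Proof.
rewrite /sv /mK mnm_sumE; have h c : ((um c *+ (r c).-1)%MM : 'X_{1..N}) (enum_rank X) = ((c == X) * (r c).-1)%N.
  by rewrite -/(sv (um c *+ _) X) sv_muln sv_um.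
case: ifP => XC.
  rewrite (bigD1 X) //= h eqxx mul1n big1 ?addn0 // => c /andP[_ /negPf ne].
  by rewrite h ne.
by rewrite big1 // => c cC; rewrite h; case: eqP => // e; rewrite -e cC in XC.
Qed.

Lemma mK_top d D r G : mat D r -> built D r G -> topdeg r G = d -> okm d r G (mK r (maxset G)).
Proof.
move=> M bG td; have sm : supp (mK r (maxset G)) G.
  by apply/suppP => X; rewrite sv_mK; case: ifP => // /in_maxset[].
have cE X : X \in G -> cnt (mK r (maxset G)) X = sv (mK r (maxset G)) X.
  move=> XG; rewrite /cnt (@eq_cnt _ _ _ (pred1 X)) ?big_pred1_eq // => Y.
  rewrite sv_mK; case: ifP => // /in_maxset[_ mY] _ /=; apply/idP/eqP => [h|->//].
  by rewrite (mY X XG h).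
apply/and3P; split=> //.
  rewrite (mdeg_top M bG sm) -td; apply/eqP/eq_bigr => X hX; have /in_maxset[XG _] := hX.
  by rewrite cE // sv_mK hX.
by apply: (drag_built M bG sm) => X XG; rewrite cE // sv_mK; case: ifP.
Qed.

(** The factor [mK r K] makes the induction go through: K collects the maximal elements already
    saturated, and the remaining variables are not below any of them. *)
Definition INDst k := forall d D r G K (u : P), mat D r -> built D r G -> topdeg r G = d -> K \subset maxset G ->
  (forall m, m \in msupp u -> [/\ adm D r G m, mdeg m = k & forall X c, (0 < sv m X)%N -> c \in K -> ~~ (X \subset c)]) ->
  rad (phi d r G) ('X_[mK r K] * u) -> u = 0.

Lemma IND0 : INDst 0.
Proof.
move=> d D r G K u M bG td KG hu hr.
have eu : u = u@_0%MM *: 1.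
  apply/mpolyP => m; rewrite mcoeffZ mcoeff1; case: eqP => [->|m0]; first by rewrite mulr1.
  rewrite mulr0; apply/eqP; rewrite mcoeff_eq0; apply/negP => /hu[_ h _].
  by apply: m0; apply/eqP; rewrite -mdeg_eq0 h.
have := hr 'X_[mK r (maxset G :\: K)]; rewrite eu -scalerAr mulr1 -scalerAl fnZ -mpolyXD.
have -> : (mK r K + mK r (maxset G :\: K))%MM = mK r (maxset G).
  apply: svP => X; rewrite svD !sv_mK in_setD; case: (boolP (X \in K)) => [/(subsetP KG) ->|] /=; by rewrite ?addn0.
by rewrite phiX (mK_top M bG td) mulr1 => ->; rewrite scale0r.
Qed.

Lemma pushD rho m n : push rho (m + n)%MM = (push rho m + push rho n)%MM.
Proof. by apply: svP => X; rewrite svD !sv_push -big_split; apply: eq_bigr => Y _; rewrite svD. Qed.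

Lemma cnt_muln m e X : cnt (m *+ e)%MM X = (cnt m X * e)%N.
Proof. by rewrite /cnt big_distrl; apply: eq_bigr => Y _; rewrite sv_muln. Qed.

Section Core.
Variables (k : nat).
Hypothesis IH : forall k', (k' < k)%N -> INDst k'.
Variables (d d1 : nat) (D : {set E}) (r r1 : {set E} -> nat) (G G1 K : {set {set E}}) (u y : P) (up : {set E} -> {set E}) (X : {set E}) (e : nat).
Hypothesis M1 : mat D r1.
Hypothesis bG1 : built D r1 G1.
Hypothesis td1 : topdeg r1 G1 = d1.
Hypothesis eG1 : G1 = [set up Z | Z in G].
Hypothesis KG1 : X |: K \subset maxset G1.
Hypothesis upK : forall c, c \in X |: K -> up c = c /\ r1 c = r c.
Hypothesis KG : X |: K \subset G.
Hypothesis XK : X \notin K.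
Hypothesis hyq : forall q, phi d1 r1 G1 (sb up G q) = phi d r G (y * q).
Hypothesis up_out : forall Z c, Z \in G -> c \in X |: K -> ~~ (Z \subset c) -> ~~ (up Z \subset c).
Hypothesis hu : forall m, m \in msupp u ->
  [/\ adm D r G m, mdeg m = k & forall Z c, (0 < sv m Z)%N -> c \in K -> ~~ (Z \subset c)].
Hypothesis hr : rad (phi d r G) ('X_[mK r K] * u).
Hypothesis Xmin : forall m Z, m \in msupp u -> (0 < sv m Z)%N -> Z \subset X -> Z = X.
Hypothesis e0 : (0 < e)%N.
Hypothesis emax : forall m, m \in msupp u -> (sv m X <= e)%N.
Hypothesis er : (e < r X)%N.
Definition red m := (m - um X *+ e)%MM.
Hypothesis adm_up : forall m, m \in msupp u -> sv m X = e -> adm D r1 G1 (push up (red m)).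
Hypothesis up_inj2 : forall m n, m \in msupp u -> n \in msupp u -> sv m X = e -> sv n X = e ->
  push up (red m) = push up (red n) -> m = n.
Variable m0 : 'X_{1..N}.
Hypothesis m0u : m0 \in msupp u.
Hypothesis m0e : sv m0 X = e.

Let redE m : sv m X = e -> m = (um X *+ e + red m)%MM.
Proof.
move=> h; rewrite /red addmC submK //; apply/mnm_lepP => i; rewrite mulmnE mnm1E.
by case: eqP => [<-|]; rewrite ?mul0n // mul1n -h.
Qed.

Let sv_red m Z : sv m X = e -> sv (red m) Z = if Z == X then 0%N else sv m Z.
Proof.
move=> h; have := congr1 (fun q => sv q Z) (redE h); rewrite svD sv_muln sv_um [X == Z]eq_sym.
by case: eqP => [->|_]; rewrite ?mul0n // h mul1n; clear; lia.
Qed.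

Let suppu m : m \in msupp u -> supp m G.
Proof.
move=> /hu[/andP[/nstP[h _] _] _ _]; apply/suppP => Z hZ; apply: (subsetP h); by rewrite inE.
Qed.

Let XG1 : X \in maxset G1. Proof. by apply: (subsetP KG1); rewrite !inE eqxx. Qed.
Let upX : up X = X. Proof. by have [] := upK (setU11 X K). Qed.
Let rX : r1 X = r X. Proof. by have [] := upK (setU11 X K). Qed.

Let push_um Z t : push up (um Z *+ t)%MM = (um (up Z) *+ t)%MM.
Proof.
apply: svP => V; rewrite sv_push sv_muln sv_um (big_mkcond (fun _ => _)) (bigD1 Z) //= big1 => [|Y ne].
  by rewrite addn0 sv_muln sv_um eqxx mul1n; case: eqP; rewrite ?mul0n ?mul1n.
by rewrite sv_muln sv_um [Z == Y]eq_sym (negPf ne) mul0n if_same.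
Qed.

Let push_mK : push up (mK r K) = mK r1 K.
Proof.
rewrite /mK (big_morph (push up) (pushD up) (_ : push up 0%MM = 0%MM)); last first.
  by apply: svP => Z; rewrite sv_push big1 /sv ?mnm0E // => Y _; rewrite /sv mnm0E.
apply: eq_bigr => c hc; rewrite push_um; have [] := upK (c := c); first by rewrite inE hc orbT.
by move=> -> ->.
Qed.

Let mKX : mK r1 (X |: K) = (mK r1 K + um X *+ (r X).-1)%MM.
Proof. by rewrite /mK big_setU1 //= addmC rX. Qed.

Let cntK : cnt (mK r1 K) X = 0%N.
Proof.
rewrite /cnt big1 // => Y YX; rewrite sv_mK; case: ifP => // hY.
have /in_maxset[_ mY] : Y \in maxset G1 by apply: (subsetP KG1); rewrite inE hY orbT.
have /in_maxset[XG _] := XG1; by move: XK; rewrite (mY X XG YX) hY.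
Qed.

Let cntX t : cnt (um X *+ t)%MM X = t.
Proof. by rewrite cnt_muln cnt_um subxx mul1n. Qed.

Let cnt_pm m : m \in msupp u -> cnt (push up m) X = sv m X.
Proof.
move=> hm; rewrite cnt_push (@eq_cnt _ _ _ (pred1 X)) ?big_pred1_eq // => Z hZ /=.
apply/idP/eqP => [h|->]; last by rewrite upX.
apply: (Xmin hm hZ); apply: contraLR h; apply: up_out (setU11 _ _); exact: (suppP _ _ (suppu hm)).
Qed.

Definition u1 : P := \sum_(m <- msupp u | sv m X == e) u@_m *: 'X_[push up (red m)].

(** X is maximal in the new structure, so a monomial contributes only if its count on X is exactly r
    X - 1. The test monomial is given r X - 1 - e copies of X, which selects the terms of u with the
    largest exponent e. *)
Lemma u1_rad : rad (phi d1 r1 G1) ('X_[mK r1 (X |: K)] * u1).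
Proof.
move=> v; rewrite (mpolyE v) mulr_sumr fn_sum big1 // => n _; rewrite -scalerAr fnZ.
have -> : phi d1 r1 G1 ('X_[mK r1 (X |: K)] * u1 * 'X_[n]) =
   \sum_(m <- msupp u | sv m X == e) u@_m * (okm d1 r1 G1 (mK r1 (X |: K) + push up (red m) + n)%MM)%:R.
  rewrite /u1 mulr_sumr mulr_suml fn_sum; apply: eq_bigr => m _.
  by rewrite -scalerAr -scalerAl fnZ -!mpolyXD phiX.
case: (boolP (supp n G1)) => sn; last first.
  by rewrite big1 ?mulr0 // => m _; rewrite /okm suppD (negPf sn) !andbF mulr0.
(* A test monomial with factors below X overfills the saturated X, and every term vanishes. *)
case: (posnP (cnt n X)) => cn; last first.
  rewrite big1 ?mulr0 // => m /eqP hm; case: (boolP (okm _ _ _ _)) => [h|]; last by rewrite mulr0.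
  rewrite -td1 in h; have := okm_top M1 bG1 h XG1; rewrite !cntD mKX cntD cntX rX; move: cn; clear; lia.
pose s Y := odflt set0 [pick Z in G | up Z == Y].
have sP Y : Y \in G1 -> s Y \in G /\ up (s Y) = Y.
  rewrite eG1 => /imsetP[Z ZG ->]; rewrite /s; case: pickP => [X' /andP[h /eqP e']//|/(_ Z)].
  by rewrite ZG eqxx.
pose n0 := push s n; have sn0 : supp n0 G by apply: (supp_push _ sn) => Y /sP[].
have en : push up n0 = n by rewrite push_comp push_eq // => Y /(suppP _ _ sn)/sP[].
pose t := ((r X).-1 - e)%N.
have := hr (y * 'X_[(um X *+ t + n0)%MM]).
have -> : 'X_[mK r K] * u * (y * 'X_[(um X *+ t + n0)%MM]) = y * (u * 'X_[(mK r K + (um X *+ t + n0))%MM]).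
  by rewrite [X in y * (u * X)]mpolyXD; ring.
rewrite -hyq {1}(mpolyE u) mulr_suml sb_sum fn_sum => h; transitivity (v@_n * 0); last by rewrite mulr0.
  congr (_ * _); apply: etrans h.
rewrite big_mkcond big_seq [RHS]big_seq; apply: eq_bigr => m hm.
rewrite -scalerAl -mpolyXD sbZ fnZ sbX.
have sK : supp (mK r K) G.
  by apply/suppP => Z; rewrite sv_mK; case: ifP => // hZ _; apply: (subsetP KG); rewrite inE hZ orbT.
have sX : supp (um X *+ t)%MM G.
  apply/suppP => Z; rewrite sv_muln sv_um; case: eqP => [<- _|//]; by apply: (subsetP KG); rewrite !inE eqxx.
case: (boolP (supp (m + (mK r K + (um X *+ t + n0)))%MM G)) => [_|/negP[]]; last first.
  by rewrite !suppD (suppu hm) sK sX sn0.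
rewrite phiX !pushD en push_mK push_um upX.
case: eqP => [he|he].
  congr (_ * (okm _ _ _ _)%:R); rewrite {2}(redE he) pushD push_um upX mKX.
  have -> : (r X).-1 = (e + t)%N by rewrite /t; move: er; clear; lia.
  apply: svP => Z; rewrite !svD !sv_muln mulnDr; clear; lia.
case: (boolP (okm _ _ _ _)) => [h'|]; last by rewrite mulr0.
rewrite -td1 in h'; have := okm_top M1 bG1 h' XG1; rewrite !cntD cntK cntX cn cnt_pm // rX.
have := emax hm; move: er he; rewrite /t; clear; lia.
Qed.

Lemma core : False.
Proof.
have u10 : u1 = 0.
  apply: (IH (k' := (k - e)%N) _ M1 bG1 td1 KG1 _ u1_rad).
    have [_ h _] := hu m0u; have : (e <= mdeg m0)%N by rewrite (redE m0e) mdegD -sum_sv (bigD1 X) //= sv_muln sv_um eqxx mul1n -addnA leq_addr.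
    by rewrite h; move: e0; clear; lia.
  move=> n; have [/hasP[m hm /andP[he /eqP ->]] _|/hasPn no] := boolP (has (fun m => (sv m X == e) && (n == push up (red m))) (msupp u)).
    move/eqP in he; split; [exact: adm_up | |].
      have [_ h _] := hu hm; rewrite mdeg_push -h {2}(redE he) mdegD.
      have -> : mdeg (um X *+ e)%MM = e by rewrite mdegMn mdeg1 mul1n.
      by clear; lia.
    move=> Z c; rewrite sv_push lt0n sum_nat_eq0 negb_forall => /existsP[Y].
    rewrite negb_imply -lt0n => /andP[/eqP <-]; rewrite sv_red //; case: eqP => // ne hY.
    have YG := suppP _ _ (suppu hm) Y hY.
    move=> hc; apply: up_out => //; case/setU1P: hc => [->|hc]; last by have [_ _ h3] := hu hm; apply: h3.
    by apply/negP => /(Xmin hm hY).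
  rewrite mcoeff_msupp /u1 raddf_sum big_seq_cond big1 ?eqxx //= => m /andP[hm he].
  by have := no m hm; rewrite he /= => ne; rewrite mcoeffZ mcoeffX eq_sym (negPf ne) mulr0.
have := congr1 (fun p : P => p@_(push up (red m0))) u10; rewrite mcoeff0 /u1 raddf_sum /=.
rewrite big_mkcond (bigD1_seq m0) ?msupp_uniq //= m0e eqxx mcoeffZ mcoeffX eqxx mulr1 big_seq_cond big1 ?addr0.
  by move/eqP; rewrite mcoeff_eq0 m0u.
move=> m /andP[hm ne]; case: eqP => //= he; rewrite mcoeffZ mcoeffX; case: eqP => [h|]; last by rewrite mulr0.
by move: ne; rewrite (up_inj2 hm m0u he m0e h) eqxx.
Qed.
End Core.

Lemma SU_red m X e : sv m X = e -> SU (red X e m) = SU m :\ X.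
Proof.
move=> h; apply/setP => Z; rewrite !inE /red /sv mnmBE mulmnE mnm1E (inj_eq enum_rank_inj) [X == Z]eq_sym.
by case: eqP => [->|_]; rewrite ?mul0n ?subn0 // mul1n -/(sv m X) h subnn.
Qed.

Lemma sv_redE m X e Z : sv m X = e -> sv (red X e m) Z = if Z == X then 0%N else sv m Z.
Proof.
move=> h; rewrite /red /sv mnmBE mulmnE mnm1E (inj_eq enum_rank_inj) [X == Z]eq_sym.
by case: eqP => [->|_]; rewrite ?mul0n ?subn0 // mul1n -/(sv m X) h subnn.
Qed.

Lemma admP D r G m : reflect (nst D r G (SU m) /\ forall X, (0 < sv m X)%N ->
   (sv m X < r X - r (\bigcup_(Y in SU m | Y \proper X) Y))%N) (adm D r G m).
Proof.
apply: (iffP andP) => -[h1 h2]; split=> //; last by apply/forall_inP => X; rewrite inE; apply: h2.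
by move=> X hX; move/forall_inP: h2; apply; rewrite inE.
Qed.

Section StarAdm.
Variables (D : {set E}) (r : {set E} -> nat) (G : {set {set E}}) (X : {set E}).
Hypothesis M : mat D r.
Hypothesis bG : built D r G.
Hypothesis XG : X \in G.
Hypothesis nX : X \notin maxset G.
Local Notation up := (up D r X).

Lemma sv_push_nst n W : (forall V, (0 < sv n V)%N -> V \in G /\ nst2 D r G V X) -> W \in G -> nst2 D r G W X ->
  sv (push up n) (up W) = sv n W.
Proof.
move=> h WG sW; rewrite sv_push (@eq_cnt _ n _ (pred1 W)) ?big_pred1_eq // => V /h[VG sV] /=.
by apply/eqP/eqP => [|->//]; apply: (up_injS M bG XG).
Qed.

Lemma SU_push n : (forall V, (0 < sv n V)%N -> V \in G /\ nst2 D r G V X) -> SU (push up n) = [set up V | V in SU n].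
Proof.
move=> h; apply/setP => Z; rewrite inE; apply/idP/imsetP => [|[V]]; last first.
  by rewrite inE => hV ->; have [h1 h2] := h V hV; rewrite sv_push_nst.
rewrite sv_push lt0n sum_nat_eq0 negb_forall => /existsP[V]; rewrite negb_imply -lt0n => /andP[/eqP <- hV].
by exists V; rewrite ?inE.
Qed.

(** The bound for Z survives contraction: if X is below Z, it is one of the smaller members and r X
    cancels; otherwise Z is a direct summand beside X and ranks over X are the old ones. *)
Lemma adm_star m e : adm D r G m -> sv m X = e -> (0 < e)%N ->
  (forall Z, (0 < sv m Z)%N -> Z \subset X -> Z = X) ->
  adm D (rs r X) (Gs D r G X) (push up (red X e m)).
Proof.
move=> /admP[nS hb] he e0 Xmin; have /nstP[/subsetP SG _] := nS; have fX := b_fl bG XG.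
have XS : X \in SU m by rewrite inE he.
have hn V : (0 < sv (red X e m) V)%N -> V \in G /\ nst2 D r G V X.
  rewrite sv_redE //; case: eqP => // _ hV; have VS : V \in SU m by rewrite inE.
  by split; [apply: SG | apply: (nst_pair nS VS XS)].
have eS : SU (push up (red X e m)) = [set up V | V in SU m :\ X] by rewrite SU_push // SU_red.
have upE V : V \in SU m -> V != X -> [/\ V \in G, ~~ (V \subset X), up V = V :\: X, up V != set0 & nst2 D r G V X].
  move=> VS ne; have VG := SG V VS; have nV : ~~ (V \subset X).
    by apply: contra ne => h; apply/eqP; apply: Xmin; rewrite // inE in VS *.
  have sV := nst_pair nS VS XS; have [e1 _ _] := up_nst M bG XG VG nV sV; split=> //.
  by rewrite e1 setD_eq0.
apply/admP; rewrite eS; split; first exact: nst_star.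
move=> Z'; rewrite -[(0 < _)%N]/(0 < sv (push up (red X e m)) Z')%N => hZ'.
have : Z' \in SU (push up (red X e m)) by rewrite inE.
rewrite eS => /imsetP[Z /setD1P[ZX ZS] eZ]; have [ZG nZ uZ Z0 sZ] := upE Z ZS ZX.
rewrite eZ sv_push_nst // sv_redE // (negPf ZX).
have /hb : (0 < sv m Z)%N by move: ZS; rewrite inE.
move=> h; apply: leq_trans h _; set A := \bigcup_(Y in SU m | Y \proper Z) Y; set A' := \bigcup_(Y in _ | _) Y.
have A'X : A' :&: X = set0.
  apply/eqP; rewrite -subset0; apply/subsetP => x /setIP[/bigcupP[Y /andP[/imsetP[V /setD1P[VX VS] ->] _]]].
  by have [_ _ -> _ _] := upE V VS VX; rewrite inE => /andP[/negP].
have rsO (U : {set E}) : U :&: X = set0 -> rs r X U = (r (U :|: X) - r X)%N by move=> h'; rewrite (rs_out M h').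
rewrite (rsO A' A'X); have hZ : (Z :\: X) :&: X = set0 by exact: DZI.
rewrite uZ (rsO _ hZ).
have eZX : (Z :\: X) :|: X = Z :|: X.
  by apply/setP => x; rewrite !inE; case: (x \in X); rewrite ?orbT ?orbF.
rewrite eZX; case: (boolP (X \subset Z)) => XZ.
  rewrite (setUidPl XZ); have : (r (A' :|: X) <= r A)%N.
    apply: (m_mono M); rewrite subUset; apply/andP; split.
      apply/bigcupsP => Y /andP[/imsetP[V /setD1P[VX VS] ->] Vp]; have [VG nV uV V0 sV] := upE V VS VX.
      rewrite uV; apply: subset_trans (subsetDl _ _) _; apply: bigcup_sup; rewrite VS /=.
      move: Vp; rewrite uV uZ !properE => /andP[h1 h2]; apply/andP; split.
        apply/subsetP => x xV; case: (boolP (x \in X)) => [/(subsetP XZ)//|xX].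
        by have := subsetP h1 x; rewrite !inE xX xV /= => /(_ isT).
      by apply: contra h2 => h2; apply: setSD.
    by apply: bigcup_sup; rewrite XS properEneq XZ eq_sym ZX.
  have := m_mono M (subsetUr A' X); have := m_mono M XZ; clear; lia.
have [_ _ rZX dZX] := pair_fac M bG ZG XG nZ XZ sZ.
have : (r A' <= r A)%N.
  apply: (m_mono M); apply/bigcupsP => Y /andP[/imsetP[V /setD1P[VX VS] ->] Vp]; have [VG nV uV V0 sV] := upE V VS VX.
  have uZ' : Z :\: X = Z by apply/setDidPl; rewrite -setI_eq0 dZX.
  rewrite uV uZ uZ' in Vp V0.
  have ncap : V :&: Z != set0.
    have /set0Pn[x xV] := V0; apply/set0Pn; exists x; rewrite inE (subsetP (proper_sub Vp) _ xV) andbT.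
    by move: xV; rewrite inE => /andP[].
  have sVZ := nst_pair nS VS ZS.
  have VZ : V \subset Z.
    apply: contraT => h1; have h2 : ~~ (Z \subset V).
      apply/negP => ZV; move: Vp; rewrite properE => /andP[_ /negP]; apply.
      by rewrite -uZ' setSD.
    by have [_ _ _ h3] := pair_fac M bG VG ZG h1 h2 sVZ; rewrite h3 eqxx in ncap.
  rewrite uV; apply: subset_trans (subsetDl _ _) _; apply: bigcup_sup; rewrite VS properEneq VZ andbT /=.
  apply/eqP => eVZ; move: Vp; rewrite eVZ uZ' properxx //.
have h3 : (r (A' :|: X) <= r A' + r X)%N := rU M A' X.
by rewrite rZX; move: h3; clear; lia.
Qed.
End StarAdm.

(** X is minimal among the sets occurring in u and e is its largest exponent. If X is maximal in G
    one stays in the same matroid, otherwise one passes to the star of X; in both cases terms of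
    smaller degree remain. *)
Theorem IND k : INDst k.
Proof.
have [n] := ubnP k; elim: n k => // n IHn k hn d D r G K u M bG td KG hu hr.
have IH k' : (k' < k)%N -> INDst k' by move=> h; apply: IHn; apply: leq_trans h _.
case: (posnP k) => [k0|k0]; first by move: hu; rewrite k0 => hu; apply: (@IND0 d D r G K).
apply/eqP; rewrite -msupp_eq0; apply: contraT => un0.
have [m1 m1u] : exists m, m \in msupp u by case: (msupp u) un0 => // m s _; exists m; rewrite inE eqxx.
pose Om := [set X | has (fun m => (0 < sv m X)%N) (msupp u)].
have [X1 hX1] : exists X, X \in Om.
  case: (boolP [exists X, (0 < sv m1 X)%N]) => [/existsP[X hX]|no].
    by exists X; rewrite inE; apply/hasP; exists m1.
  have [_ h _] := hu m1 m1u; move: k0; rewrite -h -sum_sv big1 // => X _.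
  by move: no; rewrite negb_exists => /forallP/(_ X); rewrite -leqNgt leqn0 => /eqP.
have [X hX Xmin0] := @arg_minnP _ X1 (mem Om) (fun X => #|X|) hX1.
have Xmin m Z : m \in msupp u -> (0 < sv m Z)%N -> Z \subset X -> Z = X.
  move=> hm hZ ZX; have ZO : Z \in Om by rewrite inE; apply/hasP; exists m.
  by apply/eqP; rewrite eqEcard ZX; apply: Xmin0.
pose e := (\max_(m <- msupp u) sv m X)%N.
have emax m : m \in msupp u -> (sv m X <= e)%N.
  by move=> hm; rewrite /e (bigD1_seq m) ?msupp_uniq //= leq_maxl.
have [m0 m0u m0e] : exists2 m, m \in msupp u & sv m X = e.
  have : msupp u != [::] := un0; rewrite /e; elim: (msupp u) => // m s IHs _.
  rewrite big_cons; case: (leqP (sv m X) (\max_(j <- s) sv j X)%N) => h.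
    case: (altP (s =P [::])) => [s0|/IHs[m' h1 h2]]; last by exists m'; rewrite ?inE ?h1 ?orbT // h2; apply/esym/maxn_idPr.
    by exists m; rewrite ?inE ?eqxx //; move: h; rewrite s0 big_nil leqn0 => /eqP ->.
  by exists m; rewrite ?inE ?eqxx //; apply/esym/maxn_idPl; apply: ltnW.
have hX' : X \in Om := hX; have /hasP[m2 m2u m2X] : has (fun m => (0 < sv m X)%N) (msupp u) by rewrite in_set in hX'.
have e0 : (0 < e)%N := leq_trans m2X (emax _ m2u).
have XG : X \in G.
  by have [/admP[/nstP[/subsetP s _] _] _ _] := hu m2 m2u; apply: s; rewrite inE.
have er : (e < r X)%N.
  have [/admP[_ hb] _ _] := hu m0 m0u; have := hb X; rewrite m0e => /(_ e0) h.
  exact: leq_trans h (leq_subr _ _).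
have KGG : K \subset G by apply/subsetP => c /(subsetP KG)/in_maxset[].
have XK : X \notin K by apply/negP => h; have [_ _ /(_ X X m2X h)] := hu m2 m2u; rewrite subxx.
have XKG : X |: K \subset G by rewrite subUset sub1set XG.
have redI m m' : sv m X = e -> sv m' X = e -> (forall Z, Z != X -> sv m Z = sv m' Z) -> m = m'.
  by move=> h h' hh; apply: svP => Z; case: (eqVneq Z X) => [->|/hh//]; rewrite h h'.
case: (boolP (X \in maxset G)) => Xm.
  have [] := @core k IH d d D r r G G K u 1 id X e M bG td _ _ _ XKG XK _ _ hu hr Xmin e0 emax er _ _ m0 m0u m0e.
  - by rewrite imset_id.
  - by rewrite subUset sub1set Xm.
  - by [].
  - by move=> q; rewrite [RHS]phi_kill mul1r.
  - by [].
  - move=> m hm he; rewrite push_eq //; have [/admP[nS hb] _ _] := hu m hm.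
    apply/admP; rewrite SU_red //; split; first by apply: nst_sub nS; apply: subsetDl.
    move=> Z; rewrite sv_redE //; case: eqP => // ne hZ; apply: leq_trans (hb Z hZ) _.
    apply: leq_sub2l; apply: (m_mono M); apply/bigcupsP => Y /andP[/setD1P[_ h1] h2].
    by apply: bigcup_sup; rewrite h1.
  move=> m m' _ _ h h'; rewrite !push_eq // => h3; apply: redI => // Z ne.
  by have := congr1 (fun q => sv q Z) h3; rewrite !sv_redE // (negPf ne).
have [Ew hw WE] := maxset_above XG.
have WEp : X \proper Ew by rewrite properEneq WE andbT; apply: contra Xm => /eqP ->.
have tdX := topdeg_star1 M bG hw WEp XG; have fX := b_fl bG XG.
set d1 := topdeg (rs r X) (Gs D r G X) in tdX.
have td1 : topdeg r G = d1.+1 by rewrite tdX.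
have [y [hy _]] := starcl_exists R M bG td1.
have disK c : c \in K -> [/\ c \in G, c \in maxset G, ~~ (c \subset X), c :&: X = set0 & nst2 D r G c X].
  move=> hc; have hcm := subsetP KG c hc; have cG := subsetP KGG c hc.
  have sc := max_nst bG XG hcm; have nc := max_nsub XG Xm hcm; split=> //.
  have nXc : ~~ (X \subset c) by have [_ _ h] := hu m2 m2u; apply: h m2X hc.
  by have [] := pair_fac M bG cG XG nc nXc sc.
have upc c : c \in K -> up D r X c = c.
  move=> hc; have [cG cm nc dc sc] := disK c hc; have [-> _ _] := up_nst M bG XG cG nc sc.
  by apply/setDidPl; rewrite -setI_eq0 dc.
have [] := @core k IH d d1 D r (rs r X) G (Gs D r G X) K u (y X) (up D r X) X e (mat_star M fX) (built_star M bG fX)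
  erefl erefl _ _ XKG XK _ _ hu hr Xmin e0 emax er _ _ m0 m0u m0e.
- rewrite subUset sub1set (W_max M bG XG Xm) /=; apply/subsetP => c hc; rewrite -(upc c hc).
  by apply: max_up => //; apply: (subsetP KG).
- move=> c /setU1P[->|hc]; first by rewrite up_in // rs_in.
  have [cG cm nc dc sc] := disK c hc; rewrite upc //; split=> //.
  have nXc : ~~ (X \subset c) by have [_ _ h] := hu m2 m2u; apply: h m2X hc.
  by have [_ _ e1 _] := pair_fac M bG cG XG nc nXc sc; rewrite (rs_out M dc) e1 addnK.
- by move=> q; rewrite -td td1 -(hy X XG Xm).
- move=> Z c ZG hc nZ; case: (boolP (Z \subset X)) => ZX; first by rewrite up_in.
  apply/negP => s; have uG : up D r X Z \in Gs D r G X by apply: imset_f.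
  have dX : up D r X Z :&: X = set0 by rewrite /up (negPf ZX); exact: DZI.
  case/setU1P: hc => [e1|hc].
    have /set0Pn[x xu] := b_n0 (built_star M bG fX) uG.
    by have : x \in up D r X Z :&: X; [rewrite inE xu -e1 (subsetP s) | rewrite dX inE].
  have [cG cm nc dc sc] := disK c hc; have [x xZ xX] : exists2 x, x \in Z & x \notin X by apply/subsetPn.
  have xu : x \in up D r X Z.
    by rewrite /up (negPf ZX) inE xX (subsetP (sub_clD r (XZD bG fX ZG))) // inE xZ.
  case/negP: nZ; apply: (in_comp M bG (V := [set x])) cm _ _ _ => //; rewrite ?sub1set //.
    exact: (subsetP s).
  by apply/set0Pn; exists x; rewrite inE.
- by move=> m hm he; apply: adm_star => //; [have [] := hu m hm | move=> Z; exact: (Xmin m)].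
move=> m m' hm hm' h h' eq; apply: redI => // Z ne.
have good n0 : n0 \in msupp u -> sv n0 X = e -> forall V, (0 < sv (red X e n0) V)%N -> V \in G /\ nst2 D r G V X.
  move=> hn0 he V; rewrite sv_redE //; case: eqP => // _ hV; have [/admP[nS _] _ _] := hu n0 hn0.
  have XS : X \in SU n0 by rewrite inE he.
  have VS : V \in SU n0 by rewrite inE.
  by split; [have /nstP[/subsetP s _] := nS; apply: s | apply: (nst_pair nS VS XS)].
have half n1 n2 : n1 \in msupp u -> n2 \in msupp u -> sv n1 X = e -> sv n2 X = e ->
    push (up D r X) (red X e n1) = push (up D r X) (red X e n2) -> (0 < sv n1 Z)%N -> sv n2 Z = sv n1 Z.
  move=> u1' u2' e1 e2 eq12 hZ; have hZ' : (0 < sv (red X e n1) Z)%N by rewrite sv_redE // (negPf ne).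
  have [ZG sZ] := good n1 u1' e1 Z hZ'; have := congr1 (fun q => sv q (up D r X Z)) eq12.
  rewrite (sv_push_nst M bG XG (good n1 u1' e1) ZG sZ) (sv_push_nst M bG XG (good n2 u2' e2) ZG sZ).
  by rewrite !sv_redE // (negPf ne).
case: (posnP (sv m Z)) => z1; last by rewrite (half m m').
case: (posnP (sv m' Z)) => z2; first by rewrite z1 z2.
by rewrite (half m' m).
Qed.
End Ind.

End Independence.
Import Independence.

(** * Spanning of the presented ring by admissible monomials *)

Module Spanning.
Local Open Scope ring_scope.

Section Ideal.
Variables (n : nat) (gens : {mpoly rat[n]} -> Prop).
Local Notation inI := (in_ideal gens).

Lemma inI0 : inI 0.
Proof. by exists [::]; split=> //; rewrite big_nil. Qed.
Lemma inI_gen p : gens p -> inI p.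
Proof. by move=> h; exists [:: (1, p)]; split; [move=> q; rewrite inE => /eqP -> | rewrite big_seq1 mul1r]. Qed.
Lemma inID p q : inI p -> inI q -> inI (p + q).
Proof.
move=> [s [h1 ->]] [t [h2 ->]]; exists (s ++ t); split; last by rewrite big_cat.
by move=> x; rewrite mem_cat => /orP[/h1|/h2].
Qed.
Lemma inIM a p : inI p -> inI (a * p).
Proof.
move=> [s [h1 ->]]; exists [seq (a * q.1, q.2) | q <- s]; split; first by move=> _ /mapP[x hx ->]; apply: (h1 x).
by rewrite big_map mulr_sumr; apply: eq_bigr => q _; rewrite mulrA.
Qed.
Lemma inIMr p a : inI p -> inI (p * a). Proof. by rewrite mulrC; apply: inIM. Qed.
Lemma inIZ c p : inI p -> inI (c *: p). Proof. by rewrite -mul_mpolyC; apply: inIM. Qed.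
Lemma inIN p : inI p -> inI (- p). Proof. by rewrite -scaleN1r; apply: inIZ. Qed.
Lemma inIB p q : inI p -> inI q -> inI (p - q). Proof. by move=> h1 h2; apply: inID => //; apply: inIN. Qed.
Lemma inI_sum (J : Type) (s : seq J) (Q : pred J) F : (forall i, Q i -> inI (F i)) -> inI (\sum_(i <- s | Q i) F i).
Proof. by move=> h; apply: big_ind => //; [apply: inI0 | apply: inID]. Qed.
End Ideal.

Section Span.
Variables (E : finType) (D : {set E}) (r : {set E} -> nat) (G : {set {set E}}).
Implicit Types (V W X Y Z : {set E}) (B : {set {set E}}).
Hypothesis M : mat D r.
Hypothesis bG : built D r G.
Variables (n : nat) (gens : {mpoly rat[n]} -> Prop) (xi : {set E} -> {mpoly rat[n]}).
Local Notation N := #|{: {set E}}|.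
Local Notation inI := (in_ideal gens).
Implicit Types (m : 'X_{1..N}) (p q : {mpoly rat[n]}).
Hypothesis xi_anti : forall B, B \subset G -> antichain B -> (1 < #|B|)%N ->
  clD D r (\bigcup_(X in B) X) \in G -> inI (\prod_(X in B) xi X).
Hypothesis xi_lin : forall i, i \in D -> inI (\sum_(Z in G | i \in Z) xi Z).

(** Minus the simplicial generator of X, written in the variables of the presentation. *)
Definition HX X := \sum_(Z in G | X \subset Z) xi Z.

Lemma xi_pair Z V i : Z \in G -> V \in G -> i \in Z -> i \in V -> ~~ (Z \subset V) -> ~~ (V \subset Z) -> inI (xi Z * xi V).
Proof.
move=> ZG VG iZ iV h1 h2; have [a c] := anti_pair h1 h2.
have nZV : Z \notin [set V] by rewrite inE; apply: contraNneq h1 => ->.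
have := @xi_anti [set Z; V]; rewrite !big_setU1 //= !big_set1; apply=> //; rewrite ?c //.
  by rewrite subUset !sub1set ZG.
by apply: (b_join bG) => //; apply/set0Pn; exists i; rewrite inE iZ.
Qed.

Lemma xi_full X (A : {set {set E}}) : X \in G -> (forall Y, Y \in A -> Y \in G /\ Y \proper X) ->
  (r X <= r (\bigcup_(Y in A) Y))%N -> inI (\prod_(Y in A) xi Y).
Proof.
move=> XG hA; set U := \bigcup_(Y in A) Y.
have UX : U \subset X by apply/bigcupsP => Y /hA[_ /proper_sub].
have XD : X \subset D by apply: (b_subD bG).
move=> hU; pose B := maxset A; have BA Y : Y \in B -> Y \in A by case/in_maxset.
have eU : \bigcup_(Y in B) Y = U.
  apply/setP => x; apply/bigcupP/bigcupP => [[Y /BA hY xY]|[Y hY xY]]; first by exists Y.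
  by have [Y' hY' YY'] := maxset_above hY; exists Y' => //; apply: (subsetP YY').
have cU : clD D r U = X by apply: (cl_eq M) => //; apply: (b_fl bG).
have aB : antichain B by apply/antiP => Y Z /in_maxset[_ mY] /BA hZ YZ; rewrite (mY Z).
have : inI (\prod_(Y in B) xi Y).
  apply: xi_anti => //; rewrite ?eU ?cU //; first by apply/subsetP => Y /BA/hA[].
  rewrite ltnNge leq_eqVlt ltnS leqn0; apply/negP => /orP[/cards1P[Y eY]|].
    have /BA/hA[YG YX] : Y \in B by rewrite eY inE.
    move: cU; rewrite -eU eY big_set1 (cl_eq M (subxx _)) ?(b_fl bG) // => e.
    by rewrite e properxx in YX.
  rewrite cards_eq0 => /eqP e; move: hU; rewrite -eU e big_set0 (r0 M).
  by have := b_rgt0 M bG XG; clear; lia.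
move=> h; rewrite (bigID (mem B)) /=; apply: inIMr; rewrite (eq_bigl (mem B)) // => Y.
by rewrite andb_idl // => /BA.
Qed.

(** For a point i of X not spanned by A, one factor [HX X] becomes, by the linear relation at i, a
    sum over Z through i not containing X. Next to such a Z, X may be replaced by X ∨ Z, over which
    A and Z together miss less rank. *)
Lemma xi_rel d X (A : {set {set E}}) : X \in G -> (forall Y, Y \in A -> Y \in G /\ Y \proper X) ->
  (r X - r (\bigcup_(Y in A) Y) <= d)%N -> inI ((\prod_(Y in A) xi Y) * HX X ^+ d).
Proof.
elim: d X A => [|d IH] X A XG hA hd.
  by rewrite expr0 mulr1; apply: (xi_full XG) => //; move: hd; clear; lia.
have full := @xi_full X A XG hA; set U := \bigcup_(Y in A) Y in hd full.
have UX : U \subset X by apply/bigcupsP => Y /hA[_ /proper_sub].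
have XD : X \subset D by apply: (b_subD bG).
case: (leqP (r X) (r U)) => hU; first by apply: inIMr; apply: full.
  have [i iX iU] : exists2 i, i \in X & i \notin clD D r U.
    apply/subsetPn; apply: contraL hU => h; rewrite -leqNgt -(r_cl M (subset_trans UX XD)).
    exact: (m_mono M).
  have iD : i \in D := subsetP XD _ iX.
  have iUn : i \notin U by apply: contra iU; apply: (subsetP (sub_clD r (subset_trans UX XD))).
  have rU : (r U < r (i |: U))%N.
    rewrite ltn_neqAle (m_mono M) ?subsetUr // andbT; apply: contra iU => /eqP e.
    by rewrite inE iD /= e.
  have eH : HX X = \sum_(Z in G | i \in Z) xi Z - \sum_(Z in G | (i \in Z) && ~~ (X \subset Z)) xi Z.
    have e1 : HX X = \sum_(Z | (Z \in G) && (i \in Z) && (X \subset Z)) xi Z.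
      apply: eq_bigl => Z; case: (Z \in G) => //=; case: (boolP (X \subset Z)) => h; rewrite ?andbF ?andbT //.
      by rewrite (subsetP h).
    have e2 : \sum_(Z in G | (i \in Z) && ~~ (X \subset Z)) xi Z =
        \sum_(Z | (Z \in G) && (i \in Z) && ~~ (X \subset Z)) xi Z.
      by apply: eq_bigl => Z; rewrite andbA.
    by rewrite e1 e2 (bigID (fun Z => X \subset Z) (fun Z => (Z \in G) && (i \in Z))) addrK.
  rewrite exprS {1}eH mulrBl mulrBr; apply: inIB.
    by rewrite mulrCA; apply: inIMr; apply: xi_lin.
  rewrite mulr_suml mulr_sumr; apply: inI_sum => Z /andP[ZG /andP[iZ nXZ]].
  pose X' := clD D r (X :|: Z); have XZD' : X :|: Z \subset D by rewrite subUset XD (b_subD bG ZG).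
  have sX' : X :|: Z \subset X' := sub_clD r XZD'.
  have X'G : X' \in G by apply: (b_join bG) => //; apply/set0Pn; exists i; rewrite inE iX.
  (* A member over X but not over X ∨ Z meets Z and is incomparable with it, so its product with Z
     is in the ideal. *)
  have red1 : inI (xi Z * (HX X - HX X')).
    rewrite /HX (bigID (fun V => X' \subset V)) /=.
    rewrite (eq_bigl (fun V => (V \in G) && (X' \subset V))) => [|V]; last first.
      case: (V \in G) => //=; case: (boolP (X' \subset V)) => h; rewrite ?andbF // andbT.
      by rewrite (subset_trans (subset_trans (subsetUl _ _) sX') h).
    rewrite addrAC subrr add0r mulr_sumr; apply: inI_sum => V /andP[/andP[VG XV] nV].
    apply: (xi_pair (i := i)) => //; first exact: (subsetP XV).
      by apply: contra nV => ZV; apply: (cl_min M _ (b_fl bG VG)); rewrite subUset XV.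
    by apply: contra nXZ; apply: subset_trans.
  have red2 e : inI (xi Z * (HX X ^+ e - HX X' ^+ e)) by rewrite subrXX mulrA; apply: inIMr.
  have ZA : Z \notin A by apply: contra iUn => h; apply/bigcupP; exists Z.
  have hI : inI ((\prod_(Y in Z |: A) xi Y) * HX X' ^+ d).
    apply: IH => // [Y /setU1P[->|/hA[YG YX]]|].
    - split=> //; rewrite properEneq (subset_trans (subsetUr _ _) sX') andbT.
      by apply: contraNneq nXZ => ->; apply: subset_trans sX'; apply: subsetUl.
    - by split=> //; apply: proper_sub_trans YX (subset_trans (subsetUl _ _) sX').
    rewrite big_setU1 //= -/U /X' (r_cl M XZD').
    have := m_sub M X (Z :|: U).
    have -> : X :|: (Z :|: U) = X :|: Z by rewrite setUCA (setUidPl UX) setUC.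
    have : (r (i |: U) <= r (X :&: (Z :|: U)))%N.
      by rewrite (m_mono M) // subUset sub1set !inE iX iZ /= subsetI UX subsetUr.
    by move: hd rU; clear; lia.
  rewrite big_setU1 //= in hI.
  have -> : (\prod_(Y in A) xi Y) * (xi Z * HX X ^+ d) =
     (xi Z * (HX X ^+ d - HX X' ^+ d)) * (\prod_(Y in A) xi Y) + xi Z * (\prod_(Y in A) xi Y) * HX X' ^+ d by ring.
  by apply: inID => //; apply: inIMr.
Qed.

Definition xim m := \prod_(X : {set E}) xi X ^+ sv m X.
(** The termination measure: reductions produce monomials of the same degree and larger weight, and
    weight is bounded in each degree. *)
Definition wt m := (\sum_(X : {set E}) sv m X * r X)%N.

Lemma ximD m m' : xim (m + m')%MM = xim m * xim m'.
Proof. by rewrite /xim -big_split; apply: eq_bigr => X _; rewrite svD exprD. Qed.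
Lemma wtD m m' : wt (m + m')%MM = (wt m + wt m')%N.
Proof. by rewrite /wt -big_split; apply: eq_bigr => X _; rewrite svD mulnDl. Qed.
Lemma xim_um X : xim (um X) = xi X.
Proof.
rewrite /xim (bigD1 X) //= sv_um eqxx big1 ?mulr1 ?expr1 // => Y ne.
by rewrite sv_um eq_sym (negPf ne).
Qed.
Lemma wt_um X : wt (um X) = r X.
Proof.
rewrite /wt (bigD1 X) //= sv_um eqxx big1 ?addn0 ?mul1n // => Y ne.
by rewrite sv_um eq_sym (negPf ne).
Qed.

(* Linear span of the monomials of degree [k] and weight at least [w]. *)
Definition W k w p := forall T : {mpoly rat[n]} -> Prop, T 0 -> (forall p q, T p -> T q -> T (p + q)) ->
  (forall c p, T p -> T (c *: p)) -> (forall m, supp m G -> mdeg m = k -> (w <= wt m)%N -> T (xim m)) -> T p.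

Lemma WX m : supp m G -> W (mdeg m) (wt m) (xim m).
Proof. by move=> sm T _ _ _ h; apply: h. Qed.
Lemma W_0 k w : W k w 0. Proof. by move=> T h. Qed.
Lemma WD k w p q : W k w p -> W k w q -> W k w (p + q).
Proof. by move=> h1 h2 T t0 tD tZ tX; apply: (tD); [apply: h1 | apply: h2]. Qed.
Lemma WZ k w c p : W k w p -> W k w (c *: p).
Proof. by move=> h T t0 tD tZ tX; apply: (tZ); apply: h. Qed.
Lemma W_sum k w (J : Type) (s : seq J) (Q : pred J) F : (forall i, Q i -> W k w (F i)) -> W k w (\sum_(i <- s | Q i) F i).
Proof. by move=> h; elim/big_ind: _ => [|p q hp hq|i hi]; [apply: W_0 | apply: WD | apply: h]. Qed.
Lemma W_le k w w' p : (w' <= w)%N -> W k w p -> W k w' p.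
Proof. by move=> hw h T t0 tD tZ tX; apply: h => // m s d l; apply: tX => //; apply: leq_trans l. Qed.
Lemma WM k w k' w' p q : W k w p -> W k' w' q -> W (k + k') (w + w') (p * q).
Proof.
move=> hp hq; apply: (hp (fun p => W (k + k') (w + w') (p * q))).
- by rewrite mul0r; apply: W_0.
- by move=> a b ha hb; rewrite mulrDl; apply: WD.
- by move=> c a ha; rewrite -scalerAl; apply: WZ.
move=> m sm dm wm; apply: (hq (fun q => W (k + k') (w + w') (xim m * q))).
- by rewrite mulr0; apply: W_0.
- by move=> a b ha hb; rewrite mulrDr; apply: WD.
- by move=> c a ha; rewrite -scalerAr; apply: WZ.
move=> m' sm' dm' wm'; rewrite -ximD; apply: (W_le (w := wt (m + m')%MM)); first by rewrite wtD leq_add.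
by rewrite -dm -dm' -mdegD; apply: WX; rewrite suppD sm.
Qed.
Lemma W1 : W 0 0 1.
Proof.
have e : xim 0%MM = 1 by rewrite /xim big1 // => X _; rewrite /sv mnm0E expr0.
move=> T _ _ _ tX; rewrite -e; apply: tX => //; last exact: mdeg0.
by apply/suppP => X; rewrite /sv mnm0E.
Qed.
Lemma W_xi X : X \in G -> W 1 (r X) (xi X).
Proof. by move=> XG; have := @WX (um X); rewrite supp_um mdeg1 wt_um xim_um; apply. Qed.

Lemma W_pow X t : X \in G -> W t (t * r X) (xi X ^+ t).
Proof.
move=> XG; elim: t => [|t IH]; first by rewrite expr0; apply: W1.
by rewrite exprS mulSn -add1n; apply: WM => //; apply: W_xi.
Qed.

(** The members strictly above X have larger rank, so [xi X] is the term of least weight. *)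
Lemma W_HX X t : X \in G -> W t (t * r X) (HX X ^+ t) /\ W t (t * r X).+1 (HX X ^+ t - xi X ^+ t).
Proof.
move=> XG; have h1 : W 1 (r X) (HX X).
  apply: W_sum => Z /andP[ZG XZ]; apply: (W_le (w := r Z)); [exact: (m_mono M) | exact: W_xi].
have h2 : W 1 (r X).+1 (HX X - xi X).
  rewrite /HX (bigD1 X) ?XG ?subxx //= addrAC subrr add0r; apply: W_sum => Z /andP[/andP[ZG XZ] ne].
  apply: (W_le (w := r Z)); last exact: W_xi.
  rewrite ltnNge; apply: contra ne => h; apply/eqP; apply: (fl_eq M (b_fl bG XG) XZ) => //.
  exact: (b_subD bG).
elim: t => [|t [IH1 IH2]]; first by rewrite !expr0 subrr; split; [apply: W1 | apply: W_0].
split; first by rewrite exprS mulSn -add1n; apply: WM.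
have -> : HX X ^+ t.+1 - xi X ^+ t.+1 = HX X * (HX X ^+ t - xi X ^+ t) + (HX X - xi X) * xi X ^+ t by rewrite !exprS; ring.
rewrite mulSn -add1n; apply: WD; first by rewrite -addnS; apply: WM.
by rewrite -addSn; apply: WM => //; apply: W_pow.
Qed.

Definition spanned k p := exists c : 'X_{1..N < k.+1} -> rat,
  inI (p - \sum_(m : 'X_{1..N < k.+1} | (mdeg m == k) && adm D r G m) c m *: xim m).

Lemma spanned_I k p : inI p -> spanned k p.
Proof. by move=> h; exists (fun=> 0); rewrite big1 ?subr0 // => m _; rewrite scale0r. Qed.
Lemma spannedD k p q : spanned k p -> spanned k q -> spanned k (p + q).
Proof.
move=> [c hc] [c' hc']; exists (fun m : 'X_{1..N < k.+1} => c m + c' m).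
have e : \sum_(m : 'X_{1..N < k.+1} | (mdeg m == k) && adm D r G m) (c m + c' m) *: xim m =
  \sum_(m : 'X_{1..N < k.+1} | (mdeg m == k) && adm D r G m) c m *: xim m +
  \sum_(m : 'X_{1..N < k.+1} | (mdeg m == k) && adm D r G m) c' m *: xim m.
  by rewrite -big_split; apply: eq_bigr => m _; exact: scalerDl.
by have := inID hc hc'; congr (inI _); rewrite e; ring.
Qed.
Lemma spannedZ k a p : spanned k p -> spanned k (a *: p).
Proof.
move=> [c hc]; exists (fun m : 'X_{1..N < k.+1} => a * c m); have := inIZ a hc; congr (inI _).
by rewrite scalerBr scaler_sumr; congr (_ - _); apply: eq_bigr => m _; rewrite scalerA.
Qed.

Lemma wt_bound m : (wt m <= mdeg m * #|E|)%N.
Proof.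
rewrite -sum_sv big_distrl; apply: leq_sum => X _; rewrite leq_mul2l; apply/orP; right.
exact: leq_trans (m_card M X) (max_card _).
Qed.

(** A monomial with non-nested support is in the ideal. If instead an exponent is too large,
    subtracting a multiple of [xi_rel] leaves only heavier monomials. *)
Lemma spanned_xim k m : supp m G -> mdeg m = k -> spanned k (xim m).
Proof.
have [q] := ubnP (k * #|E| - wt m)%N; elim: q m => // q IH m hq sm dm.
case: (boolP (adm D r G m)) => am.
  have hb : (mdeg m < k.+1)%N by rewrite dm.
  exists (fun m' : 'X_{1..N < k.+1} => (m' == BMultinom hb)%:R); rewrite (bigD1 (BMultinom hb)) /=; last by rewrite dm eqxx.
  rewrite eqxx scale1r big1 ?addr0 ?subrr; first exact: inI0.
  by move=> m' /andP[_ /negPf ->]; rewrite scale0r.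
have sub m1 m2 : (forall X, (sv m1 X <= sv m2 X)%N) -> exists m3, m2 = (m1 + m3)%MM.
  move=> h; exists (m2 - m1)%MM; rewrite addmC submK //; apply/mnm_lepP => i.
  by have := h (enum_val i); rewrite /sv enum_valK.
have svA (A : {set {set E}}) X : sv (\sum_(X in A) um X)%MM X = (X \in A).
  rewrite /sv mnm_sumE; case: (boolP (X \in A)) => hX; last first.
    by rewrite big1 // => Y hY; rewrite -/(sv _ _) sv_um; case: eqP hX => // <-; rewrite hY.
  rewrite (bigD1 X) //= -/(sv _ X) sv_um eqxx big1 // => Y /andP[_ ne].
  by rewrite -/(sv _ _) sv_um (negPf ne).
have ximA (A : {set {set E}}) : xim (\sum_(X in A) um X)%MM = \prod_(X in A) xi X.
  by rewrite /xim [RHS]big_mkcond; apply: eq_bigr => X _; rewrite svA; case: (X \in A).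
have SUG : SU m \subset G by apply/subsetP => X; rewrite inE; apply: (suppP _ _ sm).
case: (boolP (nst D r G (SU m))) => nS; last first.
  move: nS; rewrite /nst SUG /= negb_forall => /existsP[B]; rewrite negb_imply negbK => /andP[/and3P[BS aB cB] JG].
  have [X|m3 e3] := sub (\sum_(X in B) um X)%MM m.
    by rewrite svA; case: (boolP (X \in B)) => // /(subsetP BS); rewrite inE.
  apply: spanned_I; rewrite e3 ximD ximA; apply: inIMr; apply: xi_anti => //.
  exact: subset_trans BS SUG.
have [X hX] : exists2 X, X \in SU m & ~~ (sv m X < r X - r (\bigcup_(Y in SU m | Y \proper X) Y))%N.
  by apply/exists_inP; rewrite -negb_forall_in; move: am; rewrite /adm nS.
pose A := [set Y in SU m | Y \proper X].
have -> : \bigcup_(Y in SU m | Y \proper X) Y = \bigcup_(Y in A) Y by apply: eq_bigl => Y; rewrite [RHS]in_set.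
set t := (_ - _)%N; rewrite -leqNgt => ht; have XG := subsetP SUG _ hX.
have hA Y : Y \in A -> Y \in G /\ Y \proper X by rewrite inE => /andP[/(subsetP SUG)].
have [Y|m3 e3] := sub ((\sum_(Y in A) um Y) + um X *+ t)%MM m.
  rewrite svD svA sv_muln sv_um; case: (eqVneq X Y) => [<-|ne].
    by rewrite mul1n inE properxx andbF.
  rewrite mul0n addn0; case: (boolP (Y \in A)) => //; by rewrite !inE => /andP[].
have eXt : xim (um X *+ t)%MM = xi X ^+ t.
  rewrite /xim (bigD1 X) //= sv_muln sv_um eqxx mul1n big1 ?mulr1 // => Y ne.
  by rewrite sv_muln sv_um eq_sym (negPf ne).
have wXt : wt (um X *+ t)%MM = (t * r X)%N.
  rewrite /wt (bigD1 X) //= sv_muln sv_um eqxx mul1n big1 ?addn0 // => Y ne.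
  by rewrite sv_muln sv_um eq_sym (negPf ne).
have dXt : mdeg (um X *+ t)%MM = t by rewrite mdegMn mdeg1 mul1n.
have spW p : W k (wt m).+1 p -> spanned k p.
  apply; [exact: spanned_I (inI0 _) | exact: spannedD | exact: spannedZ|].
  move=> m' sm' dm' wm'; apply: IH => //; have := wt_bound m'; rewrite dm'; move: hq wm'; clear; lia.
have em : xim m = (\prod_(Y in A) xi Y) * HX X ^+ t * xim m3 -
   (\prod_(Y in A) xi Y) * (HX X ^+ t - xi X ^+ t) * xim m3.
  rewrite {1}e3 !ximD ximA eXt; clear; set a := xim m3; set b := HX X ^+ t; set c := xi X ^+ t.
  by rewrite -mulrBl -mulrBr opprB addrC subrK.
rewrite em; apply: spannedD.
  by apply: spanned_I; apply: inIMr; apply: xi_rel.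
rewrite -scaleN1r; apply: spannedZ; apply: spW.
move: sm; rewrite {1}e3 !suppD => /andP[/andP[sA _] s3].
have := WM (WM (WX sA) (W_HX t XG).2) (WX s3); rewrite ximA.
have -> : (mdeg (\sum_(Y in A) um Y) + t + mdeg m3 = k)%N by rewrite -dm [in RHS]e3 !mdegD dXt.
have -> : wt m = (wt (\sum_(Y in A) um Y)%MM + t * r X + wt m3)%N by rewrite [in LHS]e3 !wtD wXt.
by rewrite addnS addSn.
Qed.

Lemma spanned_all k p : (forall i, exists2 Z, Z \in G & 'X_i = xi Z) -> p \is k.-homog -> spanned k p.
Proof.
move=> hX /dhomogP hp; rewrite (mpolyE p) big_seq; apply: big_ind => [||m hm].
- by apply: spanned_I; apply: inI0.
- by move=> a b; apply: spannedD.
apply: spannedZ; rewrite -(hp m hm) => {hp hm}.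
have : W (mdeg m) 0 'X_[m].
  rewrite mpolyXE_id mdegE; apply: (big_ind2 (fun q j => W j 0 q)); first exact: W1.
    by move=> p1 k1 p2 k2 h1 h2; rewrite -[0%N]addn0; apply: WM.
  by move=> i _; have [Z ZG ->] := hX i; apply: (W_le (w := (m i * r Z)%N)) => //; apply: W_pow.
apply; [exact: spanned_I (inI0 _) | exact: spannedD | exact: spannedZ|].
by move=> m' sm' dm' _; apply: spanned_xim.
Qed.
End Span.

End Spanning.
Import Spanning.

(** * Dimensions between a spanning and an independent family *)

Module Sandwich.
Local Open Scope ring_scope.

Section Sand.
Variables (R : rcfType) (N : nat) (f : fnl R N) (d : nat).
Local Notation P := {mpoly R[N]}.
Hypothesis gf : graded f d.
Local Notation q k := (qk (Kk R N d) (gram d f) d k).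

Lemma homog_big k p : (d < k)%N -> p \is k.-homog -> rad f p.
Proof.
move=> hk hp v; rewrite (mpolyE v) mulr_sumr fn_sum big1 // => m _; rewrite -scalerAr fnZ.
have hom : p * 'X_[m] \is (k + mdeg m).-homog by rewrite dhomogM // dhomogX.
by rewrite (gradedP gf hom) ?mulr0 //; move: hk; clear; lia.
Qed.

Section Deg.
Variable k : nat.
Hypothesis kd : (k <= d)%N.
Let T := gram d f *m (Kk R N d (d - k)%N)^T.

Let radT (p : P) : p \is k.-homog -> (rv d p *m T = 0 <-> rad f p).
Proof.
move=> hp; have ep : pol (rv d p) = p := homog_rv kd hp; split=> h.
  move=> v; rewrite (mpolyE v) mulr_sumr fn_sum big1 // => m _; rewrite -scalerAr fnZ.
  have hm : ('X_[m] : P) \is (mdeg m).-homog by rewrite dhomogX.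
  have hpm := dhomogM hp hm; case: (eqVneq (k + mdeg m)%N d) => e; last by rewrite (gradedP gf hpm) ?mulr0.
  have dm : mdeg m = (d - k)%N by move: e; clear; lia.
  have md : (mdeg m <= d)%N by rewrite dm leq_subr.
  have em : pol (rv d 'X_[m]) = 'X_[m] :> P := homog_rv md hm.
  have /KkP : pol (rv d ('X_[m] : P)) \is (d - k).-homog by rewrite em -dm.
  case/submxP => X eX; rewrite -{1}ep -em -form_gram /form eX trmx_mul.
  by move: h; rewrite /T !mulmxA => ->; rewrite mul0mx mxE mulr0.
apply/matrixP => i j; rewrite [RHS]mxE ord1.
have -> : (rv d p *m T) 0 j = form (gram d f) (rv d p) (row j (Kk R N d (d - k)%N)).
  by rewrite /form /T mulmxA !mxE; apply: eq_bigr => x _; rewrite !mxE.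
by rewrite form_gram ep h.
Qed.

Let qE : q k = \rank (Kk R N d k *m T).
Proof. by rewrite /qk kd mulmxA. Qed.

Let bm s (b : 'I_s -> P) : 'M[R]_(s, _) := \matrix_i rv d (b i).
Let bm_mul s (b : 'I_s -> P) (c : 'rV[R]_s) : c *m bm b = rv d (\sum_i c 0 i *: b i).
Proof.
rewrite mulmx_sum_row; apply/rowP => j; rewrite !mxE raddf_sum summxE; apply: eq_bigr => i _.
by rewrite !mxE; apply/esym; exact: mcoeffZ.
Qed.
Let sum_homog s (b : 'I_s -> P) (c : 'I_s -> R) : (forall i, b i \is k.-homog) -> \sum_i c i *: b i \is k.-homog.
Proof. by move=> h; rewrite rpred_sum // => i _; rewrite rpredZ. Qed.

Lemma qk_le s (b : 'I_s -> P) : (forall i, b i \is k.-homog) ->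
  (forall p, p \is k.-homog -> exists c : 'I_s -> R, rad f (p - \sum_i c i *: b i)) ->
  (q k <= s)%N /\ (q k = s -> forall c : 'I_s -> R, rad f (\sum_i c i *: b i) -> forall i, c i = 0).
Proof.
move=> hb sp; have le : (Kk R N d k *m T <= bm b *m T)%MS.
  apply/row_subP => i; rewrite row_mul.
  have hp : pol (row i (Kk R N d k)) \is k.-homog by apply/KkP; apply: row_sub.
  have [c hc] := sp _ hp; apply/submxP; exists (\row_i c i); rewrite [RHS]mulmxA bm_mul.
  under eq_bigr do rewrite mxE.
  have hd : pol (row i (Kk R N d k)) - \sum_i c i *: b i \is k.-homog by rewrite rpredB // sum_homog.
  move/(radT hd): hc; rewrite (_ : rv d (_ - _) = row i (Kk R N d k) - rv d (\sum_i c i *: b i)).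
    by rewrite mulmxBl => /eqP; rewrite subr_eq0 => /eqP.
  have rvB (p p' : P) : rv d (p - p') = rv d p - rv d p' by apply/rowP => j; rewrite !mxE raddfB.
  by rewrite rvB polK.
have r1 := mxrankS le; have r2 := rank_leq_row (bm b *m T); rewrite qE; split; first exact: leq_trans r1 r2.
move=> e c /(radT (sum_homog c hb)) h i.
have fr : row_free (bm b *m T) by rewrite /row_free eqn_leq r2 -{1}e.
have : (\row_i c i) *m (bm b *m T) = 0.
  by rewrite mulmxA bm_mul -h; congr (rv d _ *m _); apply: eq_bigr => j _; rewrite mxE.
move/eqP; rewrite mulmx_free_eq0 // => /eqP/rowP/(_ i); by rewrite !mxE.
Qed.

Lemma qk_ge s (a : 'I_s -> P) : (forall i, a i \is k.-homog) ->
  (forall c : 'I_s -> R, rad f (\sum_i c i *: a i) -> forall i, c i = 0) -> (s <= q k)%N.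
Proof.
move=> ha ind; have fr : row_free (bm a *m T).
  apply/row_freeP; apply/row_freeP; rewrite -kermx_eq0; apply/eqP/row_matrixP => i; rewrite row0.
  set c := row i _; have : c *m (bm a *m T) = 0 by apply/sub_kermxP; apply: row_sub.
  rewrite mulmxA bm_mul => /(radT (sum_homog _ ha)) /ind h.
  by apply/rowP => j; rewrite h mxE.
have sub : (bm a <= Kk R N d k)%MS.
  by apply/row_subP => i; rewrite rowK; apply/KkP; rewrite (homog_rv kd).
by move: fr; rewrite /row_free qE => /eqP <-; apply: mxrankS; apply: submxMr.
Qed.
End Deg.

(** The images of the b_i span modulo the radical and the a_i are independent there, and both
    families have s elements. So q = s, and the images are independent over R, which gives
    independence of the b_i over the rationals. *)
Theorem quot_qk n (gens : {mpoly rat[n]} -> Prop) k (th : {mpoly rat[n]} -> P) s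
    (b : 'I_s -> {mpoly rat[n]}) (a : 'I_s -> P) :
  th 0 = 0 -> (forall p p', th (p + p') = th p + th p') -> (forall c p, th (c *: p) = ratr c *: th p) ->
  (forall p, p \is k.-homog -> th p \is k.-homog) -> (forall p, in_ideal gens p -> rad f (th p)) ->
  (forall i, b i \is k.-homog) ->
  (forall p, p \is k.-homog -> exists c : 'I_s -> rat, in_ideal gens (p - \sum_i c i *: b i)) ->
  (forall i, a i \is k.-homog) ->
  (forall c : 'I_s -> R, rad f (\sum_i c i *: a i) -> forall i, c i = 0) ->
  (forall (p : P) (Q : P -> Prop), p \is k.-homog -> (forall p, rad f p -> Q p) -> (forall p p', Q p -> Q p' -> Q (p + p')) ->
     (forall c p, Q p -> Q (c *: p)) -> (forall x, x \is k.-homog -> Q (th x)) -> Q p) ->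
  q k = s /\ quot_dim gens k (q k).
Proof.
move=> th0 thD thZ thH thI hb bsp ha aind surj.
have ths t (c : 'I_t -> rat) (x : 'I_t -> {mpoly rat[n]}) : th (\sum_i c i *: x i) = \sum_i ratr (c i) *: th (x i).
  by rewrite (big_morph th thD th0); apply: eq_bigr => i _; rewrite thZ.
have fin : q k = s -> (forall c : 'I_s -> R, rad f (\sum_i c i *: th (b i)) -> forall i, c i = 0) -> q k = s /\ quot_dim gens k (q k).
  move=> -> ind; split=> //; exists b; split=> [i|c hc i|p hp]; [exact: hb | | exact: bsp].
  have := ind (fun i => ratr (c i)); rewrite -ths => /(_ (thI _ hc) i) /eqP.
  by rewrite fmorph_eq0 => /eqP.
(* Above the top degree everything is in the radical, so an independent family is empty and s =
   0. *)
case: (leqP k d) => kd; last first.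
  have s0 : s = 0%N.
    case: s b a hb bsp ha aind {fin} => // s b a hb bsp ha aind.
    have := aind (fun=> 1); have r : rad f (\sum_i 1 *: a i).
      by apply: (homog_big kd); apply: rpred_sum => i _; apply: rpredZ; apply: ha.
    by move=> /(_ r ord0) /eqP; rewrite oner_eq0.
  by apply: fin => [|c _ i]; [rewrite /qk leqNgt kd s0 | by have := leq_trans (ltn_ord i) (eq_leq s0)].
have sp p : p \is k.-homog -> exists c : 'I_s -> R, rad f (p - \sum_i c i *: th (b i)).
  move=> hp; apply: (surj p (fun p => exists c : 'I_s -> R, rad f (p - \sum_i c i *: th (b i)))) => //.
  - by move=> p' h; exists (fun=> 0); rewrite big1 ?subr0 // => i _; rewrite scale0r.
  - move=> p1 p2 [c1 h1] [c2 h2]; exists (fun i => c1 i + c2 i); have := radD h1 h2; congr (rad f _).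
    have e : \sum_i (c1 i + c2 i) *: th (b i) = \sum_i c1 i *: th (b i) + \sum_i c2 i *: th (b i).
      by rewrite -big_split; apply: eq_bigr => i _; exact: scalerDl.
    by rewrite e; ring.
  - move=> c p1 [c1 h1]; exists (fun i => c * c1 i); have := radZ c h1; congr (rad f _).
    by rewrite scalerBr scaler_sumr; congr (_ - _); apply: eq_bigr => i _; rewrite scalerA.
  move=> x /bsp[c hc]; exists (fun i => ratr (c i)); have := thI _ hc; congr (rad f _).
  by rewrite -scaleN1r thD thZ ths rmorphN rmorph1 scaleN1r.
have hthb i : th (b i) \is k.-homog by apply: thH.
have [le1 eqind] := qk_le kd hthb sp; have ge1 := qk_ge kd ha aind.
have e : q k = s by apply/eqP; rewrite eqn_leq le1 ge1.
by apply: fin => //; apply: eqind.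
Qed.

Section Theta.
Variables (n : nat) (t : 'I_n -> P).
Hypothesis ht : forall i, t i \is 1.-homog.
Definition theta (p : {mpoly rat[n]}) : P := mmap (@mpolyC N R \o (ratr : rat -> R)) t p.

Lemma thetaM : {morph theta : p p' / p * p'}. Proof. by move=> p p'; rewrite /theta rmorphM. Qed.
Lemma thetaD p p' : theta (p + p') = theta p + theta p'. Proof. by rewrite /theta rmorphD. Qed.
Lemma theta0 : theta 0 = 0. Proof. by rewrite /theta rmorph0. Qed.
Lemma thetaZ c p : theta (c *: p) = ratr c *: theta p.
Proof. by rewrite -mul_mpolyC thetaM /theta mmapC /= mul_mpolyC. Qed.
Lemma theta_sum I (s : seq I) (Q : pred I) F : theta (\sum_(i <- s | Q i) F i) = \sum_(i <- s | Q i) theta (F i).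
Proof. by rewrite /theta rmorph_sum. Qed.
Lemma theta_prod I (s : seq I) (Q : pred I) F : theta (\prod_(i <- s | Q i) F i) = \prod_(i <- s | Q i) theta (F i).
Proof. by rewrite /theta rmorph_prod. Qed.
Lemma thetaX i : theta 'X_i = t i.
Proof. by rewrite /theta mmapX mmap1U. Qed.

Lemma theta_homog k p : p \is k.-homog -> theta p \is k.-homog.
Proof.
move=> /dhomogP hp; rewrite (mpolyE p) theta_sum big_seq rpred_sum // => m hm.
rewrite thetaZ rpredZ // /theta mmapX /mmap1.
have -> : k = (\sum_(i < n) (1 * m i))%N.
  transitivity (mdeg m); first by rewrite -(hp m hm).
  by rewrite mdegE; apply: eq_bigr => i _; rewrite mul1n.
apply: (big_ind2 (fun (q : P) (j : nat) => q \is j.-homog)); first exact: dhomog1.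
  by move=> *; apply: dhomogM.
by move=> i _; apply: dhomogMn.
Qed.

Lemma theta_ideal gens : (forall p, gens p -> rad f (theta p)) -> forall p, in_ideal gens p -> rad f (theta p).
Proof.
move=> h p [s [hs ->]]; rewrite theta_sum big_seq; elim/big_ind: _ => [|u v|i hi]; [exact: rad0 | exact: radD|].
by rewrite thetaM; apply: radMl; apply: h; apply: hs.
Qed.

(* The span of the image of [theta], modulo the radical. *)
Definition Sp k (p : P) := forall Q : P -> Prop, (forall p, rad f p -> Q p) -> (forall p p', Q p -> Q p' -> Q (p + p')) ->
     (forall c p, Q p -> Q (c *: p)) -> (forall x, x \is k.-homog -> Q (theta x)) -> Q p.
Lemma Sp_rad k p : rad f p -> Sp k p. Proof. by move=> h Q q0 *; apply: (q0). Qed.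
Lemma SpD k p p' : Sp k p -> Sp k p' -> Sp k (p + p').
Proof. by move=> h h' Q q0 qD qZ qX; apply: (qD); [apply: h | apply: h']. Qed.
Lemma SpZ k c p : Sp k p -> Sp k (c *: p).
Proof. by move=> h Q q0 qD qZ qX; apply: (qZ); apply: h. Qed.
Lemma Sp_sum k I (s : seq I) (Q : pred I) F : (forall i, Q i -> Sp k (F i)) -> Sp k (\sum_(i <- s | Q i) F i).
Proof. by move=> h; elim/big_ind: _ => [|p p' hp hp'|i hi]; [apply: Sp_rad; apply: rad0 | apply: SpD | apply: h]. Qed.
Lemma Sp_th k x : x \is k.-homog -> Sp k (theta x).
Proof. by move=> h Q q0 qD qZ qX; apply: qX. Qed.
Lemma Sp_mod k p p' : rad f (p - p') -> Sp k p' -> Sp k p.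
Proof. by move=> h h'; rewrite -(subrK p' p); apply: SpD h'; apply: Sp_rad. Qed.
Lemma SpM k k' p p' : Sp k p -> Sp k' p' -> Sp (k + k') (p * p').
Proof.
move=> hp hp'; apply: (hp (fun p => Sp (k + k') (p * p'))).
- by move=> u hu; apply: Sp_rad; apply: radMr.
- by move=> u v hu hv; rewrite mulrDl; apply: SpD.
- by move=> c u hu; rewrite -scalerAl; apply: SpZ.
move=> x hx; apply: (hp' (fun p' => Sp (k + k') (theta x * p'))).
- by move=> u hu; apply: Sp_rad; apply: radMl.
- by move=> u v hu hv; rewrite mulrDr; apply: SpD.
- by move=> c u hu; rewrite -scalerAr; apply: SpZ.
by move=> x' hx'; rewrite -thetaM; apply: Sp_th; apply: dhomogM.
Qed.
Lemma Sp_all : (forall j, Sp 1 ('X_j : P)) -> forall k p, p \is k.-homog -> Sp k p.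
Proof.
move=> hX k p /dhomogP hp; rewrite (mpolyE p) big_seq; apply: Sp_sum => m hm; apply: SpZ.
have -> : k = (\sum_(i < N) (1 * m i))%N.
  transitivity (mdeg m); first by rewrite -(hp m hm).
  by rewrite mdegE; apply: eq_bigr => i _; rewrite mul1n.
rewrite mpolyXE_id.
have e1 : theta 1 = 1 by rewrite /theta rmorph1.
have S0 : Sp 0 1 by rewrite -[X in Sp 0 X]e1; apply: Sp_th; apply: dhomog1.
apply: (big_ind2 (fun (q : P) (j : nat) => Sp j q)) => // [p1 k1 p2 k2|i _]; first exact: SpM.
elim: (m i) => [|e IH]; first by rewrite expr0 muln0.
by rewrite exprS mulnS; apply: SpM.
Qed.
End Theta.
End Sand.

End Sandwich.
Import Sandwich.

(** * Systems of classes and presentations of face rings *)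

Module Faces.
Local Open Scope ring_scope.

Arguments HR.phs : simpl never.
Arguments HR.phi : simpl never.
Arguments HR.sb : simpl never.

Section Face.
Variables (R : rcfType) (E : finType).
Local Notation N := #|{: {set E}}|.
Local Notation P := {mpoly R[N]}.
Local Notation hv := (@hv R E).
Local Notation phi := (@phi R E).
Local Notation sb := (@sb R E).
Implicit Types (A D T V W X Y Z c : {set E}) (B G S : {set {set E}}) (r : {set E} -> nat) (m : 'X_{1..N}).

(** The images of all variables x_Z, including maximal Z, with the relations of the Chow ring modulo
    the radical. Star functionals have one degree less, so [y_star] is conditional on a positive
    degree. *)
Record ysys D r d G (y : {set E} -> P) : Prop := Ysys {
  y_hom : forall Z, y Z \is 1.-homog;
  y_anti : forall B, B \subset G -> antichain B -> (1 < #|B|)%N ->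
    clD D r (\bigcup_(X in B) X) \in G -> rad (phi d r G) (\prod_(X in B) y X);
  y_lin : forall i, i \in D -> rad (phi d r G) (\sum_(Z in G | i \in Z) y Z);
  y_h : forall X, X \in G -> rad (phi d r G) (hv X + \sum_(Z in G | X \subset Z) y Z);
  y_star : forall d', d = d'.+1 -> starcl D r d' G y }.

Lemma nomax_anti D r G B V : mat D r -> built D r G -> B \subset G -> antichain B -> (1 < #|B|)%N ->
  clD D r (\bigcup_(X in B) X) \in G -> V \in B -> V \notin maxset G.
Proof.
move=> M bG BG /antiP aB cB JG hV; apply/negP => /in_maxset[_ mV].
have UD : \bigcup_(X in B) X \subset D by apply/bigcupsP => X /(subsetP BG)/(b_subD bG).
have sJ X : X \in B -> X \subset clD D r (\bigcup_(X in B) X).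
  by move=> hX; apply: subset_trans (sub_clD r UD); apply: bigcup_sup.
have eJ := mV _ JG (sJ V hV); have [X1 [X2 [h1 h2 ne]]] := card_gt1P cB.
have eX X : X \in B -> X = V by move=> hX; apply: aB => //; have := sJ X hX; rewrite eJ.
by move: ne; rewrite (eX X1) // (eX X2) // eqxx.
Qed.

Lemma topdeg_pos D r G V : mat D r -> built D r G -> V \in G -> V \notin maxset G -> exists d, topdeg r G = d.+1.
Proof.
move=> M bG VG nV; have [Ej hE VE] := maxset_above VG.
have VEp : V \proper Ej by rewrite properEneq VE andbT; apply: contra nV => /eqP ->.
by have := topdeg_star1 M bG hE VEp VG => <-; eexists.
Qed.

Lemma prod_homog (I : finType) (Q : {pred I}) (F : I -> P) : (forall i, F i \is 1.-homog) ->
  \prod_(i in Q) F i \is #|Q|.-homog.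
Proof.
move=> h; rewrite -sum1_card; apply: (big_ind2 (fun (q : P) (j : nat) => q \is j.-homog)) => //; first exact: dhomog1.
by move=> *; apply: dhomogM.
Qed.

(** No member lies above a maximal one, which forces its class to be minus its h; the other classes
    represent stars. In degree zero every linear form is in the radical. *)
Lemma ysys_exists D r d G : mat D r -> built D r G -> topdeg r G = d -> exists y, ysys D r d G y.
Proof.
move=> M bG; case: d => [|d] td.
  have r1 (p : P) k : (0 < k)%N -> p \is k.-homog -> rad (phi 0 r G) p.
    by move=> h hp; apply: (homog_big (@phi_graded R E 0 r G) h hp).
  have hs (Q : pred {set E}) : \sum_(Z in G | Q Z) - hv Z \is 1.-homog.
    by rewrite rpred_sum // => Z _; rewrite rpredN hv_homog.
  exists (fun Z => - hv Z); split=> //.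
  - by move=> Z; rewrite rpredN hv_homog.
  - move=> B _ _ cB _; apply: (r1 _ #|B|); first by apply: ltnW.
    by apply: prod_homog => Z; rewrite rpredN hv_homog.
  - by move=> i _; apply: (r1 _ 1%N) => //; apply: hs.
  - by move=> X _; apply: (r1 _ 1%N) => //; rewrite rpredD ?hv_homog ?hs.
have [y0 [hy0 hom0]] := starcl_exists R M bG td.
pose y Z := if Z \in maxset G then - hv Z else y0 Z.
have hom Z : y Z \is 1.-homog by rewrite /y; case: ifP => _; rewrite ?rpredN ?hv_homog.
have hy : starcl D r d G y by move=> Z ZG nZ q; rewrite /y (negPf nZ) hy0.
have sumD X Ej q : X \in G -> Ej \in maxset G -> X \subset Ej ->
    phi d.+1 r G ((hv X + \sum_(Z in G | X \subset Z) y Z) * q) = 0.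
  move=> XG hE XE; have /in_maxset[EG mE] := hE.
  have e : \sum_(Z in G | X \subset Z) y Z = - hv Ej + \sum_(Z in G | (X \subset Z) && (Z \proper Ej)) y Z.
    rewrite (bigD1 Ej) /=; last by rewrite EG XE.
    rewrite {1}/y hE; congr (_ + _); apply: eq_bigl => Z.
    case: (boolP (Z \in G)) => //= ZG; case: (boolP (X \subset Z)) => //= XZ.
    by rewrite properEneq (in_comp M bG ZG hE XZ XE (b_n0 bG XG)) andbT.
  have e2 : phi d.+1 r G ((\sum_(Z in G | (X \subset Z) && (Z \proper Ej)) y Z) * q) =
      \sum_(Z in G | (X \subset Z) && (Z \proper Ej)) phs R D r d Z G q.
    rewrite mulr_suml fn_sum; apply: eq_bigr => Z /andP[ZG /andP[_ ZE]].
    rewrite (hy Z) //; exact: proper_nmax ZE EG.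
  rewrite e mulrDl fnD mulrDl fnD e2 mulNr fnN (phi_D M bG td q hE XG XE).
  by rewrite opprD !addrA subrr add0r addNr.
exists y; split=> //.
- move=> B BG aB cB JG; apply: (nonface_rad M bG td hy hom) => // V hV; split; first exact: (subsetP BG).
  exact: nomax_anti JG hV.
- move=> i iD q; have [X XG /andP[iX /eqP rX]] := b_pt bG iD; have [Ej hE XE] := maxset_above XG.
  have := sumD X Ej q XG hE XE; rewrite mulrDl fnD (phi_pt _ _ XG rX) add0r => <-; congr (phi _ _ _ (_ * _)).
  apply: eq_bigl => Z; case: (boolP (Z \in G)) => //= ZG; apply/idP/idP => [iZ|/subsetP]; last exact.
  exact: (pt_sub M bG (b_fl bG ZG) XG rX iX iZ).
- by move=> X XG q; have [Ej hE XE] := maxset_above XG; apply: sumD XE.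
by move=> d' [<-].
Qed.

(** The input of the sandwich in every degree. The clause on degree zero makes the constant
    coefficient positive, which later fixes the degree of the polynomial. *)
Definition spanok (f : fnl R N) n (gens : {mpoly rat[n]} -> Prop) := forall k, exists s (b : 'I_s -> {mpoly rat[n]}) (a : 'I_s -> P),
  [/\ forall i, b i \is k.-homog,
      forall p, p \is k.-homog -> exists c : 'I_s -> rat, in_ideal gens (p - \sum_i c i *: b i),
      forall i, a i \is k.-homog,
      forall c : 'I_s -> R, rad f (\sum_i c i *: a i) -> forall i, c i = 0 &
      k = 0%N -> (0 < s)%N].

Lemma span_adm D r d G n (gens : {mpoly rat[n]} -> Prop) (xi : {set E} -> {mpoly rat[n]}) :
  mat D r -> built D r G -> topdeg r G = d ->
  (forall B, B \subset G -> antichain B -> (1 < #|B|)%N ->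
    clD D r (\bigcup_(X in B) X) \in G -> in_ideal gens (\prod_(X in B) xi X)) ->
  (forall i, i \in D -> in_ideal gens (\sum_(Z in G | i \in Z) xi Z)) ->
  (forall i, exists2 Z, Z \in G & 'X_i = xi Z) -> (forall Z, xi Z \is 1.-homog) ->
  spanok (phi d r G) gens.
Proof.
move=> M bG td h1 h2 h3 h4 k; pose A := [set m : 'X_{1..N < k.+1} | (mdeg m == k) && adm D r G m].
pose ev (i : 'I_#|A|) : 'X_{1..N} := bmnm (enum_val i).
exists #|A|, (fun i => xim xi (ev i)), (fun i => 'X_[ev i]).
have inA i : mdeg (ev i) = k /\ adm D r G (ev i).
  by have := enum_valP i; rewrite inE => /andP[/eqP].
split.
- move=> i; have [dm _] := inA i; rewrite /xim; have -> : k = (\sum_(X : {set E}) sv (ev i) X)%N by rewrite sum_sv.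
  apply: (big_ind2 (fun (q : {mpoly rat[n]}) (j : nat) => q \is j.-homog)); first exact: dhomog1.
    by move=> *; apply: dhomogM.
  by move=> X _; have := dhomogMn (sv (ev i) X) (h4 X); rewrite mul1n.
- move=> p hp; have [c hc] := spanned_all M bG h1 h2 h3 hp; exists (fun i : 'I_#|A| => c (enum_val i)).
  have e : \sum_(m in A) c m *: xim xi m = \sum_(i < #|A|) c (enum_val i) *: xim xi (ev i).
    by rewrite big_enum_val.
  by move: hc; congr (in_ideal _ (_ - _)); rewrite -e; apply: eq_bigl => m; rewrite inE.
- by move=> i; have [dm _] := inA i; rewrite dhomogX; apply/eqP; apply: dm.
- move=> c hc; pose u : P := \sum_i c i *: 'X_[ev i].
  have uc (m : 'X_{1..N}) : u@_m = \sum_i c i * (ev i == m)%:R.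
    by rewrite /u raddf_sum; apply: eq_bigr => i _; rewrite /= mcoeffZ mcoeffX.
  have u0 : u = 0.
    apply: (@IND R E k d D r G set0 u M bG td (sub0set _)).
      move=> m; rewrite mcoeff_msupp uc => hm.
      have [i e] : exists i, ev i = m.
        case: (boolP [exists i, ev i == m]) => [/existsP[i /eqP]|]; first by exists i.
        rewrite negb_exists => /forallP no; move: hm; rewrite big1 ?eqxx // => i _.
        by rewrite (negPf (no i)) mulr0.
      by have [dm am] := inA i; rewrite -e; split=> // X c' _; rewrite inE.
    have -> : mK r set0 = 0%MM :> 'X_{1..N} by rewrite /mK big_set0.
    by rewrite mpolyX0 mul1r.
  move=> i; have := uc (ev i); rewrite u0 mcoeff0 (bigD1 i) //= eqxx mulr1 big1 ?addr0 => [<-//|j ne].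
  case: eqP => [e|]; last by rewrite mulr0.
  have e' : enum_val j = enum_val i by apply: val_inj.
  by rewrite (enum_val_inj e') eqxx in ne.
move=> k0; rewrite card_gt0; apply/set0Pn.
have hb : (mdeg (0%MM : 'X_{1..N}) < k.+1)%N by rewrite mdeg0.
exists (BMultinom hb); rewrite inE; apply/andP; split; first by rewrite mdeg0 k0.
apply/admP; split; last by move=> X; rewrite /sv mnm0E.
have e : SU (0%MM : 'X_{1..N}) = set0 by apply/setP => X; rewrite !inE /sv mnm0E.
apply/nstP; rewrite [SU _]e sub0set; split=> // B; rewrite subset0 => /eqP -> _; by rewrite cards0.
Qed.

Lemma lift_gen (g : fnl R N) (rho : {set E} -> {set E}) G (v' : P) :
  (forall p v, g (p * v) = g (p * sb id [set rho X | X in G] v)) ->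
  exists v, [/\ forall u, g (u * v') = g (u * sb rho G v) & forall k, v' \is k.-homog -> v \is k.-homog].
Proof.
move=> kill; set G' := [set rho X | X in G] in kill; pose s Y := odflt set0 [pick X in G | rho X == Y].
have sP Y : Y \in G' -> s Y \in G /\ rho (s Y) = Y.
  move=> /imsetP[X XG ->]; rewrite /s; case: pickP => [X' /andP[h /eqP e]//|/(_ X)].
  by rewrite XG eqxx.
exists (sb s G' v'); split=> [u|k]; last exact: sb_homog.
rewrite [LHS]kill; congr (g (_ * _)).
rewrite (mpolyE v') (sb_sum id) (sb_sum s) (sb_sum rho); apply: eq_bigr => m _; rewrite !sbZ !sbX; congr (_ *: _).
case: ifPn => [h|_]; last by rewrite /HR.sb rmorph0.
rewrite sbX (supp_push _ h) => [|Y /sP[]//]; rewrite push_comp; congr 'X_[_].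
by rewrite !push_eq // => X /(suppP _ _ h)/sP[].
Qed.

Lemma HR_pull d (g f : fnl R N) rho G : (forall p v, g (p * v) = g (p * sb id [set rho X | X in G] v)) ->
  (forall q, f q = g (sb rho G q)) ->
  (forall a : {set E} -> R, (forall X, 0 < a X) -> HRf g d (lc a [set rho X | X in G])) ->
  forall a : {set E} -> R, (forall X, 0 < a X) -> HRf f d (lc a G).
Proof.
move=> kill fE hr c c0; set G' := [set rho X | X in G] in kill hr.
pose c' Y := if Y \in G' then \sum_(X in G | rho X == Y) c X else 1 : R.
have c'0 Y : 0 < c' Y.
  rewrite /c'; case: ifP => // /imsetP[X XG ->].
  rewrite (bigD1 X) ?XG ?eqxx //= ltr_pwDl ?c0 // sumr_ge0 // => X' _; exact: ltW.
apply: (HRf_pullback ltr01 _ (@sbM R E rho G) (sb1 R rho G) (@sb_homog R E rho G) _ _ (hr c' c'0)).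
- by move=> q; rewrite mul1r.
- rewrite /lc sb_sum (partition_big rho (mem G')) /=; last by move=> X XG; rewrite imset_f.
  apply: eq_bigr => Y YG'; rewrite /c' YG' scaler_suml; apply: eq_bigr => X /andP[XG /eqP <-].
  by rewrite sbZ sb_hv XG.
by move=> v'; have [v [hv' _]] := lift_gen v' kill; exists v.
Qed.

(** What a presentation of the star ring of S must satisfy: relations for non-faces, and linear
    forms from functionals vanishing on the span of the cone. *)
Record sdata D r G S n (gens : {mpoly rat[n]} -> Prop) (xi : {set E} -> {mpoly rat[n]}) : Prop := Sdata {
  s_non : forall B, (forall Z, Z \in B -> [/\ Z \in G, Z \notin maxset G & Z \notin S]) ->
     ~~ nst D r G (S :|: B) -> in_ideal gens (\prod_(Z in B) xi Z);
  s_lin : forall m : E -> rat, (forall X, X \in maxset G -> eS X m = 0) -> (forall X, X \in S -> eS X m = 0) ->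
     in_ideal gens (\sum_(Z in G | (Z \notin maxset G) && (Z \notin S)) eS Z m *: xi Z);
  s_var : forall i, exists Z, [/\ Z \in G, Z \notin maxset G, Z \notin S, nst D r G (Z |: S) & 'X_i = xi Z];
  s_hom : forall Z, xi Z \is 1.-homog }.

Lemma eS_delta X i : eS X (fun x => (x == i)%:R) = (i \in X)%:R.
Proof.
rewrite /eS big_mkcond (bigD1 i) //= eqxx big1 ?addr0 => [|x /negPf ne]; first by case: (i \in X).
by rewrite ne if_same.
Qed.
Lemma eSB X (m1 m2 : E -> rat) : eS X (fun x => m1 x - m2 x) = eS X m1 - eS X m2.
Proof. by rewrite /eS sumrB. Qed.
Lemma eSD X W (m : E -> rat) : eS X m = eS (X :\: W) m + eS (X :&: W) m.
Proof.
rewrite /eS [LHS](bigID (mem W)) /= addrC; congr (_ + _); apply: eq_bigl => x; rewrite !inE //.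
by rewrite andbC.
Qed.

(** For the empty face, the missing variable of a maximal element is restored as minus the sum over
    the nonmaximal members through a chosen point of it. *)
Lemma sdata0 D r d G n (gens : {mpoly rat[n]} -> Prop) xi :
  mat D r -> built D r G -> topdeg r G = d -> sdata D r G set0 gens xi -> spanok (phi d r G) gens.
Proof.
move=> M bG td [hn hl hv' hh]; have cC := comps_max M bG.
pose rep X := odflt X [pick Y : {set E} | [exists i in X, Y == [set i]]].
have hrep X : X \in maxset G -> exists i, i \in X.
  by move=> hX; apply/set0Pn; apply: (c_n0 cC).
have [rp hrp] : exists rp : {set E} -> option E, forall X, X \in maxset G -> exists2 i, rp X = Some i & i \in X.
  exists (fun X => [pick i in X]) => X /hrep[i iX]; case: pickP => [j jX|/(_ i)]; first by exists j.
  by rewrite iX.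
pose xi' X := if X \in maxset G then - \sum_(Z in G | (Z \notin maxset G) && (if rp X is Some i then i \in Z else false)) xi Z else xi X.
apply: (@span_adm D r d G n gens xi') => //.
- move=> B BG aB cB JG; have nm V : V \in B -> V \notin maxset G by apply: nomax_anti JG.
  rewrite (eq_bigr xi) => [|V hV]; last by rewrite /xi' (negPf (nm V hV)).
  apply: hn => [Z hZ|]; first by split; [exact: (subsetP BG) | exact: nm | rewrite inE].
  by rewrite set0U; apply/negP => /nstP[_ h]; have := h B (subxx _) aB cB; rewrite JG.
- move=> i iD; have [Ej hE iE] := c_cov cC iD; have [j ej jE] := hrp Ej hE; have /in_maxset[EG _] := hE.
  rewrite (bigD1 Ej) ?EG //= {1}/xi' hE ej.
  have -> : \sum_(Z | (Z \in G) && (i \in Z) && (Z != Ej)) xi' Z = \sum_(Z in G | (Z \notin maxset G) && (i \in Z)) xi Z.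
    apply: eq_big => [Z|Z /andP[/andP[ZG iZ] ne]].
      case: (Z \in G) => //=; case: (boolP (i \in Z)) => iZ; rewrite ?andbF //= andbT; congr (~~ _).
      by apply/eqP/idP => [->//|hZ]; apply: (c_disj cC hZ hE iZ iE).
    rewrite /xi'; case: ifP => // hZ; by case/eqP: ne; apply: (c_disj cC hZ hE iZ iE).
  have := hl (fun x => (x == i)%:R - (x == j)%:R); case=> [X hX|X|s [h1 h2]]; [|by rewrite inE|].
    rewrite eSB !eS_delta; apply/eqP; rewrite subr_eq0; apply/eqP; congr (nat_of_bool _)%:R.
    by apply/idP/idP => h; [rewrite (c_disj cC hX hE h iE) | rewrite (c_disj cC hX hE h jE)].
  have : in_ideal gens (\sum_(Z in G | (Z \notin maxset G) && (Z \notin set0)) eS Z (fun x => (x == i)%:R - (x == j)%:R) *: xi Z) by exists s.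
  congr (in_ideal _ _); rewrite addrC.
  have e1 l : \sum_(Z in G | (Z \notin maxset G) && (l \in Z)) xi Z =
     \sum_(Z in G | (Z \notin maxset G) && (Z \notin set0)) (l \in Z)%:R *: xi Z.
    rewrite big_mkcond [RHS]big_mkcond; apply: eq_bigr => Z _; rewrite in_set0 /= andbT.
    case: (Z \in G) => //=; case: (Z \in maxset G) => //=; case: (l \in Z); by rewrite ?scale1r ?scale0r.
  rewrite !e1 -sumrB; apply: eq_bigr => Z _; by rewrite eSB !eS_delta scalerBl.
- by move=> i; have [Z [ZG nZ _ _ e]] := hv' i; exists Z => //; rewrite /xi' (negPf nZ).
move=> Z; rewrite /xi'; case: ifP => // _; rewrite rpredN rpred_sum //.
Qed.

Section Step.
Variables (D : {set E}) (r : {set E} -> nat) (G S : {set {set E}}) (W : {set E}).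
Hypothesis M : mat D r.
Hypothesis bG : built D r G.
Hypothesis nS : nst D r G S.
Hypothesis nmax : forall V, V \in S -> V \notin maxset G.
Hypothesis WS : W \in S.
Local Notation up := (up D r W).
Local Notation G' := (Gs D r G W).
Local Notation S' := [set up V | V in S :\ W].
Let SG : S \subset G. Proof. by have /nstP[] := nS. Qed.
Let WG : W \in G. Proof. exact: (subsetP SG). Qed.
Let nW := nmax WS.

(** The new variable of Z' is that of its preimage nested with W and outside S, or zero if there is
    none; [up_injS] shows that the sum has at most one term. *)
Lemma sdata_step n (gens : {mpoly rat[n]} -> Prop) xi : sdata D r G S gens xi ->
  exists xi', sdata D (rs r W) G' S' gens xi'.
Proof.
move=> [hn hl hx hh]; pose good Z := [&& Z \in G, Z \notin maxset G, Z \notin S & nst2 D r G Z W].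
exists (fun Z' => \sum_(Z | good Z && (up Z == Z')) xi Z).
have one Z : good Z -> \sum_(Y | good Y && (up Y == up Z)) xi Y = xi Z.
  move=> gZ; have /and4P[ZG _ _ sZ] := gZ; rewrite (big_pred1 Z) // => Y /=.
  apply/andP/eqP => [[/and4P[YG _ _ sY] /eqP]|->]; last by rewrite gZ eqxx.
  exact: (up_injS M bG WG).
have gW Z : good Z -> Z != W by case/and4P => _ _ h _; apply: contraNneq h => ->.
have goodS' Z : good Z -> up Z \notin S'.
  move=> gZ; have /and4P[ZG _ nZ sZ] := gZ; apply: contra nZ => /imsetP[V /setD1P[_ hV]].
  by move/(up_injS M bG WG ZG (subsetP SG _ hV) sZ (nst_pair nS hV WS)) ->.
split.
- move=> B hB hnon; case: (boolP [forall Z' in B, [exists Z, good Z && (up Z == Z')]]) => [/forall_inP all|]; last first.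
    rewrite negb_forall_in => /exists_inP[Z' hZ']; rewrite negb_exists => /forallP no.
    rewrite (bigD1 Z') //= big_pred0 ?mul0r; [exact: inI0 | by move=> Z; apply/negbTE].
  pose B0 := [set Z | good Z && (up Z \in B)].
  have eB : B = [set up Z | Z in B0].
    apply/setP => Z'; apply/idP/imsetP => [h|[Z]]; last by rewrite inE => /andP[_ h] ->.
    by have /existsP[Z /andP[gZ /eqP e]] := all Z' h; exists Z => //; rewrite inE gZ e.
  have gB0 Z : Z \in B0 -> good Z by rewrite inE => /andP[].
  rewrite eB big_imset /=; last first.
    move=> Z1 Z2 /gB0/and4P[g1 _ _ s1] /gB0/and4P[g2 _ _ s2]; exact: (up_injS M bG WG).
  rewrite (eq_bigr xi) => [|Z /gB0/one //]; apply: hn => [Z /gB0/and4P[]//|].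
  apply: contra hnon => nSB; have := nst_star M bG WG nSB; rewrite inE WS => /(_ isT).
  apply: nst_sub; rewrite eB; apply/subsetP => Z' /setUP[/imsetP[V /setD1P[ne hV] ->]|/imsetP[Z hZ ->]].
    by apply: imset_f; rewrite !inE ne hV.
  by apply: imset_f; rewrite in_setD1 (gW _ (gB0 _ hZ)) inE hZ orbT.
- move=> m hmax hS'.
  have mW : eS W m = 0 by apply: hmax; apply: (W_max M bG WG nW).
  have upE Z : Z \in G -> nst2 D r G Z W -> eS (up Z) m = eS Z m.
    move=> ZG sZ; case: (boolP (Z \subset W)) => ZW; first by rewrite up_in.
    have [-> _ _] := up_nst M bG WG ZG ZW sZ; rewrite [RHS](eSD Z W).
    case: (boolP (W \subset Z)) => WZ; first by rewrite (setIidPr WZ) mW addr0.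
    have [_ _ _ ->] := pair_fac M bG ZG WG ZW WZ sZ.
    by rewrite [eS set0 m]/eS big_set0 addr0.
  have := hl m; case=> [X hX|X hX|s [h1 h2]].
  + have /in_maxset[XG _] := hX; rewrite -(upE X XG (max_nst bG WG hX)); apply: hmax; exact: max_up.
  + case: (eqVneq X W) => [->//|ne]; rewrite -(upE X (subsetP SG _ hX) (nst_pair nS hX WS)).
    by apply: hS'; apply: imset_f; rewrite !inE ne.
  have base : in_ideal gens (\sum_(Z in G | (Z \notin maxset G) && (Z \notin S)) eS Z m *: xi Z) by exists s.
  have bad : in_ideal gens (\sum_(Z in G | [&& Z \notin maxset G, Z \notin S & ~~ nst2 D r G Z W]) eS Z m *: xi Z).
    apply: inI_sum => Z /and4P[ZG nZ ZS sZ]; apply: inIZ.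
    have := hn [set Z]; rewrite big_set1; apply=> [Y /set1P ->//|]; apply: contra sZ => h.
    by apply: (nst_pair h); rewrite !inE ?eqxx ?WS ?orbT.
  have := inIB base bad; congr (in_ideal _ _).
  rewrite (bigID (fun Z => nst2 D r G Z W)) /=.
  rewrite [X in _ + X - _](eq_bigl (fun Z => (Z \in G) && [&& Z \notin maxset G, Z \notin S & ~~ nst2 D r G Z W])) => [|Z].
    rewrite addrK; under [RHS]eq_bigr do rewrite scaler_sumr.
    rewrite (exchange_big_dep (fun Z => good Z)) /=; last by move=> Z' Z _ /andP[].
    apply: eq_big => [Z|Z]; first by rewrite /good -!andbA.
    move=> /andP[/andP[ZG /andP[nZ ZS]] sZ]; have gZ : good Z by rewrite /good ZG nZ ZS.
    rewrite (big_pred1 (up Z)) => [|Z' /=]; first by rewrite upE.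
    rewrite gZ /=; apply/idP/eqP => [/andP[_ /eqP]//|->]; rewrite eqxx andbT imset_f //=.
    rewrite (goodS' Z gZ) andbT; exact: (up_nmax M bG WG nW ZG nZ (gW Z gZ) sZ).
  by rewrite -!andbA.
- move=> i; have [Z [ZG nZ ZS sZ e]] := hx i.
  have ZSn : Z \in Z |: S by rewrite !inE eqxx.
  have WSn : W \in Z |: S by rewrite inE WS orbT.
  have n2 := nst_pair sZ ZSn WSn; have gZ : good Z by rewrite /good ZG nZ ZS.
  exists (up Z); split; [exact: imset_f | exact: (up_nmax M bG WG nW ZG nZ (gW Z gZ) n2) | exact: goodS' | | by rewrite one].
  have := nst_star M bG WG sZ WSn; apply: nst_sub; apply/subsetP => Z' /setU1P[->|/imsetP[V /setD1P[ne hV] ->]].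
    by apply: imset_f; rewrite in_setD1 (gW Z gZ).
  by apply: imset_f; rewrite !inE ne hV orbT.
move=> Z'; rewrite rpred_sum //.
Qed.
End Step.
End Face.

End Faces.
Import Faces.

(** * Functionals of faces and their quotient rings *)

Module FaceQuotients.
Local Open Scope ring_scope.

Arguments HR.phs : simpl never.
Arguments HR.phi : simpl never.
Arguments HR.sb : simpl never.

Section Face2.
Variables (R : rcfType) (E : finType).
Local Notation N := #|{: {set E}}|.
Local Notation P := {mpoly R[N]}.
Local Notation hv := (@hv R E).
Local Notation phi := (@phi R E).
Local Notation sb := (@sb R E).
Implicit Types (A D T V W X Y Z : {set E}) (B G S : {set {set E}}) (r : {set E} -> nat) (m : 'X_{1..N}).

Definition fS d r G S (y : {set E} -> P) := fmul (phi d r G) (\prod_(V in S) y V).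

Lemma fSE d r G S y q : fS d r G S y q = phi d r G (\prod_(V in S) y V * q). Proof. by []. Qed.

Lemma fS_kill d r G S y (p v : P) : fS d r G S y (p * v) = fS d r G S y (p * sb id G v).
Proof.
by have := @phi_kill R E d r G (\prod_(V in S) y V * p) v; rewrite -!mulrA => h; exact: h.
Qed.

(** If the star of W has degree zero it carries no classes to restrict; but then S is reduced to W
    and both products become trivial. *)
Lemma fS_step D r d G S W y d1 y' : mat D r -> built D r G -> topdeg r G = d.+1 -> starcl D r d G y ->
  nst D r G S -> (forall V, V \in S -> V \notin maxset G) -> W \in S ->
  topdeg (rs r W) (Gs D r G W) = d1 -> (forall d', d1 = d'.+1 -> starcl D (rs r W) d' (Gs D r G W) y') ->
  d1 = d /\ forall q, fS d.+1 r G S y q = fS d1 (rs r W) (Gs D r G W) [set up D r W V | V in S :\ W] y' (sb (up D r W) G q).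
Proof.
move=> M bG td hy nS nm WS td1 hy'; have /nstP[/subsetP SG _] := nS; have WG := SG W WS; have nW := nm W WS.
have [Ej hE WE] := maxset_above WG.
have WEp : W \proper Ej by rewrite properEneq WE andbT; apply: contra nW => /eqP ->.
have ed : d1 = d by have := topdeg_star1 M bG hE WEp WG; rewrite td td1 => -[].
split=> // q; case: d1 ed td1 hy' => [|d1] ed td1 hy'; last first.
  subst d; apply: (face_step M bG td hy WG nW) => //; exact: hy'.
have S0 : S :\ W = set0.
  apply/eqP; apply: contraT => /set0Pn[V /setD1P[ne hV]].
  have n2 := nst_pair nS hV WS; have VG := SG V hV.
  have nV' := up_nmax M bG WG nW VG (nm V hV) ne n2.
  have [d'] := topdeg_pos (mat_star M (b_fl bG WG)) (built_star M bG (b_fl bG WG)) (imset_f _ VG) nV'.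
  by rewrite td1.
have e0 : \prod_(V in S) y V = y W * \prod_(V in S :\ W) y V by rewrite (big_setD1 W WS).
have p1 (z : {set E} -> P) (T : {set {set E}}) : T = set0 -> \prod_(V in T) z V = 1 by move=> ->; rewrite big_set0.
change (phi d.+1 r G (\prod_(V in S) y V * q) = phi 0 (rs r W) (Gs D r G W)
  (\prod_(V in [set up D r W V | V in S :\ W]) y' V * sb (up D r W) G q)).
by rewrite e0 (p1 y _ S0) (p1 y' _ (_ : [set up D r W V | V in S :\ W] = set0)) ?S0 ?imset0 // mulr1 mul1r -(hy W WG nW) -ed.
Qed.

(** Induction on the number of elements of S, one star at a time; the relations and the presentation
    are pulled back along the substitution of the star. *)
Theorem face_data S D r G d y : mat D r -> built D r G -> topdeg r G = d -> ysys D r d G y ->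
  nst D r G S -> (forall V, V \in S -> V \notin maxset G) ->
  exists d', [/\ graded (fS d r G S y) d',
    forall a : {set E} -> R, (forall X, 0 < a X) -> HRf (fS d r G S y) d' (lc a G) &
    forall n (gens : {mpoly rat[n]} -> Prop) xi, sdata D r G S gens xi -> spanok (fS d r G S y) gens].
Proof.
have [c] := ubnP #|S|; elim: c S D r G d y => // c IH S D r G d y hc M bG td hy nS nm.
have [S0|[W WS]] := set_0Vmem S.
  have e q : phi d r G q = fS d r G S y q by rewrite fSE S0 big_set0 mul1r.
  exists d; split.
  - by move=> m hm; rewrite -e; apply: phi_graded.
  - by move=> a a0; apply: (HRf_eq e); apply: (HR_main M bG td).
  move=> n gens xi; rewrite S0 => sd k; have [s [b [a [h1 h2 h3 h4 h5]]]] := sdata0 R M bG td sd k.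
  exists s, b, a; split=> // x hx; apply: h4 => v; by rewrite e S0; apply: hx.
have /nstP[/subsetP SG _] := nS; have WG := SG W WS; have nW := nm W WS; have fW := b_fl bG WG.
have M' := mat_star M fW; have bG' := built_star M bG fW.
have [d0 ed] := topdeg_pos M bG WG nW; rewrite td in ed.
have [y' hy'] := ysys_exists R M' bG' erefl.
have tdd : topdeg r G = d0.+1 by rewrite td.
have [e1 fE] := fS_step M bG tdd (y_star hy ed) nS nm WS erefl (y_star hy').
rewrite -ed in fE; set S' := [set _ | _ in _] in fE; set f' := fS _ (rs r W) _ _ _ in fE.
have hS' : (#|S'| < c)%N.
  by move: hc; rewrite (cardsD1 W S) WS add1n ltnS; apply: leq_ltn_trans; apply: leq_imset_card.
have nS' : nst D (rs r W) (Gs D r G W) S' := nst_star M bG WG nS WS.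
have nm' V : V \in S' -> V \notin maxset (Gs D r G W).
  move=> /imsetP[V0 /setD1P[ne hV0] ->]; apply: (up_nmax M bG WG nW (SG _ hV0) (nm _ hV0) ne).
  exact: nst_pair nS hV0 WS.
have [d' [g' h' sp']] := IH S' D _ _ _ y' hS' M' bG' erefl hy' nS' nm'.
have kill p v : f' (p * v) = f' (p * sb id [set up D r W X | X in G] v).
  exact: fS_kill.
exists d'; split.
- move=> m hm; rewrite fE sbX; case: ifP => _; last by rewrite fn0.
  by apply: g'; rewrite mdeg_push.
- exact: (HR_pull kill fE).
move=> n gens xi sd k; have [xi' sd'] := sdata_step M bG nS nm WS sd.
have [s [b [a [h1 h2 h3 h4 h5]]]] := sp' n gens xi' sd' k.
have [v hv'] := fin_all_exists (fun i : 'I_s => lift_gen (a i) kill).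
exists s, b, v; split=> // [i|x hx]; first by have [_ h] := hv' i; apply: h.
apply: h4 => w; have [w' [hw _]] := lift_gen w kill; rewrite hw.
have e0 := hx w'; rewrite fE sbM sb_sum in e0; apply: etrans e0.
rewrite !mulr_suml !fn_sum; apply: eq_bigr => i _; rewrite sbZ -!scalerAl !fnZ; congr (_ * _).
by have [h _] := hv' i; rewrite [a i * _]mulrC [sb _ _ (v i) * _]mulrC h.
Qed.

Section Quot.
Variables (D : {set E}) (r : {set E} -> nat) (G S : {set {set E}}) (d : nat) (y : {set E} -> P).
Hypothesis M : mat D r.
Hypothesis bG : built D r G.
Hypothesis td : topdeg r G = d.
Hypothesis hy : ysys D r d G y.
Hypothesis nS : nst D r G S.
Hypothesis nm : forall V, V \in S -> V \notin maxset G.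
Local Notation f := (fS d r G S y).

Lemma fS_rad p : rad (phi d r G) p -> rad f p.
Proof. by move=> h v; rewrite fSE mulrCA; apply: h. Qed.

(** The antichain that violates nestedness splits into a part in S, already present in the
    functional, and a part in B. *)
Lemma fS_nonface B : B \subset G -> ~~ nst D r G (S :|: B) -> rad f (\prod_(Z in B) y Z).
Proof.
move=> BG; have /nstP[SG _] := nS; rewrite /nst subUset SG BG /= negb_forall => /existsP[A].
rewrite negb_imply negbK => /andP[/and3P[AS aA cA] JG] v; rewrite fSE mulrA.
have AG : A \subset G by apply: subset_trans AS _; rewrite subUset SG.
have hr := y_anti hy AG aA cA JG.
have eA : \prod_(Z in A) y Z = \prod_(Z in A :&: S) y Z * \prod_(Z in A :\: S) y Z.
  rewrite (bigID (mem S)) /=; congr (_ * _); apply: eq_bigl => Z; rewrite !inE //; exact: andbC.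
rewrite (bigID (mem A)) /= [X in _ * X * _](bigID (mem (A :\: S))) /=.
have -> : \prod_(V in S | V \in A) y V = \prod_(Z in A :&: S) y Z by apply: eq_bigl => Z; rewrite !inE andbC.
have -> : \prod_(Z in B | Z \in A :\: S) y Z = \prod_(Z in A :\: S) y Z.
  apply: eq_bigl => Z; rewrite andb_idl // inE => /andP[ZS /(subsetP AS)]; by rewrite inE (negPf ZS).
set p1 := \prod_(Z in A :&: S) _ in eA *; set p2 := \prod_(Z in A :\: S) _ in eA *.
have -> : p1 * \prod_(V in S | V \notin A) y V * (p2 * \prod_(i in B | i \notin A :\: S) y i) * v =
   p1 * p2 * (\prod_(V in S | V \notin A) y V * \prod_(i in B | i \notin A :\: S) y i * v) by ring.
rewrite -eA; exact: hr.
Qed.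

Lemma fS_lin (m : E -> rat) : (forall X, X \in maxset G -> eS X m = 0) ->
  rad f (\sum_(Z in G | Z \notin maxset G) (ratr (eS Z m) : R) *: y Z).
Proof.
move=> hm; apply: fS_rad.
have h : rad (phi d r G) (\sum_(i in D) (ratr (m i) : R) *: \sum_(Z in G | i \in Z) y Z).
  by elim/big_ind: _ => [|p q|i iD]; [exact: rad0 | exact: radD | apply: radZ; exact: (y_lin hy)].
move: h; congr (rad _ _).
have eSr Z : Z \in G -> ratr (eS Z m) = \sum_(i in D | i \in Z) (ratr (m i) : R).
  move=> ZG; rewrite /eS rmorph_sum; apply: eq_bigl => i; rewrite andb_idl //; exact: (subsetP (b_subD bG ZG)).
under eq_bigr do rewrite scaler_sumr; rewrite (exchange_big_dep (mem G)) /=; last by move=> i Z _ /andP[].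
rewrite [RHS]big_mkcondr /=; apply: eq_bigr => Z ZG.
transitivity ((ratr (eS Z m) : R) *: y Z).
  by rewrite eSr // scaler_suml; apply: eq_bigl => i; rewrite ZG.
by case: ifPn => //; rewrite negbK => hZ; rewrite hm // rmorph0 scale0r.
Qed.

(* Picks a functional equal to [1] on [V] and vanishing on the rest of the face. *)
Lemma pick_lin V : V \in S -> exists m : E -> rat, [/\ eS V m = 1, forall X, X \in maxset G -> eS X m = 0 &
  forall X, X \in S -> X != V -> eS X m = 0].
Proof.
move=> hV; have /nstP[/subsetP SG hn] := nS; have cC := comps_max M bG.
pose S1 := S :|: maxset G.
have S1G X : X \in S1 -> X \in G by case/setUP => [/SG//|/in_maxset[]].
have tri X Y : X \in S1 -> Y \in S1 -> X :&: Y != set0 -> (X \subset Y) || (Y \subset X).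
  move=> hX hY n0; have mx Z1 Z2 : Z1 \in maxset G -> Z2 \in S1 -> Z1 :&: Z2 != set0 -> Z2 \subset Z1.
    move=> h1 h2 /set0Pn[x /setIP[x1 x2]].
    by apply: (in_comp M bG (V := [set x]) (S1G _ h2) h1); rewrite ?sub1set //; apply/set0Pn; exists x; rewrite inE.
  case/setUP: hX => hX; last by rewrite (mx _ _ hX hY n0) orbT.
  case/setUP: (hY) => hY'; last by rewrite (mx _ X hY') ?inE ?hX // setIC.
  have := nst_pair nS hX hY'; rewrite /nst2 (b_join bG (SG _ hX) (SG _ hY') n0) orbF.
  by [].
(* If the smaller members covered X, the maximal ones among them would form a nested antichain with
   join X, a member of G. *)
have fresh X : X \in S1 -> exists2 i, i \in X & forall Y, Y \in S1 -> Y \proper X -> i \notin Y.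
  move=> hX; pose A := [set Y in S1 | Y \proper X]; pose B := maxset A.
  have AS Y : Y \in A -> Y \in S.
    rewrite inE => /andP[/setUP[//|/in_maxset[_ mY]] YX].
    by have := YX; rewrite (mY X (S1G _ hX) (proper_sub YX)) properxx.
  have BA Y : Y \in B -> Y \in A by case/in_maxset.
  have [i iX iB] : exists2 i, i \in X & i \notin \bigcup_(Y in B) Y.
    apply/subsetPn; apply/negP => XB.
    have eX : \bigcup_(Y in B) Y = X.
      apply/eqP; rewrite eqEsubset XB andbT; apply/bigcupsP => Y /BA; rewrite inE => /andP[_ /proper_sub]//.
    have BS : B \subset S by apply/subsetP => Y /BA/AS.
    have aB : antichain B by apply/antiP => Y Z /in_maxset[_ mY] /BA hZ YZ; rewrite (mY Z).
    have cX : clD D r X = X by apply: (cl_eq M) => //; apply: (b_fl bG (S1G _ hX)).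
    case: (ltnP 1 #|B|) => cB; first by have := hn B BS aB cB; rewrite eX cX S1G.
    case: (set_0Vmem B) => [B0|[Y hY]].
      by have := b_n0 bG (S1G _ hX); rewrite -eX B0 big_set0 eqxx.
    have eB : B = [set Y] by apply/eqP; rewrite eq_sym eqEcard sub1set hY cards1.
    have := BA Y hY; rewrite inE => /andP[_]; by rewrite -eX eB big_set1 properxx.
  exists i => // Y hY YX; apply: contra iB => iY.
  have YA : Y \in A by rewrite inE hY.
  have [Y' hY' YY'] := maxset_above YA; apply/bigcupP; exists Y' => //; exact: (subsetP YY').
have VS1 : V \in S1 by rewrite inE hV.
have [i iV hi] := fresh V VS1.
have [Ej hE VE] := maxset_above (SG V hV).
have VEp : V \proper Ej by rewrite properEneq VE andbT; apply: contra (nm hV) => /eqP ->.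
have hE1 : (Ej \in S1) && (V \proper Ej) by rewrite inE hE orbT.
(* U is the next member above V. A point i new in V minus a point j new in U is separated by V alone
   among the members. *)
have [U /andP[hU VU] Umin] := @arg_minnP _ Ej (fun U => (U \in S1) && (V \proper U)) (fun U => #|U|) hE1.
have [j jU hj] := fresh U hU.
have mE X : eS X (fun x => (x == i)%:R - (x == j)%:R) = (i \in X)%:R - (j \in X)%:R by rewrite eSB !eS_delta.
have jV : j \notin V by apply: hj.
have main X : X \in S1 -> X != V -> (i \in X) = (j \in X).
  move=> hX ne; have VX0 : i \in X -> V \proper X.
    move=> iX; have : V :&: X != set0 by apply/set0Pn; exists i; rewrite inE iV.
    case/(tri V X VS1 hX)/orP => h; first by rewrite properEneq eq_sym ne.
    by have := hi X hX; rewrite properEneq ne h iX => /(_ isT).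
  apply/idP/idP => [iX|jX].
    have VX := VX0 iX; have : X :&: U != set0 by apply/set0Pn; exists i; rewrite inE iX (subsetP (proper_sub VU)).
    case/(tri X U hX hU)/orP => h; last exact: (subsetP h).
    have c1 := Umin X; rewrite hX VX in c1; have e : X = U by apply/eqP; rewrite eqEcard h c1.
    by rewrite e.
  have : X :&: U != set0 by apply/set0Pn; exists j; rewrite inE jX.
  case/(tri X U hX hU)/orP => h; last by apply: (subsetP h); apply: (subsetP (proper_sub VU)).
  case: (eqVneq X U) => [->|ne']; first by apply: (subsetP (proper_sub VU)).
  by have := hj X hX; rewrite properEneq ne' h jX => /(_ isT).
exists (fun x => (x == i)%:R - (x == j)%:R); split.
- by rewrite mE iV (negPf jV) subr0.
- move=> X hX; have h1 : X \in S1 by apply/setUP; right.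
  have h2 : X != V by apply: contraNneq (nm hV) => <-.
  by rewrite mE (main X h1 h2) subrr.
move=> X hX ne; have h1 : X \in S1 by apply/setUP; left.
by rewrite mE (main X h1 ne) subrr.
Qed.

Section Surj.
Variables (n : nat) (t : 'I_n -> P).
Hypothesis ht : forall i, t i \is 1.-homog.
Hypothesis tS : forall Z, Z \in G -> Z \notin maxset G -> Z \notin S -> rad f (y Z) \/ exists i, t i = y Z.

(** Classes of S are expressed through the others by a functional equal to one on them, classes of
    maximal elements by the relation at one of their points. *)
Lemma Sp_y Z : Z \in G -> Sp f t 1 (y Z).
Proof.
have h0 V : V \in G -> V \notin maxset G -> V \notin S -> Sp f t 1 (y V).
  move=> VG nV VS; have [h|[i <-]] := tS VG nV VS; first exact: Sp_rad.
  by rewrite -(thetaX t i); apply: Sp_th; rewrite dhomogX; apply/eqP; apply: mdeg1.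
have h1 V : V \in G -> V \notin maxset G -> Sp f t 1 (y V).
  move=> VG nV; case: (boolP (V \in S)) => VS; last exact: h0.
  have [m [m1 m2 m3]] := pick_lin VS; have := fS_lin m2.
  rewrite (bigD1 V) ?VG //= m1 rmorph1 scale1r => hr.
  apply: (Sp_mod (p' := - \sum_(Z0 | (Z0 \in G) && (Z0 \notin maxset G) && (Z0 != V)) (ratr (eS Z0 m) : R) *: y Z0)).
    by rewrite opprK.
  rewrite -scaleN1r; apply: SpZ; apply: Sp_sum => U /andP[/andP[UG nU] ne].
  case: (boolP (U \in S)) => US; last by apply: SpZ; apply: h0.
  by rewrite m3 // rmorph0 scale0r; apply: Sp_rad; apply: rad0.
move=> ZG; case: (boolP (Z \in maxset G)) => hZ; last exact: h1.
have [i iZ] : exists i, i \in Z by apply/set0Pn; apply: (b_n0 bG).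
have iD : i \in D := subsetP (b_subD bG ZG) _ iZ.
have := fS_rad (y_lin hy iD); rewrite (bigD1 Z) ?ZG //= => hr.
apply: (Sp_mod (p' := - \sum_(Z0 | (Z0 \in G) && (i \in Z0) && (Z0 != Z)) y Z0)); first by rewrite opprK.
rewrite -scaleN1r; apply: SpZ; apply: Sp_sum => U /andP[/andP[UG iU] ne]; apply: h1 => //.
by apply: contra ne => hU; rewrite (c_disj (comps_max M bG) hU hZ iU iZ).
Qed.

Lemma Sp_X j : Sp f t 1 ('X_j : P).
Proof.
have e : 'X_j = hv (enum_val j) by rewrite /HR.hv enum_valK.
rewrite e; case: (boolP (enum_val j \in G)) => XG; last first.
  by apply: Sp_rad; apply: fS_rad => q; rewrite mulrC phi_kill sb_hv (negPf XG) mulr0 fn0.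
apply: (Sp_mod (p' := - \sum_(Z in G | enum_val j \subset Z) y Z)).
  by rewrite opprK; apply: fS_rad; apply: (y_h hy).
rewrite -scaleN1r; apply: SpZ; apply: Sp_sum => U /andP[UG _]; exact: Sp_y.
Qed.

Lemma quot_face d' gens : graded f d' -> spanok f gens -> (forall p, gens p -> rad f (theta t p)) ->
  forall k, quot_dim gens k (qk (Kk R N d' ) (gram d' f) d' k) /\ (k = 0%N -> (0 < qk (Kk R N d') (gram d' f) d' k)%N).
Proof.
move=> gf sp hg k; have [s [b [a [h1 h2 h3 h4 h5]]]] := sp k.
have [||e q] := @quot_qk R N f d' gf n gens k (theta t) s b a (theta0 t) (thetaD t) (thetaZ t)
  (fun p hp => theta_homog ht hp) (theta_ideal hg) h1 h2 h3.
- exact: h4.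
- by move=> p Q hp; apply: (Sp_all Sp_X hp).
by split=> // k0; rewrite e; apply: h5.
Qed.
End Surj.
End Quot.
End Face2.

End FaceQuotients.
Import FaceQuotients.

(** * From square relations to gamma-positivity *)

Module GammaVectors.
Local Open Scope ring_scope.

Arguments HR.phs : simpl never.
Arguments HR.phi : simpl never.
Arguments HR.sb : simpl never.

Section Gamma.
Variables (R : rcfType) (E : finType).
Local Notation N := #|{: {set E}}|.
Local Notation P := {mpoly R[N]}.
Local Notation hv := (@hv R E).
Local Notation phi := (@phi R E).
Implicit Types (A D T V W X Y Z : {set E}) (B G S : {set {set E}}) (r : {set E} -> nat).

Definition squares D r G := forall Y, Y \in G -> r Y = 1%N \/
  exists T1 T2, [/\ T1 \in G, T2 \in G, T1 \proper Y, T2 \proper Y & clD D r (T1 :|: T2) = Y].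

Lemma hv_inj : injective hv.
Proof.
move=> X Y h; have := congr1 (fun p : P => p@_(um X)) h; rewrite /hv !mcoeffX eqxx.
case: eqP => [e _|_ /eqP]; last by rewrite oner_eq0.
have := congr1 (fun m => sv m Y) e; rewrite !sv_um eqxx; by case: eqP.
Qed.

(** Sorting the members by size places T1 and T2 before their join, as [sqz] demands. *)
Lemma gamma_fS D r G S d (y : {set E} -> P) d' : mat D r -> built D r G -> topdeg r G = d -> squares D r G ->
  graded (fS d r G S y) d' ->
  (forall a : {set E} -> R, (forall X, 0 < a X) -> HRf (fS d r G S y) d' (lc a G)) ->
  gampos d' (qk (Kk R N d') (gram d' (fS d r G S y)) d') /\
  (forall k, (k <= d')%N -> qk (Kk R N d') (gram d' (fS d r G S y)) d' (d' - k) = qk (Kk R N d') (gram d' (fS d r G S y)) d' k).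
Proof.
move=> M bG td sq gf hr; set f := fS d r G S y in gf hr *.
pose le (X Y : {set E}) := (#|X| <= #|Y|)%N.
pose s := sort le (enum G).
have sG X : X \in s = (X \in G) by rewrite mem_sort mem_enum.
have hs h : h \in map hv s -> h \is 1.-homog by case/mapP => X _ ->; apply: hv_homog.
have pc := piece_of gf hs.
have HRs : HR (Kk R N d') (gram d' f) d' (map (op d') (map hv s)).
  apply: (HR_of gf) => [c c0|]; last by rewrite (map_inj_uniq hv_inj) sort_uniq enum_uniq.
  rewrite big_map; have := hr (fun X => c (hv X)) (fun X => c0 _); congr (HRf _ _ _).
  rewrite /lc -big_enum /=; apply: perm_big; by rewrite perm_sym perm_sort.
have op_rd u (h : P) : rad f h -> rd (Kk R N d') (gram d' f) (u *m op d' h).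
  move=> hh; apply/(rd_gram gf); rewrite row_op => v; rewrite (fn_trunc gf); exact: radMl.
have op_rd2 u (h h1 h2 : P) : rad f ((h - h1) * (h - h2)) ->
    rd (Kk R N d') (gram d' f) (u *m (op d' h - op d' h1) *m (op d' h - op d' h2)).
  move=> hh; have opB w (g1 g2 : P) : w *m (op d' g1 - op d' g2) = rv d' (pol w * (g1 - g2)).
    by rewrite mulmxBr !row_op mulrBr; apply/rowP => j; rewrite !mxE raddfB.
  apply/(rd_gram gf); rewrite !opB => v; rewrite (fn_trunc gf) -mulrA (fn_trunc gf).
  have -> : pol u * (h - h1) * ((h - h2) * v) = (h - h1) * (h - h2) * (pol u * v) by ring.
  exact: hh.
have sqs X : X \in G -> rad f (hv X) \/ exists T1 T2, [/\ T1 \in G, T2 \in G, T1 \proper X, T2 \proper X & rad f ((hv X - hv T1) * (hv X - hv T2))].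
  move=> XG; have [r1|[T1 [T2 [g1 g2 p1 p2 e]]]] := sq X XG; [left|right].
    have h : rad (phi d r G) (hv X).
      case: (d) td => [|d0] td0; last by move=> v; apply: phi_pt.
      exact: (homog_big (@phi_graded R E 0 r G) (ltn0Sn 0) (hv_homog R X)).
    by move=> v; rewrite /f fSE mulrCA; apply: h.
  exists T1, T2; split=> //; have h := phi_square (R := R) d M bG XG g1 g2 e.
  by move=> v; rewrite /f fSE mulrCA; apply: h.
have key todo done : sorted le todo -> (forall X, X \in G -> X \in done \/ X \in todo) -> {subset todo <= G} ->
    sqz (Kk R N d') (gram d' f) (map (op d') (map hv done)) (map (op d') (map hv todo)).
  elim: todo done => [//|X t IH] done /= so cov sub; split; last first.
    apply: (IH (X :: done)); first exact: path_sorted so.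
      by move=> Z /cov[h|]; [left; rewrite inE h orbT | rewrite inE => /orP[/eqP ->|h]; [left; rewrite inE eqxx | right]].
    by move=> Z h; apply: sub; rewrite inE h orbT.
  have XG : X \in G by apply: sub; rewrite inE eqxx.
  have dn T : T \in G -> T \proper X -> T \in done.
    move=> TG TX; have [//|] := cov T TG; have lt := proper_card TX.
    rewrite inE => /orP[/eqP e|h]; first by rewrite e ltnn in lt.
    have tr : transitive le by move=> a b c; apply: leq_trans.
    by have /allP/(_ T h) := order_path_min tr so; rewrite /le leqNgt lt.
  have [h|[T1 [T2 [g1 g2 p1 p2 h]]]] := sqs X XG; [left|right]; first by move=> k u _; apply: op_rd.
  exists (op d' (hv T1)), (op d' (hv T2)); split; [by do 2 apply: map_f; apply: dn | by do 2 apply: map_f; apply: dn|].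
  by move=> k u _; apply: op_rd2.
have lt : total le by move=> a b; apply: leq_total.
split.
  apply: (gamma_of_HR (todo := map (op d') (map hv s)) (done := map (op d') (map hv [::])) pc) => //.
  apply: key; [exact: (sort_sorted lt) | by move=> X; right; rewrite sG | by move=> X; rewrite sG].
by move=> k hk; apply: (qk_sym pc).

Qed.

(** Since q d = q 0 is positive, the polynomial has degree exactly d, which is the center that
    [gamma_positive] reads off its size. *)
Lemma gamma_poly d (q : nat -> nat) : gampos d q -> q 0%N = q d -> (0 < q 0)%N -> (forall k, (d < k)%N -> q k = 0%N) ->
  exists h : {poly int}, (forall k, h`_k = (q k)%:Z) /\ gamma_positive h.
Proof.
move=> [g g0 hq] e0 q0 qd; pose h : {poly int} := \poly_(k < d.+1) (q k)%:Z.
have hE k : h`_k = (q k)%:Z.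
  by rewrite coef_poly ltnS; case: leqP => // hk; rewrite qd.
exists h; split=> //; have sh : (size h).-1 = d.
  by rewrite size_poly_eq //= -e0 -[0]/(0%N%:Z) eqz_nat -lt0n.
rewrite /gamma_positive sh; exists (fun i => (g i)%:Z); split=> //.
apply/polyP => k0.
have bin n j : ((1 + 'X : {poly int}) ^+ n)`_j = 'C(n, j)%:Z.
  elim: n j => [|n IH] j; first by rewrite expr0 coef1 bin0n; case: j.
  rewrite exprS mulrDl mul1r coefD coefXM !IH; case: j => [|j] /=; first by rewrite !bin0 addr0.
  by rewrite binS PoszD.
pose F i : nat := if (i <= k0)%N then (g i * 'C(d - i.*2, k0 - i))%N else 0%N.
have wide a b : (forall i, (a <= i)%N -> F i = 0%N) -> (\sum_(i < a) F i = \sum_(i < a + b) F i)%N.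
  move=> hz; rewrite -!(big_mkord xpredT) [RHS](big_cat_nat (n := a)) ?leq_addr //=.
  by rewrite [X in (_ + X)%N]big_nat_cond [X in (_ + X)%N]big1 ?addn0 // => i /andP[/andP[/hz]].
rewrite hE hq coef_sum.
transitivity ((\sum_(i < k0.+1) F i)%N%:Z).
  by congr Posz; apply: eq_bigr => i _; rewrite /F -ltnS ltn_ord.
rewrite (wide k0.+1 (d./2.+1)) => [|i hi]; last by rewrite /F leqNgt hi.
rewrite addnC -(wide d./2.+1 k0.+1) => [|i hi]; last first.
  by rewrite /F g0 ?mul0n ?if_same //; move: hi; clear; lia.
rewrite (big_morph Posz PoszD (erefl _)); apply: eq_bigr => i _.
rewrite coefZ coefXnM bin /F ltnNge; case: (i <= k0)%N => /=; last by rewrite mulr0.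
by rewrite PoszM.
Qed.
End Gamma.

End GammaVectors.
Import GammaVectors.

(** * From the given definitions to the internal ones *)

Module Bridge.
Local Open Scope ring_scope.

Section Bridge.
Variables (E : finType) (r : {set E} -> nat) (G : {set {set E}}).
Implicit Types (F K T V W X Y Z : {set E}) (B S : {set {set E}}).

Lemma cl_clD A : cl r A = clD setT r A.
Proof. by apply/setP => x; rewrite !inE. Qed.

Lemma flat_fl F : flat r F = fl setT r F.
Proof.
rewrite /flat /fl subsetT /=; apply/eqP/forall_inP => [e x _|h].
  by apply/implyP => hx; rewrite -e inE.
apply/setP => x; rewrite inE; apply/idP/idP => [hx|xF]; first by have /implyP := h x (in_setT x); apply.
by rewrite (setUidPr _) ?sub1set.
Qed.

Lemma nested_nst S : nested r G S = nst setT r G S.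
Proof.
rewrite /nested /nst; congr (_ && _); apply/forallP/forallP => h.
  move=> B; apply/implyP => /and3P[b1 b2 b3]; have /forallP/(_ B)/implyP := h B.
  by rewrite b1 b2 subxx b3 /joinF cl_clD; apply.
move=> A; apply/forallP => B; apply/implyP => /and4P[a1 a2 a3 a4].
have /implyP := h B; rewrite a4 (subset_trans a3 a1) /joinF cl_clD andbT /=; apply.
by apply/antiP => X Y /(subsetP a3) hX /(subsetP a3) hY; apply: (antiP _ a2).
Qed.

Hypothesis mr : matroid_rank r.
Hypothesis lr : loopless r.

Lemma frozen_mat : mat setT r.
Proof.
have [h1 h2 h3] := mr; split; [exact: h1 | exact: h2 | exact: h3 | | by move=> A; rewrite setIT].
by move=> x _; apply: lr.
Qed.
Let M := frozen_mat.

(** A largest flat properly inside F spans F together with any further point. *)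
Lemma hyperplane F : fl setT r F -> F != set0 -> exists F', [/\ fl setT r F', F' \proper F & (r F <= (r F').+1)%N].
Proof.
move=> fF F0; have h0 : fl setT r set0 && (set0 \proper F) by rewrite (fl0 M) proper0.
case: (@arg_maxnP _ set0 (fun F' => fl setT r F' && (F' \proper F)) (fun F' => #|F'|) h0) => F' /andP[fF' F'F] mx.
exists F'; split=> //; have /properP[s [x xF xF']] := F'F.
have sD : x |: F' \subset setT := subsetT _.
have sC := sub_clD r sD; set C := clD setT r (x |: F') in sC.
have CF : C \subset F by apply: (cl_min M _ fF); rewrite subUset sub1set xF.
have xC : x \in C by apply: (subsetP sC); rewrite !inE eqxx.
have F'C : F' \subset C by apply: subset_trans sC; apply: subsetUr.
have eC : C = F.
  apply/eqP; apply: contraT => ne; have := mx C; rewrite (fl_cl M sD) properEneq ne CF => /(_ isT).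
  have lt : (#|F'| < #|C|)%N by apply: proper_card; apply/properP; split=> //; exists x.
  by move=> hge; have : (#|C| <= #|F'|)%N := hge; rewrite leqNgt lt.
by rewrite -eC (r_cl M sD); have := rU M [set x] F'; rewrite (m_sing M (in_setT x)) add1n.
Qed.

Section Build.
Hypothesis bs : building_set r G.

Lemma bs_fl X : X \in G -> fl setT r X.
Proof. by case: bs => h _ /h[]; rewrite flat_fl. Qed.
Lemma bs_n0 X : X \in G -> X != set0.
Proof. by case: bs => h _ /h[]. Qed.

Let valid F H := forall X, X \in maxG_le G F -> flat r (H X) /\ H X \subset X.
Let jm F (H : {set E} -> {set E}) := cl r (\bigcup_(X in maxG_le G F) H X).

Lemma bs_iso F : fl setT r F -> F != set0 ->
  [/\ forall H, valid F H -> jm F H \subset F,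
      forall H H', valid F H -> valid F H' -> (forall X, X \in maxG_le G F -> H X \subset H' X) <-> jm F H \subset jm F H' &
      forall K, fl setT r K -> K \subset F -> exists2 H, valid F H & jm F H = K].
Proof.
by case: bs => _ h fF F0; have [|h1 h2 h3] := h F _ F0; rewrite ?flat_fl //; split=> // K; rewrite -flat_fl; apply: h3.
Qed.

Let Fx F X : X \in maxG_le G F -> X \in G /\ X \subset F. Proof. by case/in_fac. Qed.

(** The closure of x is the join of a family in the product, and having rank one it must equal one
    entry of it. If it lay in two factors, two different families would have the same join. *)
Lemma point_fac F x : fl setT r F -> x \in F -> exists X, [/\ X \in maxG_le G F, x \in X &
  forall Y, Y \in maxG_le G F -> x \in Y -> Y = X].
Proof.
move=> fF xF; have F0 : F != set0 by apply/set0Pn; exists x.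
have [h1 h2 h3] := bs_iso fF F0; pose a := clD setT r [set x].
have fa : fl setT r a := fl_cl M (subsetT _).
have xa : x \in a by rewrite (subsetP (sub_clD r (subsetT _))) // inE.
have aF : a \subset F by apply: (cl_min M _ fF); rewrite sub1set.
have ra : r a = 1%N by rewrite (r_cl M (subsetT _)) lr.
have sub_a K : fl setT r K -> K \subset a -> K != set0 -> K = a.
  move=> fK Ka /set0Pn[y yK]; apply/esym; apply: (fl_eq M fK Ka (subsetT _)).
  by rewrite ra (r_gt0 M yK (in_setT y)).
have [H vH eH] := h3 a fa aF.
have HA X : X \in maxG_le G F -> H X \subset a.
  move=> hX; rewrite -eH /jm cl_clD; apply: subset_trans (sub_clD r (subsetT _)); exact: bigcup_sup.
have [X hX HX0] : exists2 X, X \in maxG_le G F & H X != set0.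
  apply/exists_inP; apply: contraT; rewrite negb_exists_in => /forall_inP no.
  have e : \bigcup_(X in maxG_le G F) H X = set0.
    by apply: big1 => X /no; rewrite negbK => /eqP.
  move: eH; rewrite /jm e cl_clD => e'; have := r_cl M (subsetT set0); rewrite e' ra (r0 M).
  by [].
have eHX : H X = a by apply: sub_a => //; [have [] := vH X hX; rewrite flat_fl | exact: HA].
have aX : a \subset X by rewrite -eHX; have [] := vH X hX.
exists X; split=> //; first exact: (subsetP aX).
move=> Y hY xY; apply/eqP; apply: contraT => ne.
have aY : a \subset Y by apply: (cl_min M _ (bs_fl (Fx hY).1)); rewrite sub1set.
pose H1 (Z : {set E}) := if Z == X then a else set0; pose H2 (Z : {set E}) := if Z == Y then a else set0.
have f0 : flat r set0 by rewrite flat_fl (fl0 M).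
have v1 : valid F H1 by move=> Z hZ; rewrite /H1; case: eqP => [->|_]; rewrite ?f0 ?sub0set // flat_fl.
have v2 : valid F H2 by move=> Z hZ; rewrite /H2; case: eqP => [->|_]; rewrite ?f0 ?sub0set // flat_fl.
have u1 (Z0 : {set E}) : Z0 \in maxG_le G F -> \bigcup_(Z in maxG_le G F) (if Z == Z0 then a else set0) = a.
  move=> hZ; rewrite (bigD1 Z0) //= eqxx big1 ?setU0 // => Z /andP[_ /negPf ->] //.
have [_ e12] := h2 H1 H2 v1 v2; have := e12; rewrite /jm u1 // u1 // subxx => /(_ isT X hX).
rewrite /H1 /H2 eqxx eq_sym (negPf ne) subset0 => /eqP a0; by rewrite a0 inE in xa.
Qed.

(** Let the entry at X grow through flats from the empty set to X while the other factors are kept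
    whole. The joins increase strictly because the map reflects order, so the rank of F is at least
    the sum; subadditivity is the converse. *)
Lemma bs_sep F X : fl setT r F -> X \in maxG_le G F -> sep r F X.
Proof.
move=> fF hX; have [XG XF] := Fx hX; have X0 := bs_n0 XG; have fX := bs_fl XG.
have F0 : F != set0 by apply: contraNneq X0 => e; rewrite -subset0 -e.
have [h1 h2 h3] := bs_iso fF F0.
have pt x : x \in F :\: X -> exists2 Y, (Y \in maxG_le G F) && (Y != X) & x \in Y.
  rewrite inE => /andP[xX xF]; have [Y [hY xY _]] := point_fac fF xF; exists Y => //.
  by rewrite hY; apply: contraNneq xX => <-.
pose Hz Z (Y : {set E}) := if Y == X then Z else Y.
have vz Z : fl setT r Z -> Z \subset X -> valid F (Hz Z).
  move=> fZ ZX Y hY; rewrite /Hz; case: eqP => [->|_]; rewrite flat_fl; split=> //.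
  exact: bs_fl (Fx hY).1.
pose K := jm F (Hz set0).
have main c Z : (#|Z| <= c)%N -> fl setT r Z -> Z \subset X -> (r K + r Z <= r (jm F (Hz Z)))%N.
  elim: c Z => [|c IH] Z hc fZ ZX.
    by move: hc; rewrite leqn0 cards_eq0 => /eqP ->; rewrite (r0 M) addn0.
  case: (eqVneq Z set0) => [->|Z0]; first by rewrite (r0 M) addn0.
  have [Z' [fZ' Z'Z rZ]] := hyperplane fZ Z0; have Z'X := subset_trans (proper_sub Z'Z) ZX.
  have := IH Z' _ fZ' Z'X; have hc' : (#|Z'| <= c)%N by rewrite -ltnS; apply: leq_trans (proper_card Z'Z) hc.
  move=> /(_ hc') h4; have vZ := vz Z fZ ZX; have vZ' := vz Z' fZ' Z'X.
  have s1 : jm F (Hz Z') \subset jm F (Hz Z).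
    apply/(h2 _ _ vZ' vZ) => Y hY; rewrite /Hz; case: eqP => // _; exact: proper_sub.
  have : (r (jm F (Hz Z')) < r (jm F (Hz Z)))%N.
    rewrite ltnNge; apply/negP => le; have e : jm F (Hz Z) = jm F (Hz Z').
      apply: (fl_eq M _ s1 (subsetT _) le); rewrite /jm cl_clD; exact: (fl_cl M (subsetT _)).
    have s2 : jm F (Hz Z) \subset jm F (Hz Z') by rewrite e.
    have := (h2 _ _ vZ vZ').2 s2 X hX; rewrite /Hz eqxx => h5.
    by move: Z'Z; rewrite properE h5 andbF.
  by move: h4 rZ; clear; lia.
have FK : (r (F :\: X) <= r K)%N.
  rewrite /K /jm cl_clD (r_cl M (subsetT _)); apply: (m_mono M); apply/subsetP => x /pt[Y /andP[hY ne] xY].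
  by apply/bigcupP; exists Y; rewrite // /Hz (negPf ne).
have := main #|X| X (leqnn _) fX (subxx _); have := m_mono M (h1 _ (vz X fX (subxx _))) => h6 h7.
have h8 := rU M X (F :\: X); have e : X :|: F :\: X = F by rewrite -{2}(setID F X) (setIidPr XF).
rewrite /sep XF; apply/eqP; rewrite e in h8; move: h6 h7 h8 FK; clear; lia.
Qed.

(** If X and Y share a point, both lie in the only factor of X ∨ Y through that point, which must
    then be the whole join. *)
Lemma frozen_built : built setT r G.
Proof.
have fac F x : fl setT r F -> x \in F -> exists2 X, X \in maxG_le G F & x \in X.
  by move=> fF xF; have [X [h1 h2 _]] := point_fac fF xF; exists X.
split; [exact: bs_fl | exact: bs_n0 | | | exact: bs_sep].
- move=> x _; pose a := clD setT r [set x]; have fa : fl setT r a := fl_cl M (subsetT _).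
  have xa : x \in a by rewrite (subsetP (sub_clD r (subsetT _))) // inE.
  have [X hX xX] := fac a x fa xa; have [XG Xa] := Fx hX; exists X => //; rewrite xX /=.
  have := m_mono M Xa; rewrite (r_cl M (subsetT _)) lr; have := r_gt0 M xX (in_setT x); clear; lia.
move=> X Y XG YG /set0Pn[x /setIP[xX xY]]; set F := clD setT r (X :|: Y).
have fF : fl setT r F := fl_cl M (subsetT _); have sF : X :|: Y \subset F := sub_clD r (subsetT _).
have XF := subset_trans (subsetUl _ _) sF; have YF := subset_trans (subsetUr _ _) sF.
have [X1 hX1 XX1] := fac_above XG XF; have [Y1 hY1 YY1] := fac_above YG YF.
have [Z [_ _ uZ]] := point_fac fF (subsetP XF _ xX).
have eX : X1 = Z := uZ X1 hX1 (subsetP XX1 _ xX).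
have eY : Y1 = Z := uZ Y1 hY1 (subsetP YY1 _ xY).
have e : X1 = Y1 by rewrite eX eY.
have [X1G X1F] := Fx hX1; rewrite (_ : F = X1) //; apply/eqP; rewrite eqEsubset X1F andbT.
by apply: (cl_min M _ (bs_fl X1G)); rewrite subUset XX1 e YY1.
Qed.
Let bG := frozen_built.

Lemma NLG_nst S : NLG_face r G S = (S \subset G :\: maxset G) && nst setT r G S.
Proof. by rewrite /NLG_face nested_nst. Qed.

(** Consider the maximal members strictly below Y, whose union is Y when Y has rank above one: they
    do not form a face. A minimal non-face among them is a pair by flagness, its join is in G, and
    by maximality this join can only be Y. *)
Lemma flag_squares : flag r G -> squares setT r G.
Proof.
move=> fl0' Y YG; case: (eqVneq (r Y) 1%N) => [|r1]; [by left | right].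
pose A0 := [set X in G | X \proper Y]; pose A := maxset A0.
have AA X : X \in A -> X \in G /\ X \proper Y by case/in_maxset; rewrite inE => /andP[].
have YD : Y \subset setT := subsetT _.
have clY : clD setT r Y = Y by apply: (cl_eq M) => //; apply: (b_fl bG YG).
case: (boolP [exists T1 in A, [exists T2 in A, clD setT r (T1 :|: T2) == Y]]) => [/exists_inP[T1 h1 /exists_inP[T2 h2 /eqP e]]|no].
  by have [g1 p1] := AA _ h1; have [g2 p2] := AA _ h2; exists T1, T2.
have pairG T1 T2 : T1 \in A -> T2 \in A -> T1 != T2 -> clD setT r (T1 :|: T2) \notin G.
  move=> h1 h2 ne; apply/negP => cG; case/negP: no; apply/exists_inP; exists T1 => //; apply/exists_inP; exists T2 => //.
  apply: contraT => nY; have [g1 p1] := AA _ h1; have [g2 p2] := AA _ h2.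
  set J := clD _ _ _ in cG nY; have sJ : T1 :|: T2 \subset J := sub_clD r (subsetT _).
  have JY : J \subset Y by apply: (cl_min M _ (b_fl bG YG)); rewrite subUset !proper_sub.
  have JA : J \in A0 by rewrite inE cG properEneq nY.
  have /in_maxset[_ m1] := h1; have /in_maxset[_ m2] := h2.
  have e1 := m1 J JA (subset_trans (subsetUl _ _) sJ); have e2 := m2 J JA (subset_trans (subsetUr _ _) sJ).
  by rewrite -e1 e2 eqxx in ne.
have nmA X : X \in A -> X \notin maxset G.
  by move=> /AA[XG XY]; apply/negP => /in_maxset[_ mX]; have := XY; rewrite (mX Y YG (proper_sub XY)) properxx.
have AG : A \subset G :\: maxset G by apply/subsetP => X hX; rewrite inE nmA //; have [] := AA X hX.
have aA : antichain A by apply/antiP => X Z /in_maxset[_ mX] /in_maxset[hZ _] XZ; rewrite (mX Z hZ XZ).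
have UA : \bigcup_(X in A) X = Y.
  apply/eqP; rewrite eqEsubset; apply/andP; split; first by apply/bigcupsP => X /AA[_ /proper_sub].
  apply/subsetP => y yY; have [T TG /andP[yT /eqP rT]] := b_pt bG (in_setT y).
  have TY := pt_sub M bG (b_fl bG YG) TG rT yT yY.
  have TA : T \in A0 by rewrite inE TG properEneq TY andbT; apply: contraNneq r1 => <-; rewrite rT.
  by have [T' hT' TT'] := maxset_above TA; apply/bigcupP; exists T' => //; apply: (subsetP TT').
have cA : (1 < #|A|)%N.
  rewrite ltnNge leq_eqVlt ltnS leqn0; apply/negP => /orP[/cards1P[X eX]|].
    have XA : X \in A by rewrite eX inE.
    by have [_] := AA X XA; rewrite -UA eX big_set1 properxx.
  rewrite cards_eq0 => /eqP A0'; have := b_n0 bG YG; by rewrite -UA A0' big_set0 eqxx.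
have nnA : ~~ NLG_face r G A.
  rewrite NLG_nst AG /=; apply/negP => /nstP[_ h]; have := h A (subxx _) aA cA; by rewrite UA clY YG.
have [T /minsetP[nT minT] TA] := @minset_exists _ (fun T0 : {set {set E}} => ~~ NLG_face r G T0) A nnA.
have TG := subset_trans TA AG.
have c2 : #|T| = 2%N.
  apply: (fl0' T TG nT) => T' T'T; apply: contraT => nT'.
  have e := minT T' nT' (proper_sub T'T); by rewrite e properxx in T'T.
move: nT; rewrite NLG_nst TG /= /nst (subset_trans TG (subsetDl _ _)) /= negb_forall => /existsP[B].
rewrite negb_imply negbK => /andP[/and3P[BT aB cB] JG].
have eB : B = T by apply/eqP; rewrite eqEcard BT c2.
have /cards2P[T1 [T2 [ne eT]]] : #|T| == 2%N by rewrite c2.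
have t1 : T1 \in A by apply: (subsetP TA); rewrite eT !inE eqxx.
have t2 : T2 \in A by apply: (subsetP TA); rewrite eT !inE eqxx orbT.
have := pairG T1 T2 t1 t2 ne; move: JG; rewrite eB eT big_setU1 ?inE //= big_set1 => ->.
by [].
Qed.

Let d := topdeg r G.
(** A concrete real closed field containing the rationals; only dimensions leave this section. *)
Local Notation R := realalg.
Local Notation N := #|{: {set E}}|.
Local Notation P := {mpoly R[N]}.

Lemma conclude S (y : {set E} -> P) n (gens : {mpoly rat[n]} -> Prop) (t : 'I_n -> P) :
  flag r G -> ysys setT r d G y -> nst setT r G S -> (forall V, V \in S -> V \notin maxset G) ->
  (forall i, t i \is 1.-homog) ->
  (forall Z, Z \in G -> Z \notin maxset G -> Z \notin S -> rad (fS d r G S y) (y Z) \/ exists i, t i = y Z) ->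
  ((exists xi, sdata setT r G S gens xi) \/ spanok (fS d r G S y) gens) ->
  (forall p, gens p -> rad (fS d r G S y) (theta t p)) ->
  exists h : {poly int}, hilbert_poincare gens h /\ gamma_positive h.
Proof.
move=> fg hy nS nm ht tS hsp hg; have [d' [gf hr sp]] := face_data M bG erefl hy nS nm.
have {hsp}sp' : spanok (fS d r G S y) gens by case: hsp => [[xi sd]|//]; apply: sp sd.
have qd := quot_face M bG hy nS nm ht tS gf sp' hg.
have [gp sym] := gamma_fS M bG erefl (flag_squares fg) gf hr.
set q := qk _ _ _ in qd gp sym.
have [|||h [hE hg']] := gamma_poly gp.
- by have := sym 0%N (leq0n _); rewrite subn0.
- by have [_ h] := qd 0%N; apply: h.
- by move=> k hk; rewrite /q /qk leqNgt hk.
by exists h; split=> // k; exists (q k) => //; have [] := qd k.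
Qed.

Section Vars.
Variable A : {set {set E}}.
(** Zero for sets outside A, so that relations can be written over all sets. *)
Definition xvar (Z : {set E}) : {mpoly rat[#|A|]} := \sum_(i < #|A| | enum_val i == Z) 'X_i.
Lemma xvar_ev i : xvar (enum_val i) = 'X_i.
Proof. by rewrite /xvar (big_pred1 i) // => j; rewrite (inj_eq enum_val_inj). Qed.
Lemma xvar_out Z : Z \notin A -> xvar Z = 0.
Proof. by move=> h; rewrite /xvar big_pred0 // => i; apply: contraNF h => /eqP <-; apply: enum_valP. Qed.
Lemma xvar_homog Z : xvar Z \is 1.-homog.
Proof. by rewrite rpred_sum // => i _; rewrite dhomogX; apply/eqP; apply: mdeg1. Qed.
Lemma ev_of Z : Z \in A -> exists i : 'I_#|A|, enum_val i = Z.
Proof. by move=> h; exists (enum_rank_in h Z); rewrite enum_rankK_in. Qed.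
Lemma prod_var (T : comNzRingType) (B : {set {set E}}) (F : {set E} -> T) : B \subset A ->
  \prod_(i < #|A| | enum_val i \in B) F (enum_val i) = \prod_(Z in B) F Z.
Proof.
move=> BA; transitivity (\prod_(Z in A | Z \in B) F Z); first by rewrite big_enum_val_cond.
by apply: eq_bigl => Z; rewrite andb_idl // => /(subsetP BA).
Qed.
Lemma prod_xvar (B : {set {set E}}) : B \subset A -> \prod_(i < #|A| | enum_val i \in B) 'X_i = \prod_(Z in B) xvar Z.
Proof. by move=> BA; rewrite -prod_var //; apply: eq_bigr => i _; rewrite xvar_ev. Qed.
End Vars.

Lemma star_final S : flag r G -> NLG_face r G S ->
  exists h : {poly int}, star_chow_polynomial r G S h /\ gamma_positive h.
Proof.
move=> fg; rewrite NLG_nst => /andP[SGm nS].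
have nm V : V \in S -> V \notin maxset G by move=> /(subsetP SGm); rewrite in_setD => /andP[].
have SG V : V \in S -> V \in G by move=> /(subsetP SGm); rewrite in_setD => /andP[].
have [y hy] := ysys_exists R M bG (erefl d).
set rays := star_rays r G S.
have inr Z : (Z \in rays) = [&& Z \in G, Z \notin maxset G, Z \notin S & nst setT r G (Z |: S)].
  rewrite in_set in_setD NLG_nst subUset sub1set SGm andbT in_setD.
  by case: (Z \in G); case: (Z \in maxset G); case: (Z \in S).
(* Members that are not rays of the star form a non-face with S, so their classes vanish and may be
   dropped from or added to the linear relations. *)
have ray_rad Z : Z \in G -> Z \notin maxset G -> Z \notin S -> Z \notin rays -> rad (fS d r G S y) (y Z).
  move=> ZG nZ ZS nr; have := @fS_nonface R E setT r G S d y hy nS [set Z].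
  rewrite big_set1 sub1set; apply=> //; apply: contra nr => h; by rewrite inr ZG nZ ZS setUC.
apply: (conclude (S := S) (y := y) (t := fun i => y (enum_val i))) => //.
- by move=> i; apply: (y_hom hy).
- move=> Z ZG nZ ZS; case: (boolP (Z \in rays)) => hZ; last by left; apply: ray_rad.
  by right; have [i e] := ev_of hZ; exists i; rewrite e.
- left; exists (xvar rays); split.
  + move=> B hB hn; case: (boolP (B \subset rays)) => Br; last first.
      have /subsetPn[Z hZ nZ] := Br; rewrite (bigD1 Z) //= xvar_out // mul0r; exact: inI0.
    apply: inI_gen; left; exists B; split=> //; last by rewrite prod_xvar.
    by rewrite NLG_nst negb_and hn orbT.
  + move=> m h1 h2; have : in_ideal (@star_gens E r G S) (\sum_(i < #|rays|) eS (enum_val i) m *: 'X_i).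
      by apply: inI_gen; right; exists m.
    congr (in_ideal _ _); transitivity (\sum_(Z in rays) eS Z m *: xvar rays Z).
      have er : \sum_(Z in rays) eS Z m *: xvar rays Z = \sum_(i < #|rays|) eS (enum_val i) m *: xvar rays (enum_val i).
        by rewrite big_enum_val.
      by rewrite er; apply: eq_bigr => i _; rewrite xvar_ev.
    rewrite big_mkcond [RHS]big_mkcond; apply: eq_bigr => Z _; rewrite inr.
    case: (boolP (Z \in G)) => //= ZG; case: (boolP (Z \in maxset G)) => //= nZ; case: (boolP (Z \in S)) => //= ZS.
    case: ifPn => // hn; rewrite xvar_out ?scaler0 // inr ZG nZ ZS.
    exact: hn.
  + move=> i; have := enum_valP i; rewrite inr => /and4P[h1 h2 h3 h4]; exists (enum_val i).
    by split=> //; rewrite xvar_ev.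
  exact: xvar_homog.
move=> p [[T [Tr nT ->]]|[m [m1 m2 ->]]].
  rewrite theta_prod (eq_bigr (fun i => y (enum_val i))) => [|i _]; last exact: thetaX.
  rewrite prod_var //; have TG : T \subset G :\: maxset G.
    by apply/subsetP => Z /(subsetP Tr); rewrite inr in_setD => /and4P[-> ->].
  apply: (fS_nonface hy nS) => //; first exact: subset_trans TG (subsetDl _ _).
  by move: nT; rewrite NLG_nst subUset SGm TG.
have := fS_lin S bG hy m1; rewrite theta_sum.
rewrite (eq_bigr (fun i => (ratr (eS (enum_val i) m) : R) *: y (enum_val i))) => [|i _]; last by rewrite thetaZ thetaX.
have er : \sum_(Z in rays) (ratr (eS Z m) : R) *: y Z = \sum_(i < #|rays|) (ratr (eS (enum_val i) m) : R) *: y (enum_val i).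
  by rewrite big_enum_val.
rewrite -er (bigID (mem rays)) /= => h.
have h2 : rad (fS d r G S y) (\sum_(Z | (Z \in G) && (Z \notin maxset G) && (Z \notin rays)) (ratr (eS Z m) : R) *: y Z).
  elim/big_ind: _ => [|p1 p2|Z /andP[/andP[ZG nZ] nr]]; [exact: rad0 | exact: radD|].
  case: (boolP (Z \in S)) => ZS; last by apply: radZ; apply: ray_rad.
  by rewrite m2 // rmorph0 scale0r; apply: rad0.
have := radB h h2; rewrite addrK; congr (rad _ _); apply: eq_bigl => Z.
by rewrite andb_idl // inr => /and4P[-> ->].
Qed.

(** The case of the empty face, except that this presentation keeps the variables of maximal
    elements and has one relation per atom, so the spanning family is built directly. *)
Lemma chow_final : flag r G -> exists h : {poly int}, chow_polynomial r G h /\ gamma_positive h.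
Proof.
move=> fg; have [y hy] := ysys_exists R M bG (erefl d).
have n0 : nst setT r G set0.
  by apply/nstP; split; [exact: sub0set | move=> B; rewrite subset0 => /eqP -> _; rewrite cards0].
have fE q : fS d r G set0 y q = phi R d r G q by rewrite fSE big_set0 mul1r.
have atom_cl x : atom r (clD setT r [set x]).
  have fa := fl_cl M (subsetT [set x]); have xa : x \in clD setT r [set x] by rewrite (subsetP (sub_clD r (subsetT _))) // inE.
  rewrite /atom flat_fl fa /=; apply/andP; split; first by apply/set0Pn; exists x.
  apply/forallP => F; apply/implyP => /andP[]; rewrite flat_fl => fF Fa; apply: contraT => /set0Pn[z zF].
  have e : clD setT r [set x] = F.
    apply: (fl_eq M fF (proper_sub Fa) (subsetT _)); rewrite (r_cl M (subsetT _)) lr.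
    exact: (r_gt0 M zF (in_setT z)).
  by rewrite e properxx in Fa.
have cl_sub x Z : Z \in G -> (clD setT r [set x] \subset Z) = (x \in Z).
  move=> ZG; apply/idP/idP => [/subsetP|xZ]; first by apply; rewrite (subsetP (sub_clD r (subsetT _))) // inE.
  by apply: (cl_min M _ (b_fl bG ZG)); rewrite sub1set.
apply: (conclude (S := set0) (y := y) (t := fun i : 'I_#|G| => y (enum_val i))) => //.
- by move=> V; rewrite inE.
- by move=> i; apply: (y_hom hy).
- by move=> Z ZG _ _; right; have [i e] := ev_of ZG; exists i; rewrite e.
- right; have sp : spanok (phi R d r G) (@chow_gens E r G).
    apply: (@span_adm R E setT r d G #|G| _ (xvar G)) => //.
    + move=> B BG aB cB JG; apply: inI_gen; left; exists B; split=> //; last by rewrite -prod_xvar.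
      by rewrite nested_nst; apply/negP => /nstP[_ h]; have := h B (subxx _) aB cB; rewrite JG.
    + move=> x _; have : in_ideal (@chow_gens E r G) (\sum_(i < #|G| | clD setT r [set x] \subset gvar i) 'X_i).
        by apply: inI_gen; right; exists (clD setT r [set x]).
      congr (in_ideal _ _); rewrite (eq_bigr (fun i => xvar G (enum_val i))) => [|i _]; last by rewrite xvar_ev.
      transitivity (\sum_(Z in G | clD setT r [set x] \subset Z) xvar G Z); first by rewrite big_enum_val_cond.
      by apply: eq_bigl => Z; case: (boolP (Z \in G)) => //= ZG; rewrite cl_sub.
    + by move=> i; exists (enum_val i); [exact: enum_valP | rewrite xvar_ev].
    exact: xvar_homog.
  move=> k; have [s [b [a [h1 h2 h3 h4 h5]]]] := sp k; exists s, b, a; split=> // c hc; apply: h4 => v.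
  by rewrite -fE; apply: hc.
move=> p [[S [SG nS ->]]|[a [/and3P[fa a0 /forallP amin] ->]]].
  rewrite theta_prod (eq_bigr (fun i => y (enum_val i))) => [|i _]; last exact: thetaX.
  rewrite prod_var //; apply: (fS_nonface hy n0) => //.
  by rewrite set0U -nested_nst.
have [x xa] := set0Pn _ a0; have ea : clD setT r [set x] = a.
  have s : clD setT r [set x] \subset a by apply: (cl_min M); rewrite ?sub1set // -flat_fl.
  apply/eqP; apply: contraT => ne; have := amin (clD setT r [set x]).
  rewrite flat_fl (fl_cl M (subsetT _)) properEneq ne s /= => /eqP e.
  have : x \in clD setT r [set x] by rewrite (subsetP (sub_clD r (subsetT _))) // inE.
  by rewrite e inE.
rewrite theta_sum (eq_bigr (fun i => y (enum_val i))) => [|i _]; last exact: thetaX.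
have er : \sum_(Z in G | a \subset Z) y Z = \sum_(i < #|G| | a \subset enum_val i) y (enum_val i).
  by rewrite big_enum_val_cond.
rewrite /gvar -er => v; rewrite fE; apply: etrans (y_lin hy (in_setT x) v); congr (phi _ _ _ _ (_ * _)).
by apply: eq_bigl => Z; case: (boolP (Z \in G)) => //= ZG; rewrite -ea cl_sub.
Qed.
End Build.
End Bridge.

End Bridge.
Import Bridge.

Local Open Scope ring_scope.

Theorem theorem6p1 (E : finType) (r : {set E} -> nat) (G : {set {set E}}) :
  matroid_rank r -> loopless r -> building_set r G -> flag r G ->
  (exists h : {poly int}, chow_polynomial r G h /\ gamma_positive h) /\
  (forall S : {set {set E}}, NLG_face r G S ->
     exists h : {poly int}, star_chow_polynomial r G S h /\ gamma_positive h).
Proof.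
move=> mr lr bs fg; split; first exact: chow_final.
by move=> S hS; apply: star_final.
Qed.
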